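(* Let $e,m_->0$. Assume $(\eta^{in}_-,\omega^{in}_-)\in L^2_xH^{-1/2}_y$ and $\psi^{in}_-\in H^{-3/2}_xH^{-2}_y$, all with zero $x$-average, and let $(\eta_-,u_-,\phi)$ be a smooth solution of the linearized electron system with initial data $(\eta_-,\psi_-,\omega_-)|_{t=0}=(\eta^{in}_-,\psi^{in}_-,\omega^{in}_-)$. For $k\in\mathbb{Z}\setminus\{0\}$, $\xi\in\mathbb{R}$ define $$\mathcal{R}_-(t,k,\xi)=B^{in}(k,\xi)+\int_0^tS_-(0,s)M_-(s)\widehat{F^{in}_-}(k,\xi)\,ds,$$ where $F^{in}_-=\eta^{in}_-+\omega^{in}_-$. Then there is a constant $C>0$ depending only on $e,m_-$ such that for all $t\ge0$, $$\|\mathbb{Q}[u_-](t)\|^2_{L^2}+\frac{1}{m_-}\|\eta_-(t)\|^2_{L^2}\ \ge\ C\langle t\rangle\sum_{k\neq0}\int_{\mathbb{R}}\langle\xi\rangle^{-1}|\mathcal{R}_-(t,k,\xi)|^2d\xi .$$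
   Context: The domain is $\mathbb{T}\times\mathbb{R}$, where $\mathbb{T}$ is the circle (functions are $2\pi$-periodic in $x$). Fourier transform: $\hat f(k,\xi)=\frac{1}{2\pi}\iint_{\mathbb{T}\times\mathbb{R}}e^{-i(kx+\xi y)}f(x,y)\,dx\,dy$, $k\in\mathbb{Z}$, $\xi\in\mathbb{R}$. Notation: $\langle a\rangle=(1+a^2)^{1/2}$. Anisotropic Sobolev norm: $\|f\|^2_{H^r_xH^s_y}=\sum_{k}\int\langle k\rangle^{2r}\langle\xi\rangle^{2s}|\hat f(k,\xi)|^2d\xi$. A function $f(x,y)$ has zero $x$-average if $\int_{\mathbb{T}}f(x,y)\,dx=0$ for every $y$. Linearized electron Euler–Poisson system around the Couette flow (with positive constants $e,m_-$), for scalar $\eta_-(t,x,y)$, velocity $u_-=(u^x_-,u^y_-)^\top$ and potential $\phi$: $\partial_t\eta_-+y\partial_x\eta_-+\nabla\cdot u_-=0$, $\partial_tu_-+y\partial_xu_-+(u^y_-,0)^\top+\frac{1}{m_-}\nabla\eta_-=\frac{e}{m_-}\nabla\phi$, $\Delta\phi=4\pi e\,\eta_-$. Set $\psi_-=\nabla\cdot u_-$ and $\omega_-=\nabla^\perp\cdot u_-$ with $\nabla^\perp=(-\partial_y,\partial_x)^\top$. Helmholtz decomposition: $u_-=\nabla\Delta^{-1}\psi_-+\nabla^\perp\Delta^{-1}\omega_-=:\mathbb{Q}[u_-]+\mathbb{P}[u_-]$. For fixed $k\in\mathbb{Z}\setminus\{0\}$, $\xi\in\mathbb{R}$ let $\alpha(t)=k^2+(\xi-kt)^2$,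 so $\partial_t\alpha=-2k(\xi-kt)$, and $$L_-(t)=\begin{pmatrix}-\frac14\alpha^{-1}\partial_t\alpha & -\frac{1}{\sqrt{m_-}}\alpha^{1/2}\\[2pt] \frac{4\pi e^2}{\sqrt{m_-}\alpha^{1/2}}+\frac{2k^2\sqrt{m_-}}{\alpha^{3/2}}+\frac{1}{\sqrt{m_-}}\alpha^{1/2} & \frac14\alpha^{-1}\partial_t\alpha\end{pmatrix},\quad M_-(t)=\Big(0,-\frac{2k^2}{\alpha^{7/4}}\Big)^\top.$$ $S_-(t,s)$ denotes the propagator (fundamental solution matrix) of the linear ODE $\frac{d}{dt}B=L_-(t)B$ on $\mathbb{C}^2$, i.e. $S_-(t,s)B_0$ is the value at time $t$ of the solution equal to $B_0$ at time $s$. Finally $B^{in}(k,\xi)=\Big(\frac{\widehat{\eta^{in}_-}(k,\xi)}{\sqrt{m_-}(k^2+\xi^2)^{1/4}},\ \frac{\widehat{\psi^{in}_-}(k,\xi)}{(k^2+\xi^2)^{3/4}}\Big)^\top$. *)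

(* Defs.v *)
(* Linearized electron Euler--Poisson system
   around Couette flow on T x R (T = R / 2 pi Z). *)
From HB Require Import structures.
From mathcomp Require Import all_boot all_order all_algebra.
From mathcomp Require Import all_classical all_reals all_analysis.
Set Implicit Arguments.
Unset Strict Implicit.
Unset Printing Implicit Defensive.
Import Order.TTheory GRing.Theory Num.Theory.
Import numFieldNormedType.Exports.
Local Open Scope classical_set_scope.
Local Open Scope ring_scope.

Section EP.
Variable R : realType.
Local Notation mu := (@lebesgue_measure R).

Definition Tper : set R := `[0, 2 * pi].

Definition jb (a : R) : R := Num.sqrt (1 + a ^+ 2).

Definition pt (f : R -> R -> R -> R) : R -> R -> R -> R :=
  fun t x y => derive1 (fun s => f s x y) t.
Definition px (f : R -> R -> R -> R) : R -> R -> R -> R :=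
  fun t x y => derive1 (fun s => f t s y) x.
Definition py (f : R -> R -> R -> R) : R -> R -> R -> R :=
  fun t x y => derive1 (fun s => f t x s) y.

Inductive dir := Dt | Dx | Dy.

Definition pdir (d : dir) := match d with Dt => pt | Dx => px | Dy => py end.

Fixpoint pD (ds : seq dir) (f : R -> R -> R -> R) : R -> R -> R -> R :=
  match ds with [::] => f | d :: ds' => pdir d (pD ds' f) end.

Definition smooth3 (f : R -> R -> R -> R) : Prop :=
  forall ds : seq dir,
    continuous (fun p : R * R * R => pD ds f p.1.1 p.1.2 p.2) /\
    (forall t x y,
      derivable (fun s => pD ds f s x y) t 1 /\
      derivable (fun s => pD ds f t s y) x 1 /\
      derivable (fun s => pD ds f t x s) y 1).

Definition xperiodic3 (f : R -> R -> R -> R) : Prop :=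
  forall t x y, f t (x + 2 * pi) y = f t x y.

Definition EP_solution (e m : R) (eta ux uy phi : R -> R -> R -> R) : Prop :=
  forall t x y, 0 <= t ->
    [/\ pt eta t x y + y * px eta t x y + (px ux t x y + py uy t x y) = 0,
        pt ux t x y + y * px ux t x y + uy t x y + m^-1 * px eta t x y
          = e / m * px phi t x y,
        pt uy t x y + y * px uy t x y + m^-1 * py eta t x y
          = e / m * py phi t x y &
        px (px phi) t x y + py (py phi) t x y = 4 * pi * e * eta t x y].

Definition divu (ux uy : R -> R -> R -> R) (t : R) : R -> R -> R :=
  fun x y => px ux t x y + py uy t x y.
Definition curlu (ux uy : R -> R -> R -> R) (t : R) : R -> R -> R :=
  fun x y => - py ux t x y + px uy t x y.

Definition zero_xavg (f : R -> R -> R) : Prop :=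
  forall y, (\int[mu]_(x in Tper) f x y) = 0.

(* ---------- Fourier transform on T x R ----------
   Complex numbers are represented as pairs (real part, imaginary part).
   hat f(k,xi) = 1/(2 pi) \iint e^{-i(kx + xi y)} f(x,y) dx dy.
   First the x-Fourier coefficient
   f_k(y) = 1/(2 pi) \int_0^{2pi} e^{-ikx} f(x,y) dx ;
   then hat f(k, .) is the Fourier transform on R of f_k
   (g^(xi) = \int e^{-i xi y} g(y) dy), understood in the distributional
   (tempered) sense through Parseval's identity
   \int g conj(chi) dy = 1/(2 pi) \int g^ conj(chi^) dxi
   tested against all real chi in C_c^infinity(R). *)
Definition xcoef (f : R -> R -> R) (k : int) (y : R) : R * R :=
  ((2 * pi)^-1 * \int[mu]_(x in Tper) (cos (k%:~R * x) * f x y),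
   - ((2 * pi)^-1 * \int[mu]_(x in Tper) (sin (k%:~R * x) * f x y))).

Definition smooth1 (chi : R -> R) : Prop :=
  forall (n : nat) (y : R), derivable (iter n (@derive1 R R) chi) y 1.

Definition compact_supp (chi : R -> R) : Prop :=
  exists M : R, forall y, M < `|y| -> chi y = 0.

Definition is_FT (f : R -> R -> R) (F : int -> R -> R * R) : Prop :=
  forall (k : int) (chi : R -> R), smooth1 chi -> compact_supp chi ->
    let g := xcoef f k in
    (* chi^(xi) = cr xi - i sr xi *)
    let cr := fun xi => \int[mu]_(y in setT) (cos (xi * y) * chi y) in
    let sr := fun xi => \int[mu]_(y in setT) (sin (xi * y) * chi y) in
    [/\ mu.-integrable setT (fun xi => ((F k xi).1 * cr xi - (F k xi).2 * sr xi)%:E),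
        mu.-integrable setT (fun xi => ((F k xi).1 * sr xi + (F k xi).2 * cr xi)%:E),
        \int[mu]_(y in setT) ((g y).1 * chi y)
          = (2 * pi)^-1 * \int[mu]_(xi in setT) ((F k xi).1 * cr xi - (F k xi).2 * sr xi) &
        \int[mu]_(y in setT) ((g y).2 * chi y)
          = (2 * pi)^-1 * \int[mu]_(xi in setT) ((F k xi).1 * sr xi + (F k xi).2 * cr xi)].

Definition cabs2 (z : R * R) : R := z.1 ^+ 2 + z.2 ^+ 2.

Definition sob_norm2 (r s : R) (F : int -> R -> R * R) : \bar R :=
  \esum_(k in [set: int])
    (\int[mu]_(xi in [set: R])
       ((jb k%:~R) `^ (2 * r) * (jb xi) `^ (2 * s) * cabs2 (F k xi))%:E)%E.

(* ||Q[u]||^2_{L^2} with Q[u] = nabla Delta^{-1} psi, psi = div u,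
   i.e. sum_k int |hat psi(k,xi)|^2 / (k^2 + xi^2) dxi *)
Definition Qnorm2 (Psi : int -> R -> R * R) : \bar R :=
  \esum_(k in [set: int])
    (\int[mu]_(xi in [set: R])
       (cabs2 (Psi k xi) / (k%:~R ^+ 2 + xi ^+ 2))%:E)%E.

Definition L2norm2 (f : R -> R -> R) : \bar R :=
  (\int[mu]_(x in Tper) \int[mu]_(y in [set: R]) ((f x y) ^+ 2)%:E)%E.

Definition alpha (k : int) (xi t : R) : R := k%:~R ^+ 2 + (xi - k%:~R * t) ^+ 2.
Definition dalpha (k : int) (xi t : R) : R := - 2 * k%:~R * (xi - k%:~R * t).

Definition mx2 (a b c d : R) : 'M[R]_2 :=
  \matrix_(i < 2, j < 2)
    if (val i == 0)%N then (if (val j == 0)%N then a else b)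
    else (if (val j == 0)%N then c else d).

Definition Lmat (e m : R) (k : int) (xi t : R) : 'M[R]_2 :=
  let a := alpha k xi t in
  let da := dalpha k xi t in
  let sm := Num.sqrt m in
  mx2 (- (4^-1) * a^-1 * da)
      (- (sm^-1 * a `^ (2^-1)))
      (4 * pi * e ^+ 2 / (sm * a `^ (2^-1)) + 2 * k%:~R ^+ 2 * sm / a `^ (3 / 2)
         + sm^-1 * a `^ (2^-1))
      (4^-1 * a^-1 * da).

Definition Mvec (k : int) (xi t : R) : 'cV[R]_2 :=
  \col_(i < 2) if (val i == 0)%N then 0 else - (2 * k%:~R ^+ 2 / (alpha k xi t) `^ (7 / 4)).

Definition is_propagator (L : R -> 'M[R]_2) (S : R -> R -> 'M[R]_2) : Prop :=
  (forall s, S s s = 1%:M) /\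
  (forall (t s : R) (i j : 'I_2), is_derive t (1 : R) (fun tau : R => S tau s i j) ((L t *m S t s) i j)).

Definition Bin (m : R) (Eta0 Psi0 : int -> R -> R * R) (k : int) (xi : R)
  : 'cV[R]_2 * 'cV[R]_2 :=
  let q := k%:~R ^+ 2 + xi ^+ 2 in
  let c1 := (Num.sqrt m * q `^ (4^-1))^-1 in
  let c2 := (q `^ (3 / 4))^-1 in
  (\col_(i < 2) if (val i == 0)%N then c1 * (Eta0 k xi).1 else c2 * (Psi0 k xi).1,
   \col_(i < 2) if (val i == 0)%N then c1 * (Eta0 k xi).2 else c2 * (Psi0 k xi).2).

Definition Rvec (m : R) (Sk : R -> R -> 'M[R]_2) (Eta0 Psi0 Om0 : int -> R -> R * R)
  (k : int) (xi t : R) : 'cV[R]_2 * 'cV[R]_2 :=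
  let B := Bin m Eta0 Psi0 k xi in
  let Fr := (Eta0 k xi).1 + (Om0 k xi).1 in
  let Fi := (Eta0 k xi).2 + (Om0 k xi).2 in
  let G := fun s => Sk 0 s *m Mvec k xi s in
  (B.1 + \col_(i < 2) (\int[mu]_(s in `[0, t]) (G s i ord0 * Fr)),
   B.2 + \col_(i < 2) (\int[mu]_(s in `[0, t]) (G s i ord0 * Fi))).

Definition vnorm2 (v : 'cV[R]_2 * 'cV[R]_2) : R :=
  \sum_(i < 2) (v.1 i ord0 ^+ 2 + v.2 i ord0 ^+ 2).

End EP.

(* Main.v *)
Require Import Defs.

(** The estimate is proved mode by mode in [x]. Mollify the sheared mode [k <> 0] in [y]; then [N],
    [P], [V] (for eta, div u and u^y) solve a linear system in [(t, y)] in which eta + curl u is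
    conserved. Testing its Laplace transform in [y] with the adjoint of [S_-] gives the Duhamel
    formula expressing the second component of the adjoint times [N(T)] through [P(T)] and
    the quantity R_- of the statement.

    Nothing controls the solution at intermediate times as [|y| -> oo]: it may contain harmonic
    parts [e^{ky}]. So each half-line is treated separately. The boundary term of the Laplace
    transform at [y = 0] forms a holomorphic defect which decays faster than every exponential
    for large Re z, hence vanishes there, hence, by continuation, on [0 < Re z < |k|]. Letting
    Re z tend to 0 from both sides and subtracting, the formula survives for almost every frequency, since
    Laplace transforms of Fourier integrals from the two sides differ by a Poisson integral.

    The rows of [S_-(0, T)] are bounded uniformly in [k], [xi] and [T] by an energy adapted to [L_-], so
    [alpha^{1/2} |R_-|^2] is bounded by [|N(T)|^2] and [|psi(T)|^2 / alpha]. Plancherel on the half-lines,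
    Fatou and Bessel in [x] conclude, since [<T> <= 2 <xi> alpha^{1/2}]. *)
From HB Require Import structures.
From mathcomp Require Import all_boot all_order all_algebra.
From mathcomp Require Import complex.
From mathcomp Require Import ring lra.
From mathcomp Require Import all_classical all_reals all_analysis measurable_realfun.
Import Order.TTheory GRing.Theory Num.Theory.
Import numFieldNormedType.Exports.
Local Open Scope classical_set_scope.
Local Open Scope ring_scope.
Local Open Scope complex_scope.
Set Implicit Arguments.
Unset Strict Implicit.
Unset Printing Implicit Defensive.

(** Pairing with test functions, as in [is_FT], gives no integrability of a transform. Mollification
    repairs this: the product with the transform of the test function is integrable, so [N 0],
    [P 0], [F] and [P T] become absolutely convergent Fourier integrals, bounded in [y]. The
    exception is [N T]: at time [T] only the [L^2] norm of eta is at hand. Hence [N T] remains a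
    Laplace transform up to the end, controlled in [L^2] on vertical lines, whereas the other terms
    have limits at Lebesgue points.

    Continued to complex frequencies, alpha vanishes at [z = i k t + k] and [z = i k t - k]. These
    zeros stand for the harmonic parts, and the strip [0 < Re z < |k|] separates them from the
    imaginary axis.

    Holomorphy is expressed by uniform quadratic Taylor remainders; the contour shift and the
    identity theorem are derived in this form. Complex integrals are estimated by components, so the
    constants are not sharp. In the end [C = 1 / (256 K)], where [K] bounds the squared entries of
    the propagator. *)

Notation Rec := complex.Re.
Notation Imc := complex.Im.
Notation normc := ComplexField.Normc.normc.

(** * Complex numbers: modulus, exponential, calculus along a real variable *)

Section ComplexBasics.
Variable R : realType.
Notation C := R[i].
Implicit Types (z w : C) (x y : R).

Lemma Rec_add z w : Rec (z + w) = Rec z + Rec w. Proof. by case: z; case: w. Qed.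
Lemma Imc_add z w : Imc (z + w) = Imc z + Imc w. Proof. by case: z; case: w. Qed.
Lemma Rec_opp z : Rec (- z) = - Rec z. Proof. by case: z. Qed.
Lemma Imc_opp z : Imc (- z) = - Imc z. Proof. by case: z. Qed.
Lemma Rec_mul z w : Rec (z * w) = Rec z * Rec w - Imc z * Imc w.
Proof. by case: z; case: w. Qed.
Lemma Imc_mul z w : Imc (z * w) = Rec z * Imc w + Imc z * Rec w.
Proof. by case: z; case: w. Qed.
Lemma Rec_inv z : Rec z^-1 = Rec z / (Rec z ^+ 2 + Imc z ^+ 2). Proof. by case: z. Qed.
Lemma Imc_inv z : Imc z^-1 = - Imc z / (Rec z ^+ 2 + Imc z ^+ 2).
Proof. by case: z => a b /=; rewrite mulNr. Qed.
Definition RecE := (Rec_add, Imc_add, Rec_opp, Imc_opp, Rec_mul, Imc_mul).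
Lemma complex_eq z w : Rec z = Rec w -> Imc z = Imc w -> z = w.
Proof. by case: z; case: w => a b c d /= -> ->. Qed.

Lemma normc_sqrtE z : normc z = Num.sqrt (Rec z ^+ 2 + Imc z ^+ 2).
Proof. by case: z. Qed.
Lemma normc_ge0 z : 0 <= normc z. Proof. by rewrite normc_sqrtE sqrtr_ge0. Qed.
Lemma sqr_normcE z : normc z ^+ 2 = Rec z ^+ 2 + Imc z ^+ 2.
Proof. by rewrite normc_sqrtE sqr_sqrtr ?addr_ge0 ?sqr_ge0. Qed.
Lemma normcM z w : normc (z * w) = normc z * normc w.
Proof. exact: ComplexField.Normc.normcM. Qed.
Lemma normcV z : normc z^-1 = (normc z)^-1.
Proof. exact: ComplexField.Normc.normcV. Qed.
Lemma normcX z n : normc (z ^+ n) = normc z ^+ n.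
Proof.
elim: n => [|n IH]; first by rewrite !expr0 ComplexField.Normc.normc1.
by rewrite !exprS normcM IH.
Qed.
Lemma normcN z : normc (- z) = normc z. Proof. by rewrite !normc_sqrtE !RecE !sqrrN. Qed.
Lemma normc0 : normc (0 : C) = 0. Proof. exact: ComplexField.Normc.normc0. Qed.
Lemma normc1 : normc (1 : C) = 1. Proof. exact: ComplexField.Normc.normc1. Qed.
Lemma normc_i : normc ('i : C) = 1.
Proof. by rewrite normc_sqrtE /= expr0n /= expr1n add0r sqrtr1. Qed.
Lemma normc_eq0 z : normc z = 0 -> z = 0. Proof. exact: ComplexField.Normc.eq0_normc. Qed.
Lemma normc_gt0 z : z != 0 -> 0 < normc z.
Proof.
move=> z0; rewrite lt_neqAle normc_ge0 andbT eq_sym.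
by apply/eqP => /normc_eq0 /eqP; rewrite (negbTE z0).
Qed.
Lemma normcR x : normc x%:C = `|x|.
Proof. by rewrite normc_sqrtE /= expr0n /= addr0 sqrtr_sqr. Qed.
Lemma normr_Rec z : `|Rec z| <= normc z.
Proof. by rewrite normc_sqrtE -sqrtr_sqr ler_sqrt ?lerDl ?addr_ge0 ?sqr_ge0. Qed.
Lemma normr_Imc z : `|Imc z| <= normc z.
Proof. by rewrite normc_sqrtE -sqrtr_sqr ler_sqrt ?lerDr ?addr_ge0 ?sqr_ge0. Qed.
Lemma ler_normcD z w : normc (z + w) <= normc z + normc w.
Proof.
have nn : 0 <= normc z + normc w by rewrite addr_ge0 ?normc_ge0.
rewrite -(@ler_pXn2r _ 2%N) ?nnegrE ?normc_ge0 //.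
rewrite sqrrD !sqr_normcE !RecE.
suff : Rec z * Rec w + Imc z * Imc w <= normc z * normc w by lra.
rewrite (le_trans (ler_norm _))// -normcM.
rewrite normc_sqrtE !RecE -sqrtr_sqr ler_sqrt ?addr_ge0 ?sqr_ge0 //.
have := sqr_ge0 (Rec z * Imc w - Imc z * Rec w); nra.
Qed.
Lemma ler_normcB z w : normc (z - w) <= normc z + normc w.
Proof. by rewrite (le_trans (ler_normcD _ _))// normcN. Qed.
Lemma normcC z w : normc (z - w) = normc (w - z).
Proof. by rewrite -normcN opprB. Qed.
Lemma normc_le_ReIm z : normc z <= `|Rec z| + `|Imc z|.
Proof.
have -> : z = (Rec z)%:C + 'i * (Imc z)%:C by apply: complex_eq; rewrite !RecE /=; ring.
rewrite (le_trans (ler_normcD _ _))// normcM normc_i !normcR mul1r !RecE /=.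
by rewrite !mul0r mulr0 !mul1r subrr addr0 !add0r.
Qed.
Lemma ler_normc_sum (I : Type) (r : seq I) (P : pred I) (f : I -> C) :
  normc (\sum_(i <- r | P i) f i) <= \sum_(i <- r | P i) normc (f i).
Proof.
elim/big_rec2: _ => [|i y1 y2 _ h]; first by rewrite normc0.
by rewrite (le_trans (ler_normcD _ _))// lerD2l.
Qed.

Definition cexp z : C := (expR (Rec z) * cos (Imc z)) +i* (expR (Rec z) * sin (Imc z)).
Lemma cexpD z w : cexp (z + w) = cexp z * cexp w.
Proof.
by apply: complex_eq; rewrite !RecE /cexp /= !RecE expRD ?cosD ?sinD; ring.
Qed.
Lemma cexp0 : cexp 0 = 1.
Proof. by rewrite /cexp /= expR0 cos0 sin0 mulr1 mulr0. Qed.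
Lemma normc_cexp z : normc (cexp z) = expR (Rec z).
Proof.
rewrite normc_sqrtE /cexp /= !exprMn -mulrDr cos2Dsin2 mulr1 sqrtr_sqr ger0_norm // expR_ge0.
Qed.
Lemma cexpN z : cexp (- z) = (cexp z)^-1.
Proof.
have h : cexp (- z) * cexp z = 1 by rewrite -cexpD addNr cexp0.
have nz : cexp z != 0 by apply/eqP => z0; move: h; rewrite z0 mulr0 => /eqP; rewrite eq_sym oner_eq0.
by rewrite -[LHS]mulr1 -(divff nz) mulrA h mul1r.
Qed.

(** Derivatives and continuity are taken componentwise along a real variable, so that the real
    calculus applies directly. Complex differentiability enters only later, through quadratic
    remainders. *)
Definition cder (f : R -> C) (t : R) (l : C) :=
  is_derive t (1 : R) (fun s => Rec (f s)) (Rec l) /\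
  is_derive t (1 : R) (fun s => Imc (f s)) (Imc l).
Definition ccont (T : topologicalType) (f : T -> C) :=
  continuous (fun s => Rec (f s)) /\ continuous (fun s => Imc (f s)).

Lemma is_derive_eq' (f : R -> R) t l l' : is_derive t (1 : R) f l -> l = l' -> is_derive t (1 : R) f l'.
Proof. by move=> + <-. Qed.
Lemma is_derive_ext (f g : R -> R) t l : is_derive t (1 : R) f l -> f =1 g -> is_derive t (1 : R) g l.
Proof. by move=> + /funext <-. Qed.
Lemma cder_eq f t l l' : cder f t l -> l = l' -> cder f t l'.
Proof. by move=> + <-. Qed.
Lemma cder_ext f g t l : cder f t l -> f =1 g -> cder g t l.
Proof. by move=> + /funext <-. Qed.
Lemma cder_cst (c : C) t : cder (fun=> c) t 0.
Proof. by split; exact: is_derive_cst. Qed.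
Lemma cder_R (f : R -> R) t l : is_derive t (1 : R) f l -> cder (fun s => (f s)%:C) t l%:C.
Proof. by move=> h; split => //=; exact: is_derive_cst. Qed.
Lemma cder_id t : cder (fun s => s%:C) t 1.
Proof. by apply: cder_R; exact: is_derive_id. Qed.
Lemma cderD f g t l l' : cder f t l -> cder g t l' -> cder (fun s => f s + g s) t (l + l').
Proof.
move=> [f1 f2] [g1 g2]; split; rewrite RecE.
  by apply: (is_derive_ext (is_deriveD f1 g1)) => s; rewrite RecE.
by apply: (is_derive_ext (is_deriveD f2 g2)) => s; rewrite RecE.
Qed.
Lemma cderN f t l : cder f t l -> cder (fun s => - f s) t (- l).
Proof.
move=> [f1 f2]; split; rewrite RecE.
  by apply: (is_derive_ext (is_deriveN f1)) => s; rewrite RecE.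
by apply: (is_derive_ext (is_deriveN f2)) => s; rewrite RecE.
Qed.
Lemma cderB f g t l l' : cder f t l -> cder g t l' -> cder (fun s => f s - g s) t (l - l').
Proof. by move=> hf hg; apply: cderD hf (cderN hg). Qed.
Lemma cderM f g t l l' : cder f t l -> cder g t l' ->
  cder (fun s => f s * g s) t (l * g t + f t * l').
Proof.
move=> [f1 f2] [g1 g2]; split; rewrite !RecE.
  apply: (is_derive_eq' (is_derive_ext (is_deriveB (is_deriveM f1 g1) (is_deriveM f2 g2)) _)).
    by move=> s; rewrite RecE.
  by rewrite /GRing.scale /=; ring.
apply: (is_derive_eq' (is_derive_ext (is_deriveD (is_deriveM f1 g2) (is_deriveM f2 g1)) _)).
  by move=> s; rewrite RecE.
by rewrite /GRing.scale /=; ring.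
Qed.
Lemma cderZ (c : C) f t l : cder f t l -> cder (fun s => c * f s) t (c * l).
Proof. by move=> h; apply: (cder_eq (cderM (cder_cst c t) h)); rewrite mul0r add0r. Qed.
Lemma is_derive_continuous (f : R -> R) t l : is_derive t (1:R) f l -> {for t, continuous f}.
Proof. by move=> h; apply/differentiable_continuous; rewrite -derivable1_diffP. Qed.
Lemma cder_inv f t l : f t != 0 -> cder f t l -> cder (fun s => (f s)^-1) t (- l / f t ^+ 2).
Proof.
move=> f0 [f1 f2].
pose n s := Rec (f s) ^+ 2 + Imc (f s) ^+ 2.
have n0 : n t != 0.
  rewrite /n paddr_eq0 ?sqr_ge0 // !sqrf_eq0; apply: contra f0 => /andP[/eqP a /eqP b].
  by apply/eqP; apply: complex_eq.
have dn : is_derive t (1:R) n (2 * (Rec (f t) * Rec l + Imc (f t) * Imc l)).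
  apply: (is_derive_eq' (is_derive_ext (is_deriveD (is_deriveM f1 f1) (is_deriveM f2 f2)) _)).
    by move=> s; rewrite /n !expr2.
  by rewrite /GRing.scale /=; ring.
have dni := is_deriveV n0 dn.
have en : n t = Rec (f t) * Rec (f t) + Imc (f t) * Imc (f t) by rewrite /n !expr2.
split.
  apply: (is_derive_eq' (is_derive_ext (is_deriveM f1 dni) _)).
    by move=> s; rewrite Rec_inv.
  rewrite !RecE Rec_inv Imc_inv /GRing.scale /= !RecE.
  have -> : (Rec (f t) * Rec (f t) - Imc (f t) * Imc (f t)) ^+ 2 +
     (Rec (f t) * Imc (f t) + Imc (f t) * Rec (f t)) ^+ 2 = n t ^+ 2 by rewrite /n; ring.
  by rewrite en in n0 *; field.
apply: (is_derive_eq' (is_derive_ext (is_deriveM (is_deriveN f2) dni) _)).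
  by move=> s; rewrite Imc_inv.
rewrite !RecE Rec_inv Imc_inv /GRing.scale /= !RecE.
have -> : (Rec (f t) * Rec (f t) - Imc (f t) * Imc (f t)) ^+ 2 +
   (Rec (f t) * Imc (f t) + Imc (f t) * Rec (f t)) ^+ 2 = n t ^+ 2 by rewrite /n; ring.
have -> : (- (fun s => Imc (f s))) t = - Imc (f t) by [].
by rewrite en in n0 *; field.
Qed.
Lemma cder_cexp f t l : cder f t l -> cder (fun s => cexp (f s)) t (l * cexp (f t)).
Proof.
move=> [f1 f2].
have e1 : is_derive t (1:R) (fun s => expR (Rec (f s))) (expR (Rec (f t)) * Rec l).
  by apply: (is_derive_eq' (is_derive1_comp _ f1)).
have c1 : is_derive t (1:R) (fun s => cos (Imc (f s))) (- sin (Imc (f t)) * Imc l).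
  by apply: (is_derive_eq' (is_derive1_comp _ f2)).
have s1 : is_derive t (1:R) (fun s => sin (Imc (f s))) (cos (Imc (f t)) * Imc l).
  by apply: (is_derive_eq' (is_derive1_comp _ f2)).
split; rewrite !RecE /cexp /=.
  by apply: (is_derive_eq' (is_deriveM e1 c1)); rewrite /GRing.scale /=; ring.
by apply: (is_derive_eq' (is_deriveM e1 s1)); rewrite /GRing.scale /=; ring.
Qed.

Lemma ccont_cst (T : topologicalType) (c : C) : ccont (fun _ : T => c).
Proof. by split => s; exact: cvg_cst. Qed.
Lemma ccontD (T : topologicalType) (f g : T -> C) : ccont f -> ccont g -> ccont (fun s => f s + g s).
Proof.
move=> [f1 f2] [g1 g2]; split=> s; under eq_fun do rewrite RecE.
  by apply: cvgD; [exact: f1 | exact: g1].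
by apply: cvgD; [exact: f2 | exact: g2].
Qed.
Lemma ccontN (T : topologicalType) (f : T -> C) : ccont f -> ccont (fun s => - f s).
Proof.
move=> [f1 f2]; split=> s; under eq_fun do rewrite RecE.
  by apply: cvgN; exact: f1.
by apply: cvgN; exact: f2.
Qed.
Lemma ccontB (T : topologicalType) (f g : T -> C) : ccont f -> ccont g -> ccont (fun s => f s - g s).
Proof. by move=> hf hg; apply: ccontD => //; exact: ccontN. Qed.
Lemma ccontM (T : topologicalType) (f g : T -> C) : ccont f -> ccont g -> ccont (fun s => f s * g s).
Proof.
move=> [f1 f2] [g1 g2]; split=> s; under eq_fun do rewrite RecE.
  by apply: cvgB; apply: cvgM; [exact: f1 | exact: g1| exact: f2 | exact: g2].
by apply: cvgD; apply: cvgM; [exact: f1 | exact: g2| exact: f2 | exact: g1].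
Qed.
Lemma ccontR (T : topologicalType) (f : T -> R) : continuous f -> ccont (fun s => (f s)%:C).
Proof. by move=> h; split => //= s; exact: cvg_cst. Qed.
Lemma ccont_comp (T U : topologicalType) (f : T -> C) (g : U -> T) :
  ccont f -> continuous g -> ccont (fun s => f (g s)).
Proof.
move=> [f1 f2] hg; split => s.
  exact: (@continuous_comp _ _ _ g (fun s => Rec (f s)) s (hg s) (f1 _)).
exact: (@continuous_comp _ _ _ g (fun s => Imc (f s)) s (hg s) (f2 _)).
Qed.
Lemma ccont_inv (T : topologicalType) (f : T -> C) : (forall s, f s != 0) -> ccont f ->
  ccont (fun s => (f s)^-1).
Proof.
move=> f0 [f1 f2].
have n0 s : Rec (f s) ^+ 2 + Imc (f s) ^+ 2 != 0.
  rewrite paddr_eq0 ?sqr_ge0 // !sqrf_eq0; apply: contra (f0 s) => /andP[/eqP a /eqP b].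
  by apply/eqP; apply: complex_eq.
have cn : continuous (fun s => Rec (f s) ^+ 2 + Imc (f s) ^+ 2).
  move=> s; apply: cvgD; under eq_fun do rewrite expr2; rewrite expr2; apply: cvgM;
  [exact: f1|exact: f1|exact: f2|exact: f2].
split=> s.
  under eq_fun do rewrite Rec_inv.
  by apply: cvgM; [exact: f1|apply: cvgV => //; exact: cn].
under eq_fun do rewrite Imc_inv.
by apply: cvgM; [apply: cvgN; exact: f2|apply: cvgV => //; exact: cn].
Qed.
Lemma ccont_cexp (T : topologicalType) (f : T -> C) : ccont f -> ccont (fun s => cexp (f s)).
Proof.
move=> [f1 f2]; split=> s /=; apply: cvgM.
- by apply: continuous_comp; [exact: f1|exact: continuous_expR].
- by apply: continuous_comp; [exact: f2|exact: continuous_cos].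
- by apply: continuous_comp; [exact: f1|exact: continuous_expR].
- by apply: continuous_comp; [exact: f2|exact: continuous_sin].
Qed.
Lemma ccont_normc (T : topologicalType) (f : T -> C) : ccont f -> continuous (fun s => normc (f s)).
Proof.
move=> [f1 f2] s; under eq_fun do rewrite normc_sqrtE.
apply: (@continuous_comp _ _ _ (fun s => Rec (f s) ^+ 2 + Imc (f s) ^+ 2) Num.sqrt s _
  (@sqrt_continuous R _)).
apply: cvgD; under eq_fun do rewrite expr2; rewrite expr2; apply: cvgM;
  [exact: f1|exact: f1|exact: f2|exact: f2].
Qed.

(* A mean value inequality; the two components cost a factor 2. *)
Lemma mvt_bound (f f' : R -> R) (a b B : R) : a <= b -> {within `[a, b], continuous f} ->
  (forall t, a < t < b -> is_derive t (1:R) f (f' t)) ->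
  (forall t, a < t < b -> `|f' t| <= B) -> `|f b - f a| <= B * (b - a).
Proof.
rewrite le_eqVlt => /predU1P[->|ab] cf df bf; first by rewrite !subrr normr0 mulr0.
have [t tab ->] : exists2 c, c \in `]a, b[ & f b - f a = f' c * (b - a).
  by apply: MVT => // t; rewrite in_itv /= => tab; exact: df.
move: tab; rewrite in_itv /= => tab.
have h : 0 <= b - a by rewrite subr_ge0 ltW.
by rewrite normrM (ger0_norm h) ler_wpM2r // bf.
Qed.
End ComplexBasics.

Ltac nneg := repeat (first [ done | exact: normc_ge0 | exact: sqr_ge0 | exact: expR_ge0 | exact: normr_ge0
  | apply: addr_ge0 | apply: mulr_ge0 | apply: exprn_ge0 | rewrite invr_ge0 | exact: ltW ]).

(** * Holomorphic families and linear differential equations *)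

Section MeanValue.
Variable R : realType.
Notation C := R[i].

Lemma cmvt (f f' : R -> C) (a b B : R) : a <= b -> ccont f ->
  (forall t, a < t < b -> cder f t (f' t)) ->
  (forall t, a < t < b -> normc (f' t) <= B) -> normc (f b - f a) <= 2 * B * (b - a).
Proof.
move=> ab [c1 c2] df bf.
have h1 : `|Rec (f b) - Rec (f a)| <= B * (b - a).
  apply: (@mvt_bound _ (fun t => Rec (f t)) (fun t => Rec (f' t)) a b B ab).
  - exact: continuous_subspaceT.
  - by move=> t /df [].
  - by move=> t /bf; apply: le_trans; exact: normr_Rec.
have h2 : `|Imc (f b) - Imc (f a)| <= B * (b - a).
  apply: (@mvt_bound _ (fun t => Imc (f t)) (fun t => Imc (f' t)) a b B ab).
  - exact: continuous_subspaceT.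
  - by move=> t /df [].
  - by move=> t /bf; apply: le_trans; exact: normr_Imc.
rewrite (le_trans (normc_le_ReIm _))// !RecE; lra.
Qed.

Lemma cder0_cst (f : R -> C) (a b : R) : a <= b -> ccont f ->
  (forall t, a < t < b -> cder f t 0) -> f b = f a.
Proof.
move=> ab cf df; apply/eqP; rewrite -subr_eq0; apply/eqP/normc_eq0/eqP.
rewrite eq_le normc_ge0 andbT.
have := @cmvt f (fun=> 0) a b 0 ab cf df; rewrite mulr0 mul0r; apply.
by move=> t _; rewrite normc0.
Qed.

Lemma mvt_nonincr (f f' : R -> R) (a b : R) : a <= b -> {within `[a, b], continuous f} ->
  (forall t, a < t < b -> is_derive t (1:R) f (f' t)) ->
  (forall t, a < t < b -> f' t <= 0) -> f b <= f a.
Proof.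
rewrite le_eqVlt => /predU1P[->//|ab] cf df bf.
have [t tab e] : exists2 c, c \in `]a, b[ & f b - f a = f' c * (b - a).
  by apply: MVT => // t; rewrite in_itv /= => tab; exact: df.
move: tab; rewrite in_itv /= => /bf h.
by rewrite -subr_le0 e mulr_le0_ge0 // subr_ge0 ltW.
Qed.

(** The function [E t * expR (- (K * t)) - c * t] is nonincreasing: for [t >= 0] the exponential
    weight only decreases the forcing [c], hence the plain [c * T] in the bound. *)
Lemma gronwall (E E' : R -> R) (T K c : R) : 0 <= K -> 0 <= c -> 0 <= T ->
  continuous E ->
  (forall t, 0 < t < T -> is_derive t (1:R) E (E' t)) ->
  (forall t, 0 < t < T -> E' t <= K * E t + c) ->
  E T <= (E 0 + c * T) * expR (K * T).
Proof.
move=> K0 c0 T0 cE dE bE.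
have dexp (t : R) : is_derive t (1:R) (fun t => expR (- (K * t))) (- K * expR (- (K * t))).
  have h : is_derive t (1:R) (fun t : R => - (K * t)) (- K).
    by apply: is_derive_eq'; rewrite /GRing.scale /=; ring.
  by apply: (is_derive_eq' (is_derive1_comp _ h)); rewrite mulrC.
have : E T * expR (- (K * T)) - c * T <= E 0 * expR (- (K * 0)) - c * 0.
  apply: (@mvt_nonincr (fun t => E t * expR (- (K * t)) - c * t)
    (fun t => (E' t - K * E t) * expR (- (K * t)) - c)) => //.
  - apply: continuous_subspaceT => t.
    apply: (@cvgB _ _ _ _ _ (fun t => E t * expR (- (K * t))) (fun t => c * t)).
      apply: (@cvgM _ _ _ _ E (fun t => expR (- (K * t)))); first exact: cE.
      exact: (is_derive_continuous (dexp t)).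
    by apply: (@cvgM _ _ _ _ (fun=> c) id); [exact: cvg_cst|exact: cvg_id].
  - move=> t tT.
    apply: is_derive_eq'; first apply: is_deriveB.
      exact: (is_deriveM (dE _ tT) (dexp t)).
    by rewrite /GRing.scale /=; ring.
  - move=> t tT; have := bE t tT; rewrite -lerBlDl => h.
    have e0 := expR_gt0 (- (K * t)).
    have e1 : expR (- (K * t)) <= 1.
      by rewrite -expR0 ler_expR oppr_le0 mulr_ge0 // ltW // (andP tT).1.
    nra.
rewrite !mulr0 oppr0 expR0 mulr1 addr0 lerBlDr expRN => h.
have e0 := expR_gt0 (K * T).
by rewrite -ler_pdivrMr.
Qed.
End MeanValue.

(** * Uniform quantitative holomorphy and its closure properties *)

Section Hol.
Variable R : realType.
Notation C := R[i].

(* Families of functions of a complex variable, uniformly bounded and with a uniform quadratic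
   Taylor remainder on D : a quantitative form of holomorphy, stable under the solution of
   linear differential equations. *)
Definition holu (I : Type) (S : set I) (D : set C) (f f' : I -> C -> C) := exists K : R,
  forall i, S i ->
  (forall z, D z -> normc (f i z) <= K /\ normc (f' i z) <= K) /\
  (forall z w, D z -> D w -> normc (f i w - f i z - f' i z * (w - z)) <= K * normc (w - z) ^+ 2).
Definition bddC (D : set C) := exists B : R, forall z w, D z -> D w -> normc (w - z) <= B.
Definition hol (D : set C) (f f' : C -> C) := holu [set: unit] D (fun=> f) (fun=> f').

Variables (I : Type) (S : set I) (D : set C).
Hypothesis bD : bddC D.

Lemma holu_K (f f' : I -> C -> C) : holu S D f f' -> exists2 K : R, 1 <= K &
  forall i, S i ->
  (forall z, D z -> normc (f i z) <= K /\ normc (f' i z) <= K) /\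
  (forall z w, D z -> D w -> normc (f i w - f i z - f' i z * (w - z)) <= K * normc (w - z) ^+ 2).
Proof.
move=> [K h]; exists (Num.max 1 K); first by rewrite le_max lexx.
move=> i Si; have [h1 h2] := h i Si; split.
  by move=> z Dz; have [a b] := h1 z Dz; rewrite !le_max a b !orbT.
move=> z w Dz Dw; rewrite (le_trans (h2 z w Dz Dw))// ler_wpM2r ?sqr_ge0 //.
by rewrite le_max lexx orbT.
Qed.

Lemma bddC_K : exists2 B : R, 1 <= B & forall z w, D z -> D w -> normc (w - z) <= B.
Proof.
have [B hB] := bD; exists (Num.max 1 B); first by rewrite le_max lexx.
by move=> z w Dz Dw; rewrite le_max hB // orbT.
Qed.

Lemma holu_sub (J : Type) (S' : set J) (D' : set C) (g : J -> I) (f f' : I -> C -> C) :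
  (forall j, S' j -> S (g j)) -> (D' `<=` D) -> holu S D f f' ->
  holu S' D' (fun j => f (g j)) (fun j => f' (g j)).
Proof.
move=> hg hD [K h]; exists K => j Sj; have [h1 h2] := h _ (hg j Sj); split.
  by move=> z Dz; apply: h1; exact: hD.
by move=> z w Dz Dw; apply: h2; exact: hD.
Qed.

Lemma holu_cst (c : I -> C) (K : R) : (forall i, S i -> normc (c i) <= K) ->
  holu S D (fun i _ => c i) (fun _ _ => 0).
Proof.
move=> h; exists (Num.max 0 K) => i Si; split.
  by move=> z _; rewrite normc0 !le_max h // lexx orbT.
by move=> z w _ _; rewrite mul0r subrr subr0 normc0 mulr_ge0 ?sqr_ge0 // le_max lexx.
Qed.

Lemma holu_id : holu S D (fun _ z => z) (fun _ _ => 1).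
Proof.
have [B B1 hB] := bddC_K.
have [[z0 Dz0]|nD] := pselect (exists z, D z); last first.
  by exists 0 => i _; split=> z; [move=> Dz|move=> w Dz]; exfalso; apply: nD; exists z.
exists (normc z0 + B) => i _; split.
  move=> z Dz; rewrite normc1 -{1}(subrK z0 z) (le_trans (ler_normcD _ _)); last first.
    by rewrite addrC lerD2l hB.
  by split=> //; rewrite (le_trans B1)// lerDr normc_ge0.
move=> z w _ _; rewrite mul1r subrr normc0 mulr_ge0 ?sqr_ge0 // addr_ge0 ?normc_ge0 //.
by rewrite (le_trans _ B1).
Qed.

Lemma holuD (f f' g g' : I -> C -> C) : holu S D f f' -> holu S D g g' ->
  holu S D (fun i z => f i z + g i z) (fun i z => f' i z + g' i z).
Proof.
move=> [K h] [L l]; exists (K + L) => i Si; have [h1 h2] := h i Si; have [l1 l2] := l i Si.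
split.
  move=> z Dz; have [a b] := h1 z Dz; have [c d] := l1 z Dz.
  by split; rewrite (le_trans (ler_normcD _ _))// lerD.
move=> z w Dz Dw; rewrite mulrDl.
have -> : f i w + g i w - (f i z + g i z) - (f' i z * (w - z) + g' i z * (w - z)) =
   (f i w - f i z - f' i z * (w - z)) + (g i w - g i z - g' i z * (w - z)) by ring.
by rewrite (le_trans (ler_normcD _ _))// mulrDl lerD ?h2 ?l2.
Qed.

Lemma holuN (f f' : I -> C -> C) : holu S D f f' ->
  holu S D (fun i z => - f i z) (fun i z => - f' i z).
Proof.
move=> [K h]; exists K => i Si; have [h1 h2] := h i Si.
split=> [z Dz|z w Dz Dw]; first by rewrite !normcN; exact: h1.
have -> : - f i w - - f i z - - f' i z * (w - z) = - (f i w - f i z - f' i z * (w - z)) by ring.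
by rewrite normcN h2.
Qed.

Lemma holu_lip (f f' : I -> C -> C) : holu S D f f' -> exists2 K : R, 1 <= K &
  forall i, S i -> forall z w, D z -> D w -> normc (f i w - f i z) <= K * normc (w - z).
Proof.
move=> /holu_K[K K1 h]; have [B B1 hB] := bddC_K.
exists (K * (1 + B)) => [|i Si z w Dz Dw].
  by rewrite -[leLHS]mulr1 ler_pM // ?ler01// lerDl (le_trans ler01).
have [h1 h2] := h i Si.
have -> : f i w - f i z = (f i w - f i z - f' i z * (w - z)) + f' i z * (w - z) by ring.
rewrite (le_trans (ler_normcD _ _))// normcM.
have a := h2 z w Dz Dw; have [_ b] := h1 z Dz; have c := hB z w Dz Dw.
have d := normc_ge0 (w - z); have e := normc_ge0 (f' i z).
have : K * normc (w - z) ^+ 2 <= K * B * normc (w - z).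
  by rewrite expr2 mulrA ler_wpM2r // ler_wpM2l // (le_trans ler01).
have : normc (f' i z) * normc (w - z) <= K * normc (w - z) by rewrite ler_wpM2r.
lra.
Qed.

Lemma holuM (f f' g g' : I -> C -> C) : holu S D f f' -> holu S D g g' ->
  holu S D (fun i z => f i z * g i z) (fun i z => f' i z * g i z + f i z * g' i z).
Proof.
move=> hf hg; have [K K1 h] := holu_K hf; have [L L1 l] := holu_K hg.
have [G G1 hG] := holu_lip hg.
have K0 : 0 <= K by rewrite (le_trans ler01).
have L0 : 0 <= L by rewrite (le_trans ler01).
have G0 : 0 <= G by rewrite (le_trans ler01).
exists (K * L + K * L + K * G) => i Si; have [h1 h2] := h i Si; have [l1 l2] := l i Si.
have KG := mulr_ge0 K0 G0; have KL := mulr_ge0 K0 L0.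
split.
  move=> z Dz; have [a b] := h1 z Dz; have [c d] := l1 z Dz; split.
    have : normc (f i z) * normc (g i z) <= K * L by rewrite ler_pM ?normc_ge0.
    rewrite normcM; lra.
  rewrite (le_trans (ler_normcD _ _))// !normcM.
  have : normc (f' i z) * normc (g i z) <= K * L by rewrite ler_pM ?normc_ge0.
  have : normc (f i z) * normc (g' i z) <= K * L by rewrite ler_pM ?normc_ge0.
  lra.
move=> z w Dz Dw.
have -> : f i w * g i w - f i z * g i z - (f' i z * g i z + f i z * g' i z) * (w - z) =
   (f i w - f i z - f' i z * (w - z)) * g i w + (f' i z * (w - z)) * (g i w - g i z)
   + f i z * (g i w - g i z - g' i z * (w - z)) by ring.
have [a b] := h1 z Dz; have [c _] := l1 w Dw.
have d := h2 z w Dz Dw; have e := l2 z w Dz Dw; have j := hG i Si z w Dz Dw.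
set r := normc (w - z) in d e j *; have r0 : 0 <= r := normc_ge0 _.
rewrite (le_trans (ler_normcD _ _))//.
have A : normc ((f i w - f i z - f' i z * (w - z)) * g i w) <= K * r ^+ 2 * L.
  by rewrite normcM ler_pM ?normc_ge0.
have B : normc ((f' i z * (w - z)) * (g i w - g i z)) <= K * r * (G * r).
  by rewrite !normcM ler_pM ?mulr_ge0 ?normc_ge0 // ler_wpM2r.
have E : normc (f i z * (g i w - g i z - g' i z * (w - z))) <= K * (L * r ^+ 2).
  by rewrite normcM ler_pM ?normc_ge0.
have := ler_normcD ((f i w - f i z - f' i z * (w - z)) * g i w)
  ((f' i z * (w - z)) * (g i w - g i z)).
have -> : (K * L + K * L + K * G) * r ^+ 2 = K * r ^+ 2 * L + K * r * (G * r) + K * (L * r ^+ 2).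
  by ring.
lra.
Qed.

Lemma holuV (f f' : I -> C -> C) (kap : R) : 0 < kap ->
  (forall i z, S i -> D z -> kap <= normc (f i z)) -> holu S D f f' ->
  holu S D (fun i z => (f i z)^-1) (fun i z => - f' i z / f i z ^+ 2).
Proof.
move=> k0 hk hf; have [K K1 h] := holu_K hf; have [G G1 hG] := holu_lip hf.
have K0 : 0 <= K by rewrite (le_trans ler01).
have G0 : 0 <= G by rewrite (le_trans ler01).
have ki : 0 < kap^-1 by rewrite invr_gt0.
have inv i z : S i -> D z -> normc (f i z)^-1 <= kap^-1.
  by move=> Si Dz; rewrite normcV lef_pV2 ?posrE ?hk // (lt_le_trans k0) ?hk.
have nz i z : S i -> D z -> f i z != 0.
  move=> Si Dz; apply/eqP => f0; have := hk i z Si Dz; rewrite f0 normc0 => /(lt_le_trans k0).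
  by rewrite ltxx.
have P0 : 0 <= K * kap^-1 ^+ 2 by rewrite mulr_ge0 // sqr_ge0.
have Q0 : 0 <= G ^+ 2 * kap^-1 ^+ 3 by rewrite mulr_ge0 ?sqr_ge0 // exprn_ge0 // ltW.
exists (kap^-1 + K * kap^-1 ^+ 2 + G ^+ 2 * kap^-1 ^+ 3) => i Si; have [h1 h2] := h i Si.
split.
  move=> z Dz; have := inv i z Si Dz => a; split; first by lra.
  rewrite normcM normcN normcV normcX -exprVn -normcV.
  have : normc (f' i z) * normc (f i z)^-1 ^+ 2 <= K * kap^-1 ^+ 2.
    by rewrite ler_pM ?normc_ge0 ?sqr_ge0 ?(h1 z Dz).2 // lerXn2r // nnegrE ?normc_ge0 // ltW.
  lra.
move=> z w Dz Dw.
have nw := nz i w Si Dw; have nzz := nz i z Si Dz.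
(* The remainder of the inverse splits into the remainder of [f] and the square of an increment of
   [f], both of second order. *)
have -> : (f i w)^-1 - (f i z)^-1 - - f' i z / f i z ^+ 2 * (w - z) =
  - ((f i w - f i z - f' i z * (w - z)) * (f i z)^-1 ^+ 2)
  + (f i w - f i z) ^+ 2 * ((f i w)^-1 * (f i z)^-1 ^+ 2).
  by field; rewrite nw nzz.
rewrite (le_trans (ler_normcD _ _))// normcN.
have a := h2 z w Dz Dw; have b := hG i Si z w Dz Dw.
have iz := inv i z Si Dz; have iw := inv i w Si Dw.
set r := normc (w - z) in a b *; have r0 : 0 <= r := normc_ge0 _.
have c2 : normc ((f i z)^-1 ^+ 2) <= kap^-1 ^+ 2.
  by rewrite normcX lerXn2r // nnegrE ?normc_ge0 // ltW.
have A : normc ((f i w - f i z - f' i z * (w - z)) * (f i z)^-1 ^+ 2) <= K * r ^+ 2 * kap^-1 ^+ 2.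
  by rewrite normcM ler_pM ?normc_ge0.
have B : normc ((f i w - f i z) ^+ 2 * ((f i w)^-1 * (f i z)^-1 ^+ 2)) <=
   (G * r) ^+ 2 * (kap^-1 * kap^-1 ^+ 2).
  rewrite normcM; apply: ler_pM; rewrite ?normc_ge0 //.
    by rewrite normcX lerXn2r // nnegrE ?normc_ge0 // mulr_ge0.
  by rewrite normcM ler_pM ?normc_ge0.
have C0 : 0 <= kap^-1 * r ^+ 2 by rewrite mulr_ge0 ?sqr_ge0 // ltW.
have : (kap^-1 + K * kap^-1 ^+ 2 + G ^+ 2 * kap^-1 ^+ 3) * r ^+ 2 =
  kap^-1 * r ^+ 2 + K * r ^+ 2 * kap^-1 ^+ 2 + (G * r) ^+ 2 * (kap^-1 * kap^-1 ^+ 2) by ring.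
lra.
Qed.

Lemma holu_comp (D2 : set C) (g g' : C -> C) (f f' : I -> C -> C) : hol D2 g g' ->
  (forall i z, S i -> D z -> D2 (f i z)) -> holu S D f f' ->
  holu S D (fun i z => g (f i z)) (fun i z => g' (f i z) * f' i z).
Proof.
move=> [L0 l0] hD hf.
have [L L1 l] : exists2 L : R, 1 <= L & (forall z, D2 z -> normc (g z) <= L /\ normc (g' z) <= L) /\
  (forall z w, D2 z -> D2 w -> normc (g w - g z - g' z * (w - z)) <= L * normc (w - z) ^+ 2).
  have [l1 l2] := l0 tt Logic.I.
  exists (Num.max 1 L0); first by rewrite le_max lexx.
  split; first by move=> z Dz; have [a b] := l1 z Dz; rewrite !le_max a b !orbT.
  move=> z w Dz Dw; rewrite (le_trans (l2 z w Dz Dw))// ler_wpM2r ?sqr_ge0 //.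
  by rewrite le_max lexx orbT.
have [l1 l2] := l.
have [K K1 h] := holu_K hf; have [G G1 hG] := holu_lip hf.
have K0 : 0 <= K by rewrite (le_trans ler01).
have L00 : 0 <= L by rewrite (le_trans ler01).
have LK := mulr_ge0 L00 K0.
have LG : 0 <= L * G ^+ 2 by rewrite mulr_ge0 ?sqr_ge0.
exists (L + L * K + L * G ^+ 2) => i Si; have [h1 h2] := h i Si.
split.
  move=> z Dz; have [a b] := l1 _ (hD i z Si Dz); split; first by lra.
  have : normc (g' (f i z)) * normc (f' i z) <= L * K by rewrite ler_pM ?normc_ge0 ?(h1 z Dz).2.
  rewrite normcM; lra.
move=> z w Dz Dw.
have -> : g (f i w) - g (f i z) - g' (f i z) * f' i z * (w - z) =
  (g (f i w) - g (f i z) - g' (f i z) * (f i w - f i z)) +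
  g' (f i z) * (f i w - f i z - f' i z * (w - z)) by ring.
rewrite (le_trans (ler_normcD _ _))// [normc (g' _ * _)]normcM.
have a := h2 z w Dz Dw; have b := hG i Si z w Dz Dw.
have c := l2 _ _ (hD i z Si Dz) (hD i w Si Dw); have [_ d] := l1 _ (hD i z Si Dz).
set r := normc (w - z) in a b *; have r0 : 0 <= r := normc_ge0 _.
have A : normc (g' (f i z)) * normc (f i w - f i z - f' i z * (w - z)) <= L * (K * r ^+ 2).
  by rewrite ler_pM ?normc_ge0.
have B : L * normc (f i w - f i z) ^+ 2 <= L * (G * r) ^+ 2.
  by rewrite ler_wpM2l // lerXn2r // nnegrE ?normc_ge0 // mulr_ge0 // (le_trans ler01).
have C0 : 0 <= L * r ^+ 2 by rewrite mulr_ge0 ?sqr_ge0.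
have : (L + L * K + L * G ^+ 2) * r ^+ 2 = L * r ^+ 2 + L * (K * r ^+ 2) + L * (G * r) ^+ 2 by ring.
lra.
Qed.
End Hol.

(** * Primitives of continuous functions *)

Section Primitive.
Variable R : realType.
Notation mu := (@lebesgue_measure R).
Implicit Types (f g : R -> R).

Lemma cont_integrable f (a b : R) : continuous f -> mu.-integrable `[a, b] (EFin \o f).
Proof.
move=> cf; apply: continuous_compact_integrable; first exact: segment_compact.
exact: continuous_subspaceT.
Qed.

Lemma Rintegral_cat f (a b c : R) : continuous f -> a <= b -> b <= c ->
  \int[mu]_(x in `[a, c]) f x = \int[mu]_(x in `[a, b]) f x + \int[mu]_(x in `[b, c]) f x.
Proof.
move=> cf ab bc; apply/eqP; rewrite addrC -subr_eq; apply/eqP.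
rewrite (@Rintegral_itvB _ f (BLeft a) (BRight c) b) ?bnd_simp //; last exact: cont_integrable.
by rewrite Rintegral_itv_obnd_cbnd //; apply: integrableS (cont_integrable b c cf) => //;
  exact: subset_itv_oc_cc.
Qed.

(** The oriented integral from 0 to [t]: one of the two terms always vanishes, so that a single
    formula serves both signs of [t]. *)
Definition prim f (t : R) := \int[mu]_(x in `[0, t]) f x - \int[mu]_(x in `[t, 0]) f x.

Lemma Rintegral_nil f (a b : R) : b <= a -> \int[mu]_(x in `[a, b]) f x = 0.
Proof.
rewrite le_eqVlt => /predU1P[->|ba]; first by rewrite set_itv1 Rintegral_set1.
by rewrite set_itv_ge ?Rintegral_set0 // bnd_simp -ltNge.
Qed.

Lemma primE f (a t : R) : continuous f -> a <= 0 -> a <= t ->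
  prim f t = \int[mu]_(x in `[a, t]) f x - \int[mu]_(x in `[a, 0]) f x.
Proof.
move=> cf a0 at_; rewrite /prim; have [t0|t0] := leP 0 t.
  rewrite [in X in _ - X]Rintegral_nil // (@Rintegral_cat f a 0 t) //; ring.
rewrite (Rintegral_nil f (ltW t0)) (@Rintegral_cat f a t 0) ?(ltW t0) //; ring.
Qed.

Lemma prim0 f : prim f 0 = 0. Proof. by rewrite /prim subrr. Qed.

Lemma is_derive_prim f (t : R) : continuous f -> is_derive t (1:R) (prim f) (f t).
Proof.
move=> cf; pose a := Num.min 0 t - 1.
have a0 : a < 0 by rewrite /a ltrBlDr add0r gt_min ltr01.
have at_ : a < t by rewrite /a ltrBlDr gt_min ltrDl ltr01 orbT.
have tt1 : t < t + 1 by rewrite ltrDl.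
have [d e] := @continuous_FTC1_closed _ f a t (t + 1) tt1 (cont_integrable a (t + 1) cf) at_ (cf t).
have h : is_derive t (1:R) (fun y => \int[mu]_(x in `[a, y]) f x - \int[mu]_(x in `[a, 0]) f x) (f t).
  apply: is_derive_eq'; first apply: is_deriveB.
    by apply: DeriveDef; [exact: d|rewrite -derive1E; exact: e].
  by rewrite subr0.
apply: (near_eq_is_derive _ h).
near=> y; rewrite (@primE _ a y) //; first exact: ltW.
by apply: ltW; near: y; exact: lt_nbhsr.
Unshelve. all: by end_near. Qed.
End Primitive.

(** * Sequences converging at a geometric rate *)

Section Geometric.
Variable R : realType.
(** Subtracting or adding the remaining geometric tail makes the sequence monotone in either
    direction. The supremum of the lower sequence lies below every term of the upper one, which
    gives the limit and its rate at once. *)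
Lemma geom_lim (u : nat -> R) (c : R) : 0 <= c ->
  (forall n, `|u n.+1 - u n| <= c * 2^-1 ^+ n) ->
  exists l, forall n, `|u n - l| <= 2 * c * 2^-1 ^+ n.
Proof.
move=> c0 h; pose a n := u n - 2 * c * 2^-1 ^+ n; pose b n := u n + 2 * c * 2^-1 ^+ n.
have th n : 0 <= c * 2^-1 ^+ n by rewrite mulr_ge0 // exprn_ge0 // invr_ge0.
have ha n : a n <= a n.+1.
  have := h n; rewrite ler_norml => /andP[+ _]; rewrite /a exprS; have := th n; lra.
have hb n : b n.+1 <= b n.
  have := h n; rewrite ler_norml => /andP[_ +]; rewrite /b exprS; have := th n; lra.
have ma n m : a n <= a (n + m)%N.
  by elim: m => [|m IH]; rewrite ?addn0 // addnS (le_trans IH).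
have mb n m : b (n + m)%N <= b n.
  by elim: m => [|m IH]; rewrite ?addn0 // addnS (le_trans _ IH).
have ab n m : a n <= b m.
  rewrite (le_trans (ma n m))// addnC (le_trans _ (mb m n))// /a /b.
  have := th (m + n)%N; lra.
have ubA m : ubound (range a) (b m) by move=> _ [n _ <-].
exists (sup (range a)) => n; rewrite ler_norml.
have h1 : a n <= sup (range a).
  by apply: ub_le_sup; [exists (b 0%N); exact: ubA|exists n].
have h2 : sup (range a) <= b n.
  by apply: ge_sup; [exists (a 0%N), 0%N|exact: ubA].
by move: h1 h2; rewrite /a /b; lra.
Qed.
Lemma half_pow0 (c e : R) : 0 < e -> exists n, c * 2^-1 ^+ n < e.
Proof.
move=> e0; have : (fun n => c * (2^-1 : R) ^+ n) @ \oo --> c * 0.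
  apply: cvgM; first exact: cvg_cst.
  by apply: cvg_expr; rewrite ger0_norm ?invr_ge0 // invf_lt1 ?ltr1n.
rewrite mulr0 => /cvgrPdist_lt/(_ e e0)[n _ /(_ n (leqnn n))].
by rewrite sub0r normrN => /(le_lt_trans (ler_norm _)); exists n.
Qed.
Lemma le0_eps (x : R) (c : R) : (forall n, x <= c * 2^-1 ^+ n) -> x <= 0.
Proof.
move=> h; rewrite leNgt; apply/negP => x0; have [n] := half_pow0 c x0.
by rewrite ltNge h.
Qed.
End Geometric.

(** * Global solutions of linear systems by Picard iteration *)

Section LinearODE.
Variables (R : realType) (J : finType) (A : J -> J -> R -> R) (K : R).
Hypothesis cA : forall i j, continuous (A i j).
Hypothesis K0 : 0 < K.
Hypothesis bA : forall i j t, `|A i j t| <= K.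

(** Rate of the weighted norm [sup |f t| exp (- lam |t|)]. With this choice one Picard step at least
    halves distances, uniformly in time. The successor keeps [lam] positive when [J] is empty. *)
Let lam : R := 2 * K * #|J|.+1%:R.
Let lam0 : 0 < lam. Proof. by rewrite mulr_gt0 // ?mulr_gt0. Qed.

Let exp1 (F f : R -> R) (B : R) : F 0 = 0 -> (forall t, is_derive t (1:R) F (f t)) ->
  (forall t, 0 <= t -> f t <= B * expR (lam * t)) ->
  forall t, 0 <= t -> F t <= B / lam * (expR (lam * t) - 1).
Proof.
move=> F0 dF bf t t0.
have dG (x : R) : is_derive x (1:R) (fun t => F t - B / lam * expR (lam * t))
     (f x - B / lam * (lam * expR (lam * x))).
  have h : is_derive x (1:R) (fun t : R => lam * t) lam.
    by apply: is_derive_eq'; rewrite /GRing.scale /=; ring.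
  have h2 : is_derive x (1:R) (fun t : R => expR (lam * t)) (lam * expR (lam * x)).
    by apply: (is_derive_eq' (is_derive1_comp _ h)); rewrite mulrC.
  exact: (is_deriveB (dF x) (is_deriveZ (B / lam) h2)).
have : F t - B / lam * expR (lam * t) <= F 0 - B / lam * expR (lam * 0).
  apply: (mvt_nonincr t0 _ (fun x _ => dG x)).
    by apply: continuous_subspaceT => x; exact: (is_derive_continuous (dG x)).
  move=> x /andP[x0 _]; have := bf x (ltW x0).
  by rewrite mulrA divfK ?gt_eqF // subr_le0.
by rewrite F0 mulr0 expR0; lra.
Qed.

Let expabs (F f : R -> R) (B : R) : F 0 = 0 -> (forall t, is_derive t (1:R) F (f t)) ->
  0 <= B ->
  (forall t, `|f t| <= B * expR (lam * `|t|)) -> forall t, `|F t| <= B / lam * expR (lam * `|t|).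
Proof.
move=> F0 dF B0 bf.
have BL : 0 <= B / lam by rewrite divr_ge0 // ltW.
have pos (F1 f1 : R -> R) : F1 0 = 0 -> (forall t, is_derive t (1:R) F1 (f1 t)) ->
   (forall t, `|f1 t| <= B * expR (lam * `|t|)) ->
   forall t, 0 <= t -> `|F1 t| <= B / lam * expR (lam * t).
  move=> F10 dF1 bf1 t t0; rewrite ler_norml; apply/andP; split.
    rewrite lerNl (le_trans (@exp1 (fun t => - F1 t) (fun t => - f1 t) B _ _ _ t t0)) //.
    - by rewrite F10 oppr0.
    - move=> x x0; rewrite -{2}(ger0_norm x0) (le_trans _ (bf1 x))//.
      by rewrite -normrN ler_norm.
    - by rewrite ler_wpM2l // gerBl ler01.
  rewrite (le_trans (@exp1 F1 f1 B F10 dF1 _ t t0)) //.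
    by move=> x x0; rewrite -{2}(ger0_norm x0) (le_trans _ (bf1 x))// ler_norm.
  by rewrite ler_wpM2l // gerBl ler01.
move=> t; have [t0|t0] := leP 0 t.
  by rewrite [in leRHS](ger0_norm t0); apply: pos.
rewrite [in leRHS](ltr0_norm t0) -{1}(opprK t).
apply: (pos (fun t => F (- t)) (fun t => - f (- t))).
- by rewrite oppr0.
- move=> x; have h : is_derive x (1:R) (fun t : R => - t) (-1).
    by apply: is_deriveN; exact: is_derive_id.
  by apply: (is_derive_eq' (is_derive1_comp (dF (- x)) h)); rewrite mulrN1.
- by move=> x; rewrite normrN (le_trans (bf _))// normrN.
- by rewrite oppr_ge0 ltW.
Qed.

Variable x0 : J -> R.
Let X : R := \sum_j `|x0 j|.
Let X0 : 0 <= X. Proof. exact: sumr_ge0. Qed.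

Fixpoint picard (n : nat) : J -> R -> R :=
  if n is n'.+1 then fun i t => x0 i + prim (fun s => \sum_j A i j s * picard n' j s) t
  else fun i _ => x0 i.

Let csum (f : J -> R -> R) i : (forall j, continuous (f j)) ->
  continuous (fun s => \sum_j A i j s * f j s).
Proof.
move=> cf; elim: (index_enum J) => [|j r IH].
  have -> : (fun s => \sum_(j <- [::]) A i j s * f j s) = cst 0.
    by apply/funext => s; rewrite big_nil.
  exact: cst_continuous.
have -> : (fun s => \sum_(k <- j :: r) A i k s * f k s) =
    (fun s => A i j s * f j s + \sum_(k <- r) A i k s * f k s).
  by apply/funext => s; rewrite big_cons.
move=> s; apply: cvgD; last exact: IH.
by apply: cvgM; [exact: cA|exact: cf].
Qed.

Let cpicard n i : continuous (picard n i).
Proof.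
elim: n i => [|n IH] i t /=; first exact: cvg_cst.
apply: cvgD; first exact: cvg_cst.
exact: (is_derive_continuous (is_derive_prim t (csum (IH)))).
Qed.

Let lam_ge : K * #|J|%:R / lam <= 2^-1.
Proof.
rewrite /lam ler_pdivrMr // mulrA [2^-1 * _]mulrA mulVf // mul1r.
by rewrite ler_wpM2l ?(ltW K0) // ler_nat.
Qed.

Let sum_bound (f : J -> R) i t B : (forall j, `|f j| <= B) ->
  `|\sum_j A i j t * f j| <= K * #|J|%:R * B.
Proof.
move=> h; rewrite (le_trans (ler_norm_sum _ _ _))//.
rewrite (le_trans (@ler_sum _ _ _ _ _ (fun _ => K * B) _)) //.
  by move=> j _; rewrite normrM ler_pM.
by rewrite sumr_const -mulr_natl; lra.
Qed.

Let step (f g : J -> R -> R) B i t : 0 <= B ->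
  (forall j, continuous (f j)) -> (forall j, continuous (g j)) ->
  (forall j s, `|f j s - g j s| <= B * expR (lam * `|s|)) ->
  `|prim (fun s => \sum_j A i j s * f j s) t - prim (fun s => \sum_j A i j s * g j s) t| <=
  B / 2 * expR (lam * `|t|).
Proof.
move=> B0 cf cg h.
have := @expabs (fun t => prim (fun s => \sum_j A i j s * f j s) t -
   prim (fun s => \sum_j A i j s * g j s) t)
  (fun s => \sum_j A i j s * f j s - \sum_j A i j s * g j s) (K * #|J|%:R * B).
move=> /(_ _ _ _ _ t) H; rewrite (le_trans (H _ _ _ _))//.
- by rewrite !prim0 subrr.
- by move=> s; apply: is_deriveB; apply: is_derive_prim; exact: csum.
- by rewrite !mulr_ge0 // ltW.
- move=> s; rewrite -sumrB; under eq_bigr do rewrite -mulrBr.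
  by rewrite -mulrA; apply: sum_bound => j; exact: h.
rewrite ler_wpM2r ?expR_ge0 // [leLHS](_ : _ = K * #|J|%:R / lam * B); last by ring.
by rewrite [leRHS]mulrC ler_wpM2r // lam_ge.
Qed.

Let picard_step n i t : `|picard n.+1 i t - picard n i t| <= X * expR (lam * `|t|) * 2^-1 ^+ n.
Proof.
elim: n i t => [|n IH] i t.
  rewrite expr0 mulr1 /= addrAC subrr add0r.
  have := @expabs (prim (fun s => \sum_j A i j s * x0 j)) (fun s => \sum_j A i j s * x0 j)
    (K * #|J|%:R * X) (prim0 _) => /(_ _ _ _ t) H.
  rewrite (le_trans (H _ _ _))//.
  - by move=> s; apply: is_derive_prim; apply: (@csum (fun j _ => x0 j)) => j; exact: cst_continuous.
  - by rewrite !mulr_ge0 // ltW.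
  - move=> s; rewrite (le_trans (@sum_bound x0 i s X _))//.
      by move=> j; rewrite /X (bigD1 j) //= lerDl sumr_ge0.
    rewrite -[leLHS]mulr1 ler_wpM2l // ?mulr_ge0 ?(ltW K0) //.
    by rewrite -expR0 ler_expR mulr_ge0 // ltW.
  rewrite ler_wpM2r ?expR_ge0 // [leLHS](_ : _ = K * #|J|%:R / lam * X); last by ring.
  rewrite -[leRHS]mul1r ler_wpM2r // (le_trans lam_ge)// invf_le1 // ler1n //.
rewrite [picard n.+2 i t]/= [picard n.+1 i t in X in _ - X]/=.
rewrite opprD addrACA subrr add0r.
rewrite (le_trans (@step (picard n.+1) (picard n) (X * 2^-1 ^+ n) i t _ _ _ _))//.
- by rewrite mulr_ge0 // exprn_ge0 // invr_ge0.
- by move=> j s; rewrite (le_trans (IH j s))// mulrAC.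
by rewrite exprS; lra.
Qed.

(** The Picard iterates converge geometrically in the weighted norm on the whole line at once. The
    limit solves the integral equation, because one more step halves an error that is already
    geometric, and that equation is then differentiated. *)
Lemma linear_ode : exists y : J -> R -> R, (forall i, y i 0 = x0 i) /\
  (forall i t, is_derive t (1:R) (y i) (\sum_j A i j t * y j t)).
Proof.
have XE t : 0 <= X * expR (lam * `|t|) by rewrite mulr_ge0 // expR_ge0.
have /choice[y hy] : forall it : J * R, exists l, forall n,
   `|picard n it.1 it.2 - l| <= 2 * (X * expR (lam * `|it.2|)) * 2^-1 ^+ n.
  by move=> [i t]; apply: geom_lim => // n; exact: picard_step.
have {}hy i t n : `|picard n i t - y (i, t)| <= 2 * (X * expR (lam * `|t|)) * 2^-1 ^+ n.
  exact: (hy (i, t)).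
have cy i : continuous (fun t => y (i, t)).
  move=> t; apply/cvgrPdist_lt => e e0.
  have [n hn] := half_pow0 (2 * (X * expR (lam * (`|t| + 1)))) (divr_gt0 e0 (ltr0Sn R 2)).
  have e3 : 0 < e / 3 by rewrite divr_gt0.
  have /cvgrPdist_lt/(_ _ e3) hc := @cpicard n i t.
  near=> s.
  have b u : `|u| <= `|t| + 1 -> `|picard n i u - y (i, u)| < e / 3.
    move=> ut; rewrite (le_lt_trans (hy i u n))// (le_lt_trans _ hn)//.
    rewrite ler_wpM2r ?exprn_ge0 ?invr_ge0 // !ler_wpM2l //.
    by rewrite ler_expR ler_wpM2l // ltW.
  have b1 : `|picard n i t - y (i, t)| < e / 3 by apply: b; rewrite lerDl.
  have b2 : `|picard n i s - y (i, s)| < e / 3.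
    apply: b; have st : `|t - s| < 1.
      by near: s; apply/nbhs_ballP; exists 1 => //= x; rewrite /ball /=.
    have := ler_normB t (t - s); rewrite opprB addrC subrK; lra.
  have b3 : `|picard n i t - picard n i s| < e / 3 by near: s; exact: hc.
  rewrite (_ : y (i, t) - y (i, s) = - (picard n i t - y (i, t)) + (picard n i s - y (i, s))
     + (picard n i t - picard n i s)); last by ring.
  rewrite (le_lt_trans (ler_normD _ _))//.
  have := ler_normD (- (picard n i t - y (i, t))) (picard n i s - y (i, s)); rewrite normrN; lra.
have yint i t : y (i, t) = x0 i + prim (fun s => \sum_j A i j s * y (j, s)) t.
  apply/eqP; rewrite -subr_eq0 -normr_le0.
  apply: (@le0_eps _ _ (4 * (X * expR (lam * `|t|)))) => n.
  have i0 : 0 <= (2^-1 : R) ^+ n by rewrite exprn_ge0 // invr_ge0.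
  have c : `|prim (fun s => \sum_j A i j s * picard n j s) t -
             prim (fun s => \sum_j A i j s * y (j, s)) t| <= 2 * X * 2^-1 ^+ n / 2 * expR (lam * `|t|).
    apply: (@step (picard n) (fun j s => y (j, s))) => //; first by rewrite !mulr_ge0.
    by move=> j s; rewrite (le_trans (hy j s n))//; lra.
  have := hy i t n.+1; rewrite /= exprS; move: c.
  set p := prim _ t; set q := prim _ t => c a.
  rewrite (_ : y (i, t) - (x0 i + q) = - (x0 i + p - y (i, t)) + (p - q)); last by ring.
  rewrite (le_trans (ler_normD _ _))// normrN.
  have : 0 <= X * expR (lam * `|t|) * 2^-1 ^+ n by rewrite mulr_ge0 // XE.
  lra.
exists (fun i t => y (i, t)); split.
  by move=> i; rewrite yint prim0 addr0.
move=> i t; have -> : (fun t => y (i, t)) = fun t => x0 i + prim (fun s => \sum_j A i j s * y (j, s)) t.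
  by apply/funext => s; exact: yint.
apply: is_derive_eq'; first by apply: is_deriveD; apply: is_derive_prim; exact: csum.
by rewrite add0r.
Unshelve. all: by end_near. Qed.
End LinearODE.

(** * Complex linear systems and holomorphic dependence on a parameter *)

Section ComplexODE.
Variable R : realType.
Notation C := R[i].
Variable I : finType.

Lemma Rec_sum (J : Type) (r : seq J) (P : pred J) (f : J -> C) :
  Rec (\sum_(i <- r | P i) f i) = \sum_(i <- r | P i) Rec (f i).
Proof. by elim/big_rec2: _ => [//|i y1 y2 _ <-]; rewrite RecE. Qed.
Lemma Imc_sum (J : Type) (r : seq J) (P : pred J) (f : J -> C) :
  Imc (\sum_(i <- r | P i) f i) = \sum_(i <- r | P i) Imc (f i).
Proof. by elim/big_rec2: _ => [//|i y1 y2 _ <-]; rewrite RecE. Qed.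

Lemma dot_le_normc (z w : C) : Rec z * Rec w + Imc z * Imc w <= normc z * normc w.
Proof.
rewrite (le_trans (ler_norm _))// -normcM normc_sqrtE !RecE -sqrtr_sqr ler_sqrt ?addr_ge0 ?sqr_ge0 //.
have := sqr_ge0 (Rec z * Imc w - Imc z * Rec w); nra.
Qed.

Lemma cder_ccont (f f' : R -> C) : (forall t, cder f t (f' t)) -> ccont f.
Proof.
move=> h; split=> t; have [h1 h2] := h t.
  exact: (is_derive_continuous h1).
exact: (is_derive_continuous h2).
Qed.

(** Realification on [I + I]: left indices carry the real parts, right indices the imaginary
    parts. *)
Lemma complex_linear_ode (A : I -> I -> R -> C) (K : R) (c : I -> C) :
  (forall i j, ccont (A i j)) -> (forall i j t, normc (A i j t) <= K) ->
  exists y : I -> R -> C, (forall i, y i 0 = c i) /\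
    (forall i t, cder (y i) t (\sum_j A i j t * y j t)).
Proof.
move=> cA bA.
pose B (p q : I + I) (t : R) : R := match p, q with
  | inl i, inl j => Rec (A i j t) | inl i, inr j => - Imc (A i j t)
  | inr i, inl j => Imc (A i j t) | inr i, inr j => Rec (A i j t) end.
have cB p q : continuous (B p q).
  by case: p q => [i|i] [j|j]; rewrite /B; have [c1 c2] := cA i j => //;
    move=> t; apply: cvgN; exact: c2.
have K1 : 0 < Num.max 1 K by rewrite lt_max ltr01.
have bB p q t : `|B p q t| <= Num.max 1 K.
  by case: p q => [i|i] [j|j]; rewrite /B ?normrN le_max (le_trans _ (bA i j t)) ?orbT //
    ?normr_Rec ?normr_Imc.
have [y [y0 dy]] := linear_ode cB K1 bB (fun p => match p with inl i => Rec (c i) | inr i => Imc (c i) end).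
exists (fun i t => y (inl i) t +i* y (inr i) t); split.
  by move=> i; apply: complex_eq; rewrite /= y0.
move=> i t; split => /=.
  apply: (is_derive_eq' (dy (inl i) t)).
  rewrite big_sumType /= Rec_sum -big_split /=; apply: eq_bigr => j _.
  by rewrite RecE /= mulNr.
apply: (is_derive_eq' (dy (inr i) t)).
rewrite big_sumType /= Imc_sum -big_split /=; apply: eq_bigr => j _.
by rewrite RecE /= addrC.
Qed.

(** The leading 1 makes the constant dominate its own square root, so that the energy estimate for
    squares yields a bound for the moduli with the same constant. *)
Definition vgron (T K : R) := 1 + #|I|%:R * (1 + T) * expR ((2 * #|I|%:R * K + 1) * T).

Lemma vgron_ge1 T K : 0 <= T -> 1 <= vgron T K.
Proof. by move=> T0; rewrite /vgron lerDl !mulr_ge0 // ?expR_ge0 // addr_ge0. Qed.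

(** Scalar Gronwall for the sum [E] of the squared moduli; products of different components are
    split by [2 p q <= p^2 + q^2]. *)
Lemma vector_gronwall (T K : R) (A : I -> I -> R -> C) (e g : I -> R -> C) (rho gam : R) :
  0 <= T -> 0 <= K -> 0 <= rho -> 0 <= gam ->
  (forall i j t, 0 < t < T -> normc (A i j t) <= K) ->
  (forall i t, 0 < t < T -> normc (g i t) <= gam) ->
  (forall i, ccont (e i)) ->
  (forall i t, 0 < t < T -> cder (e i) t (\sum_j A i j t * e j t + g i t)) ->
  (forall i, normc (e i 0) <= rho) ->
  forall i, normc (e i T) <= vgron T K * (rho + gam).
Proof.
move=> T0 K0 r0 g0 bA bg ce de e0.
pose d : R := #|I|%:R.
pose E t := \sum_i normc (e i t) ^+ 2.
pose l i t := \sum_j A i j t * e j t + g i t.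
pose E' t := \sum_i 2 * (Rec (e i t) * Rec (l i t) + Imc (e i t) * Imc (l i t)).
have EE : E = fun t => \sum_i (Rec (e i t) ^+ 2 + Imc (e i t) ^+ 2).
  by apply/funext => t; apply: eq_bigr => i _; rewrite sqr_normcE.
have cE : continuous E.
  rewrite EE; elim: (index_enum I) => [|j r IH].
    have -> : (fun s => \sum_(i <- [::]) (Rec (e i s) ^+ 2 + Imc (e i s) ^+ 2)) = cst 0.
      by apply/funext => s; rewrite big_nil.
    exact: cst_continuous.
  have -> : (fun s => \sum_(i <- j :: r) (Rec (e i s) ^+ 2 + Imc (e i s) ^+ 2)) =
    (fun s => (Rec (e j s) * Rec (e j s) + Imc (e j s) * Imc (e j s)) +
      \sum_(i <- r) (Rec (e i s) ^+ 2 + Imc (e i s) ^+ 2)).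
    by apply/funext => s; rewrite big_cons !expr2.
  have [c1 c2] := ce j.
  move=> s; apply: cvgD; last exact: IH.
  by apply: cvgD; apply: cvgM; [exact: c1|exact: c1|exact: c2|exact: c2].
have dE t : 0 < t < T -> is_derive t (1:R) E (E' t).
  move=> tT; rewrite EE /E'; elim: (index_enum I) => [|j r IH].
    have -> : (fun s => \sum_(i <- [::]) (Rec (e i s) ^+ 2 + Imc (e i s) ^+ 2)) = cst 0.
      by apply/funext => s; rewrite big_nil.
    by rewrite big_nil; exact: is_derive_cst.
  have -> : (fun s => \sum_(i <- j :: r) (Rec (e i s) ^+ 2 + Imc (e i s) ^+ 2)) =
    (fun s => (Rec (e j s) * Rec (e j s) + Imc (e j s) * Imc (e j s)) +
      \sum_(i <- r) (Rec (e i s) ^+ 2 + Imc (e i s) ^+ 2)).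
    by apply/funext => s; rewrite big_cons !expr2.
  have [d1 d2] := de j t tT; rewrite big_cons.
  apply: is_derive_eq'.
  by congr (_ + _); rewrite /GRing.scale /= /l; ring.
have bE t : 0 < t < T -> E' t <= (2 * d * K + 1) * E t + d * gam ^+ 2.
  move=> tT; rewrite /E'.
  have step i : 2 * (Rec (e i t) * Rec (l i t) + Imc (e i t) * Imc (l i t)) <=
     \sum_j (K * (normc (e i t) ^+ 2 + normc (e j t) ^+ 2)) + (normc (e i t) ^+ 2 + gam ^+ 2).
    have h1 : Rec (e i t) * Rec (l i t) + Imc (e i t) * Imc (l i t) <= normc (e i t) * normc (l i t).
      exact: dot_le_normc.
    have h2 : normc (l i t) <= \sum_j (K * normc (e j t)) + gam.
      rewrite (le_trans (ler_normcD _ _))// lerD ?bg // (le_trans (ler_normc_sum _ _ _))//.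
      by apply: ler_sum => j _; rewrite normcM ler_wpM2r ?normc_ge0 // bA.
    have h3 : normc (e i t) * normc (l i t) <= normc (e i t) * (\sum_j (K * normc (e j t)) + gam).
      by rewrite ler_wpM2l ?normc_ge0.
    have h4 : 2 * (normc (e i t) * \sum_j (K * normc (e j t))) <=
        \sum_j (K * (normc (e i t) ^+ 2 + normc (e j t) ^+ 2)).
      rewrite !mulr_sumr; apply: ler_sum => j _.
      rewrite (_ : 2 * _ = K * (2 * normc (e i t) * normc (e j t))); last by ring.
      rewrite ler_wpM2l //.
      have := sqr_ge0 (normc (e i t) - normc (e j t)); nra.
    have := sqr_ge0 (normc (e i t) - gam); nra.
  rewrite (le_trans (@ler_sum _ _ _ _ _ _ (fun i _ => step i)))//.
  rewrite big_split /= big_split /=.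
  have -> : \sum_(i : I) gam ^+ 2 = d * gam ^+ 2 by rewrite sumr_const -mulr_natl.
  have -> : \sum_i \sum_j K * (normc (e i t) ^+ 2 + normc (e j t) ^+ 2) = 2 * d * K * E t.
    under eq_bigr do rewrite -mulr_sumr big_split /= sumr_const -mulr_natl.
    rewrite -mulr_sumr big_split /= -mulr_sumr sumr_const -mulr_natl /E /d; ring.
  by rewrite /E; lra.
have d0 : 0 <= d by rewrite /d.
have KK : 0 <= 2 * d * K + 1 by rewrite addr_ge0 // !mulr_ge0.
have dg : 0 <= d * gam ^+ 2 by rewrite mulr_ge0 // sqr_ge0.
have G := gronwall KK dg T0 cE dE bE.
have E0 : E 0 <= d * rho ^+ 2.
  rewrite /E (le_trans (@ler_sum _ _ _ _ _ (fun _ => rho ^+ 2) _)) //.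
    by move=> i _; rewrite lerXn2r // ?nnegrE ?normc_ge0.
  by rewrite sumr_const -mulr_natl.
move=> i; have M1 := vgron_ge1 K T0.
have rg : 0 <= rho + gam by rewrite addr_ge0.
rewrite -(@ler_pXn2r _ 2%N) ?nnegrE ?normc_ge0 // ?mulr_ge0 ?(le_trans ler01 M1) //.
have ei : normc (e i T) ^+ 2 <= E T.
  by rewrite /E (bigD1 i) //= lerDl sumr_ge0 // => j _; rewrite sqr_ge0.
rewrite (le_trans ei)// (le_trans G)// exprMn.
pose X := expR ((2 * d * K + 1) * T).
have X0 : 0 <= X by exact: expR_ge0.
have H1 : (E 0 + d * gam ^+ 2 * T) * X <= (rho + gam) ^+ 2 * (d * (1 + T) * X).
  rewrite (_ : _ * (d * _ * _) = ((rho + gam) ^+ 2 * (d * (1 + T))) * X); last by ring.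
  rewrite ler_wpM2r //.
  have h1 : rho ^+ 2 <= (rho + gam) ^+ 2 by rewrite lerXn2r ?nnegrE // lerDl.
  have h2 : gam ^+ 2 <= (rho + gam) ^+ 2 by rewrite lerXn2r ?nnegrE // lerDr.
  have h3 : d * rho ^+ 2 <= d * (rho + gam) ^+ 2 by rewrite ler_wpM2l.
  have h4 : d * T * gam ^+ 2 <= d * T * (rho + gam) ^+ 2 by rewrite ler_wpM2l // mulr_ge0.
  lra.
rewrite (le_trans H1)// mulrC ler_wpM2r ?sqr_ge0 //.
rewrite (le_trans (_ : _ <= vgron T K)) //; first by rewrite /vgron lerDr.
by rewrite expr2 -[leLHS]mulr1 ler_wpM2l // (le_trans ler01).
Qed.

Definition copen (D : set C) := forall z, D z -> exists2 r : R, 0 < r & forall w, normc (w - z) < r -> D w.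
Definition hol_family (J : Type) (S : set J) (D : set C) (f : J -> C -> C) := exists f', holu S D f f'.

Lemma cgeom_lim (u : nat -> C) (c : R) : 0 <= c ->
  (forall n, normc (u n.+1 - u n) <= c * 2^-1 ^+ n) ->
  exists l, forall n, normc (u n - l) <= 4 * c * 2^-1 ^+ n.
Proof.
move=> c0 h.
have [|l1 h1] := @geom_lim R (fun n => Rec (u n)) c c0.
  by move=> n; rewrite (le_trans _ (h n))// -Rec_opp -Rec_add normr_Rec.
have [|l2 h2] := @geom_lim R (fun n => Imc (u n)) c c0.
  by move=> n; rewrite (le_trans _ (h n))// -Imc_opp -Imc_add normr_Imc.
exists (l1 +i* l2) => n; rewrite (le_trans (normc_le_ReIm _))// !RecE /=.
have := h1 n; have := h2 n; lra.
Qed.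

(** Gronwall is applied three times: to the solution, to its increments in the parameter, and to
    differences of its difference quotients at [z]. The last gives a Cauchy estimate linear in the
    distances to [z]. The quotients therefore converge, and their rate of convergence is exactly the
    quadratic remainder demanded by [holu], uniformly in time. *)
Theorem ode_hol (T : R) (D : set C) (A : I -> I -> R -> C -> C) (y : I -> R -> C -> C) (c : I -> C) :
  0 <= T -> bddC D -> copen D ->
  (forall i j, hol_family `[0, T] D (A i j)) ->
  (forall i z, D z -> ccont (fun t => y i t z)) ->
  (forall i z t, D z -> 0 < t < T -> cder (fun t => y i t z) t (\sum_j A i j t z * y j t z)) ->
  (forall i z, D z -> y i 0 z = c i) ->
  forall i, hol_family `[0, T] D (y i).
Proof.
move=> T0 bD oD hA cy dy y0 i.
have [B0 B01 hB0] := bddC_K bD.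
have /choice[A' hA'] : forall p : I * I, exists A', holu `[0, T] D (A p.1 p.2) A'.
  by move=> [a b]; exact: hA.
have /choice[KA hKA] : forall p : I * I, exists K : R, 1 <= K /\ forall t, `[0, T]%classic t ->
  (forall z, D z -> normc (A p.1 p.2 t z) <= K /\ normc (A' p t z) <= K) /\
  (forall z w, D z -> D w -> normc (A p.1 p.2 t w - A p.1 p.2 t z - A' p t z * (w - z)) <= K * normc (w - z) ^+ 2).
  by move=> p; have [K K1 h] := holu_K (hA' p); exists K.
pose K := 1 + \sum_p KA p.
have KA0 p : 0 <= KA p by rewrite (le_trans ler01) // (hKA p).1.
have KAK p : KA p <= K.
  by rewrite /K (bigD1 p) //= addrCA lerDl addr_ge0 // sumr_ge0.
have K0 : 0 <= K by rewrite addr_ge0 // sumr_ge0.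
have bA a b t z : `[0, T]%classic t -> D z -> normc (A a b t z) <= K.
  by move=> tT Dz; rewrite (le_trans (((hKA (a, b)).2 t tT).1 z Dz).1).
have bA' a b t z : `[0, T]%classic t -> D z -> normc (A' (a, b) t z) <= K.
  by move=> tT Dz; rewrite (le_trans (((hKA (a, b)).2 t tT).1 z Dz).2).
have qA a b t z w : `[0, T]%classic t -> D z -> D w ->
   normc (A a b t w - A a b t z - A' (a, b) t z * (w - z)) <= K * normc (w - z) ^+ 2.
  move=> tT Dz Dw; rewrite (le_trans (((hKA (a, b)).2 t tT).2 z w Dz Dw))//.
  by rewrite ler_wpM2r // sqr_ge0.
have lA a b t z w : `[0, T]%classic t -> D z -> D w ->
   normc (A a b t w - A a b t z) <= K * (1 + B0) * normc (w - z).
  move=> tT Dz Dw.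
  rewrite -[A a b t w - _](subrK (A' (a, b) t z * (w - z))).
  rewrite (le_trans (ler_normcD _ _))// normcM.
  have h1 := qA a b t z w tT Dz Dw; have h2 := bA' a b t z tT Dz; have h3 := hB0 z w Dz Dw.
  have h4 := normc_ge0 (w - z).
  have : normc (A' (a, b) t z) * normc (w - z) <= K * normc (w - z) by rewrite ler_wpM2r.
  have : K * normc (w - z) ^+ 2 <= K * B0 * normc (w - z) by rewrite expr2 mulrA ler_wpM2r // ler_wpM2l.
  lra.
have in0T t : 0 <= t <= T -> `[0, T]%classic t by rewrite /= in_itv.
have oo t u : 0 <= u <= T -> 0 < t < u -> 0 < t < T.
  by move=> /andP[_ uT] /andP[-> tu] /=; rewrite (lt_le_trans tu).
have ooc t : 0 < t < T -> `[0, T]%classic t.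
  by move=> /andP[a b]; apply: in0T; rewrite (ltW a) (ltW b).
pose d : R := #|I|%:R.
have d0 : 0 <= d by rewrite /d.
pose G := vgron T K.
have G1 : 1 <= G by exact: vgron_ge1.
have G0 : 0 <= G by rewrite (le_trans ler01).
have Gle u : 0 <= u <= T -> vgron u K <= G.
  move=> /andP[u0 uT]; rewrite /G /vgron lerD2l.
  rewrite ler_pM ?mulr_ge0 ?addr_ge0 ?expR_ge0 //; first by rewrite ler_wpM2l // lerD2l.
  by rewrite ler_expR ler_wpM2l // addr_ge0 // !mulr_ge0.
have gron u (e g : I -> R -> C) (z : C) (gam rho : R) : 0 <= u <= T -> D z -> 0 <= rho -> 0 <= gam ->
    (forall i, ccont (e i)) ->
    (forall i t, 0 < t < T -> cder (e i) t (\sum_j A i j t z * e j t + g i t)) ->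
    (forall i t, 0 < t < T -> normc (g i t) <= gam) -> (forall i, normc (e i 0) <= rho) ->
    forall i, normc (e i u) <= G * (rho + gam).
  move=> uT Dz r0 g0 ce de bg e0 j.
  have [u0 _] := andP uT.
  rewrite (le_trans (@vector_gronwall u K (fun a b t => A a b t z) e g rho gam u0 K0 r0 g0 _ _ ce _ e0 j)) //.
  - by move=> a b t tu; apply: bA => //; apply: ooc; exact: oo tu.
  - by move=> a t tu; apply: bg; exact: oo tu.
  - by move=> a t tu; apply: de; exact: oo tu.
  by rewrite ler_wpM2r ?addr_ge0 ?Gle.
pose X := \sum_j normc (c j).
have X0 : 0 <= X by apply: sumr_ge0 => j _; exact: normc_ge0.
have by_ j u z : 0 <= u <= T -> D z -> normc (y j u z) <= G * X.
  move=> uT Dz; rewrite -[X]addr0.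
  apply: (gron u (fun j t => y j t z) (fun _ _ => 0) z 0 X) => //.
  - by move=> a; exact: cy.
  - by move=> a t tT; rewrite addr0; exact: dy.
  - by move=> a t _; rewrite normc0.
  - by move=> a; rewrite y0 // /X (bigD1 a) //= lerDl sumr_ge0 // => b _; exact: normc_ge0.
have GX0 : 0 <= G * X by rewrite mulr_ge0.
pose L := G * (d * (K * (1 + B0)) * (G * X)).
have B00 : 0 <= B0 by rewrite (le_trans ler01).
have KB0 : 0 <= K * (1 + B0) by rewrite mulr_ge0 // addr_ge0.
have sumC (f : I -> C) (M : R) : (forall j, normc (f j) <= M) -> normc (\sum_j f j) <= d * M.
  move=> h; rewrite (le_trans (ler_normc_sum _ _ _))//.
  rewrite (le_trans (@ler_sum _ _ _ _ _ (fun _ => M) _)) //.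
  by rewrite sumr_const -mulr_natl.
have lipy j u z w : 0 <= u <= T -> D z -> D w -> normc (y j u w - y j u z) <= L * normc (w - z).
  move=> uT Dz Dw.
  have -> : L * normc (w - z) = G * (0 + d * (K * (1 + B0) * normc (w - z) * (G * X))).
    by rewrite /L; ring.
  apply: (gron u (fun j t => y j t w - y j t z)
     (fun j t => \sum_b (A j b t w - A j b t z) * y b t w) z) => //.
  - by apply: mulr_ge0 => //; apply: mulr_ge0 => //; apply: mulr_ge0; rewrite ?normc_ge0.
  - by move=> a; apply: ccontB; exact: cy.
  - move=> a t tT; apply: (cder_eq (cderB (dy a w t Dw tT) (dy a z t Dz tT))).
    by rewrite -big_split -sumrB; apply: eq_bigr => b _ /=; ring.
  - move=> a t tT; apply: sumC => b; rewrite normcM ler_pM ?normc_ge0 //.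
      by apply: lA => //; exact: ooc.
    by apply: by_ => //; exact: ooc.
  - by move=> a; rewrite !y0 // subrr normc0.
have L0 : 0 <= L by rewrite /L; nneg.
pose Q j t z w := (y j t w - y j t z) / (w - z).
pose M := G * (d * (K * (G * X) + K * L)).
have M0 : 0 <= M by rewrite /M; nneg.
have nzC (z w : C) : w != z -> w - z != 0 by rewrite subr_eq0.
have cauchy j u z w1 w2 : 0 <= u <= T -> D z -> D w1 -> D w2 -> w1 != z -> w2 != z ->
   normc (Q j u z w1 - Q j u z w2) <= M * (normc (w1 - z) + normc (w2 - z)).
  move=> uT Dz D1 D2 n1 n2.
  pose r := normc (w1 - z) + normc (w2 - z).
  have r0 : 0 <= r by rewrite addr_ge0 ?normc_ge0.
  have -> : M * r = G * (0 + d * (K * (G * X) * r + K * L * r)) by rewrite /M; ring.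
  pose g j t := \sum_b ((A j b t w1 - A j b t z) / (w1 - z) * y b t w1
     - (A j b t w2 - A j b t z) / (w2 - z) * y b t w2).
  apply: (gron u (fun j t => Q j t z w1 - Q j t z w2) g z) => //.
  - by nneg.
  - move=> a; apply: ccontB; (apply: ccontM; last exact: ccont_cst); apply: ccontB; exact: cy.
  - move=> a t tT.
    have h w : D w -> cder (fun t => Q a t z w) t
       ((\sum_b A a b t w * y b t w - \sum_b A a b t z * y b t z) / (w - z)).
      move=> Dw; apply: (cder_eq (cderM (cderB (dy a w t Dw tT) (dy a z t Dz tT)) (cder_cst (w - z)^-1 t))).
      by rewrite mulr0 addr0.
    apply: (cder_eq (cderB (h w1 D1) (h w2 D2))).
    rewrite /g -big_split -!sumrB !mulr_suml -sumrB; apply: eq_bigr => b _ /=.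
    by rewrite /Q; field; rewrite !nzC.
  - move=> a t tT; apply: sumC => b; have tc := ooc t tT.
    have q (w : C) : D w -> w != z ->
      normc ((A a b t w - A a b t z) / (w - z) - A' (a, b) t z) <= K * normc (w - z).
      move=> Dw nw; have p0 : 0 < normc (w - z) by apply: normc_gt0; exact: nzC.
      have -> : (A a b t w - A a b t z) / (w - z) - A' (a, b) t z =
        (A a b t w - A a b t z - A' (a, b) t z * (w - z)) / (w - z) by field; rewrite nzC.
      by rewrite normcM normcV ler_pdivrMr // -mulrA -expr2; exact: qA.
    have -> : (A a b t w1 - A a b t z) / (w1 - z) * y b t w1
       - (A a b t w2 - A a b t z) / (w2 - z) * y b t w2 =
      (((A a b t w1 - A a b t z) / (w1 - z) - A' (a, b) t z) * y b t w1
       - ((A a b t w2 - A a b t z) / (w2 - z) - A' (a, b) t z) * y b t w2)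
      + A' (a, b) t z * ((y b t w1 - y b t z) - (y b t w2 - y b t z)) by ring.
    rewrite (le_trans (ler_normcD _ _))// lerD //.
      rewrite (le_trans (ler_normcB _ _))// !normcM /r mulrDr lerD //.
        rewrite mulrAC ler_pM ?normc_ge0 // ?q ?by_ //.
      rewrite mulrAC ler_pM ?normc_ge0 // ?q ?by_ //.
    rewrite normcM -mulrA ler_pM ?normc_ge0 ?bA' // (le_trans (ler_normcB _ _))//.
    by rewrite /r mulrDr lerD // lipy.
  - by move=> a; rewrite /Q !y0 // !subrr !mul0r subrr normc0.
(* The limit is taken along the real dyadic increments [h n], which stay in [D] by openness; the
   Cauchy estimate carries the rate over to every other [w]. Outside the domain the value 0 is a
   dummy. *)
have /choice[y' hy'] : forall tz : R * C, exists l, forall w, 0 <= tz.1 <= T -> D tz.2 -> D w -> w != tz.2 ->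
    normc (Q i tz.1 tz.2 w - l) <= M * normc (w - tz.2).
  move=> [t z] /=; have [[tT Dz]|nn] := pselect (0 <= t <= T /\ D z); last first.
    by exists 0 => w tT Dz; exfalso; apply: nn.
  have [r r0 hr] := oD z Dz.
  pose h n : C := (r / 2 * 2^-1 ^+ n)%:C.
  have hp n : 0 < r / 2 * 2^-1 ^+ n by rewrite mulr_gt0 ?divr_gt0 // exprn_gt0 // invr_gt0.
  have nh n : normc (h n) = r / 2 * 2^-1 ^+ n by rewrite normcR gtr0_norm.
  have i1 n : (2^-1 : R) ^+ n <= 1 by rewrite exprn_ile1 // ?invr_ge0 // invf_le1 // ler1n.
  have Dh n : D (z + h n).
    apply: hr; rewrite addrC addKr nh; have := i1 n; have := hp n => a b.
    have : r / 2 * 2^-1 ^+ n <= r / 2 * 1 by rewrite ler_wpM2l // divr_ge0 // ltW.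
    lra.
  have nzh n : z + h n != z.
    by apply/eqP => /eqP; rewrite -subr_eq0 addrC addKr => /eqP e; move: (nh n); rewrite e normc0 => e2;
      move: (hp n); rewrite -e2 ltxx.
  have [|n|l hl] := @cgeom_lim (fun n => Q i t z (z + h n)) (M * (r * 2)).
  - by rewrite mulr_ge0 // mulr_ge0 // ltW.
  - rewrite (le_trans (cauchy i t z _ _ tT Dz (Dh _) (Dh _) (nzh _) (nzh _)))//.
    rewrite -mulrA ler_wpM2l //.
    have e1 m : z + h m - z = h m by rewrite addrC addKr.
    rewrite !e1 !nh exprS; have := mulr_gt0 r0 (_ : 0 < 2^-1 ^+ n); rewrite exprn_gt0 ?invr_gt0 // => /(_ isT).
    lra.
  exists l => w _ _ Dw nw.
  rewrite -subr_le0; apply: (@le0_eps _ _ (M * (r / 2) + 4 * (M * (r * 2)))) => n.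
  have e1 m : z + h m - z = h m by rewrite addrC addKr.
  have c1 := cauchy i t z w (z + h n) tT Dz Dw (Dh n) nw (nzh n).
  rewrite e1 nh in c1.
  have c2 := hl n.
  have := ler_normcD (Q i t z w - Q i t z (z + h n)) (Q i t z (z + h n) - l).
  rewrite addrA subrK; lra.
exists (fun t z => y' (t, z)); exists (G * X + L + M) => t tT; have tT' : 0 <= t <= T by move: tT; rewrite /= in_itv.
split.
  move=> z Dz; split; first by rewrite (le_trans (by_ i t z tT' Dz))//; lra.
  have [r r0 hr] := oD z Dz.
  apply/ler_addgt0Pr => eps eps0.
  (* An increment small enough to stay in [D] and to keep the error [M * s] below [eps]: the
     derivative inherits the Lipschitz bound [L] of the quotients. *)
  pose s := Num.min (r / 2) (eps / (M + 1)).
  have M1 : 0 < M + 1 by rewrite ltr_wpDl.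
  have s0 : 0 < s by rewrite /s lt_min !divr_gt0.
  have sr : s < r by rewrite /s gt_min ltr_pdivrMr // ltr_pMr // ltr1n.
  have se : M * s <= eps.
    have : s <= eps / (M + 1) by rewrite /s ge_min lexx orbT.
    rewrite ler_pdivlMr // => h; have := M0; nra.
  have Dw : D (z + s%:C) by apply: hr; rewrite addrC addKr normcR gtr0_norm.
  have nw : z + s%:C != z.
    by rewrite -subr_eq0 addrC addKr; apply/eqP => -[e]; move: s0; rewrite e ltxx.
  have := hy' (t, z) (z + s%:C) tT' Dz Dw nw; rewrite /= addrAC subrr add0r normcR gtr0_norm // => h1.
  have h2 : normc (Q i t z (z + s%:C)) <= L.
    rewrite /Q normcM normcV ler_pdivrMr; last by apply: normc_gt0; rewrite subr_eq0.
    exact: lipy.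
  have := ler_normcB (Q i t z (z + s%:C)) (Q i t z (z + s%:C) - y' (t, z)).
  rewrite opprB addrCA subrr addr0; lra.
move=> z w Dz Dw; have [->|nw] := eqVneq w z.
  by rewrite !subrr mulr0 subrr normc0 mulr_ge0 // ?sqr_ge0 // !addr_ge0.
have -> : y i t w - y i t z - y' (t, z) * (w - z) = (Q i t z w - y' (t, z)) * (w - z).
  by rewrite /Q; field; rewrite subr_eq0.
rewrite normcM expr2 mulrA ler_wpM2r ?normc_ge0 //.
rewrite (le_trans (hy' (t, z) w tT' Dz Dw nw))// ler_wpM2r ?normc_ge0 //=; lra.
Qed.
End ComplexODE.

(** * Laplace transforms and Poisson integrals *)

Section IntegralBasics.
Variable R : realType.
Notation C := R[i].
Notation mu := (@lebesgue_measure R).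
Notation mR := (measurableTypeR R).
Implicit Types (D : set mR) (f g : R -> C).

Lemma integrable_le D (f g : R -> R) : measurable D -> measurable_fun D f ->
  mu.-integrable D (EFin \o g) -> (forall x, D x -> `|f x| <= g x) ->
  mu.-integrable D (EFin \o f).
Proof.
move=> mD mf ig fg; apply: (le_integrable mD _ _ ig); first exact/measurable_EFinP.
by move=> x Dx /=; rewrite lee_fin (le_trans (fg x Dx))// ler_norm.
Qed.

Lemma Rint_abs_le D (f g : R -> R) : measurable D -> mu.-integrable D (EFin \o f) ->
  mu.-integrable D (EFin \o g) -> (forall x, D x -> `|f x| <= g x) ->
  `|\int[mu]_(x in D) f x| <= \int[mu]_(x in D) g x.
Proof.
move=> mD if_ ig fg; rewrite (le_trans (le_normr_Rintegral mD if_))//.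
by apply: le_Rintegral => //; exact: integrable_norm.
Qed.

Definition cinteg D f := mu.-integrable D (EFin \o (fun x => Rec (f x))) /\
  mu.-integrable D (EFin \o (fun x => Imc (f x))).
Definition cmeas D f := measurable_fun D (fun x => Rec (f x)) /\
  measurable_fun D (fun x => Imc (f x)).
Definition cint D f : C := (\int[mu]_(x in D) Rec (f x)) +i* (\int[mu]_(x in D) Imc (f x)).

Lemma eq_cint D f g : (forall x, D x -> f x = g x) -> cint D f = cint D g.
Proof.
by move=> h; congr (_ +i* _); apply: eq_Rintegral => x /set_mem /h ->.
Qed.
Lemma eq_cinteg D f g : measurable D -> (forall x, D x -> f x = g x) -> cinteg D f -> cinteg D g.
Proof.
by move=> mD h [h1 h2]; split;
  [apply: eq_integrable h1 => // x /set_mem /h /= -> | apply: eq_integrable h2 => // x /set_mem /h /= ->].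
Qed.
Lemma cinteg_le D f (g : R -> R) : measurable D -> cmeas D f -> mu.-integrable D (EFin \o g) ->
  (forall x, D x -> normc (f x) <= g x) -> cinteg D f.
Proof.
by move=> mD [m1 m2] ig fg; split; apply: (integrable_le mD _ ig) => // x Dx;
  rewrite (le_trans _ (fg x Dx)) // ?normr_Rec ?normr_Imc.
Qed.
(** The factor 2 is the price of bounding real and imaginary parts separately; it only affects
    constants later on. *)
Lemma cint_le D f (g : R -> R) : measurable D -> cinteg D f -> mu.-integrable D (EFin \o g) ->
  (forall x, D x -> normc (f x) <= g x) -> normc (cint D f) <= 2 * \int[mu]_(x in D) g x.
Proof.
move=> mD [m1 m2] ig fg; rewrite (le_trans (normc_le_ReIm _))//=.
have h1 : `|\int[mu]_(x in D) Rec (f x)| <= \int[mu]_(x in D) g x.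
  by apply: Rint_abs_le => // x Dx; rewrite (le_trans (normr_Rec _)) // fg.
have h2 : `|\int[mu]_(x in D) Imc (f x)| <= \int[mu]_(x in D) g x.
  by apply: Rint_abs_le => // x Dx; rewrite (le_trans (normr_Imc _)) // fg.
lra.
Qed.
Lemma cintegD D f g : measurable D -> cinteg D f -> cinteg D g -> cinteg D (fun x => f x + g x).
Proof.
move=> mD [f1 f2] [g1 g2]; split.
  by apply: eq_integrable (integrableD mD f1 g1) => // x _ /=; rewrite RecE.
by apply: eq_integrable (integrableD mD f2 g2) => // x _ /=; rewrite RecE.
Qed.
Lemma cintD D f g : measurable D -> cinteg D f -> cinteg D g ->
  cint D (fun x => f x + g x) = cint D f + cint D g.
Proof.
move=> mD [f1 f2] [g1 g2]; apply: complex_eq; rewrite !RecE /=.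
  by rewrite -RintegralD //; apply: eq_Rintegral => x _; rewrite RecE.
by rewrite -RintegralD //; apply: eq_Rintegral => x _; rewrite RecE.
Qed.
Lemma cintegZ D f (c : C) : measurable D -> cinteg D f -> cinteg D (fun x => c * f x).
Proof.
move=> mD [f1 f2]; split.
  by apply: eq_integrable (integrableB mD (integrableZl mD (Rec c) f1) (integrableZl mD (Imc c) f2))
    => // x _ /=; rewrite RecE.
by apply: eq_integrable (integrableD mD (integrableZl mD (Rec c) f2) (integrableZl mD (Imc c) f1))
    => // x _ /=; rewrite RecE.
Qed.
Lemma integrableZ' D (c : R) (f : R -> R) : measurable D -> mu.-integrable D (EFin \o f) ->
  mu.-integrable D (EFin \o (fun x => c * f x)).
Proof. by move=> mD h; apply: eq_integrable (integrableZl mD c h). Qed.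
Lemma cintZ D f (c : C) : measurable D -> cinteg D f ->
  cint D (fun x => c * f x) = c * cint D f.
Proof.
move=> mD [f1 f2]; apply: complex_eq; rewrite !RecE /=.
  rewrite -!RintegralZl // -RintegralB; [|by []|exact: integrableZ'..].
  by apply: eq_Rintegral => x _; rewrite RecE.
rewrite -!RintegralZl // -RintegralD; [|by []|exact: integrableZ'..].
by apply: eq_Rintegral => x _; rewrite RecE.
Qed.
Lemma cintegN D f : measurable D -> cinteg D f -> cinteg D (fun x => - f x).
Proof. by move=> mD /(cintegZ (-1) mD); apply: (eq_cinteg mD) => x _; rewrite mulN1r. Qed.
Lemma cintN D f : measurable D -> cinteg D f -> cint D (fun x => - f x) = - cint D f.
Proof.
by move=> mD h; rewrite -mulN1r -cintZ //; apply: eq_cint => x _; rewrite mulN1r.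
Qed.
Lemma cintegB D f g : measurable D -> cinteg D f -> cinteg D g -> cinteg D (fun x => f x - g x).
Proof. by move=> mD hf hg; apply: cintegD => //; exact: cintegN. Qed.
Lemma cintB D f g : measurable D -> cinteg D f -> cinteg D g ->
  cint D (fun x => f x - g x) = cint D f - cint D g.
Proof. by move=> mD hf hg; rewrite cintD ?cintN //; exact: cintegN. Qed.
Lemma ccont_cmeas D f : measurable D -> ccont f -> cmeas D f.
Proof.
by move=> mD [c1 c2]; split; apply: measurable_funTS; exact: continuous_measurable_fun.
Qed.
Lemma cmeasM D f g : cmeas D f -> cmeas D g -> cmeas D (fun x => f x * g x).
Proof.
move=> [f1 f2] [g1 g2]; split.
  by under eq_fun do rewrite RecE; apply: measurable_funB; apply: measurable_funM.
by under eq_fun do rewrite RecE; apply: measurable_funD; apply: measurable_funM.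
Qed.
Lemma ccont_cinteg f (a b : R) : ccont f -> cinteg `[a, b] f.
Proof. by move=> [c1 c2]; split; exact: cont_integrable. Qed.
Lemma Rint_FTC (F f : R -> R) (a b : R) : a <= b -> continuous f ->
  (forall x, is_derive x (1:R) F (f x)) -> \int[mu]_(x in `[a, b]) f x = F b - F a.
Proof.
move=> ab cf dF; move: ab; rewrite le_eqVlt => /predU1P[->|ab].
  by rewrite set_itv1 Rintegral_set1 subrr.
rewrite /Rintegral (@continuous_FTC2 _ f F) //.
- exact: continuous_subspaceT.
- split; first by move=> x _; exact: ex_derive.
    by apply: cvg_at_right_filter; exact: (is_derive_continuous (dF a)).
  by apply: cvg_at_left_filter; exact: (is_derive_continuous (dF b)).
- by move=> x _; rewrite derive1E; exact: derive_val.
Qed.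
Lemma cint_FTC (F f : R -> C) (a b : R) : a <= b -> ccont f -> (forall x, cder F x (f x)) ->
  cint `[a, b] f = F b - F a.
Proof.
move=> ab [c1 c2] dF; apply: complex_eq; rewrite RecE /=.
  by rewrite (Rint_FTC ab c1 (fun x => (dF x).1)) Rec_opp.
by rewrite (Rint_FTC ab c2 (fun x => (dF x).2)) Imc_opp.
Qed.
Lemma Rint_cst (a b c : R) : a <= b -> \int[mu]_(x in `[a, b]) c = c * (b - a).
Proof.
move=> ab.
have d (x : R) : is_derive x (1:R) (fun x => c * x) c.
  by apply: is_derive_eq'; rewrite /GRing.scale /=; ring.
have cc : continuous (fun _ : R => c) by move=> x; exact: cvg_cst.
by rewrite (Rint_FTC ab cc d); ring.
Qed.
Lemma cint_itv_le f (a b B : R) : a <= b -> ccont f -> (forall x, a <= x <= b -> normc (f x) <= B) ->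
  normc (cint `[a, b] f) <= 2 * B * (b - a).
Proof.
move=> ab cf bf; rewrite -mulrA -Rint_cst //; apply: cint_le => //; first exact: ccont_cinteg.
- by apply: (@cont_integrable _ (fun=> B)); exact: cst_continuous.
Qed.

(** Lebesgue measure is determined by its values on half-open intervals. Serves for translations and
    for the reflection. *)
Lemma lebesgue_pushforward (phi : mR -> mR) : measurable_fun [set: mR] phi ->
  (forall a b : R, mu (phi @^-1` `]a, b]) = mu (`]a, b]%classic : set R)) ->
  forall A, measurable A -> mu A = pushforward mu phi A.
Proof.
move=> mphi h.
pose phi' : {mfun measurableTypeR R >-> measurableTypeR R} :=
  HB.pack phi (isMeasurableFun.Build _ _ _ _ _ mphi).
apply: (@lebesgue_measure_unique R (pushforward mu phi')) => _ [[a b] _ <-] /=.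
by rewrite /pushforward h.
Qed.
Lemma shift_preimage (c a b : R) : (fun x : mR => x + c : mR) @^-1` `]a, b] = `]a - c, b - c]%classic.
Proof.
by apply/seteqP; split => x /=; rewrite !in_itv /=; rewrite ltrBlDr lerBrDr.
Qed.
Lemma measurable_shift (c : R) : measurable_fun [set: mR] (fun x : mR => x + c : mR).
Proof. by apply: continuous_measurable_fun => x; apply: cvgD; [exact: cvg_id|exact: cvg_cst]. Qed.
Lemma lebesgue_shift (c : R) A : measurable A -> mu A = pushforward mu (fun x : mR => x + c : mR) A.
Proof.
apply: lebesgue_pushforward; first exact: measurable_shift.
move=> a b; rewrite shift_preimage !lebesgue_measure_itv /= !lte_fin.
by rewrite ltrD2r -!EFinB; congr (if _ then _%:E else _); ring.
Qed.
Lemma ge0_int_shift (c : R) (f : mR -> \bar R) : measurable_fun [set: mR] f -> (forall x, 0 <= f x)%E ->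
  (\int[mu]_x f (x + c)%R = \int[mu]_x f x)%E.
Proof.
move=> mf f0; rewrite [RHS](@eq_measure_integral _ _ _ _ (pushforward mu (fun x : mR => x + c : mR))).
- exact: measurable_shift.
- by move=> H; rewrite ge0_integral_pushforward.
- by move=> H A mA _; exact: lebesgue_shift.
Qed.
Lemma integrable_shift (c : R) (f : R -> R) : mu.-integrable [set: mR] (EFin \o f) ->
  mu.-integrable [set: mR] (EFin \o (fun x => f (x + c))).
Proof.
move=> /integrableP[mf foo]; apply/integrableP; split.
  apply/measurable_EFinP; apply: measurableT_comp (measurable_shift c).
  exact/measurable_EFinP.
rewrite (@ge0_int_shift c (fun x => `|(f x)%:E|%E)) //.
by apply: measurableT_comp.
Qed.
Lemma Rint_shift (c : R) (f : R -> R) : mu.-integrable [set: mR] (EFin \o f) ->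
  \int[mu]_x f (x + c) = \int[mu]_x f x.
Proof.
move=> if_; have /integrableP[mf _] := if_.
rewrite /Rintegral; congr fine.
rewrite [RHS](@eq_measure_integral _ _ _ _ (pushforward mu (fun x : mR => x + c : mR))).
- exact: measurable_shift.
- move=> H; rewrite (@integral_pushforward _ _ _ _ _ (fun x : mR => x + c : mR)) //.
  exact: (integrable_shift c if_).
- by move=> H A mA _; exact: lebesgue_shift.
Qed.
Lemma cint_shift (c : R) f : cinteg setT f -> cint setT (fun x => f (x + c)) = cint setT f.
Proof.
move=> [f1 f2]; apply: complex_eq => /=.
  exact: (@Rint_shift c (fun x => Rec (f x))).
exact: (@Rint_shift c (fun x => Imc (f x))).
Qed.

Lemma exp_weight (x Y : R) : 0 < x ->
  mu.-integrable `[Y, +oo[ (EFin \o (fun y => expR (- (x * y)))) /\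
  \int[mu]_(y in `[Y, +oo[) expR (- (x * y)) = expR (- (x * Y)) / x.
Proof.
move=> x0.
have dl (y : R) : is_derive y (1:R) (fun y : R => - (x * y)) (- x).
  by apply: is_derive_eq'; rewrite /GRing.scale /=; ring.
have de (y : R) : is_derive y (1:R) (fun y => expR (- (x * y))) (- x * expR (- (x * y))).
  by apply: (is_derive_eq' (is_derive1_comp _ (dl y))); rewrite mulrC.
have dF (y : R) : is_derive y (1:R) (fun y => - x^-1 * expR (- (x * y))) (expR (- (x * y))).
  by apply: (is_derive_eq' (is_deriveZ _ (de y))); rewrite /GRing.scale /=; field; rewrite gt_eqF.
have ce : continuous (fun y : R => expR (- (x * y))) by move=> y; exact: (is_derive_continuous (de y)).
have key : (\int[mu]_(y in `[Y, +oo[) (expR (- (x * y)))%:E = (0 : R)%:E - (- x^-1 * expR (- (x * Y)))%:E)%E.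
  apply: (@ge0_continuous_FTC2y R (fun y => expR (- (x * y))) (fun y => - x^-1 * expR (- (x * y)))).
  - by move=> y _; exact: expR_ge0.
  - exact: continuous_subspaceT.
  - rewrite -[X in _ --> X](mulr0 (- x^-1)); apply: cvgM; first exact: cvg_cst.
    apply: (@cvg_comp _ _ _ (fun y => x * y) (fun y => expR (- y)) _ +oo); last exact: cvgr_expR.
    apply/cvgryPge => a; near=> y; rewrite -ler_pdivrMl //; near: y.
  - by move=> y _; exact: ex_derive.
  - by apply: cvg_at_right_filter; exact: (is_derive_continuous (dF Y)).
  - by move=> y _; rewrite derive1E; exact: derive_val.
split.
  apply/integrableP; split.
    by apply/measurable_EFinP; apply: measurable_funTS; exact: continuous_measurable_fun.
  under eq_integral do rewrite gee0_abs ?lee_fin ?expR_ge0 //.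
  by rewrite key -EFinB ltry.
by rewrite /Rintegral key -EFinB /= sub0r mulNr opprK mulrC.
Unshelve. all: by end_near. Qed.
End IntegralBasics.

(** * Second-order remainder of the complex exponential *)

Section ExpRemainder.
Variable R : realType.
Notation C := R[i].

Lemma quad_is_derive (f : R -> R) (t l r K : R) : 0 < r -> 0 <= K ->
  (forall h, `|h| < r -> `|f (t + h) - f t - h * l| <= K * h ^+ 2) -> is_derive t (1:R) f l.
Proof.
move=> r0 K0 hf.
have cv : (fun h => h^-1 *: ((f \o shift t) (h *: (1:R)) - f t)) @ 0^' --> l.
  apply/cvgrPdist_le => e e0; near=> h.
  have h0 : h != 0 by near: h; exact: nbhs_dnbhs_neq.
  have hr : `|h| < r.
    near: h; apply: dnbhs0_lt; exact: r0.
  have he : `|h| <= e / (K + 1).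
    near: h; apply: dnbhs0_le; rewrite divr_gt0 //; lra.
  have -> : l - h^-1 *: ((f \o shift t) (h *: (1:R)) - f t) = - (f (t + h) - f t - h * l) / h.
    by rewrite /GRing.scale /= mulr1 (addrC h t); field.
  have hp : 0 < `|h| by rewrite normr_gt0.
  rewrite normrM normrN normfV ler_pdivrMr // (le_trans (hf h hr))//.
  rewrite -real_normK ?num_real // expr2 mulrA ler_wpM2r //.
  move: he; rewrite ler_pdivlMr; last by lra.
  have := ltW hp; nra.
apply: DeriveDef; first by apply/cvg_ex; exists l.
exact: cvg_lim.
Unshelve. all: by end_near. Qed.

Lemma quad_cder (f : R -> C) (t r K : R) (l : C) : 0 < r -> 0 <= K ->
  (forall h, `|h| < r -> normc (f (t + h) - f t - h%:C * l) <= K * h ^+ 2) -> cder f t l.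
Proof.
move=> r0 K0 hf; split.
  apply: (quad_is_derive r0 K0) => h /hf; apply: le_trans.
  by rewrite (le_trans _ (normr_Rec _)) // !RecE /= mul0r subr0.
apply: (quad_is_derive r0 K0) => h /hf; apply: le_trans.
by rewrite (le_trans _ (normr_Imc _)) // !RecE /= mul0r addr0.
Qed.

Lemma cder_line (z h : C) t : cder (fun s => z + s%:C * h) t h.
Proof.
apply: (cder_eq (cderD (cder_cst z t) (cderM (cder_id t) (cder_cst h t)))).
by rewrite mulr0 mul1r add0r addr0.
Qed.

Lemma cexp_lip (a b : C) (M : R) : Rec a <= M -> Rec b <= M ->
  normc (cexp b - cexp a) <= 2 * expR M * normc (b - a).
Proof.
move=> aM bM.
have d t : cder (fun s => cexp (a + s%:C * (b - a))) t ((b - a) * cexp (a + t%:C * (b - a))).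
  by apply: cder_cexp; exact: cder_line.
have h := @cmvt R _ _ 0 1 (expR M * normc (b - a)) ler01 (cder_ccont d) (fun t _ => d t) _.
move: h; rewrite mul1r mul0r addr0 addrCA subrr addr0 subr0 mulr1 mulrA; apply.
move=> t /andP[t0 t1]; rewrite normcM mulrC ler_wpM2r ?normc_ge0 // normc_cexp ler_expR.
rewrite !RecE /= mul0r subr0; nra.
Qed.

Lemma cexp_rem (a b : C) (M : R) : Rec a <= M -> Rec b <= M ->
  normc (cexp b - cexp a - cexp a * (b - a)) <= 4 * expR M * normc (b - a) ^+ 2.
Proof.
move=> aM bM.
have d t : cder (fun s => cexp (a + s%:C * (b - a)) - s%:C * ((b - a) * cexp a)) t
    ((b - a) * (cexp (a + t%:C * (b - a)) - cexp a)).
  apply: (cder_eq (cderB (cder_cexp (cder_line a (b - a) t)) (cderM (cder_id t) (cder_cst _ t)))).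
  by ring.
have h := @cmvt R _ _ 0 1 (normc (b - a) * (2 * expR M * normc (b - a))) ler01 (cder_ccont d)
  (fun t _ => d t) _.
have e : cexp (a + 1%:C * (b - a)) - 1%:C * ((b - a) * cexp a) -
   (cexp (a + 0%:C * (b - a)) - 0%:C * ((b - a) * cexp a)) = cexp b - cexp a - cexp a * (b - a).
  by rewrite !mul1r !mul0r addr0 subr0 addrCA subrr addr0; ring.
move: h; rewrite e subr0 mulr1 => h; rewrite (le_trans (h _))//; last by rewrite expr2; lra.
move=> t /andP[t0 t1]; rewrite normcM ler_wpM2l ?normc_ge0 //.
have rt : Rec (a + t%:C * (b - a)) <= M by rewrite !RecE /= mul0r subr0; nra.
rewrite (le_trans (cexp_lip aM rt))// addrAC subrr add0r normcM normcR gtr0_norm //.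
rewrite ler_wpM2l ?mulr_ge0 ?expR_ge0 // -[leRHS]mul1r ler_wpM2r ?normc_ge0 // ltW //.
Qed.

Lemma hol_cexp (D : set C) (M : R) : (forall z, D z -> Rec z <= M) -> hol D (@cexp R) (@cexp R).
Proof.
move=> hD; exists (4 * expR M) => -[] _; split.
  move=> z Dz; rewrite normc_cexp; have : expR (Rec z) <= expR M by rewrite ler_expR hD.
  have := expR_ge0 M; lra.
by move=> z w Dz Dw; apply: cexp_rem; exact: hD.
Qed.
End ExpRemainder.

(** * Laplace transforms of bounded functions on the half-line *)

Section Laplace.
Variable R : realType.
Notation C := R[i].
Notation mu := (@lebesgue_measure R).
Notation mR := (measurableTypeR R).

(** Half of the decay rate pays for a power of [y]; this makes the differentiated Laplace integrand
    integrable. *)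
Lemma le_exp_half (x y : R) : 0 < x -> 0 <= y -> y * expR (- (x * y)) <= 2 / x * expR (- (x / 2 * y)).
Proof.
move=> x0 y0.
have h : x / 2 * y <= expR (x / 2 * y) by have := expR_ge1Dx (x / 2 * y); lra.
have -> : - (x * y) = - (x / 2 * y) + - (x / 2 * y) by field.
rewrite expRD mulrA ler_wpM2r ?expR_ge0 // expRN ler_pdivrMr ?expR_gt0 //.
have -> : y = 2 / x * (x / 2 * y) by field; rewrite gt_eqF.
rewrite -[in leRHS](_ : x / 2 * y = x / 2 * (2 / x * (x / 2 * y))); last by field; rewrite gt_eqF.
by rewrite ler_wpM2l // divr_ge0 // ltW.
Qed.
Lemma le_exp_sqr (x y : R) : 0 < x -> 0 <= y -> y ^+ 2 * expR (- (x * y)) <= 16 / x ^+ 2 * expR (- (x / 2 * y)).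
Proof.
move=> x0 y0;
have h : x / 4 * y <= expR (x / 4 * y) by have := expR_ge1Dx (x / 4 * y); lra.
have -> : - (x * y) = - (x / 2 * y) + - (x / 4 * y) + - (x / 4 * y) by field.
have -> : expR (- (x / 2 * y) + - (x / 4 * y) + - (x / 4 * y)) =
  expR (- (x / 2 * y)) * (expR (- (x / 4 * y)) * expR (- (x / 4 * y))) by rewrite !expRD mulrA.
rewrite mulrCA [leRHS]mulrC ler_wpM2l ?expR_ge0 //.
have h0 : 0 <= x / 4 * y by rewrite mulr_ge0 // divr_ge0 // ltW.
have E0 := expR_gt0 (x / 4 * y).
rewrite expRN -expr2 exprVn ler_pdivrMr ?exprn_gt0 //.
have -> : y ^+ 2 = 16 / x ^+ 2 * (x / 4 * y) ^+ 2 by field; rewrite gt_eqF.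
rewrite ler_wpM2l ?divr_ge0 ?sqr_ge0 // lerXn2r ?nnegrE // ltW //.
Qed.

Lemma exp_integrable (x Y B : R) : 0 < x -> mu.-integrable `[Y, +oo[ (EFin \o (fun y => B * expR (- (x * y)))).
Proof. by move=> x0; apply: integrableZ' => //; exact: (exp_weight Y x0).1. Qed.

Lemma halfline_cinteg (f : R -> C) (x Y B : R) : 0 < x -> ccont f ->
  (forall y, Y <= y -> normc (f y) <= B * expR (- (x * y))) -> cinteg `[Y, +oo[ f.
Proof.
move=> x0 cf bf; apply: (@cinteg_le R _ f (fun y => B * expR (- (x * y)))) => //.
- exact: ccont_cmeas.
- exact: exp_integrable.
- by move=> y /=; rewrite in_itv /= andbT; exact: bf.
Qed.

Lemma halfline_le (f : R -> C) (x Y B : R) : 0 < x -> ccont f ->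
  (forall y, Y <= y -> normc (f y) <= B * expR (- (x * y))) ->
  normc (cint `[Y, +oo[ f) <= 2 * B / x * expR (- (x * Y)).
Proof.
move=> x0 cf bf.
rewrite (le_trans (@cint_le R _ f (fun y => B * expR (- (x * y))) _ (halfline_cinteg x0 cf bf) _ _)) //.
- exact: exp_integrable.
- by move=> y /=; rewrite in_itv /= andbT; exact: bf.
rewrite RintegralZl //; last exact: (exp_weight Y x0).1.
by rewrite (exp_weight Y x0).2 le_eqVlt; apply/orP; left; apply/eqP; field; rewrite gt_eqF.
Qed.

Lemma halfline_cat (f : R -> C) (Y : R) : 0 <= Y -> cinteg `[0, +oo[ f ->
  cint `[0, +oo[ f = cint `[0, Y] f + cint `[Y, +oo[ f.
Proof.
have key (h : R -> R) : 0 <= Y -> mu.-integrable `[0, +oo[ (EFin \o h) ->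
   \int[mu]_(x in `[0, +oo[) h x = \int[mu]_(x in `[0, Y]) h x + \int[mu]_(x in `[Y, +oo[) h x.
  move=> Y0 ih; apply/eqP; rewrite addrC -subr_eq; apply/eqP.
  rewrite (@Rintegral_itvB _ h (BLeft 0) +oo%O Y) ?bnd_simp //.
  rewrite Rintegral_itv_obnd_cbnd //; apply: integrableS ih => //.
  by apply: subset_itvr; rewrite bnd_simp.
by move=> Y0 [f1 f2]; apply: complex_eq; rewrite RecE /=; exact: key.
Qed.

Definition Lap (g : R -> C) (z : C) := cint `[0, +oo[ (fun y => cexp (- (z * y%:C)) * g y).

Variables (g : R -> C) (B : R).
Hypothesis cg : ccont g.
Hypothesis bg : forall y, 0 <= y -> normc (g y) <= B.

Let B0 : 0 <= B. Proof. by rewrite (le_trans (normc_ge0 _) (bg (lexx 0))). Qed.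

Lemma ccont_RC : ccont (fun y : R => y%:C).
Proof. by apply: ccontR => y; exact: cvg_id. Qed.

Lemma ccont_expmul (z : C) : ccont (fun y : R => cexp (- (z * y%:C))).
Proof. by apply: ccont_cexp; apply: ccontN; apply: ccontM; [exact: ccont_cst|exact: ccont_RC]. Qed.

Lemma Rec_mulR (z : C) (y : R) : Rec (z * y%:C) = Rec z * y.
Proof. by rewrite !RecE /= mulr0 subr0. Qed.

Lemma Lap_bound (z : C) (y : R) : 0 <= y ->
  normc (cexp (- (z * y%:C)) * g y) <= B * expR (- (Rec z * y)).
Proof.
move=> y0; rewrite normcM normc_cexp RecE Rec_mulR mulrC ler_wpM2r ?expR_ge0 //; exact: bg.
Qed.

Lemma ccont_Lap (z : C) : ccont (fun y : R => cexp (- (z * y%:C)) * g y).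
Proof. by apply: ccontM => //; exact: ccont_expmul. Qed.

Lemma Lap_cinteg (z : C) : 0 < Rec z -> cinteg `[0, +oo[ (fun y => cexp (- (z * y%:C)) * g y).
Proof.
move=> z0; apply: (halfline_cinteg z0 (ccont_Lap z)) => y y0; exact: Lap_bound.
Qed.

Lemma Lap_trunc (z : C) (Y : R) : 0 < Rec z -> 0 <= Y ->
  normc (Lap g z - cint `[0, Y] (fun y => cexp (- (z * y%:C)) * g y)) <=
    2 * B / Rec z * expR (- (Rec z * Y)).
Proof.
move=> z0 Y0; rewrite /Lap (halfline_cat Y0 (Lap_cinteg z0)) addrC addrA addNr add0r.
apply: (halfline_le z0 (ccont_Lap z)) => y Yy; apply: Lap_bound; exact: le_trans Yy.
Qed.

Lemma Lap_le (z : C) : 0 < Rec z -> normc (Lap g z) <= 2 * B / Rec z.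
Proof.
move=> z0; rewrite (le_trans (halfline_le z0 (ccont_Lap z) (Lap_bound z)))//.
by rewrite mulr0 oppr0 expR0 mulr1.
Qed.

(** The Taylor remainder of [cexp] is integrated against [g]. It is of order
    [y^2 |w - z|^2 exp (- x0 y)], and half of the decay absorbs the square of [y]. *)
Lemma Lap_hol (D : set C) (x0 : R) : 0 < x0 -> (forall z, D z -> x0 <= Rec z) ->
  exists f', hol D (Lap g) f'.
Proof.
move=> x00 hD.
pose f' (z : C) := cint `[0, +oo[ (fun y => - (y%:C * (cexp (- (z * y%:C)) * g y))).
exists f'; pose K := 2 * B / x0 + 2 * (B * (2 / x0)) / (x0 / 2) + 2 * (4 * B * (16 / x0 ^+ 2)) / (x0 / 2).
have x20 : 0 < x0 / 2 by rewrite divr_gt0.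
have k1 : 0 <= 2 * B / x0 by rewrite divr_ge0 ?mulr_ge0 // ltW.
have k2 : 0 <= 2 * (B * (2 / x0)) / (x0 / 2) by rewrite !mulr_ge0 ?invr_ge0 // ltW.
have k3 : 0 <= 2 * (4 * B * (16 / x0 ^+ 2)) / (x0 / 2).
  by rewrite !mulr_ge0 ?invr_ge0 ?sqr_ge0 ?(ltW x20).
have pos z : D z -> 0 < Rec z by move=> /hD; exact: lt_le_trans.
have ez (z : C) (y : R) : D z -> 0 <= y -> expR (- (Rec z * y)) <= expR (- (x0 * y)).
  by move=> Dz y0; rewrite ler_expR lerN2 ler_wpM2r // hD.
have cf' z : ccont (fun y : R => - (y%:C * (cexp (- (z * y%:C)) * g y))).
  by apply: ccontN; apply: ccontM; [exact: ccont_RC|exact: ccont_Lap].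
have bf' z y : D z -> 0 <= y -> normc (- (y%:C * (cexp (- (z * y%:C)) * g y))) <=
    B * (2 / x0) * expR (- (x0 / 2 * y)).
  move=> Dz y0; rewrite normcN normcM normcR ger0_norm //.
  rewrite (le_trans (ler_wpM2l y0 (Lap_bound z y0)))// mulrCA -[leRHS]mulrA ler_wpM2l //.
  rewrite (le_trans _ (le_exp_half x00 y0))// ler_wpM2l //; exact: ez.
have if' z : D z -> cinteg `[0, +oo[ (fun y => - (y%:C * (cexp (- (z * y%:C)) * g y))).
  by move=> Dz; apply: (halfline_cinteg x20 (cf' z)) => y y0; exact: bf'.
exists K => -[] _; split.
  move=> z Dz; split.
    rewrite (le_trans (Lap_le (pos z Dz)))//.
    have : 2 * B / Rec z <= 2 * B / x0.
      by rewrite ler_wpM2l ?mulr_ge0 // lef_pV2 ?posrE ?hD // pos.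
    by rewrite /K; lra.
  rewrite (le_trans (halfline_le x20 (cf' z) (fun y => bf' z y Dz)))//.
  by rewrite mulr0 oppr0 expR0 mulr1 /K; lra.
move=> z w Dz Dw.
have iz := Lap_cinteg (pos z Dz); have iw := Lap_cinteg (pos w Dw).
have -> : Lap g w - Lap g z - f' z * (w - z) =
  cint `[0, +oo[ (fun y => (cexp (- (w * y%:C)) * g y - cexp (- (z * y%:C)) * g y) -
    (w - z) * (- (y%:C * (cexp (- (z * y%:C)) * g y)))).
  rewrite cintB //; [|exact: cintegB|by apply: cintegZ => //; exact: if'].
  by rewrite cintB // cintZ //; [rewrite [in RHS]mulrC|exact: if'].
have bnd y : 0 <= y -> normc ((cexp (- (w * y%:C)) * g y - cexp (- (z * y%:C)) * g y) -
    (w - z) * (- (y%:C * (cexp (- (z * y%:C)) * g y)))) <=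
    normc (w - z) ^+ 2 * (4 * B * (16 / x0 ^+ 2)) * expR (- (x0 / 2 * y)).
  move=> y0.
  have -> : (cexp (- (w * y%:C)) * g y - cexp (- (z * y%:C)) * g y) -
    (w - z) * (- (y%:C * (cexp (- (z * y%:C)) * g y))) =
    (cexp (- (w * y%:C)) - cexp (- (z * y%:C)) - cexp (- (z * y%:C)) * (- (w * y%:C) - - (z * y%:C))) * g y.
    by ring.
  rewrite normcM (le_trans (ler_wpM2l (normc_ge0 _) (bg y0)))//.
  have M (u : C) : D u -> Rec (- (u * y%:C)) <= - (x0 * y).
    by move=> Du; rewrite RecE Rec_mulR lerN2 ler_wpM2r // hD.
  rewrite (le_trans (ler_wpM2r B0 (cexp_rem (M z Dz) (M w Dw))))//.
  have -> : normc (- (w * y%:C) - - (z * y%:C)) ^+ 2 = normc (w - z) ^+ 2 * y ^+ 2.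
    have -> : - (w * y%:C) - - (z * y%:C) = - ((w - z) * y%:C) by ring.
    by rewrite normcN normcM normcR exprMn real_normK ?num_real.
  have h := le_exp_sqr x00 y0.
  have -> : 4 * expR (- (x0 * y)) * (normc (w - z) ^+ 2 * y ^+ 2) * B =
    (normc (w - z) ^+ 2 * (4 * B)) * (y ^+ 2 * expR (- (x0 * y))) by ring.
  rewrite [leRHS](_ : _ = (normc (w - z) ^+ 2 * (4 * B)) * (16 / x0 ^+ 2 * expR (- (x0 / 2 * y)))); last by ring.
  by rewrite ler_wpM2l // mulr_ge0 ?sqr_ge0 // mulr_ge0.
have cc : ccont (fun y : R => (cexp (- (w * y%:C)) * g y - cexp (- (z * y%:C)) * g y) -
    (w - z) * (- (y%:C * (cexp (- (z * y%:C)) * g y)))).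
  apply: ccontB; first by apply: ccontB; exact: ccont_Lap.
  by apply: ccontM; [exact: ccont_cst|exact: cf'].
rewrite (le_trans (halfline_le x20 cc bnd))// mulr0 oppr0 expR0 mulr1.
rewrite [leLHS](_ : _ = 2 * (4 * B * (16 / x0 ^+ 2)) / (x0 / 2) * normc (w - z) ^+ 2); last by ring.
by rewrite ler_wpM2r ?sqr_ge0 // /K; lra.
Qed.
End Laplace.

(** * Laplace transforms of Fourier integrals *)

Section LaplaceOne.
Variable R : realType.
Notation C := R[i].
Notation mu := (@lebesgue_measure R).
Notation mR := (measurableTypeR R).

Lemma neq0_Rec (w : C) : 0 < Rec w -> w != 0.
Proof. by move=> w0; apply/eqP => e; move: w0; rewrite e /= ltxx. Qed.

Lemma cint_exp (w : C) (Y : R) : w != 0 -> 0 <= Y ->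
  cint `[0, Y] (fun y => cexp (- (w * y%:C))) = (1 - cexp (- (w * Y%:C))) / w.
Proof.
move=> w0 Y0.
have d (y : R) : cder (fun y => - cexp (- (w * y%:C)) / w) y (cexp (- (w * y%:C))).
  have h : cder (fun y : R => - (w * y%:C)) y (- w).
    by apply: (cder_eq (cderN (cderZ w (cder_id y)))); rewrite mulr1.
  apply: (cder_eq (cderM (cderN (cder_cexp h)) (cder_cst w^-1 y))).
  by field.
rewrite (cint_FTC Y0 (ccont_expmul w) d) mulr0 oppr0 cexp0; field.
exact: w0.
Qed.

Lemma Lap1 (w : C) : 0 < Rec w -> Lap (fun=> 1) w = w^-1.
Proof.
move=> w0; have wn0 := neq0_Rec w0.
apply/eqP; rewrite -subr_eq0; apply/eqP/normc_eq0/eqP; rewrite eq_le normc_ge0 andbT.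
apply/ler_addgt0Pr => e e0; rewrite add0r.
have b1 (y : R) : 0 <= y -> normc ((fun=> 1 : C) y) <= 1 by move=> _; rewrite normc1.
pose c := 2 * 1 / Rec w + normc w^-1.
have key Y : 0 <= Y -> normc (Lap (fun=> 1) w - w^-1) <= c * expR (- (Rec w * Y)).
  move=> Y0; have h := Lap_trunc (ccont_cst R (1 : C)) b1 w0 Y0.
  have e1 : cint `[0, Y] (fun y => cexp (- (w * y%:C)) * 1) = (1 - cexp (- (w * Y%:C))) / w.
    by rewrite -cint_exp //; apply: eq_cint => y _; rewrite mulr1.
  rewrite e1 in h.
  have -> : Lap (fun=> 1) w - w^-1 = (Lap (fun=> 1) w - (1 - cexp (- (w * Y%:C))) / w) - cexp (- (w * Y%:C)) / w.
    by ring.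
  have h2 : normc (cexp (- (w * Y%:C)) / w) = normc w^-1 * expR (- (Rec w * Y)).
    by rewrite normcM normc_cexp RecE Rec_mulR mulrC.
  have := ler_normcB (Lap (fun=> 1) w - (1 - cexp (- (w * Y%:C))) / w) (cexp (- (w * Y%:C)) / w).
  by move=> /le_trans; apply; rewrite h2 /c [leRHS]mulrDl lerD.
have cp : 0 <= c by rewrite addr_ge0 ?normc_ge0 // divr_ge0 ?mulr1 // ltW.
(* Chosen so that [e * (Rec w * Y) = c]; then [1 + x <= expR x] suffices to push the truncation
   error below [e]. *)
pose Y := c / (e * Rec w).
have Y0 : 0 <= Y by rewrite divr_ge0 // mulr_ge0 // ltW.
rewrite (le_trans (key Y Y0))// expRN ler_pdivrMr ?expR_gt0 //.
have h := expR_ge1Dx (Rec w * Y).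
have e2 : e * (Rec w * Y) = c by rewrite /Y; field; rewrite !gt_eqF.
have : e * (1 + Rec w * Y) <= e * expR (Rec w * Y) by rewrite ler_wpM2l // ltW.
lra.
Qed.

Lemma Lap1_cinteg (w : C) : 0 < Rec w -> cinteg `[0, +oo[ (fun y => cexp (- (w * y%:C)) * 1).
Proof.
move=> w0; have b1 (y : R) : 0 <= y -> normc ((fun=> 1 : C) y) <= 1 by move=> _; rewrite normc1.
exact: (Lap_cinteg (ccont_cst R (1 : C)) b1 w0).
Qed.

(** Domination by a product of two integrable functions gives integrability for the product measure,
    which is what Fubini requires. *)
Lemma Rfubini (h : mR * mR -> R) (A E : R -> R) : measurable_fun setT h ->
  (forall x y, `|h (x, y)| <= A x * E y) ->
  mu.-integrable [set: mR] (EFin \o A) -> mu.-integrable [set: mR] (EFin \o E) ->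
  \int[mu]_x (\int[mu]_y h (x, y)) = \int[mu]_y (\int[mu]_x h (x, y)).
Proof.
move=> mh hb iA iE.
have m1 x : measurable_fun [set: mR] (fun y => h (x, y)) by apply: measurableT_comp.
have m2 y : measurable_fun [set: mR] (fun x => h (x, y)) by apply: measurableT_comp.
have i1 x : mu.-integrable [set: mR] (EFin \o (fun y => h (x, y))).
  by apply: (integrable_le (g := fun y => A x * E y)) => //; exact: integrableZ'.
have i2 y : mu.-integrable [set: mR] (EFin \o (fun x => h (x, y))).
  apply: (integrable_le (g := fun x => E y * A x)) => //; first exact: integrableZ'.
  by move=> x _; rewrite mulrC.
have ip : (mu \x mu)%E.-integrable [set: mR * mR] (EFin \o h).
  apply/integrable12ltyP; first exact/measurable_EFinP.
  have AE0 x y : 0 <= A x * E y by rewrite (le_trans _ (hb x y)).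
  apply: (@le_lt_trans _ _ (\int[mu]_x (`|A x| * \int[mu]_y `|E y|)%:E)%E).
    apply: ge0_le_integral => //.
    - by move=> x _; exact: integral_ge0.
    - apply: (@measurable_fun_fubini_tonelli_F _ _ mR mR R mu (fun p => `|(EFin \o h) p|)%E); last by [].
      by apply: measurableT_comp => //; apply/measurable_EFinP.
    - by apply/measurable_EFinP; apply: measurable_funM => //; apply: measurableT_comp => //;
        case/integrableP : iA => /measurable_EFinP.
    - move=> x _ /=.
      rewrite EFinM /Rintegral fineK; last first.
        by apply: integrable_fin_num => //; exact: integrable_norm.
      rewrite -ge0_integralZl //.
      + apply: ge0_le_integral => //.
        * by apply/measurable_EFinP; apply: measurableT_comp.
        * apply/measurable_EFinP; apply: measurable_funM => //; apply: measurableT_comp => //.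
          by case/integrableP : iE => /measurable_EFinP.
        * by move=> y _; rewrite -EFinM lee_fin -normrM (le_trans (hb x y)) // ler_norm.
      + by apply/measurable_EFinP; apply: measurableT_comp => //; case/integrableP : iE => /measurable_EFinP.
  have : mu.-integrable [set: mR] (EFin \o (fun x => \int[mu]_y `|E y| * `|A x|)).
    by apply: integrableZ' => //; exact: integrable_norm.
  move=> /integrableP[_]; apply: le_lt_trans; apply: ge0_le_integral => //.
  - by move=> x _; rewrite lee_fin mulr_ge0 // Rintegral_ge0.
  - by apply/measurable_EFinP; apply: measurable_funM => //; apply: measurableT_comp => //;
      case/integrableP : iA => /measurable_EFinP.
  - by apply/measurable_EFinP; apply: measurableT_comp => //; apply: measurable_funM => //;
      apply: measurableT_comp => //; case/integrableP : iA => /measurable_EFinP.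
  - by move=> x _ /=; rewrite lee_fin mulrC ler_norm.
have F := Fubini ip.
rewrite /Rintegral; congr fine.
transitivity (\int[mu]_x \int[mu]_y (EFin \o h) (x, y))%E.
  by apply: eq_integral => x _; rewrite fineK //; exact: integrable_fin_num (i1 x).
rewrite F; apply: eq_integral => y _; rewrite fineK //; exact: integrable_fin_num (i2 y).
Qed.

Lemma cintRec D (f : R -> C) : Rec (cint D f) = \int[mu]_(y in D) Rec (f y).
Proof. by []. Qed.
Lemma cintImc D (f : R -> C) : Imc (cint D f) = \int[mu]_(y in D) Imc (f y).
Proof. by []. Qed.

Lemma cfubini (P : mR * mR -> C) (A E : R -> R) :
  measurable_fun setT (fun p => Rec (P p)) -> measurable_fun setT (fun p => Imc (P p)) ->
  (forall x y, normc (P (x, y)) <= A x * E y) ->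
  mu.-integrable [set: mR] (EFin \o A) -> mu.-integrable [set: mR] (EFin \o E) ->
  cint [set: mR] (fun y => cint [set: mR] (fun x => P (x, y))) =
  cint [set: mR] (fun x => cint [set: mR] (fun y => P (x, y))).
Proof.
move=> m1 m2 bP iA iE.
have F1 := Rfubini (h := fun p => Rec (P p)) m1 (fun x y => le_trans (normr_Rec _) (bP x y)) iA iE.
have F2 := Rfubini (h := fun p => Imc (P p)) m2 (fun x y => le_trans (normr_Imc _) (bP x y)) iA iE.
apply: complex_eq; rewrite ?cintRec ?cintImc.
  by under eq_Rintegral do rewrite cintRec; rewrite -F1.
by under eq_Rintegral do rewrite cintImc; rewrite -F2.
Qed.

Lemma cmeas_prod_exp (z : C) :
  measurable_fun [set: mR * mR] (fun p => Rec (cexp (- ((z - 'i * (p.1)%:C) * (p.2)%:C)))) /\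
  measurable_fun [set: mR * mR] (fun p => Imc (cexp (- ((z - 'i * (p.1)%:C) * (p.2)%:C)))).
Proof.
have m1 : measurable_fun [set: mR * mR] (fun p => - (Rec z * p.2)).
  by apply: measurableT_comp => //; apply: measurable_funM.
have m2 : measurable_fun [set: mR * mR] (fun p => - ((Imc z - p.1) * p.2)).
  by apply: measurableT_comp => //; apply: measurable_funM => //; apply: measurable_funB.
have r (p : mR * mR) : Rec (- ((z - 'i * (p.1)%:C) * (p.2)%:C)) = - (Rec z * p.2).
  by rewrite !RecE /=; ring.
have i (p : mR * mR) : Imc (- ((z - 'i * (p.1)%:C) * (p.2)%:C)) = - ((Imc z - p.1) * p.2).
  by rewrite !RecE /=; ring.
split; rewrite /cexp /=; under eq_fun do rewrite r i; apply: measurable_funM.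
- by apply: measurableT_comp m1; exact: measurable_expR.
- by apply: (measurableT_comp _ m2); apply: continuous_measurable_fun; exact: continuous_cos.
- by apply: measurableT_comp m1; exact: measurable_expR.
- by apply: (measurableT_comp _ m2); apply: continuous_measurable_fun; exact: continuous_sin.
Qed.

Lemma Rint_set_indic (D : set mR) (f : R -> R) : measurable D ->
  \int[mu]_(y in D) f y = \int[mu]_y (f y * \1_D y).
Proof.
move=> mD; rewrite Rintegral_mkcond; apply: eq_Rintegral => y _.
by rewrite patchE indicE; case: ifP; rewrite ?mulr1 ?mulr0.
Qed.

Lemma Imc_mulR (z : C) (y : R) : Imc (z * y%:C) = Imc z * y.
Proof. by rewrite !RecE /= mulr0 add0r. Qed.

Lemma cint_set_indic (D : set mR) (f : R -> C) : measurable D ->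
  cint D f = cint [set: mR] (fun y => f y * (\1_D y)%:C).
Proof.
move=> mD; apply: complex_eq; rewrite ?cintRec ?cintImc (Rint_set_indic _ mD); apply: eq_Rintegral => y _.
  by rewrite Rec_mulR.
by rewrite Imc_mulR.
Qed.

Lemma cinteg_cmeas (D : set mR) (f : R -> C) : cinteg D f -> cmeas D f.
Proof. by move=> [/integrableP[/measurable_EFinP ? _] /integrableP[/measurable_EFinP ? _]]. Qed.

Lemma cinteg_normc (D : set mR) (f : R -> C) : measurable D -> cinteg D f ->
  mu.-integrable D (EFin \o (fun x => normc (f x))).
Proof.
move=> mD h; have [i1 i2] := h; have [m1 m2] := cinteg_cmeas h.
apply: (integrable_le (g := fun x => `|Rec (f x)| + `|Imc (f x)|)) => //.
- under eq_fun do rewrite normc_sqrtE.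
  apply: (measurableT_comp (f := @Num.sqrt R)).
    by apply: continuous_measurable_fun; exact: sqrt_continuous.
  by apply: measurable_funD; apply: measurable_funX.
- by apply: eq_integrable (integrableD _ (integrable_norm i1) (integrable_norm i2)).
- by move=> x _; rewrite ger0_norm ?normc_ge0 // normc_le_ReIm.
Qed.

Lemma cinteg_bddM (D : set mR) (f g : R -> C) (B : R) : measurable D -> cinteg D f -> cmeas D g ->
  (forall x, D x -> normc (g x) <= B) -> cinteg D (fun x => f x * g x).
Proof.
move=> mD hf mg hg; apply: (cinteg_le mD (cmeasM (cinteg_cmeas hf) mg) (integrableZ' B mD (cinteg_normc mD hf))).
by move=> x Dx; rewrite normcM mulrC ler_wpM2r ?normc_ge0 // hg.
Qed.

Lemma normc_cexp_i (a b : R) : normc (cexp ('i * a%:C * b%:C)) = 1.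
Proof. by rewrite normc_cexp Rec_mulR !RecE /= mul0r mul1r subrr mul0r expR0. Qed.

Lemma ccont_cexp_i (y : R) : ccont (fun xi : R => cexp ('i * xi%:C * y%:C)).
Proof.
apply: ccont_cexp; apply: ccontM; last exact: ccont_cst.
by apply: ccontM; [exact: ccont_cst|exact: ccont_RC].
Qed.

(** Fubini with majorant [|X xi| exp (- Re z y)]: the inner integral is the Laplace transform of 1
    at [z - i xi]. A half-line transform of a Fourier integral is thus a Cauchy integral of its
    density. *)
Lemma Lap_Fourier (X : R -> C) (z : C) : cinteg [set: mR] X -> 0 < Rec z ->
  Lap (fun y => cint [set: mR] (fun xi => X xi * cexp ('i * xi%:C * y%:C))) z =
  cint [set: mR] (fun xi => X xi / (z - 'i * xi%:C)).
Proof.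
move=> iX z0; have [i1 i2] := iX.
have rz (xi : R) : Rec (z - 'i * xi%:C) = Rec z by rewrite !RecE /=; ring.
have wn0 (xi : R) : z - 'i * xi%:C != 0 by apply: neq0_Rec; rewrite rz.
pose D : set mR := `[0, +oo[%classic.
have mD : measurable D by exact: measurable_itv.
pose A (xi : R) := normc (X xi).
pose E (y : R) := expR (- (Rec z * y)) * \1_D y.
have mX1 : measurable_fun [set: mR] (fun x => Rec (X x)) by case/integrableP : i1 => /measurable_EFinP.
have mX2 : measurable_fun [set: mR] (fun x => Imc (X x)) by case/integrableP : i2 => /measurable_EFinP.
have iA : mu.-integrable [set: mR] (EFin \o A).
  exact: cinteg_normc.
have iE : mu.-integrable [set: mR] (EFin \o E).
  have := (exp_weight 0 z0).1 => /(integrable_mkcond _ mD).1.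
  apply: eq_integrable => // y _; rewrite /E /= patchE indicE.
  by case: ifP; rewrite ?mulr1 ?mulr0.
pose P (p : mR * mR) : C := X p.1 * cexp (- ((z - 'i * (p.1)%:C) * (p.2)%:C)) * (\1_D p.2)%:C.
have bP x y : normc (P (x, y)) <= A x * E y.
  rewrite /P /= !normcM normc_cexp RecE Rec_mulR rz normcR indicE /E indicE -mulrA.
  by case: (y \in D); rewrite ?normr1 ?normr0.
have [e1 e2] := cmeas_prod_exp z.
have mX1' : measurable_fun [set: mR * mR] (fun p => Rec (X p.1)) by apply: measurableT_comp mX1 _.
have mX2' : measurable_fun [set: mR * mR] (fun p => Imc (X p.1)) by apply: measurableT_comp mX2 _.
have mI : measurable_fun [set: mR * mR] (fun p => \1_D p.2 : R).
  by exact: (measurableT_comp (measurable_indic mD) measurable_snd).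
have mP1 : measurable_fun [set: mR * mR] (fun p => Rec (P p)).
  under eq_fun do rewrite /P Rec_mulR Rec_mul.
  by apply: measurable_funM => //; apply: measurable_funB; apply: measurable_funM.
have mP2 : measurable_fun [set: mR * mR] (fun p => Imc (P p)).
  have -> : (fun p => Imc (P p)) = fun p => Imc (X p.1 * cexp (- ((z - 'i * (p.1)%:C) * (p.2)%:C))) * \1_D p.2.
    by apply/funext => p; rewrite /P !RecE /= mulr0 add0r.
  under eq_fun do rewrite Imc_mul.
  by apply: measurable_funM => //; apply: measurable_funD; apply: measurable_funM.
have in1 (xi : R) : X xi / (z - 'i * xi%:C) = cint [set: mR] (fun y => P (xi, y)).
  have il : cinteg D (fun y => cexp (- ((z - 'i * xi%:C) * y%:C)) * 1).
    by apply: Lap1_cinteg; rewrite rz.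
  have l1 : (z - 'i * xi%:C)^-1 = cint D (fun y => cexp (- ((z - 'i * xi%:C) * y%:C)) * 1).
    by symmetry; apply: Lap1; rewrite rz.
  rewrite l1 -(cintZ (X xi) mD il).
  rewrite (cint_set_indic _ mD); apply: eq_cint => y _.
  by rewrite /P mulr1.
have in2 (y : R) : cexp (- (z * y%:C)) * cint [set: mR] (fun xi => X xi * cexp ('i * xi%:C * y%:C)) * (\1_D y)%:C =
   cint [set: mR] (fun xi => P (xi, y)).
  have iXe : cinteg [set: mR] (fun xi => X xi * cexp ('i * xi%:C * y%:C)).
    apply: (@cinteg_bddM _ _ _ 1 measurableT iX); first exact: ccont_cmeas (ccont_cexp_i y).
    by move=> xi _; rewrite normc_cexp_i.
  rewrite mulrAC -(cintZ _ measurableT iXe); apply: eq_cint => xi _; rewrite /P /=.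
  have -> : - ((z - 'i * xi%:C) * y%:C) = - (z * y%:C) + 'i * xi%:C * y%:C by ring.
  by rewrite cexpD; ring.
rewrite /Lap (cint_set_indic _ mD).
transitivity (cint [set: mR] (fun y => cint [set: mR] (fun xi => P (xi, y)))).
  by apply: eq_cint => y _; rewrite in2.
transitivity (cint [set: mR] (fun xi => cint [set: mR] (fun y => P (xi, y)))).
  exact: cfubini mP1 mP2 bP iA iE.
by apply: eq_cint => xi _; rewrite in1.
Qed.
End LaplaceOne.

(** * Poisson averages at Lebesgue points *)

Section Poisson.
Variable R : realType.
Notation C := R[i].
Notation mu := (@lebesgue_measure R).
Notation mR := (measurableTypeR R).

(** Normalized to mass [2 * pi], the form in which it arises as the sum of [1 / (e - i x)] and
    [1 / (e + i x)]. *)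
Definition poisson (e x : R) := 2 * e / (e ^+ 2 + x ^+ 2).

Lemma poisson_den (e x : R) : 0 < e -> 0 < e ^+ 2 + x ^+ 2.
Proof. by move=> e0; rewrite ltr_pwDl ?sqr_ge0 // exprn_gt0. Qed.

Lemma poisson_ge0 (e x : R) : 0 < e -> 0 <= poisson e x.
Proof. by move=> e0; rewrite divr_ge0 ?mulr_ge0 // ltW // poisson_den. Qed.

Lemma poisson_le (e x : R) : 0 < e -> poisson e x <= 2 / e.
Proof.
move=> e0; rewrite ler_pdivrMr ?poisson_den //.
have -> : 2 / e * (e ^+ 2 + x ^+ 2) = 2 * e + 2 / e * x ^+ 2 by field; rewrite gt_eqF.
by rewrite lerDl mulr_ge0 ?sqr_ge0 // divr_ge0 // ltW.
Qed.

Lemma continuous_poisson (e : R) : 0 < e -> continuous (poisson e).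
Proof.
move=> e0 x; apply: cvgM; first exact: cvg_cst.
apply: cvgV; first by rewrite gt_eqF // poisson_den.
by apply: cvgD; [exact: cvg_cst|exact: exprn_continuous].
Qed.

(** Outside the ball of radius [e] the ratio of the two kernels is at most 4/5, attained on its
    boundary; inside, the narrower kernel is at most [4 / e]. Halving the width is thus a
    contraction up to an average over a ball. *)
Lemma poisson_half (e x : R) : 0 < e ->
  poisson (e / 2) x <= 4 / 5 * poisson e x + (4 / e) * \1_(ball (0:R) e) x.
Proof.
move=> e0; have e20 : 0 < e / 2 by rewrite divr_gt0.
have p0 := poisson_ge0 x e0.
rewrite indicE; case: (boolP (x \in _)) => /=.
  by move=> _; have := poisson_le x e20; rewrite (_ : 2 / (e / 2) = 4 / e); [lra|field; rewrite gt_eqF].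
move=> /negP xe; have ex : e ^+ 2 <= x ^+ 2.
  rewrite -[leRHS](real_normK (num_real x)) lerXn2r ?nnegrE ?(ltW e0) //.
  by rewrite leNgt; apply/negP => xl; apply: xe; rewrite inE /ball /= sub0r normrN.
rewrite mulr0 addr0 /poisson.
have d1 := poisson_den x e0; have d2 := poisson_den x e20.
rewrite [leRHS](_ : _ = 8 / 5 * e / (e ^+ 2 + x ^+ 2)); last by ring.
rewrite ler_pdivrMr // mulrAC ler_pdivlMr //.
have : 0 <= e * (x ^+ 2 - e ^+ 2) by rewrite mulr_ge0 ?subr_ge0 // ltW.
nra.
Qed.

Lemma poisson_mass (e : R) : 0 < e -> mu.-integrable [set: mR] (EFin \o poisson e) /\
  \int[mu]_x poisson e x = 2 * pi.
Proof.
move=> e0.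
have cp := continuous_poisson e0.
have dl (x : R) : is_derive x (1:R) (fun x : R => x / e) e^-1.
  by apply: is_derive_eq'; rewrite /GRing.scale /=; ring.
have dF (x : R) : is_derive x (1:R) (fun x : R => 2 * atan (x / e)) (poisson e x).
  apply: (is_derive_eq' (is_deriveZ _ (is_derive1_comp _ (dl x)))).
  rewrite /GRing.scale /= /poisson; field.
  by rewrite !gt_eqF ?poisson_den.
have cF : (fun x : R => 2 * atan (x / e)) @ +oo --> 2 * (pi / 2).
  apply: cvgM; first exact: cvg_cst.
  apply: (cvg_comp _ _ _ (@cvgy_atan R)).
  by apply: gt0_cvgMly; [rewrite invr_gt0|exact: cvg_id].
have half : (\int[mu]_(x in `[0%R, +oo[) (poisson e x)%:E = pi%:E)%E.
  rewrite (@ge0_continuous_FTC2y _ _ (fun x : R => 2 * atan (x / e)) _ (2 * (pi / 2))) //.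
  - by rewrite mul0r atan0 mulr0 sube0; congr EFin; field.
  - by move=> x _; exact: poisson_ge0.
  - exact: continuous_subspaceT.
  - by apply: cvg_at_right_filter; exact: (is_derive_continuous (dF 0)).
  - by move=> x _; rewrite derive1E; exact: derive_val.
have full : (\int[mu]_x (poisson e x)%:E = (2 * pi)%:E)%E.
  rewrite ge0_symfun_integralT.
  - by rewrite -set_itvcy half EFinM.
  - by move=> x; exact: poisson_ge0.
  - by [].
  - by move=> x; rewrite /poisson /= sqrrN.
split; last by rewrite /Rintegral full.
apply/integrableP; split; first by apply/measurable_EFinP; exact: continuous_measurable_fun.
under eq_integral => x _ do rewrite /= ger0_norm ?poisson_ge0 //.
by rewrite full ltry.
Qed.

Lemma recursion_lim (th : R) (a b : nat -> R) : 0 <= th < 1 -> (forall n, 0 <= a n) ->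
  (forall n, a n.+1 <= th * a n + b n) -> b @ \oo --> (0:R) -> a @ \oo --> (0:R).
Proof.
move=> /andP[t0 t1] a0 h hb; apply/cvgrPdist_le => e e0.
have e1 : 0 < e * (1 - th) / 2 by rewrite divr_gt0 // mulr_gt0 // subr_gt0.
have /cvgrPdist_le/(_ _ e1)[N _ hN] := hb.
have key n : a (N + n)%N <= th ^+ n * a N + e / 2.
  elim: n => [|n IH]; first by rewrite addn0 expr0; lra.
  rewrite addnS (le_trans (h _))// exprS.
  have := hN (N + n)%N (leq_addr _ _); rewrite sub0r normrN => /ler_normlW.
  have := ler_wpM2l t0 IH; nra.
have : (fun n => th ^+ n * a N) @ \oo --> 0 * a N.
  apply: cvgM; last exact: cvg_cst.
  by apply: cvg_expr; rewrite ger0_norm.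
have e2 : 0 < e / 2 by lra.
rewrite mul0r => /cvgrPdist_le/(_ _ e2)[M _ hM].
exists (N + M)%N => // n /= nNM; rewrite sub0r normrN ger0_norm //.
rewrite -(subnKC (leq_trans (leq_addr _ _) nNM)) (le_trans (key _))//.
have := hM (n - N)%N; rewrite /= leq_subRL; last exact: leq_trans (leq_addr _ _) nNM.
by move=> /(_ nNM); rewrite sub0r normrN => /ler_normlW; lra.
Qed.

Lemma davg_Rint (f : R -> R) (x r : R) : mu.-integrable [set: mR] (EFin \o f) -> 0 < r ->
  davg f x r = ((2 * r)^-1 * \int[mu]_(y in (ball x r : set mR)) `|f y - f x|)%:E.
Proof.
move=> if_ r0; rewrite /davg /iavg /= lebesgue_measure_ball; last exact: ltW.
rewrite inver gt_eqF ?mulrn_wgt0 // EFinM -(mulr_natl r 2); congr (_ * _)%E.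
rewrite /Rintegral fineK //.
have mb : measurable (ball x r : set mR) by exact: measurable_ball.
apply: integrable_fin_num => //; apply: integrable_norm => //.
have i1 : mu.-integrable (ball x r : set mR) (EFin \o f) by apply: integrableS if_.
have i2 : mu.-integrable (ball x r : set mR) (EFin \o (cst (f x))).
  apply/integrableP; split; first exact/measurable_EFinP.
  rewrite /= integral_cst // [X in (_ * X)%E]lebesgue_measure_ball ?ltW // -EFinM ltry //.
by apply: eq_integrable (integrableB mb i1 i2).
Qed.

Lemma poisson_shift (e xi : R) : 0 < e ->
  mu.-integrable [set: mR] (EFin \o (fun s => poisson e (s - xi))) /\
  \int[mu]_s poisson e (s - xi) = 2 * pi.
Proof.
move=> e0; have [h1 h2] := poisson_mass e0; split; first exact: integrable_shift.
by rewrite (@Rint_shift _ (- xi) (poisson e)).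
Qed.

Lemma poisson_mulr_integrable (f : R -> R) (e xi : R) : 0 < e ->
  mu.-integrable [set: mR] (EFin \o f) ->
  mu.-integrable [set: mR] (EFin \o (fun s => f s * poisson e (s - xi))).
Proof.
move=> e0 if_; have [/measurable_EFinP mf _] := integrableP _ _ _ if_.
have [/integrableP[/measurable_EFinP mp _] _] := poisson_shift xi e0.
apply: (integrable_le (g := fun s => 2 / e * `|f s|)) => //.
- exact: measurable_funM.
- by apply: integrableZ' => //; exact: integrable_norm.
- move=> s _; rewrite normrM mulrC ler_wpM2r // ger0_norm ?poisson_ge0 //; exact: poisson_le.
Qed.

(** For the Poisson averages [a n] of [|f - f xi|] at width [2^-n], [poisson_half] gives
    [a n.+1 <= 4/5 a n + b n], where [b n] is a multiple of the average over a ball and tends to 0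
    at a Lebesgue point. This recursion takes the place of a dyadic decomposition of the kernel. *)
Lemma poisson_lim (f : R -> R) (xi : R) : mu.-integrable [set: mR] (EFin \o f) -> lebesgue_pt f xi ->
  (fun n : nat => \int[mu]_s (f s * poisson (2^-1 ^+ n) (s - xi))) @ \oo --> 2 * pi * f xi.
Proof.
move=> if_ lf; pose e (n : nat) : R := 2^-1 ^+ n.
have e0 n : 0 < e n by rewrite exprn_gt0 // invr_gt0.
have eS n : e n.+1 = e n / 2 by rewrite /e exprS mulrC.
pose g s := `|f s - f xi|.
have ifp n := poisson_mulr_integrable xi (e0 n) if_.
have ip n := (poisson_shift xi (e0 n)).1.
have ic n : mu.-integrable [set: mR] (EFin \o (fun s => f xi * poisson (e n) (s - xi))) by exact: integrableZ'.
have igp n : mu.-integrable [set: mR] (EFin \o (fun s => g s * poisson (e n) (s - xi))).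
  apply: eq_integrable (integrable_norm (integrableB measurableT (ifp n) (ic n))) => //.
  move=> s _ /=; congr EFin; rewrite -mulrBl normrM; congr (_ * _); rewrite ger0_norm //.
  exact: poisson_ge0.
pose a n := \int[mu]_s (g s * poisson (e n) (s - xi)).
have mb r : measurable (ball xi r : set mR) by exact: measurable_ball.
have ig r : mu.-integrable (ball xi r : set mR) (EFin \o g).
  apply: integrable_norm => //.
  have i1 : mu.-integrable (ball xi r : set mR) (EFin \o f) by apply: integrableS if_.
  have i2 : mu.-integrable (ball xi r : set mR) (EFin \o (cst (f xi))).
    apply/integrableP; split; first exact/measurable_EFinP.
    rewrite /= integral_cst //.
    have [r0|r0] := leP 0 r; first by rewrite [X in (_ * X)%E]lebesgue_measure_ball // -EFinM ltry.
    by rewrite (ball0 _ _).2 ?ltW // measure0 mule0 ltry.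
  by apply: eq_integrable (integrableB (mb r) i1 i2).
have igi r : mu.-integrable [set: mR] (EFin \o (fun s => g s * \1_(ball xi r) s)).
  have := (integrable_mkcond _ (mb r)).1 (ig r).
  apply: eq_integrable => // y _; rewrite /= patchE indicE.
  by case: ifP; rewrite ?mulr1 ?mulr0.
pose b n := 4 / e n * \int[mu]_(y in (ball xi (e n) : set mR)) g y.
have ha n : a n.+1 <= 4 / 5 * a n + b n.
  rewrite /b Rint_set_indic // /a -!RintegralZl // -RintegralD //; last 2 first.
  - exact: integrableZ'.
  - exact: integrableZ'.
  apply: le_Rintegral => //.
  - by apply: eq_integrable (integrableD measurableT (integrableZ' (4 / 5) measurableT (igp n)) (integrableZ' (4 / e n) measurableT (igi (e n)))).
  move=> s _; rewrite eS (le_trans (ler_wpM2l (normr_ge0 _) (poisson_half (s - xi) (e0 n))))//.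
  have -> : \1_(ball 0 (e n)) (s - xi) = \1_(ball xi (e n)) s :> R.
    rewrite !indicE; apply: (congr1 (fun b : bool => b%:R)).
    by apply/idP/idP; rewrite !inE /ball /= sub0r opprB.
  by rewrite -/(g s); lra.
have a0 n : 0 <= a n.
  by rewrite /a; apply: Rintegral_ge0 => s _; rewrite mulr_ge0 // ?normr_ge0 //; exact: poisson_ge0.
have ce : e @ \oo --> (0:R)^'+.
  move=> A /nbhs_ballP[d /= d0 hA]; have [N hN] := half_pow0 1 d0.
  exists N => // n /= Nn; apply: (hA _ _ (e0 n)); rewrite /ball /= sub0r normrN ger0_norm ?ltW //.
  apply: le_lt_trans hN; rewrite mul1r /e ler_wiXn2l // ?invr_ge0 // invf_le1 ?ltr0n ?ler1n //.
have hb : b @ \oo --> (0:R).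
  have := fine_cvg (cvg_comp _ _ ce lf); rewrite /comp => h.
  have -> : b = fun n => 8 * fine (davg f xi (e n)).
    by apply/funext => n; rewrite davg_Rint //= /b; field; rewrite gt_eqF.
  have /cvgrPdist_le h' := h eventually_filter.
  apply/cvgrPdist_le => eps eps0; have e80 : 0 < eps / 8 by rewrite divr_gt0.
  have [N _ hN] := h' _ e80; exists N => // n /hN; rewrite !sub0r !normrN normrM.
  by rewrite ger0_norm // ler_pdivlMr // mulrC.
have la : a @ \oo --> (0:R) by apply: recursion_lim ha hb => //; apply/andP; split; lra.
apply/cvgrPdist_le => eps eps0.
have /cvgrPdist_le/(_ _ eps0)[N _ hN] := la.
exists N => // n /hN; rewrite sub0r normrN => /ler_normlW; apply: le_trans.
rewrite distrC -(poisson_shift xi (e0 n)).2 mulrC -RintegralZl // -RintegralB //.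
rewrite (le_trans (le_normr_Rintegral _ _))//.
  by apply: eq_integrable (integrableB measurableT (ifp n) (ic n)).
rewrite le_eqVlt; apply/orP; left; apply/eqP; apply: eq_Rintegral => s _.
by rewrite -mulrBl normrM; congr (_ * _); rewrite ger0_norm // poisson_ge0.
Qed.
End Poisson.

(** * Reflection, Fourier integrals and their two half-line transforms *)

Section Reflection.
Variable R : realType.
Notation C := R[i].
Notation mu := (@lebesgue_measure R).
Notation mR := (measurableTypeR R).

Lemma measurable_neg : measurable_fun [set: mR] (fun x : mR => - x : mR).
Proof. by apply: continuous_measurable_fun => x; apply: cvgN; exact: cvg_id. Qed.

Lemma lebesgue_neg A : measurable A -> mu A = pushforward mu (fun x : mR => - x : mR) A.
Proof.
apply: lebesgue_pushforward; first exact: measurable_neg.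
move=> a b.
have -> : (fun x : mR => - x : mR) @^-1` `]a, b] = `[- b, - a[%classic.
  by apply/seteqP; split => x /=; rewrite !in_itv /= => /andP[h1 h2]; apply/andP; split; lra.
rewrite !lebesgue_measure_itv /= !lte_fin ltrN2.
by rewrite -!EFinB; congr (if _ then _%:E else _); ring.
Qed.

Lemma ge0_int_neg (f : mR -> \bar R) : measurable_fun [set: mR] f -> (forall x, 0 <= f x)%E ->
  (\int[mu]_x f (- x)%R = \int[mu]_x f x)%E.
Proof.
move=> mf f0; rewrite [RHS](@eq_measure_integral _ _ _ _ (pushforward mu (fun x : mR => - x : mR))).
- exact: measurable_neg.
- by move=> H; rewrite ge0_integral_pushforward.
- by move=> H A mA _; exact: lebesgue_neg.
Qed.

Lemma integrable_neg (f : R -> R) : mu.-integrable [set: mR] (EFin \o f) ->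
  mu.-integrable [set: mR] (EFin \o (fun x => f (- x))).
Proof.
move=> /integrableP[mf foo]; apply/integrableP; split.
  apply/measurable_EFinP; apply: measurableT_comp measurable_neg.
  exact/measurable_EFinP.
rewrite (@ge0_int_neg (fun x => `|(f x)%:E|%E)) //.
by apply: measurableT_comp.
Qed.

Lemma Rint_neg (f : R -> R) : mu.-integrable [set: mR] (EFin \o f) ->
  \int[mu]_x f (- x) = \int[mu]_x f x.
Proof.
move=> if_; have /integrableP[mf _] := if_.
rewrite /Rintegral; congr fine.
rewrite [RHS](@eq_measure_integral _ _ _ _ (pushforward mu (fun x : mR => - x : mR))).
- exact: measurable_neg.
- move=> H; rewrite (@integral_pushforward _ _ _ _ _ (fun x : mR => - x : mR)) //.
  exact: (integrable_neg if_).
- by move=> H A mA _; exact: lebesgue_neg.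
Qed.

Lemma cinteg_neg (f : R -> C) : cinteg [set: mR] f -> cinteg [set: mR] (fun x => f (- x)).
Proof. by move=> [f1 f2]; split; exact: (@integrable_neg (fun x => _ (f x))). Qed.

Lemma cint_neg (f : R -> C) : cinteg [set: mR] f ->
  cint [set: mR] (fun x => f (- x)) = cint [set: mR] f.
Proof.
move=> [f1 f2]; apply: complex_eq; rewrite ?cintRec ?cintImc.
  exact: (@Rint_neg (fun x => Rec (f x))).
exact: (@Rint_neg (fun x => Imc (f x))).
Qed.

(** The inverse Fourier integral without its normalization; the constant [2 * pi] reappears in the
    boundary values. *)
Definition FI (X : R -> C) (y : R) : C := cint [set: mR] (fun xi => X xi * cexp ('i * xi%:C * y%:C)).

Lemma FI_cinteg (X : R -> C) (y : R) : cinteg [set: mR] X ->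
  cinteg [set: mR] (fun xi => X xi * cexp ('i * xi%:C * y%:C)).
Proof.
move=> iX; apply: (@cinteg_bddM _ _ _ _ 1 measurableT iX); first exact: ccont_cmeas (ccont_cexp_i y).
by move=> xi _; rewrite normc_cexp_i.
Qed.

Lemma FI_neg (X : R -> C) (y : R) : cinteg [set: mR] X ->
  FI (fun s => X (- s)) y = FI X (- y).
Proof.
move=> iX; rewrite /FI -(cint_neg (FI_cinteg (- y) iX)); apply: eq_cint => s _.
by congr (_ * cexp _); rewrite !rmorphN !(mulrN, mulNr) opprK.
Qed.

(** The two transforms are Cauchy integrals with kernels [1 / (e - i (s - xi))] and
    [1 / (e + i (s - xi))]. Each may diverge as [e] tends to 0, but in the sum the singular parts
    cancel and an approximate identity remains. *)
Lemma FI_poisson (X : R -> C) (e xi : R) : cinteg [set: mR] X -> 0 < e ->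
  Lap (FI X) (e%:C + 'i * xi%:C) + Lap (fun y => FI X (- y)) (e%:C - 'i * xi%:C) =
  cint [set: mR] (fun s => X s * (poisson e (s - xi))%:C).
Proof.
move=> iX e0.
have r1 (s : R) : Rec (e%:C + 'i * s%:C) = e by rewrite !RecE /=; ring.
have r2 (s : R) : Rec (e%:C - 'i * s%:C) = e by rewrite !RecE /=; ring.
have L1 := @Lap_Fourier R X (e%:C + 'i * xi%:C) iX.
have L2 := @Lap_Fourier R _ (e%:C - 'i * xi%:C) (cinteg_neg iX).
have {}L1 : Lap (FI X) (e%:C + 'i * xi%:C) = _ := L1 ltac:(by rewrite r1).
have {}L2 : Lap (FI (fun s => X (- s))) (e%:C - 'i * xi%:C) = _ := L2 ltac:(by rewrite r2).
have eX : FI (fun s => X (- s)) = fun y => FI X (- y) by apply/funext => y; exact: FI_neg.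
have w1 (s : R) : e%:C + 'i * xi%:C - 'i * s%:C = e%:C - 'i * (s - xi)%:C by rewrite rmorphB; ring.
have w2 (s : R) : e%:C - 'i * xi%:C - 'i * (- s)%:C = e%:C + 'i * (s - xi)%:C by rewrite rmorphB rmorphN; ring.
have ne (w : C) : Rec w = e -> w != 0 by move=> we; apply: neq0_Rec; rewrite we.
have nb (w : C) : Rec w = e -> normc w^-1 <= e^-1.
  move=> we; rewrite normcV lef_pV2 ?posrE //; last by rewrite normc_gt0 // ne.
  by rewrite -we (le_trans (ler_norm _)) // normr_Rec.
have ib (w : R -> C) : (forall s, Rec (w s) = e) -> ccont w -> cinteg [set: mR] (fun s => X s / w s).
  move=> we cw; apply: (@cinteg_bddM _ _ _ _ e^-1 measurableT iX).
    by apply: ccont_cmeas => //; apply: ccont_inv => // s; exact: ne.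
  by move=> s _; exact: nb.
have cl : ccont (fun s : R => (s - xi)%:C).
  by apply: ccontR => s; apply: cvgB; [exact: cvg_id|exact: cvg_cst].
have i1 : cinteg [set: mR] (fun s => X s / (e%:C - 'i * (s - xi)%:C)).
  by apply: ib => //; apply: ccontB; [exact: ccont_cst|apply: ccontM => //; exact: ccont_cst].
have i2 : cinteg [set: mR] (fun s => X s / (e%:C + 'i * (s - xi)%:C)).
  by apply: ib => //; apply: ccontD; [exact: ccont_cst|apply: ccontM => //; exact: ccont_cst].
have L2' : Lap (fun y => FI X (- y)) (e%:C - 'i * xi%:C) = cint [set: mR] (fun s => X s / (e%:C + 'i * (s - xi)%:C)).
  rewrite -eX L2 -(cint_neg i2); apply: eq_cint => s _ /=.
  by congr (_ / _); rewrite -w2 opprK.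
have L1' : Lap (FI X) (e%:C + 'i * xi%:C) = cint [set: mR] (fun s => X s / (e%:C - 'i * (s - xi)%:C)).
  by rewrite L1; apply: eq_cint => s _; rewrite w1.
rewrite L1' L2' -(cintD measurableT i1 i2); apply: eq_cint => s _.
rewrite -mulrDr; congr (_ * _).
have n1 := ne _ (r1 (s - xi)); have n2 := ne _ (r2 (s - xi)).
apply: (mulIf n1); apply: (mulIf n2).
have -> : ((e%:C - 'i * (s - xi)%:C)^-1 + (e%:C + 'i * (s - xi)%:C)^-1) * (e%:C + 'i * (s - xi)%:C)
   * (e%:C - 'i * (s - xi)%:C) = (2 * e)%:C.
  have -> : (2 * e)%:C = e%:C + e%:C by rewrite -rmorphD /=; congr (_ %:C); ring.
  move: n1 n2; generalize (s - xi)%:C => u n1 n2.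
  by field; rewrite n1 n2.
have -> : (poisson e (s - xi))%:C * (e%:C + 'i * (s - xi)%:C) * (e%:C - 'i * (s - xi)%:C) =
   (poisson e (s - xi) * (e ^+ 2 + (s - xi) ^+ 2))%:C.
  by apply: complex_eq; rewrite !RecE /=; ring.
by congr (_ %:C); rewrite /poisson mulfVK // gt_eqF // poisson_den.
Qed.

(** Fourier uniqueness, pointwise: by [FI_poisson] all Poisson averages of [X] are sums of Laplace
    transforms of the zero function. *)
Lemma FI_eq0 (X : R -> C) (xi : R) : cinteg [set: mR] X -> (forall y, FI X y = 0) ->
  lebesgue_pt (fun s => Rec (X s)) xi -> lebesgue_pt (fun s => Imc (X s)) xi -> X xi = 0.
Proof.
move=> iX F0 l1 l2; have [i1 i2] := iX.
have L0 (z : C) (g : R -> C) : (forall y, g y = 0) -> Lap g z = 0.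
  move=> g0; rewrite /Lap (_ : (fun _ => _) = (fun y => (0 : C))); last first.
    by apply/funext => y; rewrite g0 mulr0.
  by apply: complex_eq; rewrite ?cintRec ?cintImc /Rintegral integral0.
have P0 n : cint [set: mR] (fun s => X s * (poisson (2^-1 ^+ n) (s - xi))%:C) = 0.
  by rewrite -FI_poisson // ?exprn_gt0 ?invr_gt0 // !L0 ?addr0 // => y; exact: F0.
have key (f : R -> R) : (forall n : nat, \int[mu]_s (f s * poisson (2^-1 ^+ n) (s - xi)) = 0) ->
   mu.-integrable [set: mR] (EFin \o f) -> lebesgue_pt f xi -> f xi = 0.
  move=> f0 if_ lf; have := poisson_lim if_ lf.
  rewrite (_ : (fun n : nat => _) = fun=> 0); last by apply/funext.
  move=> h; have : (0:R) = 2 * pi * f xi by apply: (cvg_unique _ _ h); [|exact: cvg_cst].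
  move=> /esym /eqP; rewrite !mulf_eq0 => /orP[/orP[|]|/eqP //].
    by rewrite pnatr_eq0.
  by rewrite gt_eqF // pi_gt0.
apply: complex_eq.
  apply: (key (fun s => Rec (X s))) => // n; rewrite -[RHS]/(Rec 0) -(P0 n) cintRec.
  by apply: eq_Rintegral => s _; rewrite Rec_mulR.
apply: (key (fun s => Imc (X s))) => // n; rewrite -[RHS]/(Imc 0) -(P0 n) cintImc.
by apply: eq_Rintegral => s _; rewrite Imc_mulR.
Qed.
End Reflection.

(** * Calculus on a closed interval *)

Section Clamp.
Variable R : realType.
Notation C := R[i].
Notation mu := (@lebesgue_measure R).
Notation mR := (measurableTypeR R).

(** Composition with this projection extends a function controlled only on [[a, b]] to one that is
    continuous on the whole line. *)
Definition clamp (a b x : R) := Num.max a (Num.min x b).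

Lemma clamp_id (a b x : R) : a <= x <= b -> clamp a b x = x.
Proof. by move=> /andP[ax xb]; rewrite /clamp (min_idPl xb) (max_idPr ax). Qed.

Lemma clamp_itv (a b x : R) : a <= b -> a <= clamp a b x <= b.
Proof.
move=> ab; rewrite /clamp; case: (leP x b) => h1.
  by case: (leP a x) => h2; apply/andP; split; lra.
by rewrite (max_idPr ab) ab lexx.
Qed.

Lemma clamp_lip (a b x y : R) : a <= b -> `|clamp a b x - clamp a b y| <= `|x - y|.
Proof.
move=> ab; rewrite /clamp.
case: (leP x b) => h1; case: (leP y b) => h2; rewrite ?(max_idPr ab) ?subrr ?normr0 //;
  try case: (leP a x) => h3; try case: (leP a y) => h4; rewrite ?subrr ?normr0 //;
  rewrite ler_norml; have := ler_norm (x - y); have := lerNnormlW (lexx `|x - y|);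
  by move=> *; apply/andP; split; lra.
Qed.

Lemma lip_continuous (f : R -> R) (K : R) : (forall s t, `|f s - f t| <= K * `|s - t|) -> continuous f.
Proof.
move=> h t; have K0 : 0 <= K.
  by have := le_trans (normr_ge0 _) (h 1 0); rewrite subr0 normr1 mulr1.
apply/cvgrPdist_le => e e0; have e1 : 0 < e / (K + 1) by rewrite divr_gt0 //; lra.
near=> s; rewrite (le_trans (h _ _))//.
have : `|t - s| <= e / (K + 1) by near: s; exact: cvgr_dist_le e1.
rewrite ler_pdivlMr; last by lra.
have := normr_ge0 (t - s); lra.
Unshelve. all: by end_near. Qed.

Lemma lip_ccont (f : R -> C) (K : R) : (forall s t, normc (f s - f t) <= K * `|s - t|) -> ccont f.
Proof.
move=> h; split; apply: (@lip_continuous _ K) => s t; rewrite (le_trans _ (h s t))//.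
  by rewrite -Rec_opp -Rec_add normr_Rec.
by rewrite -Imc_opp -Imc_add normr_Imc.
Qed.

Lemma continuous_clamp (a b : R) : a <= b -> continuous (clamp a b).
Proof. by move=> ab; apply: (@lip_continuous _ 1) => s t; rewrite mul1r; exact: clamp_lip. Qed.

Lemma cder_cont (f : R -> C) : (forall t, exists d, cder f t d) -> ccont f.
Proof. by move=> h; split => t; have [d [d1 d2]] := h t; [exact: is_derive_continuous d1|exact: is_derive_continuous d2]. Qed.

Lemma Rint_FTC_in (F f : R -> R) (a b : R) : a <= b -> continuous f ->
  (forall x, a <= x <= b -> is_derive x (1:R) F (f x)) -> \int[mu]_(x in `[a, b]) f x = F b - F a.
Proof.
move=> ab cf dF; move: (ab); rewrite le_eqVlt => /predU1P[->|ab'].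
  by rewrite set_itv1 Rintegral_set1 subrr.
have oo x : x \in `]a, b[ -> is_derive x (1:R) F (f x).
  by rewrite in_itv /= => /andP[/ltW h1 /ltW h2]; apply: dF; rewrite h1.
rewrite /Rintegral (@continuous_FTC2 _ f F) //.
- exact: continuous_subspaceT.
- split; first by move=> x /oo dx; exact: ex_derive.
    by apply: cvg_at_right_filter; apply: (is_derive_continuous (dF a _)); rewrite lexx.
  by apply: cvg_at_left_filter; apply: (is_derive_continuous (dF b _)); rewrite lexx andbT.
- by move=> x /oo dx; rewrite derive1E; exact: derive_val.
Qed.

Lemma cint_FTC_in (F f : R -> C) (a b : R) : a <= b -> ccont f ->
  (forall x, a <= x <= b -> cder F x (f x)) -> cint `[a, b] f = F b - F a.
Proof.
move=> ab [c1 c2] dF; apply: complex_eq; rewrite RecE ?cintRec ?cintImc.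
  by rewrite (Rint_FTC_in ab c1 (fun x xab => (dF x xab).1)) Rec_opp.
by rewrite (Rint_FTC_in ab c2 (fun x xab => (dF x xab).2)) Imc_opp.
Qed.

Lemma cmvt_in (f f' : R -> C) (a b B : R) : a <= b ->
  (forall t, a <= t <= b -> cder f t (f' t)) ->
  (forall t, a <= t <= b -> normc (f' t) <= B) -> normc (f b - f a) <= 2 * B * (b - a).
Proof.
move=> ab df bf.
have oo t : a < t < b -> a <= t <= b by move=> /andP[/ltW -> /ltW ->].
have w (g g' : R -> R) : (forall t, a <= t <= b -> is_derive t (1:R) g (g' t)) -> {within `[a, b], continuous g}.
  move=> dg; apply: derivable_within_continuous => t; rewrite in_itv /= => /dg dt; exact: ex_derive.
have h1 : `|Rec (f b) - Rec (f a)| <= B * (b - a).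
  apply: (@mvt_bound _ (fun t => Rec (f t)) (fun t => Rec (f' t)) a b B ab).
  - by apply: w => t /df [].
  - by move=> t /oo /df [].
  - by move=> t /oo /bf; apply: le_trans; exact: normr_Rec.
have h2 : `|Imc (f b) - Imc (f a)| <= B * (b - a).
  apply: (@mvt_bound _ (fun t => Imc (f t)) (fun t => Imc (f' t)) a b B ab).
  - by apply: w => t /df [].
  - by move=> t /oo /df [].
  - by move=> t /oo /bf; apply: le_trans; exact: normr_Imc.
rewrite (le_trans (normc_le_ReIm _))// !RecE; lra.
Qed.
End Clamp.

(** * Vanishing of rapidly decaying holomorphic functions *)

Section HolFamily.
Variable R : realType.
Notation C := R[i].
Variables (I : Type) (S : set I) (D : set C).
Hypothesis bD : bddC D.

(** Here and below the derivative is hidden, so that holomorphy of long expressions can be assembled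
    term by term. *)
Lemma famC (c : I -> C) (K : R) : (forall i, S i -> normc (c i) <= K) -> hol_family S D (fun i _ => c i).
Proof. by move=> h; eexists; exact: (holu_cst D h). Qed.
Lemma fam_id : hol_family S D (fun _ z => z).
Proof. by eexists; exact: (holu_id S bD). Qed.
Lemma famD (f g : I -> C -> C) : hol_family S D f -> hol_family S D g ->
  hol_family S D (fun i z => f i z + g i z).
Proof. by move=> [f' hf] [g' hg]; eexists; exact: (holuD hf hg). Qed.
Lemma famN (f : I -> C -> C) : hol_family S D f -> hol_family S D (fun i z => - f i z).
Proof. by move=> [f' hf]; eexists; exact: (holuN hf). Qed.
Lemma famB (f g : I -> C -> C) : hol_family S D f -> hol_family S D g ->
  hol_family S D (fun i z => f i z - g i z).
Proof. by move=> hf hg; apply: famD => //; exact: famN. Qed.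
Lemma famM (f g : I -> C -> C) : hol_family S D f -> hol_family S D g ->
  hol_family S D (fun i z => f i z * g i z).
Proof. by move=> [f' hf] [g' hg]; eexists; exact: (holuM bD hf hg). Qed.
Lemma famV (f : I -> C -> C) (kap : R) : 0 < kap -> (forall i z, S i -> D z -> kap <= normc (f i z)) ->
  hol_family S D f -> hol_family S D (fun i z => (f i z)^-1).
Proof. by move=> k0 h [f' hf]; eexists; exact: (holuV bD k0 h hf). Qed.
Lemma fam_comp (D2 : set C) (g : C -> C) (f : I -> C -> C) : hol_family [set: unit] D2 (fun=> g) ->
  (forall i z, S i -> D z -> D2 (f i z)) -> hol_family S D f -> hol_family S D (fun i z => g (f i z)).
Proof.
move=> [g' hg] h [f' hf]; exists (fun i z => g' tt (f i z) * f' i z).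
apply: (holu_comp bD (g' := g' tt) _ h hf).
by have [K hK] := hg; exists K => -[] _; exact: (hK tt Logic.I).
Qed.
Lemma fam_sub (J : Type) (S' : set J) (D' : set C) (g : J -> I) (f : I -> C -> C) :
  (forall j, S' j -> S (g j)) -> (D' `<=` D) -> hol_family S D f -> hol_family S' D' (fun j => f (g j)).
Proof. by move=> h hD [f' hf]; eexists; exact: (holu_sub h hD hf). Qed.
Lemma famX (f : I -> C -> C) (n : nat) : hol_family S D f -> hol_family S D (fun i z => f i z ^+ n).
Proof.
move=> hf; elim: n => [|n IH].
  by apply: (@famC (fun=> 1) 1) => i _; rewrite normc1.
have -> : (fun i z => f i z ^+ n.+1) = (fun i z => f i z * f i z ^+ n).
  by apply/funext => i; apply/funext => z; rewrite exprS.
exact: famM.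
Qed.
End HolFamily.
Notation holo D f := (hol_family [set: unit] D (fun=> f)).

(** * Contour shift, uniqueness in a half-plane and the identity theorem *)

Section HalfPlane.
Variable R : realType.
Notation C := R[i].
Notation mu := (@lebesgue_measure R).
Notation mR := (measurableTypeR R).

Lemma holo_K (D : set C) (f : C -> C) : holo D f -> exists f' : C -> C, exists2 K : R, 1 <= K &
  (forall z, D z -> normc (f z) <= K /\ normc (f' z) <= K) /\
  (forall z w, D z -> D w -> normc (f w - f z - f' z * (w - z)) <= K * normc (w - z) ^+ 2).
Proof. by move=> [f' /holu_K[K K1 /(_ tt Logic.I) h]]; exists (f' tt); exists K. Qed.

Lemma holo_cder (D : set C) (f f' : C -> C) (K : R) : 0 <= K -> copen D ->
  (forall z w, D z -> D w -> normc (f w - f z - f' z * (w - z)) <= K * normc (w - z) ^+ 2) ->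
  forall z v t, D (z + t%:C * v) -> cder (fun s => f (z + s%:C * v)) t (v * f' (z + t%:C * v)).
Proof.
move=> K0 oD h z v t Dt; have [r r0 hr] := oD _ Dt.
have v1 : 0 < normc v + 1 by have := normc_ge0 v; lra.
apply: (@quad_cder _ _ _ (r / (normc v + 1)) (K * normc v ^+ 2)).
- by rewrite divr_gt0.
- by rewrite mulr_ge0 ?sqr_ge0.
move=> e he.
have e1 : z + (t + e)%:C * v - (z + t%:C * v) = e%:C * v by rewrite rmorphD /=; ring.
have De : D (z + (t + e)%:C * v).
  apply: hr; rewrite e1 normcM normcR.
  move: he; rewrite ltr_pdivlMr //; have := normr_ge0 e; lra.
have := h _ _ Dt De; rewrite e1 normcM normcR exprMn real_normK ?num_real //.
have -> : f' (z + t%:C * v) * (e%:C * v) = e%:C * (v * f' (z + t%:C * v)) by ring.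
by rewrite (mulrC (e ^+ 2)) (mulrA K).
Qed.

(** Adding the expansion at [z] evaluated in [w] and the expansion at [w] evaluated in [z] cancels
    the increments of [f]; only the difference of the derivatives is left. *)
Lemma derive_lip (D : set C) (f f' : C -> C) (K : R) :
  (forall z w, D z -> D w -> normc (f w - f z - f' z * (w - z)) <= K * normc (w - z) ^+ 2) ->
  forall z w, D z -> D w -> normc (f' w - f' z) <= 2 * K * normc (w - z).
Proof.
move=> h z w Dz Dw; have [->|wz] := eqVneq w z; first by rewrite !subrr normc0 mulr0.
have wz0 : 0 < normc (w - z) by rewrite normc_gt0 // subr_eq0.
rewrite -(ler_pM2r wz0) -normcM.
have h1 := h z w Dz Dw; have h2 := h w z Dw Dz.
have -> : (f' w - f' z) * (w - z) = (f w - f z - f' z * (w - z)) + (f z - f w - f' w * (z - w)) by ring.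
rewrite (le_trans (ler_normcD _ _))//; rewrite normcC in h2.
have e2 : 2 * K * normc (w - z) * normc (w - z) = K * normc (w - z) ^+ 2 + K * normc (w - z) ^+ 2 by ring.
by rewrite e2 lerD.
Qed.

(** Integrable weight on vertical lines. Decay hypotheses use its square: one factor gives
    integrability, the other smallness of the tails and of the horizontal sides. *)
Definition cauchyw (s : R) := (1 + s ^+ 2)^-1.

Lemma cauchyw_poisson s : cauchyw s = 2^-1 * poisson 1 s.
Proof. by rewrite /cauchyw /poisson expr1n mulr1 mulrA mulVf // mul1r. Qed.

Lemma cauchyw_gt0 s : 0 < cauchyw s. Proof. by rewrite invr_gt0 ltr_pwDl ?sqr_ge0. Qed.
Lemma cauchyw_le1 s : cauchyw s <= 1.
Proof. by rewrite invf_le1 ?ltr_pwDl ?sqr_ge0 // lerDl sqr_ge0. Qed.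
Lemma cauchyw_sqr s : cauchyw s ^+ 2 <= cauchyw s.
Proof. by rewrite expr2 ler_piMr ?cauchyw_le1 // ltW // cauchyw_gt0. Qed.

Lemma cauchyw_mass : mu.-integrable [set: mR] (EFin \o cauchyw) /\ \int[mu]_s cauchyw s = pi.
Proof.
have [h1 h2] := poisson_mass (@ltr01 R).
have -> : cauchyw = fun s => 2^-1 * poisson 1 s by apply/funext; exact: cauchyw_poisson.
by split; [exact: integrableZ'|rewrite RintegralZl // h2; field].
Qed.

Lemma cauchyw_cinteg (g : R -> C) (B : R) : ccont g -> (forall s, normc (g s) <= B * cauchyw s) ->
  cinteg [set: mR] g /\ normc (cint [set: mR] g) <= 2 * (B * pi).
Proof.
move=> cg hg; have [i1 i2] := cauchyw_mass.
have ig : cinteg [set: mR] g.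
  by apply: (cinteg_le measurableT (ccont_cmeas measurableT cg) (integrableZ' B measurableT i1)) => s _.
split=> //; rewrite -i2 -RintegralZl //.
by apply: cint_le => //; exact: integrableZ'.
Qed.

Lemma cauchyw_tail (g : R -> C) (B M : R) : ccont g -> 0 <= B -> 0 <= M ->
  (forall s, normc (g s) <= B * cauchyw s ^+ 2) ->
  normc (cint [set: mR] g - cint `[- M, M] g) <= 2 * (B * cauchyw M * pi).
Proof.
move=> cg B0 M0 hg; have [i1 i2] := cauchyw_mass.
have ig := (@cauchyw_cinteg g B cg (fun s => le_trans (hg s) (ler_wpM2l B0 (cauchyw_sqr s)))).1.
have mD : measurable (`[- M, M]%classic : set mR) by exact: measurable_itv.
have mI : cmeas [set: mR] (fun s => (\1_`[- M, M]%classic s : R)%:C).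
  by split; [exact: measurable_indic|exact: measurable_cst].
have igI : cinteg [set: mR] (fun s => g s * (\1_`[- M, M]%classic s)%:C).
  apply: (@cinteg_bddM _ _ _ _ 1 measurableT ig mI) => s _.
  by rewrite normcR indicE; case: (_ \in _); rewrite ?normr1 ?normr0.
rewrite (cint_set_indic _ mD) -(cintB measurableT ig igI).
rewrite -i2 -RintegralZl //; apply: cint_le => //; [exact: cintegB|exact: integrableZ'|].
move=> s _; rewrite indicE; case: (boolP (s \in _)) => [_|].
  by rewrite mulr1 subrr normc0 !mulr_ge0 // ltW // cauchyw_gt0.
rewrite notin_setE /= in_itv /= => /negP; rewrite negb_and -!ltNge => sM.
rewrite mulr0 subr0 (le_trans (hg s))// -mulrA ler_wpM2l // expr2 ler_wpM2r ?(ltW (cauchyw_gt0 _)) //.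
rewrite lef_pV2 ?posrE ?ltr_pwDl ?sqr_ge0 // lerD2l.
by case/orP: sM => ?; nra.
Qed.

Lemma line_copen (x1 rho : R) : copen [set z : C | x1 < Rec z /\ normc z < rho].
Proof.
move=> z [zx zr]; exists (Num.min (Rec z - x1) (rho - normc z)).
  by rewrite lt_min !subr_gt0 zx.
move=> w; rewrite lt_min => /andP[h1 h2]; split.
  have := normr_Rec (w - z); rewrite Rec_add Rec_opp => /le_lt_trans/(_ h1).
  by rewrite ltr_norml => /andP[]; lra.
by have := ler_normcD (w - z) z; rewrite subrK; lra.
Qed.

Lemma bddC_ball (D : set C) (rho : R) : (forall z, D z -> normc z <= rho) -> bddC D.
Proof.
move=> h; exists (2 * rho) => z w /h hz /h hw; have := ler_normcB w z; lra.
Qed.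

Section Contour.
Variables (G : C -> C) (x1 B : R).
Hypothesis hG : forall rho : R, holo [set z : C | x1 < Rec z /\ normc z < rho] G.
Hypothesis bG : forall z, x1 < Rec z -> normc (G z) <= B * expR (- Rec z) * cauchyw (Imc z) ^+ 2.

Let ln (x s : R) : C := x%:C + s%:C * 'i.
Let Rln x s : Rec (ln x s) = x. Proof. by rewrite !RecE /=; ring. Qed.
Let Iln x s : Imc (ln x s) = s. Proof. by rewrite !RecE /=; ring. Qed.
Let nln x s : normc (ln x s) <= `|x| + `|s|.
Proof. by have := normc_le_ReIm (ln x s); rewrite Rln Iln. Qed.

Let B0 : 0 <= B.
Proof.
have := le_trans (normc_ge0 _) (bG (z := ln (x1 + 1) 0) _); rewrite Rln Iln => h.
have {}h := h ltac:(by rewrite ltrDl).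
by rewrite -(pmulr_lge0 _ (expR_gt0 (- (x1 + 1)))) -(pmulr_lge0 _ (exprn_gt0 2 (cauchyw_gt0 0))).
Qed.

Let cG x : x1 < x -> ccont (fun s => G (ln x s)).
Proof.
move=> xx; apply: cder_cont => t.
have [G' [K K1 [_ h]]] := holo_K (hG (`|x| + `|t| + 1)).
exists ('i * G' (ln x t)).
apply: (holo_cder (le_trans ler01 K1) (@line_copen _ _) h (z := x%:C) (v := 'i)).
by split; rewrite -/(ln x t) ?Rln //; have := nln x t; lra.
Qed.

Let bG' x s : x1 < x -> normc (G (ln x s)) <= B * expR (- x) * cauchyw s ^+ 2.
Proof. by move=> xx; have := @bG (ln x s); rewrite Rln Iln; apply. Qed.

Let J M x := cint `[- M, M] (fun s => G (ln x s)).

(** By the Cauchy-Riemann equations the derivative of [G] in the abscissa is its derivative along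
    the vertical line divided by [i], hence integrates to endpoint values. *)
Let derJ M t : 0 <= M -> x1 < t -> cder (J M) t ((G (ln t M) - G (ln t (- M))) / 'i).
Proof.
move=> M0 tx; have i0 : ('i : C) != 0 by rewrite neq0Ci.
have [G' [K K1 [hb h]]] := holo_K (hG (`|t| + (t - x1) + M + 1)).
have MM : - M <= M by lra.
set D := [set z : C | _] in h hb.
have inD x s : `|x - t| < t - x1 -> - M <= s <= M -> D (ln x s).
  rewrite ltr_norml => /andP[h1 h2] /andP[s1 s2]; split; rewrite ?Rln; first by lra.
  rewrite (le_lt_trans (nln x s))//.
  have : `|s| <= M by rewrite ler_norml s1.
  have : `|x| <= `|t| + `|x - t| by rewrite -{1}(subrK t x) addrC ler_normD.
  have : `|x - t| < t - x1 by rewrite ltr_norml; apply/andP; split; lra.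
  lra.
have inDt s : - M <= s <= M -> D (ln t s) by move=> hs; apply: inD => //; rewrite subrr normr0 subr_gt0.
pose g s := G' (ln t (clamp (- M) M s)).
have cg : ccont g.
  apply: (@lip_ccont _ _ (2 * K)) => s s'.
  rewrite (le_trans (derive_lip h (inDt _ (clamp_itv s' MM)) (inDt _ (clamp_itv s MM))))//.
  rewrite ler_wpM2l //; first by lra.
  have -> : ln t (clamp (- M) M s) - ln t (clamp (- M) M s') = (clamp (- M) M s - clamp (- M) M s')%:C * 'i.
    by rewrite /ln rmorphB /=; ring.
  by rewrite normcM normcR normc_i mulr1 clamp_lip.
have eg : cint `[- M, M] g = (G (ln t M) - G (ln t (- M))) / 'i.
  rewrite (cint_FTC_in (F := fun s => G (ln t s) / 'i) MM cg); first by rewrite mulrBl.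
  move=> s sM; have := holo_cder (le_trans ler01 K1) (@line_copen _ _) h (z := t%:C) (v := 'i) (t := s) (inDt s sM).
  move=> dd; apply: (cder_eq (cder_ext (cderZ 'i^-1 dd) _)).
    by move=> u; rewrite mulrC.
  by rewrite mulrA mulVf // mul1r /g clamp_id.
rewrite -eg; apply: (@quad_cder _ _ _ (t - x1) (4 * K * M)); first by rewrite subr_gt0.
  by rewrite mulr_ge0 //; lra.
move=> e he.
have te : x1 < t + e by move: he; rewrite ltr_norml => /andP[]; lra.
have c1 := cG te; have c2 := cG tx.
have m : measurable (`[- M, M]%classic : set mR) by exact: measurable_itv.
have j1 := ccont_cinteg (- M) M c1; have j2 := ccont_cinteg (- M) M c2; have j3 := ccont_cinteg (- M) M cg.
rewrite /J -(cintB m j1 j2) -(cintZ _ m j3) -(cintB m (cintegB m j1 j2) (cintegZ _ m j3)).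
have cc : ccont (fun s => G (ln (t + e) s) - G (ln t s) - e%:C * g s).
  by apply: ccontB; [exact: ccontB|apply: ccontM => //; exact: ccont_cst].
rewrite (le_trans (cint_itv_le (B := K * e ^+ 2) MM cc _))//; last by lra.
move=> s sM; rewrite /g clamp_id //.
have De : D (ln (t + e) s) by apply: inD => //; rewrite addrAC subrr add0r.
have := h _ _ (inDt s sM) De.
have -> : ln (t + e) s - ln t s = e%:C by rewrite /ln rmorphD /=; ring.
by rewrite normcR real_normK ?num_real // (mulrC (G' _)).
Qed.

(** The contour theorem for a tall rectangle, in differential form: moving the line from [x] to [x']
    changes the truncated integral only by the horizontal sides, of size [cauchyw M], while the
    integral over the far line is of order [expR (- x')]. *)
Lemma contour_zero x : x1 < x -> cint [set: mR] (fun s => G (ln x s)) = 0.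
Proof.
move=> xx; apply/normc_eq0/eqP; rewrite eq_le normc_ge0 andbT.
pose B' := B * expR (- x1).
have B'0 : 0 <= B' by rewrite mulr_ge0 ?expR_ge0.
have bB y s : x1 < y -> normc (G (ln y s)) <= B' * cauchyw s ^+ 2.
  move=> xy; rewrite (le_trans (bG' s xy))// ler_wpM2r ?sqr_ge0 // ler_wpM2l // ler_expR; lra.
have key M x' : 0 <= M -> x <= x' -> normc (cint [set: mR] (fun s => G (ln x s))) <=
   4 * B' * (pi + (x' - x)) * cauchyw M + 2 * pi * B * expR (- x').
  move=> M0 xx'; have xx1 : x1 < x' by lra.
  have t1 := cauchyw_tail (cG xx) B'0 M0 (fun s => bB x s xx).
  have t2 := cauchyw_tail (cG xx1) B'0 M0 (fun s => bB x' s xx1).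
  have t3 : normc (cint [set: mR] (fun s => G (ln x' s))) <= 2 * (B * expR (- x') * pi).
    apply: (cauchyw_cinteg (cG xx1) _).2 => s; rewrite (le_trans (bG' s xx1))//.
    by rewrite ler_wpM2l ?cauchyw_sqr // mulr_ge0 ?expR_ge0.
  have t4 : normc (J M x' - J M x) <= 2 * (2 * B' * cauchyw M) * (x' - x).
    apply: (cmvt_in xx' (f' := fun t => (G (ln t M) - G (ln t (- M))) / 'i)).
      by move=> t /andP[h1 h2]; apply: derJ => //; lra.
    move=> t /andP[h1 h2]; have xt : x1 < t by lra.
    rewrite normcM normcV normc_i invr1 mulr1 (le_trans (ler_normcB _ _))//.
    have := bB t M xt; have := bB t (- M) xt.
    have -> : cauchyw (- M) = cauchyw M by rewrite /cauchyw sqrrN.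
    have := ler_wpM2l B'0 (cauchyw_sqr M); lra.
  rewrite -/(J M x) in t1; rewrite -/(J M x') in t2.
  have := ler_normcD (cint [set: mR] (fun s => G (ln x s)) - J M x)
    (cint [set: mR] (fun s => G (ln x' s)) - (cint [set: mR] (fun s => G (ln x' s)) - J M x') - (J M x' - J M x)).
  set a := cint _ _; set b := cint _ _; have -> : a - J M x + (b - (b - J M x') - (J M x' - J M x)) = a by ring.
  have := ler_normcB (b - (b - J M x')) (J M x' - J M x); have := ler_normcB b (b - J M x').
  move: t1 t2 t3 t4; rewrite -/a -/b; lra.
apply/ler_addgt0Pr => e e0; rewrite add0r.
pose c := 2 * pi * B.
have c0 : 0 <= c by rewrite !mulr_ge0 // pi_ge0.
(* Makes the far line contribute at most [e / 2], by [1 + x' <= expR x']. The height [M] is chosen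
   afterwards and depends on [x']. *)
pose x' := `|x| + 2 * c / e.
have xx' : x <= x' by rewrite (le_trans (ler_norm x)) // lerDl divr_ge0 ?(ltW e0) // mulr_ge0.
have h1 : c * expR (- x') <= e / 2.
  rewrite expRN ler_pdivrMr ?expR_gt0 //.
  have hx := expR_ge1Dx x'.
  have : 2 * c <= e * x'.
    rewrite /x' mulrDr (_ : e * (2 * c / e) = 2 * c); last by field; rewrite gt_eqF.
    by rewrite lerDr mulr_ge0 // ltW.
  have : e * (1 + x') <= e * expR x' by rewrite ler_wpM2l // ltW.
  lra.
pose d := 4 * B' * (pi + (x' - x)).
have d0 : 0 <= d by rewrite !mulr_ge0 // addr_ge0 ?pi_ge0 // subr_ge0.
pose M := 2 * d / e.
have M0 : 0 <= M by rewrite divr_ge0 ?(ltW e0) // mulr_ge0.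
rewrite (le_trans (key M x' M0 xx'))// -/c -/d.
have : d * cauchyw M <= e / 2; last by lra.
rewrite ler_pdivrMr ?ltr_pwDl ?sqr_ge0 //.
have : e * M = 2 * d by rewrite /M; field; rewrite gt_eqF.
have := sqr_ge0 (M - 1); nra.
Qed.
End Contour.

(* By contour shift every Fourier coefficient of the restriction to a vertical line is zero. *)
Theorem halfplane_zero (H : C -> C) (x1 : R) :
  (forall rho : R, holo [set z : C | x1 < Rec z /\ normc z < rho] H) ->
  (forall Y : R, exists B, forall z, x1 < Rec z ->
     normc (H z) <= B * expR (- (Y * Rec z)) * cauchyw (Imc z) ^+ 2) ->
  forall z, x1 < Rec z -> H z = 0.
Proof.
move=> hH bH z zx; set x := Rec z in zx.
have ln (s : R) : Rec (x%:C + s%:C * 'i) = x /\ Imc (x%:C + s%:C * 'i) = s by rewrite !RecE /=; split; ring.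
pose X (s : R) := H (x%:C + s%:C * 'i).
have cX : ccont X.
  apply: cder_cont => t.
  have [G' [K K1 [_ h]]] := holo_K (hH (`|x| + `|t| + 1)).
  exists ('i * G' (x%:C + t%:C * 'i)).
  apply: (holo_cder (le_trans ler01 K1) (@line_copen _ _) h).
  split; first by rewrite (ln t).1.
  by have := normc_le_ReIm (x%:C + t%:C * 'i); rewrite (ln t).1 (ln t).2; lra.
have iX : cinteg [set: mR] X.
  have [B hB] := bH 0.
  have B0 : 0 <= B.
    have := le_trans (normc_ge0 _) (hB (x%:C + 0%:C * 'i) _); rewrite (ln 0).1 (ln 0).2 mul0r oppr0 expR0 mulr1.
    by move=> /(_ zx); rewrite pmulr_lge0 // exprn_gt0 // cauchyw_gt0.
  apply: (@cauchyw_cinteg X B cX _).1 => s; have := hB (x%:C + s%:C * 'i).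
  rewrite (ln s).1 (ln s).2 mul0r oppr0 expR0 mulr1 => /(_ zx) /le_trans; apply.
  by rewrite ler_wpM2l // cauchyw_sqr.
have F0 y : FI X y = 0.
  (* One unit more than [y]: after compensating the growth of [cexp (z * y)] a factor
     [expR (- Rec z)] is left for the contour argument. *)
  have [B hB] := bH (y + 1).
  have hG (rho : R) : holo [set z : C | x1 < Rec z /\ normc z < rho] (fun z => H z * cexp (z * y%:C)).
    have bD : bddC [set z : C | x1 < Rec z /\ normc z < rho] by apply: (@bddC_ball _ rho) => w [_ /ltW].
    apply: famM => //; apply: (fam_comp (D2 := [set w : C | Rec w <= rho * `|y|]) bD).
    - by have [K hK] := hol_cexp (D := [set w : C | Rec w <= rho * `|y|]) (M := rho * `|y|) (fun w h => h);
        eexists; exists K; exact: hK.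
    - move=> _ w _ [_ wr] /=; rewrite Rec_mulR (le_trans (ler_norm _))// normrM ler_wpM2r //.
      by rewrite (le_trans (normr_Rec _)) // ltW.
    - by apply: famM => //; [exact: fam_id|apply: (@famC _ _ _ _ _ (normc y%:C))].
  have bG w : x1 < Rec w -> normc (H w * cexp (w * y%:C)) <= B * expR (- Rec w) * cauchyw (Imc w) ^+ 2.
    move=> wx; rewrite normcM normc_cexp Rec_mulR.
    rewrite (le_trans (ler_wpM2r (expR_ge0 _) (hB w wx)))// le_eqVlt; apply/orP; left; apply/eqP.
    have -> : - Rec w = - ((y + 1) * Rec w) + Rec w * y by ring.
    by rewrite expRD; ring.
  have := contour_zero hG bG zx.
  have -> : (fun s : R => H (x%:C + s%:C * 'i) * cexp ((x%:C + s%:C * 'i) * y%:C)) =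
    (fun s => cexp (x%:C * y%:C) * (X s * cexp ('i * s%:C * y%:C))).
    apply/funext => s; rewrite -/(X s).
    have -> : (x%:C + s%:C * 'i) * y%:C = x%:C * y%:C + 'i * s%:C * y%:C by ring.
    by rewrite cexpD; ring.
  rewrite (cintZ _ measurableT (FI_cinteg y iX)) => /eqP; rewrite mulf_eq0 => /orP[|/eqP //].
  by move=> /eqP h; have := normc_cexp (x%:C * y%:C); rewrite h normc0 => /esym/eqP; rewrite gt_eqF ?expR_gt0.
have lp (f : R -> R) (t : R) : continuous f -> lebesgue_pt f t.
  move=> cf; apply: (@continuous_lebesgue_pt _ f t setT) => //.
  - by split => //; exact: openT.
  - exact: continuous_measurable_fun.
  - exact: cf.
have := FI_eq0 (xi := Imc z) iX F0 (lp _ _ cX.1) (lp _ _ cX.2); rewrite /X.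
suff -> : x%:C + (Imc z)%:C * 'i = z by [].
by apply: complex_eq; [rewrite (ln _).1|rewrite (ln _).2].
Qed.

Lemma clog (c : C) : c != 0 -> exists w, cexp w = c.
Proof.
move=> c0; have n0 := normc_gt0 c0.
pose a := Rec c / normc c; pose b := Imc c / normc c.
have ab : a ^+ 2 + b ^+ 2 = 1.
  by rewrite /a /b !exprMn -mulrDl -sqr_normcE exprVn mulfV // expf_neq0 // gt_eqF.
have a1 : -1 <= a <= 1 by apply/andP; split; have := sqr_ge0 b; nra.
have sb : sin (acos a) = `|b| by rewrite sin_acos // -sqrtr_sqr -ab; congr Num.sqrt; ring.
pose th := if 0 <= b then acos a else - acos a.
have ct : cos th = a by rewrite /th; case: ifP => _; rewrite ?cosN acosK // in_itv.
have st : sin th = b.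
  rewrite /th; case: ifP => b0; rewrite ?sinN sb; first by rewrite ger0_norm.
  by rewrite ltr0_norm ?opprK // ltNge b0.
exists (ln (normc c) +i* th); apply: complex_eq; rewrite /cexp /= lnK ?posrE // ?ct ?st.
  by rewrite /a mulrC divfK // gt_eqF.
by rewrite /b mulrC divfK // gt_eqF.
Qed.

(** The identity theorem on a disc. The substitution [z = z0 + r exp (- v)] maps the half-plane
    [Re v > 0] onto the punctured disc and turns vanishing near [z0] into vanishing for large
    [Re v]. Decay faster than every exponential is then automatic and [halfplane_zero] applies; the
    factor [v^-4] supplies the decay in [Im v]. *)
Lemma disc_zero (f : C -> C) (z0 : C) (r0 r : R) : 0 < r0 ->
  holo [set z | normc (z - z0) < r] f -> (forall z, normc (z - z0) < r0 -> f z = 0) ->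
  forall z, normc (z - z0) < r -> f z = 0.
Proof.
move=> r00 hf f0 z zr.
have [zz0|zz0] := eqVneq z z0; first by apply: f0; rewrite zz0 subrr normc0.
have r_gt0 : 0 < r := le_lt_trans (normc_ge0 _) zr.
have rn0 : (r%:C : C) != 0 by apply: neq0_Rec.
have u0 : (z - z0) / r%:C != 0 by rewrite mulf_neq0 ?invr_eq0 // subr_eq0.
have [w0 hw0] := clog u0; pose w := - w0.
have hw : z0 + r%:C * cexp (- w) = z by rewrite opprK hw0 mulrCA mulfV // mulr1 addrC subrK.
have wpos : 0 < Rec w.
  have : normc (cexp w0) < 1 by rewrite hw0 normcM normcV normcR gtr0_norm // ltr_pdivrMr // mul1r.
  by rewrite normc_cexp -expR0 ltr_expR /w RecE oppr_gt0.
pose x1 := Rec w / 2; have x10 : 0 < x1 by rewrite divr_gt0.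
have inD v : 0 < Rec v -> normc (z0 + r%:C * cexp (- v) - z0) < r.
  move=> v0; rewrite addrC addrA addNr add0r normcM normcR gtr0_norm // normc_cexp RecE.
  by rewrite gtr_pMr // -expR0 ltr_expR oppr_lt0.
pose H v := f (z0 + r%:C * cexp (- v)) * v^-1 ^+ 4.
suff : H w = 0.
  rewrite /H hw => /eqP; rewrite mulf_eq0 expf_eq0 /= invr_eq0 => /orP[/eqP //|/eqP w00].
  by move: wpos; rewrite w00 ltxx.
have xw : x1 < Rec w by rewrite /x1; lra.
apply: (halfplane_zero (x1 := x1) _ _ xw).
  move=> rho; set D := [set _ | _].
  have bD : bddC D by apply: (@bddC_ball _ rho) => v [_ /ltW].
  apply: famM => //.
    apply: (fam_comp bD hf) => [_ v _ [vx _]|]; first by apply: inD; exact: lt_trans vx.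
    apply: famD => //; first by apply: (@famC _ _ _ _ _ (normc z0)).
    apply: famM => //; first by apply: (@famC _ _ _ _ _ (normc (r%:C))).
    apply: (fam_comp (D2 := [set v : C | Rec v <= 0]) bD).
    - by have [K hK] := hol_cexp (D := [set v : C | Rec v <= 0]) (M := 0) (fun w h => h);
        eexists; exists K; exact: hK.
    - by move=> _ v _ [vx _] /=; rewrite RecE oppr_le0 ltW // (lt_trans x10).
    - by apply: famN => //; exact: fam_id.
  apply: famX => //; apply: (famV bD x10) => [_ v _ [vx _]|]; last exact: fam_id.
  by rewrite (le_trans (ltW vx)) // (le_trans (ler_norm _)) // normr_Rec.
move=> Y; have [f' [K K1 [hK _]]] := holo_K hf; have K0 := le_trans ler01 K1.
(* For [Rec v > X2] the image point lies in the small disc, where [f] vanishes. For smaller [Rec v]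
   the constant [expR (|Y| |X2|)] compensates the exponential. *)
pose X2 := ln (r / r0); pose c := Num.min x1 1.
have c0 : 0 < c by rewrite lt_min x10 ltr01.
have c1 : c <= 1 by rewrite ge_min lexx orbT.
have cx1 : c <= x1 by rewrite ge_min lexx.
have c40 : 0 <= c^-1 ^+ 4 by rewrite exprn_ge0 // invr_ge0 ltW.
exists (K * c^-1 ^+ 4 * expR (`|Y| * `|X2|)) => v vx.
have cw := ltW (cauchyw_gt0 (Imc v)).
have v0 : 0 < Rec v by exact: lt_trans vx.
have [vX|vX] := ltP X2 (Rec v).
  rewrite /H f0 ?mul0r ?normc0.
    by rewrite (mulr_ge0 _ (sqr_ge0 _)) // mulr_ge0 ?expR_ge0 // mulr_ge0 ?expR_ge0 // mulr_ge0.
  rewrite addrC addrA addNr add0r normcM normcR gtr0_norm // normc_cexp RecE expRN ltr_pdivrMr ?expR_gt0 //.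
  rewrite mulrC -ltr_pdivrMr // -[ltLHS](@lnK _ (r / r0)) ?posrE ?divr_gt0 //.
  by rewrite ltr_expR.
have e1 : 1 <= expR (`|Y| * `|X2|) * expR (- (Y * Rec v)).
  rewrite -expRD -expR0 ler_expR subr_ge0 (le_trans (ler_norm _))// normrM ler_wpM2l //.
  by rewrite gtr0_norm // (le_trans vX) // ler_norm.
have nv : 0 < normc v by apply: normc_gt0; exact: neq0_Rec.
have n1 : normc (v^-1 ^+ 4) <= c^-1 ^+ 4 * cauchyw (Imc v) ^+ 2.
  have h : normc v^-1 ^+ 2 <= c^-1 ^+ 2 * cauchyw (Imc v).
    rewrite normcV !exprVn -invfM lef_pV2 ?posrE ?mulr_gt0 ?exprn_gt0 ?ltr_pwDl ?sqr_ge0 //.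
    have h1 : c ^+ 2 <= Rec v ^+ 2 by rewrite lerXn2r ?nnegrE ?(ltW c0) ?(ltW v0) //; lra.
    have h2 : c ^+ 2 * Imc v ^+ 2 <= 1 * Imc v ^+ 2.
      by rewrite ler_wpM2r ?sqr_ge0 // exprn_ile1 // ltW.
    by rewrite sqr_normcE mulrDr mulr1; lra.
  rewrite normcX (_ : 4%N = (2 * 2)%N) // exprM (le_trans (lerXn2r 2 _ _ h)) ?nnegrE ?sqr_ge0 //.
    by rewrite mulr_ge0 ?sqr_ge0 // ltW // cauchyw_gt0.
  by rewrite exprMn -exprM.
rewrite /H normcM.
have a1 := (hK _ (inD v v0)).1.
have k0 : 0 <= K * (c^-1 ^+ 4 * cauchyw (Imc v) ^+ 2).
  by rewrite mulr_ge0 // mulr_ge0 // sqr_ge0.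
rewrite (le_trans (ler_pM (normc_ge0 _) (normc_ge0 _) a1 n1))//.
rewrite -[leLHS]mulr1 (le_trans (ler_wpM2l k0 e1))// le_eqVlt; apply/orP; left; apply/eqP; ring.
Qed.

(** Discs of radius [r] about equidistant points of the segment. Consecutive centres have distance
    [d < r], so each disc contains the disc of radius [r - d] about the next centre. *)
Lemma chain_zero (D : set C) (f : C -> C) (a b : C) (r0 r : R) : 0 < r0 -> 0 < r -> holo D f ->
  (forall s z, 0 <= s <= 1 -> normc (z - (a + s%:C * (b - a))) < r -> D z) ->
  (forall z, normc (z - a) < r0 -> f z = 0) -> forall z, normc (z - b) < r -> f z = 0.
Proof.
move=> r00 r_gt0 hf hD f0.
have [n hn] : exists n : nat, normc (b - a) < n.+1%:R * r.
  exists (Num.truncn (normc (b - a) / r)); rewrite -ltr_pdivrMr //.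
  exact: truncnS_gt.
pose p j := a + (j%:R / n.+1%:R)%:C * (b - a).
have hs j : (j <= n.+1)%N -> 0 <= (j%:R / n.+1%:R : R) <= 1.
  by move=> jn; rewrite divr_ge0 //= ler_pdivrMr ?ltr0n // mul1r ler_nat.
have hp j : (j <= n.+1)%N -> holo [set z | normc (z - p j) < r] f.
  move=> /hs jn; apply: (fam_sub (g := id) _ _ hf) => // z; exact: hD.
suff key j : (j <= n.+1)%N -> forall z, normc (z - p j) < r -> f z = 0.
  move=> z zb; apply: (key n.+1) => //; rewrite /p divff ?pnatr_eq0 //.
  by rewrite mul1r addrCA subrr addr0.
elim: j => [|j IH] jn.
  apply: (disc_zero r00 (hp 0%N jn)) => z; rewrite /p mul0r mul0r addr0; exact: f0.
pose d := normc (b - a) / n.+1%:R.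
have dr : d < r by rewrite ltr_pdivrMr ?ltr0n // mulrC.
apply: (disc_zero (r0 := r - d) _ (hp _ jn)); first by rewrite subr_gt0.
move=> z zd; apply: (IH (ltnW jn)).
have -> : z - p j = (z - p j.+1) + n.+1%:R^-1%:C * (b - a).
  have nj : (j.+1%:R / n.+1%:R : R) = j%:R / n.+1%:R + n.+1%:R^-1 by rewrite -(natr1 j) mulrDl mul1r.
  by rewrite /p nj rmorphD /=; ring.
have := ler_normcD (z - p j.+1) (n.+1%:R^-1%:C * (b - a)).
have -> : normc (n.+1%:R^-1%:C * (b - a)) = d.
  by rewrite normcM normcR ger0_norm ?invr_ge0 // mulrC.
by move: zd; lra.
Qed.
End HalfPlane.

(** * The mode system under the Laplace transform *)

Section Parametric.
Variable R : realType.
Notation C := R[i].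
Notation mu := (@lebesgue_measure R).
Notation mR := (measurableTypeR R).

(** Compactness of the segment makes continuity at [p] uniform in [y]; continuity and
    differentiability of parameter integrals both rest on it. *)
Lemma near_unif (T : topologicalType) (f : T * R -> R) (p : T) (a b e : R) : continuous f -> 0 < e ->
  \forall p' \near p, forall y, a <= y <= b -> `|f (p', y) - f (p, y)| <= e.
Proof.
move=> cf e0.
have /compact_near_coveringP hc := @segment_compact R a b.
have h := @hc _ (nbhs p) (fun p' y => `|f (p', y) - f (p, y)| <= e) (nbhs_filter p).
apply: filterS (h _) => [p' hp y yab|y _]; first by apply: hp; rewrite /= in_itv.
have e2 : 0 < e / 2 by rewrite divr_gt0.
have /cvgrPdist_le/(_ _ e2) c1 := cf (p, y).
have [[A B] /= [nA nB] hAB] := c1.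
exists (B, A) => //= -[y' p'] /= [By Ap].
have h1 : `|f (p, y) - f (p', y')| <= e / 2 by apply: (hAB (p', y')).
have h2 : `|f (p, y) - f (p, y')| <= e / 2 by apply: (hAB (p, y')); split => //=; exact: nbhs_singleton.
rewrite (_ : f (p', y') - f (p, y') = (f (p, y) - f (p, y')) - (f (p, y) - f (p', y'))); last by ring.
by rewrite (le_trans (ler_normB _ _)) //; lra.
Qed.

Lemma continuous_pair (T : topologicalType) (f : T * R -> R) (p : T) : continuous f -> continuous (fun y => f (p, y)).
Proof.
move=> cf y; apply: (@continuous_comp _ _ _ (fun y => (p, y)) f); last exact: cf.
exact: (cvg_pair (cvg_cst p) cvg_id).
Qed.

Lemma Rint_dist_le (f g : R -> R) (a b e : R) : a <= b -> continuous f -> continuous g ->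
  (forall y, a <= y <= b -> `|f y - g y| <= e) ->
  `|\int[mu]_(y in `[a, b]) f y - \int[mu]_(y in `[a, b]) g y| <= e * (b - a).
Proof.
move=> ab cf cg h; rewrite -Rint_cst // -RintegralB //; [|exact: cont_integrable..].
apply: Rint_abs_le => //.
- by apply: (@cont_integrable _ (fun y => f y - g y)) => y; apply: cvgB; [exact: cf|exact: cg].
- by apply: (@cont_integrable _ (fun=> e)); exact: cst_continuous.
Qed.

Lemma Rint_param_cont (T : topologicalType) (f : T * R -> R) (a b : R) : a <= b -> continuous f ->
  continuous (fun p => \int[mu]_(y in `[a, b]) f (p, y)).
Proof.
move=> ab cf p; apply/cvgrPdist_le => e e0.
have e1 : 0 < e / (b - a + 1) by rewrite divr_gt0 //; lra.
apply: filterS (near_unif p a b cf e1) => p' hp.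
rewrite distrC (le_trans (Rint_dist_le ab (continuous_pair (p := p') cf) (continuous_pair (p := p) cf) hp))//.
rewrite mulrAC ler_pdivrMr; last by lra.
by rewrite ler_wpM2l ?ltW //; lra.
Qed.

(** Differentiability in the parameter is asked only near [t], because the evolution equations hold
    for nonnegative times only. *)
Lemma Rint_param_derive (f f' : R * R -> R) (a b t r : R) : a <= b -> 0 < r ->
  continuous f -> continuous f' ->
  (forall s y, `|s - t| < r -> a <= y <= b -> is_derive s (1:R) (fun s => f (s, y)) (f' (s, y))) ->
  is_derive t (1:R) (fun t => \int[mu]_(y in `[a, b]) f (t, y)) (\int[mu]_(y in `[a, b]) f' (t, y)).
Proof.
move=> ab r0 cf cf' df; set F := fun t => _; set L := Rintegral _ _ _.
have cv : (fun h => h^-1 *: ((F \o shift t) (h *: (1:R)) - F t)) @ 0^' --> L.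
  apply/cvgrPdist_le => e e0.
  have e1 : 0 < e / (b - a + 1) by rewrite divr_gt0 //; lra.
  have /nbhs_ballP[d /= d0 hd] := near_unif t a b cf' e1.
  near=> h.
  have h0 : h != 0 by near: h; exact: nbhs_dnbhs_neq.
  have hd' : `|h| < Num.min d r by near: h; apply: dnbhs0_lt; rewrite lt_min d0.
  move: hd'; rewrite lt_min => /andP[hd1 hd2].
  have e2 : (F \o shift t) (h *: (1:R)) = F (t + h) by rewrite /= /GRing.scale /= mulr1 addrC.
  have hp : 0 < `|h| by rewrite normr_gt0.
  have key y : a <= y <= b -> `|(f (t + h, y) - h * f' (t, y)) - f (t, y)| <= e / (b - a + 1) * `|h|.
    move=> yab.
    have D s : `|s - t| < r -> is_derive s (1:R) (fun s => f (s, y) - (s - t) * f' (t, y)) (f' (s, y) - f' (t, y)).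
      move=> /df/(_ yab) ds; apply: is_derive_eq'; rewrite /GRing.scale /=; ring.
    have sd s : `|s - t| <= `|h| -> `|f' (s, y) - f' (t, y)| <= e / (b - a + 1).
      move=> sh; apply: (hd s) => //; rewrite /ball /= distrC; exact: le_lt_trans sh hd1.
    have W u v : (forall s, u <= s <= v -> `|s - t| <= `|h|) -> {within `[u, v], continuous (fun s => f (s, y) - (s - t) * f' (t, y))}.
      move=> uv; apply: derivable_within_continuous => s; rewrite in_itv /= => /uv sh.
      have ds := D s (le_lt_trans sh hd2); exact: ex_derive.
    have [hpos|hneg] := leP 0 h.
      have B s : t <= s <= t + h -> `|s - t| <= `|h|.
        by move=> /andP[? ?]; rewrite (ger0_norm hpos) ger0_norm; lra.
      have tt : t <= t + h by lra.
      have := @mvt_bound _ (fun s => f (s, y) - (s - t) * f' (t, y)) (fun s => f' (s, y) - f' (t, y)) t (t + h) (e / (b - a + 1)) tt (W _ _ B).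
      rewrite subrr mul0r subr0 [t + h - t]addrAC subrr add0r (ger0_norm hpos); apply.
      - by move=> s /andP[/ltW s1 /ltW s2]; apply: D; rewrite (le_lt_trans _ hd2) // B // s1.
      - by move=> s /andP[/ltW s1 /ltW s2]; apply: sd; rewrite B // s1.
    have B s : t + h <= s <= t -> `|s - t| <= `|h|.
      by move=> /andP[? ?]; rewrite (ltr0_norm hneg) ler0_norm; lra.
    have tt : t + h <= t by lra.
    have := @mvt_bound _ (fun s => f (s, y) - (s - t) * f' (t, y)) (fun s => f' (s, y) - f' (t, y)) (t + h) t (e / (b - a + 1)) tt (W _ _ B).
    rewrite subrr mul0r subr0 [t + h - t]addrAC subrr add0r distrC (ltr0_norm hneg).
    rewrite (_ : t - (t + h) = - h); last by ring.
    apply.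
    - by move=> s /andP[/ltW s1 /ltW s2]; apply: D; rewrite (le_lt_trans _ hd2) // B // s1.
    - by move=> s /andP[/ltW s1 /ltW s2]; apply: sd; rewrite B // s1.
  have c1 : continuous (fun y => f (t + h, y) - h * f' (t, y)).
    move=> y; apply: cvgB; first exact: continuous_pair.
    by apply: cvgM; [exact: cvg_cst|exact: continuous_pair].
  have := Rint_dist_le ab c1 (continuous_pair (p := t) cf) key.
  rewrite RintegralB //; last 2 first.
  - by apply: (@cont_integrable _ (fun y => f (t + h, y))); exact: continuous_pair.
  - by apply: (@cont_integrable _ (fun y => h * f' (t, y))) => y; apply: cvgM; [exact: cvg_cst|exact: continuous_pair].
  rewrite RintegralZl //; last by apply: (@cont_integrable _ (fun y => f' (t, y))); exact: continuous_pair.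
  move=> H; have {}H : `|F (t + h) - h * L - F t| <= e / (b - a + 1) * `|h| * (b - a) := H.
  rewrite -[F (_ + t)]/((F \o shift t) (h *: (1:R))) e2.
  have -> : L - h^-1 *: (F (t + h) - F t) = - (F (t + h) - h * L - F t) / h.
    by rewrite /GRing.scale /=; field.
  rewrite normrM normrN normfV ler_pdivrMr // (le_trans H)//.
  rewrite mulrAC ler_wpM2r // mulrAC ler_pdivrMr; last by lra.
  by rewrite ler_wpM2l ?ltW //; lra.
apply: DeriveDef; first by apply/cvg_ex; exists L.
exact: cvg_lim.
Unshelve. all: by end_near. Qed.

Definition jcont (g : R -> R -> C) := ccont (fun p : R * R => g p.1 p.2).

Lemma cint_param_cont (T : topologicalType) (f : T -> R -> C) (a b : R) : a <= b ->
  ccont (fun q : T * R => f q.1 q.2) -> ccont (fun p => cint `[a, b] (f p)).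
Proof. by move=> ab [c1 c2]; split; [exact: (Rint_param_cont ab c1)|exact: (Rint_param_cont ab c2)]. Qed.

Lemma cint_param_der (f f' : R -> R -> C) (a b t r : R) : a <= b -> 0 < r ->
  jcont f -> jcont f' ->
  (forall s y, `|s - t| < r -> a <= y <= b -> cder (fun s => f s y) s (f' s y)) ->
  cder (fun t => cint `[a, b] (f t)) t (cint `[a, b] (f' t)).
Proof.
move=> ab r0 [c1 c2] [c1' c2'] df; split.
  by apply: (Rint_param_derive ab r0 c1 c1') => s y sr yab; exact: (df s y sr yab).1.
by apply: (Rint_param_derive ab r0 c2 c2') => s y sr yab; exact: (df s y sr yab).2.
Qed.

Lemma rect_bound (f : R -> R -> C) (a b c d : R) : jcont f ->
  exists B, forall t y, a <= t <= b -> c <= y <= d -> normc (f t y) <= B.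
Proof.
move=> cf.
have cn := ccont_normc cf.
have K : compact (`[a, b] `*` `[c, d])%classic by apply: compact_setX; exact: segment_compact.
have := continuous_compact (continuous_subspaceT cn) K.
move=> /compact_bounded[M [_ hM]]; exists (M + 1) => t y tab ycd.
have := hM (M + 1) _ (normc (f t y)); rewrite ltrDl ltr01 => /(_ isT) h.
by rewrite (le_trans (ler_norm _)) // h //; exists (t, y) => //=; rewrite !in_itv.
Qed.

Lemma cder_near (f g : R -> C) t l r : 0 < r -> (forall s, `|s - t| < r -> f s = g s) ->
  cder f t l -> cder g t l.
Proof.
move=> r0 fg [d1 d2].
have n : \forall s \near t, f s = g s.
  by apply/nbhs_ballP; exists r => //= s; rewrite /ball /= distrC; exact: fg.
by split; [move: d1|move: d2]; apply: near_eq_is_derive; apply: filterS n => s ->.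
Qed.
End Parametric.

(** * Truncated Laplace transforms and the system of one mode *)

Section Modes.
Variable R : realType.
Notation C := R[i].
Notation mu := (@lebesgue_measure R).
Notation mR := (measurableTypeR R).

Definition lap_trunc (Y : R) (z : C) (g : R -> C) := cint `[0, Y] (fun y => cexp (- (z * y%:C)) * g y).

(* [Y]-boundary term at [y] of the truncated Laplace transform of a derivative *)
Definition lbd (Y : R) (z : C) (g : R -> C) := cexp (- (z * Y%:C)) * g Y - g 0.

(** Integration by parts for the twisted derivative [g1 = g' - kap g], whose symbol is [z - kap]. *)
Lemma lap_trunc_der (Y : R) (z kap : C) (g g1 : R -> C) : 0 <= Y -> ccont g -> ccont g1 ->
  (forall y, cder g y (g1 y + kap * g y)) ->
  lap_trunc Y z g1 = (z - kap) * lap_trunc Y z g + lbd Y z g.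
Proof.
move=> Y0 cg cg1 dg.
have h (y : R) : cder (fun y => cexp (- (z * y%:C))) y (- z * cexp (- (z * y%:C))).
  by apply: cder_cexp; apply: (cder_eq (cderN (cderZ z (cder_id y)))); rewrite mulr1.
have d (y : R) : cder (fun y => cexp (- (z * y%:C)) * g y) y
    (cexp (- (z * y%:C)) * g1 y - (z - kap) * (cexp (- (z * y%:C)) * g y)).
  by apply: (cder_eq (cderM (h y) (dg y))); ring.
have c1 := ccontM (ccont_expmul z) cg1; have c0 := ccontM (ccont_expmul z) cg.
have m : measurable (`[0, Y]%classic : set mR) by exact: measurable_itv.
have cc : ccont (fun y : R => cexp (- (z * y%:C)) * g1 y - (z - kap) * (cexp (- (z * y%:C)) * g y)).
  by apply: ccontB => //; apply: ccontM => //; exact: ccont_cst.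
have := cint_FTC Y0 cc d; rewrite mulr0 oppr0 cexp0 mul1r -/(lbd Y z g) => <-.
rewrite (cintB m (ccont_cinteg 0 Y c1) (cintegZ _ m (ccont_cinteg 0 Y c0))) (cintZ _ m (ccont_cinteg 0 Y c0)).
by rewrite addrC subrK.
Qed.

Lemma lap_truncB Y z f g : ccont f -> ccont g -> lap_trunc Y z (fun y => f y - g y) = lap_trunc Y z f - lap_trunc Y z g.
Proof.
move=> cf cg; have c1 := ccontM (ccont_expmul z) cf; have c0 := ccontM (ccont_expmul z) cg.
have m : measurable (`[0, Y]%classic : set mR) by exact: measurable_itv.
rewrite /lap_trunc -(cintB m (ccont_cinteg 0 Y c1) (ccont_cinteg 0 Y c0)).
by apply: eq_cint => y _; rewrite mulrBr.
Qed.
Lemma lap_truncZ Y z c f : ccont f -> lap_trunc Y z (fun y => c * f y) = c * lap_trunc Y z f.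
Proof.
move=> cf; have c1 := ccontM (ccont_expmul z) cf.
have m : measurable (`[0, Y]%classic : set mR) by exact: measurable_itv.
rewrite /lap_trunc -(cintZ _ m (ccont_cinteg 0 Y c1)).
by apply: eq_cint => y _; rewrite mulrCA.
Qed.
Lemma lap_truncD Y z f g : ccont f -> ccont g -> lap_trunc Y z (fun y => f y + g y) = lap_trunc Y z f + lap_trunc Y z g.
Proof.
move=> cf cg; have -> : (fun y => f y + g y) = (fun y => f y - (- 1) * g y).
  by apply/funext => y; rewrite mulN1r opprK.
rewrite lap_truncB // ?lap_truncZ //; first by rewrite mulN1r opprK.
by apply: ccontM => //; exact: ccont_cst.
Qed.
Lemma eq_lap_trunc Y z f g : (forall y, f y = g y) -> lap_trunc Y z f = lap_trunc Y z g.
Proof. by move=> fg; congr lap_trunc; exact/funext. Qed.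

Lemma jcont_y (g : R -> R -> C) t : jcont g -> ccont (g t).
Proof. by move=> [c1 c2]; split; [exact: (continuous_pair (p := t) c1)|exact: (continuous_pair (p := t) c2)]. Qed.
Lemma jcont_t (g : R -> R -> C) y : jcont g -> ccont (g ^~ y).
Proof.
move=> cg; apply: (@ccont_comp _ _ _ (fun p : R * R => g p.1 p.2) (fun t : R => (t, y))) => //.
by move=> t; exact: (cvg_pair cvg_id (cvg_cst y)).
Qed.

Lemma lap_trunc_jcont Y z (g : R -> R -> C) : 0 <= Y -> jcont g -> ccont (fun t => lap_trunc Y z (g t)).
Proof.
move=> Y0 cg; apply: cint_param_cont => //; apply: ccontM => //.
apply: (@ccont_comp _ _ _ (fun y : R => cexp (- (z * y%:C))) (fun q : R * R => q.2)).
  exact: ccont_expmul.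
by move=> q; exact: cvg_snd.
Qed.

Lemma lap_trunc_cder Y z (g g' : R -> R -> C) t : 0 <= Y -> 0 < t -> jcont g -> jcont g' ->
  (forall s y, 0 <= s -> cder (g ^~ y) s (g' s y)) ->
  cder (fun t => lap_trunc Y z (g t)) t (lap_trunc Y z (g' t)).
Proof.
move=> Y0 t0 cg cg' dg.
have ce : jcont (fun _ y : R => cexp (- (z * y%:C))).
  apply: (@ccont_comp _ _ _ (fun y : R => cexp (- (z * y%:C))) (fun q : R * R => q.2)).
    exact: ccont_expmul.
  by move=> q; exact: cvg_snd.
apply: (@cint_param_der _ (fun s y => cexp (- (z * y%:C)) * g s y) (fun s y => cexp (- (z * y%:C)) * g' s y) 0 Y t t) => //.
- exact: ccontM.
- exact: ccontM.
- move=> s y st _; apply: cderZ; apply: dg.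
  by move: st; rewrite ltr_norml => /andP[]; lra.
Qed.

(** The trailing digits count applications of the sheared derivative [d/dy - i k t]. The field
    [ms_el] is the elliptic equation [Delta u^y = d_y div u + d_x curl u] with curl u replaced by
    [F - N], where [F] does not depend on time. In [ms_Pt] the Poisson equation is already
    substituted, with [c = 4 pi e^2]. *)
Record mode_sys (k m c : R) (N P V N1 N2 P1 V1 V2 : R -> R -> C) (F : R -> C) : Prop := ModeSys {
  ms_N : jcont N; ms_P : jcont P; ms_V : jcont V; ms_N1 : jcont N1; ms_N2 : jcont N2;
  ms_P1 : jcont P1; ms_V1 : jcont V1; ms_V2 : jcont V2; ms_F : ccont F;
  ms_Nt : forall t y, 0 <= t -> cder (N ^~ y) t (- P t y);
  ms_Pt : forall t y, 0 <= t -> cder (P ^~ y) t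
     (- (2 * k)%:C * 'i * V t y - m^-1%:C * (N2 t y - (k ^+ 2)%:C * N t y) + (c / m)%:C * N t y);
  ms_Ny : forall t y, cder (N t) y (N1 t y + (k * t)%:C * 'i * N t y);
  ms_N1y : forall t y, cder (N1 t) y (N2 t y + (k * t)%:C * 'i * N1 t y);
  ms_Py : forall t y, cder (P t) y (P1 t y + (k * t)%:C * 'i * P t y);
  ms_Vy : forall t y, cder (V t) y (V1 t y + (k * t)%:C * 'i * V t y);
  ms_V1y : forall t y, cder (V1 t) y (V2 t y + (k * t)%:C * 'i * V1 t y);
  ms_el : forall t y, 0 <= t ->
     V2 t y - (k ^+ 2)%:C * V t y = P1 t y + k%:C * 'i * (F y - N t y) }.

(** Under [y -> - y] the frequency [k] and the vertical component [V] change sign, and each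
    [y]-derivative contributes one more sign. The left half-line is thereby reduced to the right
    one. *)
Lemma mode_sys_refl k m c N P V N1 N2 P1 V1 V2 F : mode_sys k m c N P V N1 N2 P1 V1 V2 F ->
  mode_sys (- k) m c (fun t y => N t (- y)) (fun t y => P t (- y)) (fun t y => - V t (- y))
    (fun t y => - N1 t (- y)) (fun t y => N2 t (- y)) (fun t y => - P1 t (- y))
    (fun t y => V1 t (- y)) (fun t y => - V2 t (- y)) (fun y => F (- y)).
Proof.
move=> [cN cP cV cN1 cN2 cP1 cV1 cV2 cF Nt Pt Ny N1y Py Vy V1y el].
have cr (g : R -> R -> C) : jcont g -> jcont (fun t y => g t (- y)).
  move=> cg; apply: (@ccont_comp _ _ _ (fun p : R * R => g p.1 p.2) (fun q : R * R => (q.1, - q.2))) => //.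
  by move=> q; exact: (cvg_pair cvg_fst (cvgN cvg_snd)).
have dr (f : R -> C) y l : cder f (- y) l -> cder (fun y => f (- y)) y (- l).
  have dn : is_derive y (1:R) (fun y : R => - y) (- 1) by apply: is_derive_eq'; rewrite ?subr0.
  move=> [d1 d2]; split.
    by apply: (is_derive_eq' (is_derive1_comp d1 dn)); rewrite RecE mulrN1.
  by apply: (is_derive_eq' (is_derive1_comp d2 dn)); rewrite RecE mulrN1.
have ka t : (- k * t)%:C = - (k * t)%:C :> C by rewrite mulNr rmorphN.
split; try (by exact: cr); try (by apply: ccontN; exact: cr).
- by apply: (@ccont_comp _ _ _ F (fun y : R => - y)) => // y; apply: cvgN; exact: cvg_id.
- by move=> t y /Nt.
- move=> t y t0; apply: (cder_eq (Pt t (- y) t0)).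
  have e : (2 * - k)%:C = - (2 * k)%:C :> C by rewrite mulrN rmorphN.
  by rewrite sqrrN e; ring.
- by move=> t y; apply: (cder_eq (dr _ _ _ (Ny t (- y)))); rewrite ka; ring.
- by move=> t y; apply: (cder_eq (cderN (dr _ _ _ (N1y t (- y))))); rewrite ka; ring.
- by move=> t y; apply: (cder_eq (dr _ _ _ (Py t (- y)))); rewrite ka; ring.
- by move=> t y; apply: (cder_eq (cderN (dr _ _ _ (Vy t (- y))))); rewrite ka; ring.
- by move=> t y; apply: (cder_eq (dr _ _ _ (V1y t (- y)))); rewrite ka; ring.
- move=> t y t0; have := el t (- y) t0; rewrite sqrrN rmorphN => e.
  have -> : - V2 t (- y) - (k ^+ 2)%:C * - V t (- y) = - (V2 t (- y) - (k ^+ 2)%:C * V t (- y)) by ring.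
  by rewrite e; ring.
Qed.
End Modes.

(** * The adjoint system at complex frequency *)

Section Adjoint.
Variable R : realType.
Notation C := R[i].
Notation mu := (@lebesgue_measure R).
Notation mR := (measurableTypeR R).
Variables (k m c T : R).
Hypotheses (m0 : 0 < m) (c0 : 0 <= c) (T0 : 0 <= T).

(** Symbols under the Laplace transform: [dl] of the sheared derivative, [al] of minus the sheared
    Laplacian. At [z = i xi] the latter is alpha; its zeros satisfy [dl = k] or [dl = - k], the
    exponents of harmonic functions. *)
Definition dl (z : C) (t : R) : C := z - (k * t)%:C * 'i.
Definition al (z : C) (t : R) : C := (k ^+ 2)%:C - dl z t ^+ 2.
Definition nonchar (z : C) := forall t, 0 <= t <= T -> al z t != 0.

Lemma ccont_bound (f : R -> C) (a b : R) : ccont f -> exists B : R, forall t, a <= t <= b -> normc (f t) <= B.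
Proof.
move=> cf; have cj : jcont (fun t _ : R => f t).
  by apply: (@ccont_comp _ _ _ f (fun p : R * R => p.1)) => // p; exact: cvg_fst.
by have [B hB] := rect_bound a b 0 0 cj; exists B => t tab; apply: (hB t 0) => //; rewrite lexx.
Qed.

Lemma ccont_dl z : ccont (dl z).
Proof.
apply: ccontB; first exact: ccont_cst.
apply: ccontM; last exact: ccont_cst.
by apply: ccontR => t; apply: cvgM; [exact: cvg_cst|exact: cvg_id].
Qed.
Lemma ccont_al z : ccont (al z).
Proof. by apply: ccontB; [exact: ccont_cst|rewrite /al; under eq_fun do rewrite expr2; apply: ccontM; exact: ccont_dl]. Qed.

Lemma cder_dl z t : cder (dl z) t (- (k%:C * 'i)).
Proof.
have h : is_derive t (1:R) (fun t : R => k * t) k by apply: is_derive_eq'; rewrite /GRing.scale /=; ring.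
by apply: (cder_eq (cderB (cder_cst z t) (cderM (cder_R h) (cder_cst 'i t)))); rewrite mulr0 addr0 sub0r.
Qed.
Lemma cder_al z t : cder (al z) t (2 * k%:C * 'i * dl z t).
Proof.
have h := cderB (cder_cst (k ^+ 2)%:C t) (cderM (cder_dl z t) (cder_dl z t)).
by apply: (cder_eq h); ring.
Qed.

Section Fam.
Variable D : set C.
Hypothesis bD : bddC D.

Lemma fam_ccont (f : R -> C) : ccont f -> hol_family `[0, T] D (fun t _ => f t).
Proof.
move=> cf; have [B hB] := ccont_bound 0 T cf.
by apply: (@famC _ _ _ _ _ B) => t /=; rewrite in_itv /=; exact: hB.
Qed.
Lemma fam_dl : hol_family `[0, T] D (fun t z => dl z t).
Proof.
apply: famB; first exact: fam_id.
apply: (@fam_ccont (fun t => (k * t)%:C * 'i)); apply: ccontM; last exact: ccont_cst.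
by apply: ccontR => t; apply: cvgM; [exact: cvg_cst|exact: cvg_id].
Qed.
Lemma fam_al : hol_family `[0, T] D (fun t z => al z t).
Proof.
apply: famB; first by apply: fam_ccont; exact: ccont_cst.
by apply: famX => //; exact: fam_dl.
Qed.
Lemma fam_alV (kap : R) : 0 < kap -> (forall z t, D z -> 0 <= t <= T -> kap <= normc (al z t)) ->
  hol_family `[0, T] D (fun t z => (al z t)^-1).
Proof.
move=> k0 h; apply: (famV bD k0) fam_al => t z /=; rewrite in_itv /= => t0 Dz; exact: h.
Qed.
End Fam.

Variables (N P V N1 V1 : R -> R -> C).
Hypotheses (cN : jcont N) (cP : jcont P) (cV : jcont V) (cN1 : jcont N1) (cV1 : jcont V1).

(** The boundary term at [y] left in the transformed equation for [P] once the transform of [V] has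
    been eliminated. *)
Definition Gb (z : C) (y t : R) : C := - m^-1%:C * (dl z t * N t y + N1 t y) +
  (2 * k)%:C * 'i / al z t * (P t y - dl z t * V t y - V1 t y).

Definition cf10 (z : C) (t : R) : C := (2 * k ^+ 2)%:C * (al z t)^-1 ^+ 2 + m^-1%:C + (c / m)%:C / al z t.

(** Unknowns in this order: [a], [b], [J1], [J2]. The first, divided by [al], is tested against the
    transform of [P], the second against minus that of [N]; [J1] accumulates the source [F] and [J2]
    the boundary term at [y = 0]. Putting all four into one system gives their holomorphy in one
    application of [ode_hol]. *)
Definition adjA (i j : 'I_4) (t : R) (z : C) : C :=
  match val i, val j with
  | 0%N, 1%N => - al z t
  | 1%N, 0%N => cf10 z t
  | 2%N, 0%N => (al z t)^-1 ^+ 2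
  | 3%N, 0%N => Gb z 0 t / al z t
  | _, _ => 0
  end.

Lemma fam_Gb (D : set C) (kap : R) (y : R) : bddC D -> 0 < kap ->
  (forall z t, D z -> 0 <= t <= T -> kap <= normc (al z t)) ->
  hol_family `[0, T] D (fun t z => Gb z y t).
Proof.
move=> bD k0 h; have VV := fam_alV bD k0 h; have d := fam_dl bD.
have cc g : jcont g -> hol_family `[0, T] D (fun t _ => g t y).
  by move=> cg; apply: fam_ccont => //; exact: jcont_t.
have cst (w : C) : hol_family `[0, T] D (fun t _ => w) by apply: fam_ccont => //; exact: ccont_cst.
exact: (famD (famM bD (cst _) (famD (famM bD d (cc _ cN)) (cc _ cN1)))
  (famM bD (famM bD (cst _) VV) (famB (famB (cc _ cP) (famM bD d (cc _ cV))) (cc _ cV1)))).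
Qed.

Lemma fam_adjA (D : set C) (kap : R) i j : bddC D -> 0 < kap ->
  (forall z t, D z -> 0 <= t <= T -> kap <= normc (al z t)) ->
  hol_family `[0, T] D (adjA i j).
Proof.
move=> bD k0 h; have VV := fam_alV bD k0 h; have d := fam_dl bD.
have cst (w : C) : hol_family `[0, T] D (fun t _ => w) by apply: fam_ccont => //; exact: ccont_cst.
rewrite /adjA; case: i => -[|[|[|[|//]]]] /= _; case: j => -[|[|[|[|//]]]] /= _;
  try match goal with |- hol_family _ _ (fun _ _ => 0) => exact: cst end.
- by apply: famN; exact: fam_al.
- exact: (famD (famD (famM bD (cst _) (famX bD 2 VV)) (cst _)) (famM bD (cst _) VV)).
- exact: famX.
- by apply: famM => //; exact: (fam_Gb 0 bD k0 h).
Qed.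

Lemma nonchar_clamp z t : nonchar z -> al z (clamp 0 T t) != 0.
Proof. by apply; exact: clamp_itv. Qed.

Lemma ccont_clampf (f : R -> C) : ccont f -> ccont (fun t => f (clamp 0 T t)).
Proof. by move=> cf; apply: (@ccont_comp _ _ _ f (clamp 0 T)) => //; exact: continuous_clamp. Qed.

Lemma ccont_alV z : nonchar z -> ccont (fun t => (al z (clamp 0 T t))^-1).
Proof.
move=> hz; apply: ccont_inv; first by move=> t; exact: nonchar_clamp.
exact: ccont_clampf (ccont_al z).
Qed.

Lemma ccont_Gb z y : nonchar z -> ccont (fun t => Gb z y (clamp 0 T t)).
Proof.
move=> hz; have cd := ccont_clampf (ccont_dl z); have ca := ccont_alV hz.
have cj g : jcont g -> ccont (fun t => g (clamp 0 T t) y).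
  by move=> cg; apply: (ccont_clampf (f := g ^~ y)); exact: jcont_t.
exact: (ccontD (ccontM (ccont_cst _ _) (ccontD (ccontM cd (cj _ cN)) (cj _ cN1)))
  (ccontM (ccontM (ccont_cst _ _) ca) (ccontB (ccontB (cj _ cP) (ccontM cd (cj _ cV))) (cj _ cV1)))).
Qed.

Lemma ccont_adjA z i j : nonchar z -> ccont (fun t => adjA i j (clamp 0 T t) z).
Proof.
move=> hz; have ca := ccont_alV hz; have c2 := ccontM ca ca.
rewrite /adjA; case: i => -[|[|[|[|//]]]] /= _; case: j => -[|[|[|[|//]]]] /= _;
  try match goal with |- ccont (fun _ => 0) => exact: ccont_cst end.
- by apply: ccontN; exact: ccont_clampf (ccont_al z).
- exact: (ccontD (ccontD (ccontM (ccont_cst _ _) c2) (ccont_cst _ _)) (ccontM (ccont_cst _ _) ca)).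
- exact: c2.
- exact: (ccontM (ccont_Gb 0 hz) ca).
Qed.

Lemma sum4 (f : 'I_4 -> C) : \sum_j f j = f ord0 + f (@Ordinal 4 1 isT) + f (@Ordinal 4 2 isT) + f (@Ordinal 4 3 isT).
Proof.
rewrite !big_ord_recl big_ord0 addr0 !addrA; do !congr (_ + _); congr f; exact: val_inj.
Qed.

Definition adj_eqs (a b J1 J2 : R -> C) (z : C) :=
  [/\ ccont a, ccont b, ccont J1 & ccont J2] /\
  forall t, 0 < t < T ->
  [/\ cder a t (- al z t * b t), cder b t (cf10 z t * a t), cder J1 t ((al z t)^-1 ^+ 2 * a t) &
     cder J2 t (Gb z 0 t / al z t * a t)].

Definition adj_hol (a : R -> C -> C) := forall (D : set C) (kap : R), copen D -> bddC D -> 0 < kap ->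
  (forall z t, D z -> 0 <= t <= T -> kap <= normc (al z t)) -> hol_family `[0, T] D a.

(** The coefficients are frozen outside [[0, T]] by [clamp], since [al] might vanish there; at
    frequencies where it vanishes inside [[0, T]] the functions are set to 0. *)
Lemma adj_exists (ca cb : C) : exists a b J1 J2 : R -> C -> C,
  [/\ forall z, nonchar z -> [/\ a 0 z = ca, b 0 z = cb, J1 0 z = 0 & J2 0 z = 0],
     forall z, nonchar z -> adj_eqs (a ^~ z) (b ^~ z) (J1 ^~ z) (J2 ^~ z) z &
     [/\ adj_hol a, adj_hol b, adj_hol J1 & adj_hol J2]].
Proof.
pose ci (i : 'I_4) : C := match val i with 0%N => ca | 1%N => cb | _ => 0 end.
have /choice[y hy] : forall z, exists y : 'I_4 -> R -> C, nonchar z -> (forall i, y i 0 = ci i) /\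
    (forall i t, cder (y i) t (\sum_j adjA i j (clamp 0 T t) z * y j t)).
  move=> z; have [hz|nz] := pselect (nonchar z); last by exists (fun _ _ => 0).
  have bnd i j : exists B : R, forall t, normc (adjA i j (clamp 0 T t) z) <= B.
    have [B hB] := ccont_bound 0 T (ccont_adjA i j hz).
    exists B => t; have := hB (clamp 0 T t) (clamp_itv t T0).
    by rewrite (clamp_id (clamp_itv t T0)).
  have /choice[B hB] : forall p : 'I_4 * 'I_4, exists B : R, forall t, normc (adjA p.1 p.2 (clamp 0 T t) z) <= B.
    by move=> [i j]; exact: bnd.
  have B0 p : 0 <= B p by exact: le_trans (normc_ge0 _) (hB p 0).
  have [|y hy] := @complex_linear_ode R 'I_4 (fun i j t => adjA i j (clamp 0 T t) z) (\sum_p B p) ci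
    (fun i j => ccont_adjA i j hz).
    move=> i j t; rewrite (le_trans (hB (i, j) t)) // (bigD1 (i, j)) //= lerDl.
    by apply: sumr_ge0.
  by exists y.
pose e1 := @Ordinal 4 1 isT; pose e2 := @Ordinal 4 2 isT; pose e3 := @Ordinal 4 3 isT.
have yh i : adj_hol (fun t z => y z i t).
  move=> D kap oD bD k0 h.
  have nc z : D z -> nonchar z.
    move=> Dz t t0; apply/eqP => e; have := h z t Dz t0; rewrite e normc0 => /(lt_le_trans k0).
    by rewrite ltxx.
  apply: (@ode_hol R _ T D adjA (fun i t z => y z i t) ci T0 bD oD _ _ _ _ i).
  - by move=> a b; exact: (fam_adjA a b bD k0 h).
  - by move=> a z /nc /hy[_ dy]; exact: cder_ccont (dy a).
  - move=> a z t /nc /hy[_ dy] /andP[t1 t2]; apply: (cder_eq (dy a t)).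
    by rewrite clamp_id // (ltW t1) ltW.
  - by move=> a z /nc /hy[y0 _]; exact: y0.
exists (fun t z => y z ord0 t), (fun t z => y z e1 t), (fun t z => y z e2 t), (fun t z => y z e3 t).
split => //.
- by move=> z /hy[y0 _]; rewrite !y0.
- move=> z /hy[_ dy]; split; first by split; exact: cder_ccont (dy _).
  move=> t /andP[t1 t2]; have tt : 0 <= t <= T by rewrite (ltW t1) ltW.
  split; [have := dy ord0 t|have := dy e1 t|have := dy e2 t|have := dy e3 t];
    rewrite sum4 /adjA /= clamp_id // => h; apply: (cder_eq h).
  + by rewrite !mul0r !addr0 add0r.
  + by rewrite !mul0r !addr0.
  + by rewrite !mul0r !addr0.
  + by rewrite !mul0r !addr0.
Qed.

Lemma ccont_dot (u v : R -> C) : ccont u -> ccont v ->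
  continuous (fun t => Rec (u t) * Rec (v t) + Imc (u t) * Imc (v t)).
Proof. by move=> [u1 u2] [v1 v2] t; apply: cvgD; apply: cvgM; [exact: u1|exact: v1|exact: u2|exact: v2]. Qed.

Lemma is_derive_dot (u v : R -> C) t u' v' : cder u t u' -> cder v t v' ->
  is_derive t (1:R) (fun t => Rec (u t) * Rec (v t) + Imc (u t) * Imc (v t))
    (Rec u' * Rec (v t) + Imc u' * Imc (v t) + (Rec (u t) * Rec v' + Imc (u t) * Imc v')).
Proof.
move=> [u1 u2] [v1 v2]; apply: (is_derive_eq' (is_deriveD (is_deriveM u1 v1) (is_deriveM u2 v2))).
by rewrite /GRing.scale /=; ring.
Qed.

(** [al] is the product of [k - dl] and [k + dl]. Both moduli are at least 1 and their sum is at
    least twice that of [dl]. *)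
Lemma al_ge_dl z t : `|k| + 1 <= Rec z -> normc (dl z t) <= normc (al z t).
Proof.
move=> zk; have r : Rec (dl z t) = Rec z by rewrite !RecE /=; ring.
have -> : al z t = (k%:C - dl z t) * (k%:C + dl z t) by rewrite /al rmorphXn /=; ring.
rewrite normcM.
have h1 : 1 <= normc (k%:C - dl z t).
  have := normr_Rec (k%:C - dl z t); rewrite Rec_add Rec_opp r /=; apply: le_trans.
  by rewrite distrC (le_trans _ (ler_norm _)) //; have := ler_norm k; lra.
have h2 : 1 <= normc (k%:C + dl z t).
  have := normr_Rec (k%:C + dl z t); rewrite Rec_add r /=; apply: le_trans.
  by rewrite (le_trans _ (ler_norm _)) //; have := lerNnormlW (lexx `|k|); lra.
have h3 : 2 * normc (dl z t) <= normc (k%:C - dl z t) + normc (k%:C + dl z t).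
  have := ler_normcB (k%:C + dl z t) (k%:C - dl z t).
  have -> : k%:C + dl z t - (k%:C - dl z t) = 2%:C * dl z t by ring.
  by rewrite normcM normcR ger0_norm // addrC.
have := normc_ge0 (dl z t).
have : 0 <= (normc (k%:C - dl z t) - 1) * (normc (k%:C + dl z t) - 1) by rewrite mulr_ge0 // subr_ge0.
lra.
Qed.

Let s := Num.sqrt m.
Let s0 : 0 < s. Proof. by rewrite sqrtr_gt0. Qed.
Let ss : s * s = m. Proof. by rewrite -expr2 sqr_sqrtr // ltW. Qed.

(** The energy [|a / dl|^2 / m + |b|^2] symmetrizes the principal part: the two cross terms add up
    to a multiple of [Re dl = Re z], and the imaginary part of [dl], of any size, drops out. All
    other terms are bounded uniformly in [z]. The rate [T / sqrt m] is the distance travelled at the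
    speed of propagation [1 / sqrt m]. *)
Lemma adj_energy (ca cb : C) : exists M : R, 0 <= M /\ forall z (a b J1 J2 : R -> C),
  `|k| + 1 <= Rec z -> nonchar z -> adj_eqs a b J1 J2 z -> a 0 = ca -> b 0 = cb ->
  forall t, 0 <= t <= T -> normc (a t / dl z t) <= M * expR (Rec z * (T / s)) /\
    normc (b t) <= M * expR (Rec z * (T / s)).
Proof.
pose c2 := 2 * k ^+ 2 + c / m.
have k20 : 0 <= k ^+ 2 by exact: sqr_ge0.
have mi : 0 <= m^-1 by rewrite invr_ge0 ltW.
have c20 : 0 <= c2 by apply: addr_ge0; exact: mulr_ge0.
pose c1 := k ^+ 2 / m * s + 2 * `|k| + c2 * s.
have c10 : 0 <= c1.
  apply: addr_ge0; last by apply: mulr_ge0 => //; exact: ltW.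
  by apply: addr_ge0; [apply: mulr_ge0; [exact: mulr_ge0|exact: ltW]|exact: mulr_ge0].
pose E0 := normc ca ^+ 2 / m + normc cb ^+ 2.
have E00 : 0 <= E0 by apply: addr_ge0; [apply: mulr_ge0 => //; exact: sqr_ge0|exact: sqr_ge0].
exists ((s + 1) * Num.sqrt (E0 * expR (c1 * T))); split.
  by rewrite mulr_ge0 ?sqrtr_ge0 // addr_ge0 // ltW.
move=> z a b J1 J2 zk hz [[cta ctb _ _] de] a0 b0 t tT.
set x := Rec z in zk *.
have x1 : 1 <= x by have := normr_ge0 k; lra.
have rd u : Rec (dl z u) = x by rewrite !RecE /=; ring.
have dn0 u : dl z u != 0 by apply: neq0_Rec; rewrite rd; lra.
have d1 u : 1 <= normc (dl z u) by rewrite (le_trans x1) // -(rd u) (le_trans (ler_norm _)) // normr_Rec.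
have iv u : normc (dl z u)^-1 <= 1 by rewrite normcV invf_le1 // (lt_le_trans ltr01).
have ada u := al_ge_dl u zk.
have an0 u : al z u != 0.
  apply/eqP => e; have := ada u; rewrite e normc0 => h; have := d1 u; lra.
pose A u := a u / dl z u.
have cA : ccont A by apply: ccontM => //; apply: ccont_inv => //; exact: ccont_dl.
pose dot (u v : C) := Rec u * Rec v + Imc u * Imc v.
have dotE u : dot u u = normc u ^+ 2 by rewrite sqr_normcE /dot !expr2.
pose E u := m^-1 * dot (A u) (A u) + dot (b u) (b u).
have EE u : E u = normc (A u) ^+ 2 / m + normc (b u) ^+ 2 by rewrite /E !dotE mulrC.
have cE : continuous E.
  move=> u; apply: cvgD; last exact: ccont_dot.
  by apply: cvgM; [exact: cvg_cst|exact: ccont_dot].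
pose A' u := dl z u * b u - (k ^+ 2)%:C / dl z u * b u + k%:C * 'i / dl z u * A u.
pose B' u := m^-1%:C * (dl z u * A u) + ((2 * k ^+ 2)%:C * (al z u)^-1 ^+ 2 * dl z u + (c / m)%:C * ((al z u)^-1 * dl z u)) * A u.
have dA u : 0 < u < T -> cder A u (A' u).
  move=> /de[da _ _ _]; apply: (cder_eq (cderM da (cder_inv (dn0 u) (cder_dl z u)))).
  rewrite /A' /A; have := dn0 u; rewrite /al; move: (dl z u) (a u) (b u) => d a1 b1 dn.
  by field.
have dB u : 0 < u < T -> cder b u (B' u).
  move=> /de[_ db _ _]; apply: (cder_eq db); rewrite /B' /A /cf10.
  have := dn0 u; have := an0 u; move: (al z u) (dl z u) (a u) => l d a1 ln dn.
  rewrite {1}(_ : a1 = d * (a1 / d)); last by rewrite mulrC divfK.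
  by generalize (a1 / d) (c / m)%:C m^-1%:C => w v1 v2; ring.
pose E' u := m^-1 * (2 * dot (A u) (A' u)) + 2 * dot (b u) (B' u).
have dE u : 0 < u < T -> is_derive u (1:R) E (E' u).
  move=> uT; have h1 := is_derive_dot (dA u uT) (dA u uT); have h2 := is_derive_dot (dB u uT) (dB u uT).
  have h3 := is_deriveZ m^-1 h1.
  apply: (is_derive_eq' (is_deriveD h3 h2)); rewrite /E' /dot /GRing.scale /=; ring.
pose K := 2 * x / s + c1.
have dotD u v w : dot u (v + w) = dot u v + dot u w by rewrite /dot !RecE; ring.
have dotN u v : dot u (- v) = - dot u v by rewrite /dot !RecE; ring.
have dotRC (r : R) u v : dot u (r%:C * v) = r * dot u v by rewrite /dot !RecE /=; ring.
have dotle u v : dot u v <= normc u * normc v by exact: dot_le_normc.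
have sym u v w : dot u (w * v) + dot v (w * u) = 2 * Rec w * dot u v by rewrite /dot !RecE; ring.
have dotCC u v (l r : C) B1 : normc l <= B1 -> dot u (l * v) <= B1 * (normc u * normc v).
  move=> lB; rewrite (le_trans (dotle _ _))// normcM mulrCA ler_wpM2r // mulr_ge0 ?normc_ge0 //.
have bE u : 0 < u < T -> E' u <= K * E u + 0.
  move=> uT; rewrite addr0.
  pose p := normc (A u); pose q := normc (b u).
  have p0 : 0 <= p by exact: normc_ge0.
  have q0 : 0 <= q by exact: normc_ge0.
  have pq : 2 * (p * q) <= s * E u.
    have h : 0 <= (p / s - q) ^+ 2 * s by rewrite mulr_ge0 ?sqr_ge0 // ltW.
    have e : (p / s - q) ^+ 2 * s = s * E u - 2 * (p * q).
      rewrite EE -/p -/q -ss; field; rewrite gt_eqF //.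
    by rewrite e in h; lra.
  have pp : p ^+ 2 / m <= E u by rewrite EE lerDl sqr_ge0.
  have t1 : dot (A u) (A' u) <= dot (A u) (dl z u * b u) + k ^+ 2 * (p * q) + `|k| * p ^+ 2.
    rewrite /A' !dotD; have -> : - ((k ^+ 2)%:C / dl z u * b u) = (- (k ^+ 2)%:C / dl z u) * b u by ring.
    have h1 := @dotCC (A u) (b u) (- (k ^+ 2)%:C / dl z u) 0 (k ^+ 2).
    have h2 := @dotCC (A u) (A u) (k%:C * 'i / dl z u) 0 `|k|.
    have {}h1 := h1 ltac:(rewrite normcM normcN normcR ger0_norm ?sqr_ge0 // ler_piMr ?sqr_ge0 //; exact: iv).
    have {}h2 := h2 ltac:(rewrite !normcM normcR normc_i mulr1 ler_piMr //; exact: iv).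
    rewrite -/p -/q -expr2 in h1 h2; lra.
  have t2 : dot (b u) (B' u) <= m^-1 * dot (b u) (dl z u * A u) + c2 * (p * q).
    rewrite /B' dotD dotRC lerD2l (mulrC p).
    apply: (@dotCC _ _ _ 0).
    have ia : normc (al z u)^-1 * normc (dl z u) <= 1.
      by rewrite normcV mulrC ler_pdivrMr ?mul1r // (lt_le_trans ltr01) // (le_trans (d1 u)).
    have ia1 : normc (al z u)^-1 <= 1 by rewrite normcV invf_le1 ?(le_trans (d1 u)) // (lt_le_trans ltr01) // (le_trans (d1 u)).
    rewrite (le_trans (ler_normcD _ _))// lerD //.
      have k22 : 0 <= 2 * k ^+ 2 by exact: mulr_ge0.
      rewrite expr2 -!mulrA normcM normcR (ger0_norm k22) ler_piMr //.
      rewrite normcM mulr_ile1 ?normc_ge0 // normcM //.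
    have cm : 0 <= c / m by exact: mulr_ge0.
    by rewrite normcM normcR (ger0_norm cm) ler_piMr // normcM.
  have t3 := sym (A u) (b u) (dl z u); rewrite rd in t3.
  have t4 : dot (A u) (b u) <= p * q by exact: dotle.
  have i0 : 0 <= m^-1 by rewrite invr_ge0 ltW.
  have f1 : m^-1 * (2 * dot (A u) (A' u)) <= m^-1 * (2 * (dot (A u) (dl z u * b u) + k ^+ 2 * (p * q) + `|k| * p ^+ 2)).
    by rewrite ler_wpM2l // ler_wpM2l.
  have f2 : m^-1 * (2 * (dot (A u) (dl z u * b u) + dot (b u) (dl z u * A u))) <= 2 * x / s * E u.
    have -> : 2 * x / s * E u = 2 * x * m^-1 * (s * E u) by rewrite -ss; field; rewrite gt_eqF.
    rewrite t3; have : x * m^-1 * dot (A u) (b u) <= x * m^-1 * (p * q) by rewrite ler_wpM2l // mulr_ge0 //; lra.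
    have : x * m^-1 * (2 * (p * q)) <= x * m^-1 * (s * E u) by rewrite ler_wpM2l // mulr_ge0 //; lra.
    lra.
  have f3 : k ^+ 2 / m * (2 * (p * q)) <= k ^+ 2 / m * (s * E u) by rewrite ler_wpM2l // mulr_ge0 ?sqr_ge0.
  have f4 : `|k| * (p ^+ 2 / m) <= `|k| * E u by rewrite ler_wpM2l.
  have f5 : c2 * (2 * (p * q)) <= c2 * (s * E u) by rewrite ler_wpM2l.
  rewrite /E' /K /c1; lra.
have K0 : 0 <= K by rewrite addr_ge0 // divr_ge0 ?(ltW s0) // mulr_ge0 //; lra.
have [t0 tT'] := andP tT.
have sub u : 0 < u < t -> 0 < u < T by move=> /andP[-> h]; exact: lt_le_trans tT'.
have := gronwall K0 (lexx 0) t0 cE (fun u h => dE u (sub u h)) (fun u h => bE u (sub u h)).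
rewrite mul0r addr0 => h.
have hE0 : E 0 <= E0.
  rewrite EE /A a0 b0 /E0 lerD2r ler_pM2r ?invr_gt0 // normcM exprMn ler_piMr ?sqr_ge0 //.
  by rewrite exprn_ile1 ?normc_ge0 // iv.
pose M := Num.sqrt (E0 * expR (c1 * T)).
have e2 : E t <= (M * expR (x * (T / s))) ^+ 2.
  rewrite (le_trans h)// exprMn sqr_sqrtr; last by rewrite mulr_ge0 ?expR_ge0.
  have -> : expR (x * (T / s)) ^+ 2 = expR (2 * x / s * T).
    by rewrite expr2 -expRD; congr expR; field; rewrite gt_eqF.
  rewrite -[leRHS]mulrA -expRD ler_pM ?expR_ge0 //.
    by rewrite EE addr_ge0 ?sqr_ge0 // divr_ge0 ?sqr_ge0 // ltW.
  rewrite ler_expR (le_trans (ler_wpM2l K0 tT')) // /K; lra.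
have m2 : 0 <= M * expR (x * (T / s)) by rewrite mulr_ge0 ?sqrtr_ge0 ?expR_ge0.
have b1 : normc (b t) <= M * expR (x * (T / s)).
  by rewrite -(@ler_pXn2r _ 2) ?nnegrE ?normc_ge0 // (le_trans _ e2) // EE lerDr divr_ge0 ?sqr_ge0 // ltW.
have a1 : normc (A t) <= s * (M * expR (x * (T / s))).
  have sm2 := mulr_ge0 (ltW s0) m2.
  rewrite -(@ler_pXn2r _ 2) ?nnegrE ?normc_ge0 // [leRHS]exprMn [s ^+ 2]expr2 ss.
  by rewrite mulrC -(ler_pdivrMr _ _ m0) (le_trans _ e2) // EE lerDl sqr_ge0.
by split; rewrite -?mulrA -/M mulrDl ?mul1r; have := mulr_ge0 (ltW s0) m2; lra.
Qed.
End Adjoint.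

(** * The defect of the half-line formula and its vanishing *)

Section Vanishing.
Variable R : realType.
Notation C := R[i].
Notation mu := (@lebesgue_measure R).
Notation mR := (measurableTypeR R).
Variables (k m c T : R) (N P V N1 N2 P1 V1 V2 : R -> R -> C) (F : R -> C).
Hypotheses (m0 : 0 < m) (c0 : 0 <= c) (T0 : 0 <= T).
Hypothesis ms : mode_sys k m c N P V N1 N2 P1 V1 V2 F.
Notation dl := (dl k).
Notation al := (al k).
Notation Gb := (Gb k m N P V N1 V1).
Notation adj_eqs := (adj_eqs k m c T N P V N1 V1).

(** The transformed elliptic equation can be solved for the transform of [V], with denominator [al].
    Substituting it closes the equation in [P], [N] and [F], up to boundary terms at 0 and [Y]. *)
Lemma cder_lap_P (z : C) (Y t : R) : 0 <= Y -> 0 < t -> al z t != 0 ->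
  cder (fun t => lap_trunc Y z (P t)) t
   (2%:C * k%:C * 'i * dl z t / al z t * lap_trunc Y z (P t) +
    ((2 * k ^+ 2)%:C / al z t + m^-1%:C * al z t + (c / m)%:C) * lap_trunc Y z (N t) -
    (2 * k ^+ 2)%:C / al z t * lap_trunc Y z F + (cexp (- (z * Y%:C)) * Gb z Y t - Gb z 0 t)).
Proof.
move=> Y0 t0 an0; have [cN cP cV cN1 cN2 cP1 cV1 cV2 cF Nt Pt Ny N1y Py Vy V1y el] := ms.
have t0' := ltW t0.
have cyc g : jcont g -> ccont (g t) by move=> cg; exact: jcont_y.
have eN := lap_trunc_der z Y0 (cyc _ cN) (cyc _ cN1) (Ny t).
have eN1 := lap_trunc_der z Y0 (cyc _ cN1) (cyc _ cN2) (N1y t).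
have eP := lap_trunc_der z Y0 (cyc _ cP) (cyc _ cP1) (Py t).
have eV := lap_trunc_der z Y0 (cyc _ cV) (cyc _ cV1) (Vy t).
have eV1 := lap_trunc_der z Y0 (cyc _ cV1) (cyc _ cV2) (V1y t).
rewrite -/(dl z t) in eN eN1 eP eV eV1.
have cs (w : C) (f : R -> C) : ccont f -> ccont (fun y => w * f y).
  by move=> cf; apply: ccontM => //; exact: ccont_cst.
have eel : lap_trunc Y z (V2 t) - (k ^+ 2)%:C * lap_trunc Y z (V t) =
   lap_trunc Y z (P1 t) + k%:C * 'i * (lap_trunc Y z F - lap_trunc Y z (N t)).
  have fe : (fun y => V2 t y - (k ^+ 2)%:C * V t y) = (fun y => P1 t y + k%:C * 'i * (F y - N t y)).
    by apply/funext => y; exact: el.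
  have cFN := ccontB cF (cyc _ cN).
  have := congr1 (lap_trunc Y z) fe.
  rewrite (lap_truncB _ _ (cyc _ cV2) (cs _ _ (cyc _ cV))) (lap_truncD _ _ (cyc _ cP1) (cs _ _ cFN)).
  by rewrite !lap_truncZ ?(lap_truncB _ _ cF (cyc _ cN)) //; exact: cyc.
have jcs (w : C) g : jcont g -> jcont (fun t y => w * g t y).
  by move=> cg; apply: ccontM => //; exact: ccont_cst.
pose Pt' t y := - (2 * k)%:C * 'i * V t y - m^-1%:C * (N2 t y - (k ^+ 2)%:C * N t y) + (c / m)%:C * N t y.
have cPt : jcont Pt'.
  exact: (ccontD (ccontB (jcs _ _ cV) (jcs _ (fun t y => N2 t y - (k ^+ 2)%:C * N t y)
    (ccontB cN2 (jcs _ _ cN)))) (jcs _ _ cN)).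
have d := lap_trunc_cder z Y0 t0 cP cPt Pt.
have e : lap_trunc Y z (Pt' t) = - (2 * k)%:C * 'i * lap_trunc Y z (V t)
   - m^-1%:C * (lap_trunc Y z (N2 t) - (k ^+ 2)%:C * lap_trunc Y z (N t)) + (c / m)%:C * lap_trunc Y z (N t).
  have cn := cs (k ^+ 2)%:C _ (cyc _ cN); have cq := ccontB (cyc _ cN2) cn.
  have cv := cs (- (2 * k)%:C * 'i) _ (cyc _ cV); have cm := cs m^-1%:C _ cq.
  rewrite (lap_truncD _ _ (ccontB cv cm) (cs _ _ (cyc _ cN))) (lap_truncB _ _ cv cm).
  rewrite (lap_truncZ _ _ _ cq) (lap_truncB _ _ (cyc _ cN2) cn) !lap_truncZ //; exact: cyc.
apply: (cder_eq d); rewrite e.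
rewrite eV1 eV eP /lbd in eel; rewrite eN1 eN /Gb /lbd.
move: eel; set v := lap_trunc Y z (V t); set p := lap_trunc Y z (P t); set n := lap_trunc Y z (N t).
set f := lap_trunc Y z F; set E := cexp _.
have aE : al z t = (k ^+ 2)%:C - dl z t ^+ 2 by [].
move: an0 aE; set l := al z t; set dd := dl z t => an0 aE eel.
have k2 : (k ^+ 2)%:C = k%:C ^+ 2 :> C by rewrite rmorphXn.
have ii : 'i * 'i = - 1 :> C by apply: complex_eq; rewrite RecE /=; ring.
have ev : v = - (dd * p + (E * P t Y - P t 0) + k%:C * 'i * (f - n) - dd * (E * V t Y - V t 0) -
   (E * V1 t Y - V1 t 0)) / l.
  apply: (mulIf an0); rewrite divfK // aE.
  have -> : v * ((k ^+ 2)%:C - dd ^+ 2) = - (dd * (dd * v + (E * V t Y - V t 0)) + (E * V1 t Y - V1 t 0) - (k ^+ 2)%:C * v)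
     + dd * (E * V t Y - V t 0) + (E * V1 t Y - V1 t 0) by ring.
  by rewrite eel; ring.
have eiv : 'i * v = - ('i * (dd * p + (E * P t Y - P t 0) - dd * (E * V t Y - V t 0) -
   (E * V1 t Y - V1 t 0))) / l + k%:C * (f - n) / l.
  rewrite ev; transitivity (- ('i * (dd * p + (E * P t Y - P t 0) - dd * (E * V t Y - V t 0) -
   (E * V1 t Y - V1 t 0))) / l - 'i * 'i * (k%:C * (f - n) / l)); first by ring.
  by rewrite ii; ring.
have k22 : (2 * k ^+ 2)%:C = 2%:C * k%:C ^+ 2 :> C by rewrite rmorphM /= k2.
have k1 : (2 * k)%:C = 2%:C * k%:C :> C by rewrite rmorphM.
have alg (mi cm kk ic d1 p1 n1 f1 E1 v1 l1 w2 PY P0 VY V0 V1Y V10 NY N0 N1Y N10 : C) : l1 != 0 ->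
  l1 = kk ^+ 2 - d1 ^+ 2 ->
  ic * v1 = - (ic * (d1 * p1 + (E1 * PY - P0) - d1 * (E1 * VY - V0) - (E1 * V1Y - V10))) / l1 + kk * (f1 - n1) / l1 ->
  - (w2 * kk) * ic * v1 - mi * (d1 * (d1 * n1 + (E1 * NY - N0)) + (E1 * N1Y - N10) - kk ^+ 2 * n1) + cm * n1 =
  w2 * kk * ic * d1 / l1 * p1 + (w2 * kk ^+ 2 / l1 + mi * l1 + cm) * n1 - w2 * kk ^+ 2 / l1 * f1 +
  (E1 * (- mi * (d1 * NY + N1Y) + w2 * kk * ic / l1 * (PY - d1 * VY - V1Y)) -
   (- mi * (d1 * N0 + N10) + w2 * kk * ic / l1 * (P0 - d1 * V0 - V10))).
  move=> l10 le ev1.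
  have -> : - (w2 * kk) * ic * v1 = - (w2 * kk) * (ic * v1) by ring.
  by rewrite ev1 [in mi * l1]le; field.
by rewrite k22 k1 k2; apply: alg => //; rewrite aE k2.
Qed.

(** By the adjoint equations all interior terms cancel in the time derivative of the tested
    quantity, and [J2] absorbs the boundary term at 0. Only the boundary term at height [Y] is left
    to integrate in time. *)
Lemma trunc_bound (z : C) (Y Bd : R) (a b J1 J2 : R -> C) : 0 <= Y -> nonchar k T z ->
  adj_eqs a b J1 J2 z ->
  (forall t, 0 < t < T -> normc (a t / al z t * (cexp (- (z * Y%:C)) * Gb z Y t)) <= Bd) ->
  normc ((a T / al z T * lap_trunc Y z (P T) - b T * lap_trunc Y z (N T) +
      (2 * k ^+ 2)%:C * lap_trunc Y z F * J1 T + J2 T) -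
    (a 0 / al z 0 * lap_trunc Y z (P 0) - b 0 * lap_trunc Y z (N 0) +
      (2 * k ^+ 2)%:C * lap_trunc Y z F * J1 0 + J2 0)) <= 2 * Bd * T.
Proof.
move=> Y0 hz [[ca cb cJ1 cJ2] de] hB.
pose W (l : C) t := a t * l * lap_trunc Y z (P t) - b t * lap_trunc Y z (N t) +
      (2 * k ^+ 2)%:C * lap_trunc Y z F * J1 t + J2 t.
pose Phi t := W (al z (clamp 0 T t))^-1 t.
have cP := lap_trunc_jcont z Y0 (ms_P ms); have cN := lap_trunc_jcont z Y0 (ms_N ms).
have cPhi : ccont Phi.
  exact: (ccontD (ccontD (ccontB (ccontM (ccontM ca (ccont_alV T0 hz)) cP) (ccontM cb cN))
    (ccontM (ccont_cst _ _) cJ1)) cJ2).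
have e t : 0 <= t <= T -> Phi t = W (al z t)^-1 t by move=> t0; rewrite /Phi clamp_id.
rewrite -[X in normc (X - _)]/(W (al z T)^-1 T) -[X in normc (_ - X)]/(W (al z 0)^-1 0) -!e ?lexx ?T0 //.
rewrite -[T in leRHS]subr0.
apply: (cmvt T0 cPhi (f' := fun t => a t / al z t * (cexp (- (z * Y%:C)) * Gb z Y t))) => // t tT.
have [t0 t1] := andP tT; have tT' : 0 <= t <= T by rewrite (ltW t0) ltW.
have an0 := hz t tT'.
have [da db dJ1 dJ2] := de t tT.
have dP := cder_lap_P Y0 t0 an0.
have dN : cder (fun t => lap_trunc Y z (N t)) t (- lap_trunc Y z (P t)).
  have cNP : jcont (fun t y => - P t y) by apply: ccontN; exact: ms_P ms.
  apply: (cder_eq (lap_trunc_cder z Y0 t0 (ms_N ms) cNP (ms_Nt ms))).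
  rewrite -mulN1r -lap_truncZ; last by apply: jcont_y; exact: ms_P ms.
  by apply: eq_lap_trunc => y; rewrite mulN1r.
have dl' := cder_inv an0 (cder_al k z t).
have r0 : 0 < Num.min t (T - t) by rewrite lt_min t0 subr_gt0.
apply: (cder_near r0 (f := fun t => W (al z t)^-1 t)) => [u|].
  rewrite lt_min ltr_norml => /andP[/andP[u1 u2] u3]; symmetry; apply: e.
  by move: u3; rewrite ltr_norml => /andP[u3 u4]; apply/andP; split; lra.
apply: (cder_eq (cderD (cderD (cderB (cderM (cderM da dl') dP) (cderM db dN)) (cderZ _ dJ1)) dJ2)).
rewrite /cf10; move: an0; generalize (al z t) (dl z t) => l d an0.
rewrite (_ : 2%:C = 2 :> C); last by rewrite rmorph_nat.
have k22 : (2 * k ^+ 2)%:C = 2 * k%:C ^+ 2 :> C by rewrite rmorphM /= rmorphXn rmorph_nat.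
rewrite k22; generalize m^-1%:C (c / m)%:C => mi cm.
by field.
Qed.

Variables (B : R).
Hypotheses (bN0 : forall y, 0 <= y -> normc (N 0 y) <= B) (bP0 : forall y, 0 <= y -> normc (P 0 y) <= B)
  (bNT : forall y, 0 <= y -> normc (N T y) <= B) (bPT : forall y, 0 <= y -> normc (P T y) <= B)
  (bF : forall y, 0 <= y -> normc (F y) <= B).
Variables (ca cb : C) (a b J1 J2 : R -> C -> C).
Hypothesis ini : forall z, nonchar k T z -> [/\ a 0 z = ca, b 0 z = cb, J1 0 z = 0 & J2 0 z = 0].
Hypothesis eqs : forall z, nonchar k T z -> adj_eqs (a ^~ z) (b ^~ z) (J1 ^~ z) (J2 ^~ z) z.
Hypothesis hols : [/\ adj_hol k T a, adj_hol k T b, adj_hol k T J1 & adj_hol k T J2].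

(** The increment from time 0 to [T] of the tested quantity, with the truncated transforms replaced
    by those of the whole half-line. *)
Definition Dlt (z : C) := (a T z / al z T * Lap (P T) z - b T z * Lap (N T) z) -
  (ca / al z 0 * Lap (P 0) z - cb * Lap (N 0) z) + (2 * k ^+ 2)%:C * Lap F z * J1 T z + J2 T z.

Lemma Dlt_holo (D : set C) (x0 kap : R) : copen D -> bddC D -> 0 < x0 -> 0 < kap ->
  (forall z, D z -> x0 <= Rec z) -> (forall z t, D z -> 0 <= t <= T -> kap <= normc (al z t)) ->
  holo D Dlt.
Proof.
move=> oD bD x00 k0 hx ha; have [ha1 hb1 hJ1 hJ2] := hols.
have at_ (f : R -> C -> C) s : 0 <= s <= T -> hol_family `[0, T] D f -> holo D (f s).
  move=> sT hf; apply: (fam_sub (g := fun _ : unit => s) _ _ hf) => // j _; rewrite /= in_itv.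
have TT : 0 <= T <= T by rewrite T0 lexx.
have T00 : 0 <= (0 : R) <= T by apply/andP; split.
have cst (w : C) : holo D (fun=> w) by apply: (@famC _ _ _ _ _ (normc w)).
have L (g : R -> C) : ccont g -> (forall y, 0 <= y -> normc (g y) <= B) -> holo D (Lap g).
  by move=> cg bg; have [f' [K hK]] := Lap_hol cg bg x00 hx; exists (fun=> f'); exists K.
have aV := fam_alV bD k0 ha.
have LPT := L _ (jcont_y T (ms_P ms)) bPT; have LNT := L _ (jcont_y T (ms_N ms)) bNT.
have LP0 := L _ (jcont_y 0 (ms_P ms)) bP0; have LN0 := L _ (jcont_y 0 (ms_N ms)) bN0.
have LF := L _ (ms_F ms) bF.
have hT f : adj_hol k T f -> holo D (f T) by move=> hf; apply: at_ => //; exact: hf oD bD k0 ha.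
exact: (famD (famD (famB (famB (famM bD (famM bD (hT _ ha1) (at_ _ _ TT aV)) LPT) (famM bD (hT _ hb1) LNT))
  (famB (famM bD (famM bD (cst ca) (at_ _ _ T00 aV)) LP0) (famM bD (cst cb) LN0)))
  (famM bD (famM bD (cst _) LF) (hT _ hJ1))) (hT _ hJ2)).
Qed.

Lemma far_nonchar z : `|k| + 1 <= Rec z -> nonchar k T z.
Proof.
move=> zk t _; apply/eqP => e; have := al_ge_dl t zk; rewrite e normc0.
have := normr_Rec (dl z t); rewrite (_ : Rec (dl z t) = Rec z); last by rewrite !RecE /=; ring.
by have := ler_norm (Rec z); have := normr_ge0 k; lra.
Qed.

(** The height [Y] is free. The data at times 0 and [T] are bounded on the half-line, so removing
    the truncation costs [expR (- (Rec z * Y))]. At intermediate times the solution enters only at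
    the single height [Y], where compactness of [[0, T]] bounds it; this is why no control at
    infinity is required there. *)
Lemma Dlt_decay (Y : R) : 0 <= Y -> exists K : R, 0 <= K /\ forall z, `|k| + 1 <= Rec z ->
  normc (Dlt z) <= K * normc z * (expR (Rec z * (T / Num.sqrt m)) * expR (- (Rec z * Y))).
Proof.
move=> Y0.
have [M [M0 hM]] := @adj_energy R k m c T m0 c0 N P V N1 V1 ca cb.
have bnd g : jcont g -> exists2 B2 : R, 0 <= B2 & forall t, 0 <= t <= T -> normc (g t Y) <= B2.
  move=> cg; have [B2 h] := ccont_bound 0 T (jcont_t Y cg); exists B2 => //.
  by rewrite (le_trans (normc_ge0 _) (h 0 _)) // lexx.
have [b1 b10 h1] := bnd _ (ms_N ms); have [b2 b20 h2] := bnd _ (ms_N1 ms).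
have [b3 b30 h3] := bnd _ (ms_P ms); have [b4 b40 h4] := bnd _ (ms_V ms).
have [b5 b50 h5] := bnd _ (ms_V1 ms).
pose B2 := b1 + b2 + b3 + b4 + b5.
have B20 : 0 <= B2 by rewrite !addr_ge0.
pose cg := (2 / m + 6 * `|k|) * B2.
have mi0 : 0 <= m^-1 by rewrite invr_ge0 ltW.
have cg0 : 0 <= cg by rewrite mulr_ge0 // addr_ge0 // mulr_ge0.
have B0 : 0 <= B by rewrite (le_trans (normc_ge0 _) (bF (lexx 0))).
pose q := 1 + `|k| * T.
have q0 : 0 <= q by rewrite addr_ge0 // mulr_ge0.
pose K1 := 2 * (M * cg * q) * T.
have K10 : 0 <= K1 by apply: mulr_ge0 => //; apply: mulr_ge0 => //; apply: mulr_ge0 => //; exact: mulr_ge0.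
pose K2 := (M + M + normc ca + normc cb + 2 * k ^+ 2 * (2 * M * T)) * (2 * B).
have K20 : 0 <= K2.
  have := normc_ge0 ca; have := normc_ge0 cb.
  have : 0 <= 2 * k ^+ 2 * (2 * M * T).
    by apply: mulr_ge0; apply: mulr_ge0 => //; [exact: sqr_ge0|exact: mulr_ge0].
  by move=> *; apply: mulr_ge0; [lra|exact: mulr_ge0].
exists (K1 + K2); split; first by lra.
move=> z zk; have hz := far_nonchar zk.
have [a0 b0 J10 J20] := ini hz; have es := eqs hz.
have hE := hM z _ _ _ _ zk hz es a0 b0.
set x := Rec z in zk hE *.
have k0 := normr_ge0 k.
have x1 : 1 <= x by lra.
set e1 := expR (x * (T / Num.sqrt m)) in hE *; set e2 := expR (- (x * Y)).
have e10 : 1 <= e1 by rewrite -expR0 ler_expR mulr_ge0 ?divr_ge0 ?sqrtr_ge0 //; lra.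
have e20 : 0 < e2 by exact: expR_gt0.
have rd u : Rec (dl z u) = x by rewrite !RecE /=; ring.
have d1 u : 1 <= normc (dl z u) by rewrite (le_trans x1) // -(rd u) (le_trans (ler_norm _)) // normr_Rec.
have dn0 u : dl z u != 0 by apply: neq0_Rec; rewrite rd; lra.
have ada u := al_ge_dl u zk.
have z1 : 1 <= normc z by rewrite (le_trans x1) // (le_trans (ler_norm _)) // normr_Rec.
have ia u : normc (al z u)^-1 <= 1.
  by rewrite normcV invf_le1 ?(lt_le_trans ltr01) // (le_trans (d1 u)).
have id u : normc (al z u)^-1 * normc (dl z u) <= 1.
  by rewrite normcV mulrC ler_pdivrMr ?mul1r ?ada // (lt_le_trans ltr01) // (le_trans (d1 u)).
have aa t : 0 <= t <= T -> normc (a t z / al z t) <= M * e1.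
  move=> tT; have [ea _] := hE t tT.
  have -> : a t z / al z t = a t z / dl z t * ((al z t)^-1 * dl z t).
    by rewrite (mulrC (al z t)^-1) mulrA divfK.
  rewrite normcM (le_trans _ ea) // ler_piMr ?normc_ge0 // normcM; exact: id.
have qz t : 0 <= t <= T -> normc (dl z t) <= q * normc z.
  move=> /andP[t0 tT]; rewrite (le_trans (ler_normcB _ _))// normcM normc_i mulr1 normcR normrM (ger0_norm t0).
  have h : `|k| * t <= `|k| * T by rewrite ler_wpM2l.
  have : `|k| * T * 1 <= `|k| * T * normc z by rewrite ler_wpM2l // mulr_ge0.
  by rewrite /q; lra.
have Gbd t : 0 <= t <= T -> normc (Gb z Y t) <= cg * (q * normc z).
  move=> tT; rewrite (le_trans _ (ler_wpM2l cg0 (qz t tT))) // /Gb.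
  set d := normc (dl z t).
  have dd : 1 <= d by exact: d1.
  have f1 : normc (- m^-1%:C * (dl z t * N t Y + N1 t Y)) <= 2 / m * (B2 * d).
    rewrite normcM normcN normcR (ger0_norm mi0) (_ : 2 / m * (B2 * d) = m^-1 * (2 * (B2 * d))); last by ring.
    rewrite ler_wpM2l // (le_trans (ler_normcD _ _))// normcM -/d.
    have : d * normc (N t Y) <= d * B2 by rewrite ler_wpM2l ?(le_trans (h1 t tT)) ?/B2 //; lra.
    have : normc (N1 t Y) <= B2 by rewrite (le_trans (h2 t tT)) // /B2; lra.
    have : B2 * 1 <= B2 * d by rewrite ler_wpM2l.
    lra.
  have f2 : normc ((2 * k)%:C * 'i / al z t * (P t Y - dl z t * V t Y - V1 t Y)) <= 2 * `|k| * (3 * (B2 * d)).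
    rewrite normcM ler_pM ?normc_ge0 //.
      by rewrite !normcM normc_i mulr1 normcR normrM ger0_norm // ler_piMr // mulr_ge0.
    rewrite (le_trans (ler_normcB _ _))// (le_trans (lerD (ler_normcB _ _) (lexx _)))// normcM -/d.
    have : d * normc (V t Y) <= d * B2 by rewrite ler_wpM2l ?(le_trans (h4 t tT)) ?/B2 //; lra.
    have : normc (P t Y) <= B2 by rewrite (le_trans (h3 t tT)) // /B2; lra.
    have : normc (V1 t Y) <= B2 by rewrite (le_trans (h5 t tT)) // /B2; lra.
    have : B2 * 1 <= B2 * d by rewrite ler_wpM2l.
    lra.
  by rewrite (le_trans (ler_normcD _ _))// /cg; lra.
have ez : normc (cexp (- (z * Y%:C))) = e2 by rewrite normc_cexp RecE Rec_mulR.
have hyp t : 0 < t < T -> normc (a t z / al z t * (cexp (- (z * Y%:C)) * Gb z Y t)) <=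
    M * e1 * (e2 * (cg * (q * normc z))).
  move=> /andP[/ltW t0 /ltW tT]; have tt : 0 <= t <= T by rewrite t0.
  rewrite [normc _]normcM; apply: ler_pM; rewrite ?normc_ge0 ?aa //.
  rewrite [normc _]normcM ez; apply: ler_pM; rewrite ?normc_ge0 ?(ltW e20) //; exact: Gbd.
have tb := trunc_bound Y0 hz es hyp.
rewrite /= a0 b0 J10 J20 in tb.
have J1b : normc (J1 T z) <= 2 * (M * e1) * T.
  have [[_ _ cJ1 _] de] := es.
  have := cmvt T0 cJ1 (f' := fun t => (al z t)^-1 ^+ 2 * a t z) (B := M * e1).
  rewrite /= J10 !subr0; apply.
    by move=> t /de[].
  move=> t /andP[/ltW t0 /ltW tT]; have tt : 0 <= t <= T by rewrite t0.
  rewrite expr2 -mulrA normcM (le_trans _ (aa t tt)) // mulrC (mulrC (a t z)) ler_piMr ?normc_ge0 //.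
have tail (g : R -> C) : ccont g -> (forall y : R, 0 <= y -> normc (g y) <= B) -> normc (Lap g z - lap_trunc Y z g) <= 2 * B * e2.
  move=> cg' bg; rewrite (le_trans (Lap_trunc cg' bg _ Y0)) //; first by lra.
  rewrite -/x ler_wpM2r ?(ltW e20) // ler_piMr ?mulr_ge0 // invf_le1 //; lra.
have t1 := tail _ (jcont_y T (ms_P ms)) bPT; have t2 := tail _ (jcont_y T (ms_N ms)) bNT.
have t3 := tail _ (jcont_y 0 (ms_P ms)) bP0; have t4 := tail _ (jcont_y 0 (ms_N ms)) bN0.
have t5 := tail _ (ms_F ms) bF.
move: tb t1 t2 t3 t4 t5; rewrite /Dlt.
set lP := lap_trunc Y z (P T); set lN := lap_trunc Y z (N T); set lP0 := lap_trunc Y z (P 0).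
set lN0 := lap_trunc Y z (N 0); set lF := lap_trunc Y z F.
set LP := Lap (P T) z; set LN := Lap (N T) z; set LP0 := Lap (P 0) z.
set LN0 := Lap (N 0) z; set LF := Lap F z.
move=> tb t1 t2 t3 t4 t5.
set X := _ - _ in tb.
have -> : a T z / al z T * LP - b T z * LN - (ca / al z 0 * LP0 - cb * LN0) + (2 * k ^+ 2)%:C * LF * J1 T z + J2 T z =
  X + (a T z / al z T * (LP - lP) - b T z * (LN - lN) - (ca / al z 0 * (LP0 - lP0) - cb * (LN0 - lN0)) +
    (2 * k ^+ 2)%:C * (LF - lF) * J1 T z).
  by rewrite /X; ring.
have TT : 0 <= T <= T by rewrite T0 lexx.
have B2e : 0 <= 2 * B * e2 by apply: mulr_ge0; [exact: mulr_ge0|exact: ltW].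
have Me : 0 <= M * e1 by rewrite mulr_ge0 //; lra.
have p1 : normc (a T z / al z T * (LP - lP)) <= M * e1 * (2 * B * e2).
  by rewrite normcM ler_pM ?normc_ge0 // aa.
have p2 : normc (b T z * (LN - lN)) <= M * e1 * (2 * B * e2).
  by rewrite normcM ler_pM ?normc_ge0 //; exact: (hE T TT).2.
have p3 : normc (ca / al z 0 * (LP0 - lP0)) <= normc ca * e1 * (2 * B * e2).
  rewrite normcM ler_pM ?normc_ge0 // normcM ler_pM ?normc_ge0 //; exact: le_trans (ia 0) e10.
have p4 : normc (cb * (LN0 - lN0)) <= normc cb * e1 * (2 * B * e2).
  by rewrite normcM ler_pM ?normc_ge0 // ler_peMr ?normc_ge0.
have p5 : normc ((2 * k ^+ 2)%:C * (LF - lF) * J1 T z) <= 2 * k ^+ 2 * (2 * B * e2) * (2 * (M * e1) * T).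
  have k20 : 0 <= 2 * k ^+ 2 by rewrite mulr_ge0 ?sqr_ge0.
  rewrite normcM ler_pM ?normc_ge0 // normcM normcR (ger0_norm k20) ler_wpM2l //.
have s1 := ler_normcD X (a T z / al z T * (LP - lP) - b T z * (LN - lN) - (ca / al z 0 * (LP0 - lP0) - cb * (LN0 - lN0)) +
    (2 * k ^+ 2)%:C * (LF - lF) * J1 T z).
have s2 := ler_normcD (a T z / al z T * (LP - lP) - b T z * (LN - lN) - (ca / al z 0 * (LP0 - lP0) - cb * (LN0 - lN0)))
    ((2 * k ^+ 2)%:C * (LF - lF) * J1 T z).
have s3 := ler_normcB (a T z / al z T * (LP - lP) - b T z * (LN - lN)) (ca / al z 0 * (LP0 - lP0) - cb * (LN0 - lN0)).
have s4 := ler_normcB (a T z / al z T * (LP - lP)) (b T z * (LN - lN)).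
have s5 := ler_normcB (ca / al z 0 * (LP0 - lP0)) (cb * (LN0 - lN0)).
have tb' : normc X <= K1 * normc z * (e1 * e2).
  rewrite (le_trans tb) // /K1 le_eqVlt; apply/orP; left; apply/eqP; ring.
have s6 : K2 * (e1 * e2) <= K2 * normc z * (e1 * e2).
  by rewrite ler_wpM2r ?mulr_ge0 ?(ltW e20) ?ler_peMr //; lra.
have s7 : K2 * (e1 * e2) = M * e1 * (2 * B * e2) + M * e1 * (2 * B * e2) + normc ca * e1 * (2 * B * e2) +
  normc cb * e1 * (2 * B * e2) + 2 * k ^+ 2 * (2 * B * e2) * (2 * (M * e1) * T).
  by rewrite /K2; ring.
have e3 : (K1 + K2) * normc z * (e1 * e2) = K1 * normc z * (e1 * e2) + K2 * normc z * (e1 * e2) by ring.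
rewrite e3 (le_trans s1)// lerD // (le_trans _ s6)// s7 (le_trans s2)// lerD // (le_trans s3)//.
rewrite -[leRHS]addrA lerD //; first by rewrite (le_trans s4)// lerD.
by rewrite (le_trans s5)// lerD.
Qed.

Lemma Dlt_far z : `|k| + 1 < Rec z -> Dlt z = 0.
Proof.
move=> zk; have kk := normr_ge0 k.
have zn w : `|k| + 1 < Rec w -> 1 <= normc w.
  by move=> wk; have := normr_Rec w; have := ler_norm (Rec w); lra.
(* One power cancels the factor [normc z] of [Dlt_decay], four give the decay in [Imc z] asked for
   by [halfplane_zero]. *)
pose H w := Dlt w * w^-1 ^+ 5.
suff : H z = 0.
  have z0 : z != 0 by apply: neq0_Rec; lra.
  by rewrite /H => /eqP; rewrite mulf_eq0 expf_eq0 /= invr_eq0 (negbTE z0) orbF => /eqP.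
apply: (halfplane_zero (x1 := `|k| + 1) _ _ zk).
  move=> rho; set D := [set _ | _].
  have bD : bddC D by apply: (@bddC_ball _ _ rho) => v [_ /ltW].
  apply: famM => //.
    apply: (@Dlt_holo D 1 1) => //.
    - exact: line_copen.
    - by move=> w [wk _]; lra.
    - move=> w t [wk _] _; rewrite (le_trans _ (al_ge_dl t (ltW wk))) //.
      have := normr_Rec (dl w t); rewrite (_ : Rec (dl w t) = Rec w); last by rewrite !RecE /=; ring.
      by have := ler_norm (Rec w); lra.
  by apply: famX => //; apply: (famV bD ltr01) => [_ w _ [wk _]|]; [exact: zn|exact: fam_id].
move=> Y'; have s0 : 0 <= T / Num.sqrt m by rewrite divr_ge0 // sqrtr_ge0.
(* The truncation height exceeds the required rate [Y'] by exactly the growth rate of the adjoint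
   solution. *)
have Y0 : 0 <= `|Y'| + T / Num.sqrt m by rewrite addr_ge0.
have [K [K0 hK]] := Dlt_decay Y0; exists K => w wk.
have w0 : 0 < Rec w by lra.
have z1 := zn w wk; have nw : 0 < normc w by lra.
rewrite /H normcM normcX normcV.
rewrite (le_trans (ler_wpM2r _ (hK w (ltW wk)))) ?exprn_ge0 ?invr_ge0 ?normc_ge0 //.
rewrite -expRD.
have -> : Rec w * (T / Num.sqrt m) + - (Rec w * (`|Y'| + T / Num.sqrt m)) = - (`|Y'| * Rec w) by ring.
have e1 : expR (- (`|Y'| * Rec w)) <= expR (- (Y' * Rec w)).
  by rewrite ler_expR lerN2 ler_wpM2r ?(ltW w0) // ler_norm.
have -> : K * normc w * expR (- (`|Y'| * Rec w)) * (normc w)^-1 ^+ 5 =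
   K * expR (- (`|Y'| * Rec w)) * ((normc w ^+ 2)^-1) ^+ 2 by field; rewrite gt_eqF.
apply: ler_pM; rewrite ?sqr_ge0 ?mulr_ge0 ?expR_ge0 ?ler_wpM2l //.
have h : (normc w ^+ 2)^-1 <= cauchyw (Imc w).
  rewrite lef_pV2 ?posrE ?exprn_gt0 ?ltr_pwDl ?sqr_ge0 // sqr_normcE lerD2r.
  have : 1 * 1 <= Rec w * Rec w by apply: ler_pM => //; lra.
  by rewrite expr2 mul1r.
have h0 : 0 <= (normc w ^+ 2)^-1 by rewrite invr_ge0 sqr_ge0.
by rewrite lerXn2r ?nnegrE // (le_trans h0).
Qed.

Lemma Rec_dl z t : Rec (dl z t) = Rec z. Proof. by rewrite !RecE /=; ring. Qed.
Lemma Imc_dl z t : Imc (dl z t) = Imc z - k * t. Proof. by rewrite !RecE /=; ring. Qed.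

Lemma al_lb (kap : R) z t : 0 <= kap -> kap <= normc (k%:C - dl z t) -> kap <= normc (k%:C + dl z t) ->
  kap ^+ 2 <= normc (al z t).
Proof.
move=> k0 h1 h2; have -> : al z t = (k%:C - dl z t) * (k%:C + dl z t) by rewrite /al rmorphXn /=; ring.
by rewrite normcM expr2 ler_pM.
Qed.

Lemma box_copen (x1 x2 y1 y2 : R) : copen [set w : C | x1 < Rec w < x2 /\ y1 < Imc w < y2].
Proof.
move=> w [/andP[a1 a2] /andP[b1' b2']]; exists (Num.min (Num.min (Rec w - x1) (x2 - Rec w)) (Num.min (Imc w - y1) (y2 - Imc w))).
  by rewrite !lt_min !subr_gt0 a1 a2 b1' b2'.
move=> v; rewrite !lt_min => /andP[/andP[v1 v2] /andP[v3 v4]].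
have := le_lt_trans (normr_Rec (v - w)) v1; have := le_lt_trans (normr_Rec (v - w)) v2.
have := le_lt_trans (normr_Imc (v - w)) v3; have := le_lt_trans (normr_Imc (v - w)) v4.
rewrite Rec_add Rec_opp Imc_add Imc_opp !ltr_norml => /andP[? ?] /andP[? ?] /andP[? ?] /andP[? ?].
by split; apply/andP; split; lra.
Qed.

Lemma box_bddC (x1 x2 y1 y2 : R) : bddC [set w : C | x1 < Rec w < x2 /\ y1 < Imc w < y2].
Proof.
apply: (@bddC_ball _ _ (`|x1| + `|x2| + `|y1| + `|y2|)) => w [/andP[a1 a2] /andP[b1' b2']].
rewrite (le_trans (normc_le_ReIm w)) // -addrA lerD // ler_norml.
  by have := ler_norm x2; have := lerNnormlW (lexx `|x1|); have := normr_ge0 x1; have := normr_ge0 x2;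
    move=> *; apply/andP; split; lra.
by have := ler_norm y2; have := lerNnormlW (lexx `|y1|); have := normr_ge0 y1; have := normr_ge0 y2;
    move=> *; apply/andP; split; lra.
Qed.

(** In the right half-plane [al] vanishes only on the line [Re z = |k|], at heights
    [|Im z| <= |k| T]. The continuation passes above these points: horizontally from [A] to [Bp],
    then vertically to [z]. *)
Theorem Dlt_zero z : 0 < Rec z < `|k| -> Dlt z = 0.
Proof.
move=> /andP[]; set x := Rec z => x0 xk.
(* The margin 2 leaves a vertical distance of at least 1 to the zeros on the whole box between
   heights [sg - 1] and [sg + 1]. *)
pose sg := `|k| * T + 2.
pose A : C := (`|k| + 2)%:C + sg%:C * 'i; pose Bp : C := x%:C + sg%:C * 'i.
have cRI (u v : R) : Rec (u%:C + v%:C * 'i) = u /\ Imc (u%:C + v%:C * 'i) = v.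
  by rewrite !RecE /=; split; ring.
have lin (w u v : C) s r : 0 <= s <= 1 -> normc (w - (u + s%:C * (v - u))) < r ->
   [/\ Rec u + s * (Rec v - Rec u) - r < Rec w, Rec w < Rec u + s * (Rec v - Rec u) + r,
       Imc u + s * (Imc v - Imc u) - r < Imc w & Imc w < Imc u + s * (Imc v - Imc u) + r].
  move=> _ h; have := le_lt_trans (normr_Rec _) h; have := le_lt_trans (normr_Imc _) h.
  have -> : Rec (w - (u + s%:C * (v - u))) = Rec w - (Rec u + s * (Rec v - Rec u)) by rewrite !RecE /=; ring.
  have -> : Imc (w - (u + s%:C * (v - u))) = Imc w - (Imc u + s * (Imc v - Imc u)) by rewrite !RecE /=; ring.
  by rewrite !ltr_norml => /andP[? ?] /andP[? ?]; split; lra.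
have kt t : 0 <= t <= T -> `|k * t| <= `|k| * T.
  by move=> /andP[t0 tT]; rewrite normrM (ger0_norm t0) ler_wpM2l.
have kpos : 0 < `|k| by lra.
have kk : `|k| * `|k| = k * k by rewrite -normrM ger0_norm // -expr2 sqr_ge0.
pose r := Num.min x 1 / 2.
have r0 : 0 < r by rewrite divr_gt0 // lt_min x0 ltr01.
have rx : r <= x / 2 by rewrite /r ler_pM2r ?invr_gt0 // ge_min lexx.
have r1 : r <= 1 / 2 by rewrite /r ler_pM2r ?invr_gt0 // ge_min lexx orbT.
have step1 w : normc (w - Bp) < r -> Dlt w = 0.
  pose D := [set w : C | x / 2 < Rec w < `|k| + 4 /\ sg - 1 < Imc w < sg + 1].
  have hD : holo D Dlt.
    apply: (@Dlt_holo D (x / 2) (1 ^+ 2)).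
    - exact: box_copen.
    - exact: box_bddC.
    - by rewrite divr_gt0.
    - by rewrite expr1n.
    - by move=> v [/andP[/ltW]].
    - move=> v t [_ /andP[v1 v2]] tT; have := kt t tT; rewrite ler_norml => /andP[k1 k2].
      apply: al_lb => //.
        rewrite (le_trans _ (normr_Imc _)) // Imc_add Imc_opp Imc_dl /= sub0r normrN (le_trans _ (ler_norm _)) //.
        by rewrite /sg in v1; lra.
      rewrite (le_trans _ (normr_Imc _)) // Imc_add Imc_dl /= add0r (le_trans _ (ler_norm _)) //.
      by rewrite /sg in v1; lra.
  apply: (chain_zero (r0 := 1 / 2) (a := A) _ r0 hD) => //.
    move=> s v s01 /(lin _ _ _ _ _ s01)[]; rewrite !(cRI _ _).1 !(cRI _ _).2 subrr mulr0 addr0 => l1 l2 l3 l4.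
    have [s0 s1] := andP s01.
    have h1 : s * (x - (`|k| + 2)) <= 0 by rewrite mulr_ge0_le0 //; lra.
    have h2 : x - (`|k| + 2) <= s * (x - (`|k| + 2)).
      have : 0 <= (1 - s) * ((`|k| + 2) - x) by rewrite mulr_ge0 //; lra.
      lra.
    by split; apply/andP; split; lra.
  move=> v vA; apply: Dlt_far; have := le_lt_trans (normr_Rec _) vA.
  by rewrite Rec_add Rec_opp (cRI _ _).1 ltr_norml => /andP[]; lra.
(* Half the distance to the line of zeros: the second box stays [kap] away from it, so that [al] is
   at least [kap ^+ 2] in modulus. *)
pose kap := (`|k| - x) / 2; have kap0 : 0 < kap by rewrite divr_gt0 // subr_gt0.
pose r2 := Num.min r kap; have r20 : 0 < r2 by rewrite lt_min r0.
have r2r : r2 <= r by rewrite ge_min lexx.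
have r2k : r2 <= kap by rewrite ge_min lexx orbT.
pose Y0 := `|sg| + `|Imc z| + 1.
pose D := [set w : C | x / 2 < Rec w < x + kap /\ - Y0 < Imc w < Y0].
have hD : holo D Dlt.
  apply: (@Dlt_holo D (x / 2) (kap ^+ 2)).
  - exact: box_copen.
  - exact: box_bddC.
  - by rewrite divr_gt0.
  - by rewrite exprn_gt0.
  - by move=> v [/andP[/ltW]].
  - move=> v t [/andP[v1 v2] _] tT.
    have v3 : Rec v < `|k| - kap by rewrite /kap in v2 *; lra.
    apply: al_lb; first exact: ltW.
      rewrite (le_trans _ (normr_Rec _)) // Rec_add Rec_opp Rec_dl /=.
      have [k0|k0] := lerP 0 k; [have e := ger0_norm k0|have e := ltr0_norm k0]; rewrite e in v3.
        by rewrite (le_trans _ (ler_norm _)) //; lra.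
      by rewrite -normrN (le_trans _ (ler_norm _)) //; lra.
    rewrite (le_trans _ (normr_Rec _)) // Rec_add Rec_dl /=.
    have [k0|k0] := lerP 0 k; [have e := ger0_norm k0|have e := ltr0_norm k0]; rewrite e in v3.
      by rewrite (le_trans _ (ler_norm _)) //; lra.
    by rewrite -normrN (le_trans _ (ler_norm _)) //; lra.
apply: (chain_zero (r0 := r) (a := Bp) (b := z) r0 r20 hD) => //; last by rewrite subrr normc0.
move=> s v s01 /(lin _ _ _ _ _ s01)[]; rewrite !(cRI _ _).1 !(cRI _ _).2 -/x subrr mulr0 addr0 => l1 l2 l3 l4.
have [s0 s1] := andP s01.
have h1 : `|sg + s * (Imc z - sg)| <= `|sg| + `|Imc z|.
  rewrite (_ : sg + s * (Imc z - sg) = (1 - s) * sg + s * Imc z); last by ring.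
  rewrite (le_trans (ler_normD _ _)) // !normrM (ger0_norm s0) ger0_norm; last by lra.
  rewrite lerD //; [have := normr_ge0 sg|have := normr_ge0 (Imc z)]; nra.
move: h1; rewrite ler_norml => /andP[h1 h2].
by split; apply/andP; split; rewrite /Y0 /kap in r2k *; lra.
Qed.
End Vanishing.

(** * Boundary values at the imaginary axis *)

Section BoundaryLimit.
Variable R : realType.
Notation C := R[i].
Notation mu := (@lebesgue_measure R).
Notation mR := (measurableTypeR R).

Definition ccvg (u : nat -> C) (l : C) := forall e : R, 0 < e -> exists n0, forall n, (n0 <= n)%N -> normc (u n - l) <= e.

Lemma ccvgD u v a b : ccvg u a -> ccvg v b -> ccvg (fun n => u n + v n) (a + b).
Proof.
move=> hu hv e e0; have e2 : 0 < e / 2 by rewrite divr_gt0.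
have [n1 h1] := hu _ e2; have [n2 h2] := hv _ e2; exists (maxn n1 n2) => n; rewrite geq_max => /andP[/h1 a1 /h2 a2].
have -> : u n + v n - (a + b) = (u n - a) + (v n - b) by ring.
by have := ler_normcD (u n - a) (v n - b); lra.
Qed.

Lemma ccvgZ (c : C) u a : ccvg u a -> ccvg (fun n => c * u n) (c * a).
Proof.
move=> hu e e0; have c1 : 0 < normc c + 1 by have := normc_ge0 c; lra.
have [n1 h1] := hu _ (divr_gt0 e0 c1); exists n1 => n /h1; rewrite ler_pdivlMr // -mulrBr normcM => h.
have := normc_ge0 (u n - a); have := normc_ge0 c; nra.
Qed.

Lemma ccvgN u a : ccvg u a -> ccvg (fun n => - u n) (- a).
Proof. by move=> /(ccvgZ (- 1)); rewrite mulN1r; congr ccvg; apply/funext => n; rewrite mulN1r. Qed.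

Lemma ccvgB u v a b : ccvg u a -> ccvg v b -> ccvg (fun n => u n - v n) (a - b).
Proof. by move=> hu hv; apply: ccvgD => //; exact: ccvgN. Qed.

Lemma ccvg_eq u v a : ccvg u a -> (exists n0, forall n, (n0 <= n)%N -> u n = v n) -> ccvg v a.
Proof.
move=> hu [n0 h] e e0; have [n1 h1] := hu e e0; exists (maxn n0 n1) => n.
by rewrite geq_max => /andP[/h <- /h1].
Qed.

(* a coefficient converging at rate [eps] times a quantity of size [o(1/eps)] *)
Lemma ccvg_coef (c : nat -> C) (c0 : C) (ep : nat -> R) (K : R) (v : nat -> C) : 0 <= K ->
  (forall n, 0 <= ep n) -> (exists n0, forall n, (n0 <= n)%N -> normc (c n - c0) <= K * ep n) ->
  ccvg (fun n => (ep n)%:C * v n) 0 -> ccvg (fun n => (c n - c0) * v n) 0.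
Proof.
move=> K0 ep0 [n0 hc] hv e e0; have K1 : 0 < K + 1 by lra.
have [n1 h1] := hv _ (divr_gt0 e0 K1); exists (maxn n0 n1) => n; rewrite geq_max => /andP[/hc h2 /h1].
rewrite !subr0 !normcM normcR ger0_norm // ler_pdivlMr // => h.
have nv := normc_ge0 (v n); have := ler_wpM2r nv h2; have := mulr_ge0 (ep0 n) nv; lra.
Qed.

Definition hp (n : nat) : R := 2^-1 ^+ n.
Lemma hp_gt0 n : 0 < hp n. Proof. by rewrite exprn_gt0 // invr_gt0. Qed.
Lemma hp_lim (e : R) : 0 < e -> exists n0, forall n, (n0 <= n)%N -> hp n < e.
Proof.
move=> e0; have [N hN] := half_pow0 1 e0; exists N => n Nn.
by apply: le_lt_trans hN; rewrite mul1r /hp ler_wiXn2l // ?invr_ge0 // invf_le1 ?ltr0n ?ler1n.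
Qed.

(** [zr] approaches [i xi] for the right half-line; [zl] approaches [- i xi] for the reflected left
    one, where the sign of the frequency is reversed. *)
Definition zr (xi : R) (n : nat) : C := (hp n)%:C + 'i * xi%:C.
Definition zl (xi : R) (n : nat) : C := (hp n)%:C - 'i * xi%:C.

(** The condition on the modulus bounds the Poisson averages of [|X|]; single Cauchy integrals, in
    which nothing cancels, are estimated by them. *)
Definition leb (X : R -> C) (xi : R) := [/\ lebesgue_pt (fun s => Rec (X s)) xi,
  lebesgue_pt (fun s => Imc (X s)) xi & lebesgue_pt (fun s => normc (X s)) xi].

Lemma ae_leb (X : R -> C) : cinteg [set: mR] X -> {ae mu, forall xi, leb X xi}.
Proof.
move=> iX; have [i1 i2] := iX; have i3 := cinteg_normc measurableT iX.
have li (f : R -> R) : mu.-integrable [set: mR] (EFin \o f) -> locally_integrable [set: R] f.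
  by move=> if_; apply: (open_integrable_locally openT if_).
have := lebesgue_differentiation (li _ i1); have := lebesgue_differentiation (li _ i2).
have := lebesgue_differentiation (li _ i3).
by apply: filterS3; [exact: (ae_filter_ringOfSetsType mu)|move=> xi ? ? ?; split].
Qed.

Lemma cint_poisson_cvg (X : R -> C) xi : cinteg [set: mR] X -> leb X xi ->
  ccvg (fun n => cint [set: mR] (fun s => X s * (poisson (hp n) (s - xi))%:C)) ((2 * pi)%:C * X xi).
Proof.
move=> [i1 i2] [l1 l2 _] e e0; have e2 : 0 < e / 2 by rewrite divr_gt0.
have /cvgrPdist_le/(_ _ e2)[n1 _ h1] := poisson_lim i1 l1.
have /cvgrPdist_le/(_ _ e2)[n2 _ h2] := poisson_lim i2 l2.
exists (maxn n1 n2) => n; rewrite geq_max => /andP[/h1 a1 /h2 a2].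
rewrite normcC (le_trans (normc_le_ReIm _)) // Rec_add Rec_opp Imc_add Imc_opp cintRec cintImc.
under eq_Rintegral do rewrite Rec_mulR.
under [X in _ + `|_ - X|]eq_Rintegral do rewrite Imc_mulR.
have -> : Rec ((2 * pi)%:C * X xi) = 2 * pi * Rec (X xi) by rewrite mulrC Rec_mulR mulrC.
have -> : Imc ((2 * pi)%:C * X xi) = 2 * pi * Imc (X xi) by rewrite mulrC Imc_mulR mulrC.
by move: a1 a2; rewrite /hp; lra.
Qed.

Lemma Lap_FI_cvg (X : R -> C) xi : cinteg [set: mR] X -> leb X xi ->
  ccvg (fun n => Lap (FI X) (zr xi n) + Lap (fun y => FI X (- y)) (zl xi n)) ((2 * pi)%:C * X xi).
Proof.
move=> iX lX; apply: ccvg_eq (cint_poisson_cvg iX lX) _; exists 0%N => n _.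
by rewrite -FI_poisson // hp_gt0.
Qed.

Lemma Lap_FI_r (X : R -> C) (xi : R) n : cinteg [set: mR] X ->
  Lap (FI X) (zr xi n) = cint [set: mR] (fun s => X s / ((hp n)%:C - 'i * (s - xi)%:C)).
Proof.
move=> iX; have r : Rec (zr xi n) = hp n by rewrite !RecE /=; ring.
have r0 : 0 < Rec (zr xi n) by rewrite r hp_gt0.
have := Lap_Fourier iX r0; rewrite -/(FI X) => ->.
by apply: eq_cint => s _; congr (_ / _); rewrite /zr rmorphB; ring.
Qed.

Lemma Lap_FI_l (X : R -> C) (xi : R) n : cinteg [set: mR] X ->
  Lap (fun y => FI X (- y)) (zl xi n) = cint [set: mR] (fun s => X s / ((hp n)%:C + 'i * (s - xi)%:C)).
Proof.
move=> iX; have := FI_poisson xi iX (hp_gt0 n).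
rewrite -/(zr xi n) -/(zl xi n) Lap_FI_r // => /(canRL (addKr _)) ->.
have r (s : R) : Rec ((hp n)%:C - 'i * (s - xi)%:C) = hp n by rewrite !RecE /=; ring.
have r' (s : R) : Rec ((hp n)%:C + 'i * (s - xi)%:C) = hp n by rewrite !RecE /=; ring.
have ne (w : C) : Rec w = hp n -> w != 0 by move=> we; apply: neq0_Rec; rewrite we hp_gt0.
have cl : ccont (fun s : R => (s - xi)%:C).
  by apply: ccontR => s; apply: cvgB; [exact: cvg_id|exact: cvg_cst].
have i1 : cinteg [set: mR] (fun s => X s / ((hp n)%:C - 'i * (s - xi)%:C)).
  apply: (@cinteg_bddM _ _ _ _ (hp n)^-1 measurableT iX).
    apply: ccont_cmeas => //; apply: ccont_inv; first by move=> s; exact: ne.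
    by apply: ccontB; [exact: ccont_cst|apply: ccontM => //; exact: ccont_cst].
  move=> s _; rewrite normcV lef_pV2 ?posrE ?hp_gt0 ?normc_gt0 ?ne //.
  by rewrite -{1}(r s) (le_trans (ler_norm _)) // normr_Rec.
have i2 : cinteg [set: mR] (fun s => X s * (poisson (hp n) (s - xi))%:C).
  apply: (@cinteg_bddM _ _ _ _ (2 / hp n) measurableT iX).
    apply: ccont_cmeas => //; apply: ccontR => s.
    apply: (@continuous_comp _ _ _ (fun s => s - xi) (poisson (hp n))).
      by apply: cvgB; [exact: cvg_id|exact: cvg_cst].
    by apply: continuous_poisson; exact: hp_gt0.
  by move=> s _; rewrite normcR ger0_norm ?poisson_ge0 ?hp_gt0 // poisson_le ?hp_gt0.
rewrite addrC -(cintB measurableT i2 i1); apply: eq_cint => s _.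
rewrite -mulrBr; congr (_ * _).
have n1 := ne _ (r s); have n2 := ne _ (r' s).
have -> : (poisson (hp n) (s - xi))%:C = (2 * hp n)%:C / (((hp n)%:C - 'i * (s - xi)%:C) * ((hp n)%:C + 'i * (s - xi)%:C)).
  apply: (mulIf (mulf_neq0 n1 n2)); rewrite divfK ?mulf_neq0 //.
  have -> : ((hp n)%:C - 'i * (s - xi)%:C) * ((hp n)%:C + 'i * (s - xi)%:C) = (hp n ^+ 2 + (s - xi) ^+ 2)%:C.
    by apply: complex_eq; rewrite !RecE /=; ring.
  by rewrite -rmorphM /=; congr (_ %:C); rewrite /poisson divfK // gt_eqF // poisson_den // hp_gt0.
have -> : (2 * hp n)%:C = (hp n)%:C + (hp n)%:C by rewrite -rmorphD /=; congr (_ %:C); ring.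
move: n1 n2; generalize (s - xi)%:C (hp n)%:C => u h n1 n2.
by field; rewrite n1 n2.
Qed.

(** A one-sided transform may diverge at the axis, but only as [o(1/h)]. Since [(h / |w|)^2] is
    [h / 2] times the Poisson kernel, [h / |w| <= eta + h / (2 eta) * poisson h]. The first term is
    small with [eta]; the second is small with [h], as the Poisson averages of [|X|] stay bounded at
    a Lebesgue point. *)
Lemma cauchy_small (X : R -> C) xi (w : nat -> R -> C) : cinteg [set: mR] X -> leb X xi ->
  (forall n s, normc (w n s) ^+ 2 = hp n ^+ 2 + (s - xi) ^+ 2) -> (forall n, ccont (w n)) ->
  ccvg (fun n => (hp n)%:C * cint [set: mR] (fun s => X s / w n s)) 0.
Proof.
move=> iX [_ _ l3] hw cw e e0.
have i3 := cinteg_normc measurableT iX.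
pose A := \int[mu]_s normc (X s).
have A0 : 0 <= A by apply: Rintegral_ge0 => s _; exact: normc_ge0.
have /cvgrPdist_le/(_ _ ltr01)[n1 _ h1] := poisson_lim i3 l3.
pose M := 2 * pi * normc (X xi) + 1.
have M0 : 0 <= M by rewrite addr_ge0 // !mulr_ge0 ?pi_ge0 ?normc_ge0.
pose eta := e / (4 * (A + 1)).
have eta0 : 0 < eta by rewrite divr_gt0 // mulr_gt0 //; lra.
have M1 : 0 < 2 * (M + 1) by lra.
have [n2 h2] := hp_lim (divr_gt0 (mulr_gt0 eta0 e0) M1).
exists (maxn n1 n2) => n; rewrite geq_max => /andP[/h1 a1 /h2 a2].
have h0 := hp_gt0 n; set h := hp n in h0 a1 a2 *.
have wn0 s : w n s != 0.
  apply/eqP => ws; have := hw n s; rewrite ws normc0 expr0n /= => /eqP; rewrite eq_sym gt_eqF //.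
  exact: poisson_den.
have wp s : 0 < normc (w n s) by rewrite normc_gt0.
have key s : h / normc (w n s) <= eta + h / (2 * eta) * poisson h (s - xi).
  have -> : h / (2 * eta) * poisson h (s - xi) = (h / normc (w n s)) ^+ 2 / eta.
    rewrite expr_div_n hw -/h /poisson; field; rewrite !gt_eqF //; exact: poisson_den.
  set u := h / _; have [ue|ue] := leP u eta.
    by rewrite (le_trans ue) // lerDl divr_ge0 ?sqr_ge0 // ltW.
  have : u <= u ^+ 2 / eta; last by lra.
  rewrite ler_pdivlMr // expr2 ler_wpM2l ?ltW //; lra.
have ig : mu.-integrable [set: mR] (EFin \o (fun s => eta * normc (X s) + h / (2 * eta) * (normc (X s) * poisson h (s - xi)))).
  apply: eq_integrable (integrableD measurableT (integrableZ' eta measurableT i3)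
    (integrableZ' (h / (2 * eta)) measurableT (poisson_mulr_integrable xi h0 i3))) => //.
have iw : cinteg [set: mR] (fun s => h%:C * (X s / w n s)).
  apply: (cinteg_le measurableT _ ig).
    apply: cmeasM; first by split; exact: measurable_cst.
    apply: cmeasM; first exact: cinteg_cmeas iX.
    by apply: ccont_cmeas => //; exact: ccont_inv.
  move=> s _; rewrite normcM normcM normcR ger0_norm ?(ltW h0) // normcV mulrCA -/h.
  by have := ler_wpM2l (normc_ge0 (X s)) (key s); rewrite -/h; lra.
have iXw : cinteg [set: mR] (fun s => X s / w n s).
  have := cintegZ (h%:C)^-1 measurableT iw; apply: eq_cinteg => // s _.
  by rewrite mulrA mulVf ?mul1r // -[0]/((0:R)%:C) (inj_eq (@complexI R)) gt_eqF.
rewrite subr0 -(cintZ _ measurableT iXw).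
rewrite (le_trans (cint_le measurableT iw ig _)) //.
  move=> s _; rewrite normcM normcM normcR ger0_norm ?(ltW h0) // normcV mulrCA -/h.
  by have := ler_wpM2l (normc_ge0 (X s)) (key s); rewrite -/h; lra.
rewrite RintegralD //; [|exact: integrableZ'|by apply: integrableZ' => //; exact: poisson_mulr_integrable].
rewrite !RintegralZl //; last exact: poisson_mulr_integrable.
rewrite -/A.
have b1 : \int[mu]_x (normc (X x) * poisson h (x - xi)) <= M.
  by move: a1; rewrite -/h ler_norml => /andP[]; rewrite /M /h /hp; lra.
have b2 : eta * A <= e / 4.
  have : eta * (A + 1) = e / 4 by rewrite /eta; field; lra.
  by lra.
have b3 : h / (2 * eta) * M <= e / 4.
  move: a2; rewrite ltr_pdivlMr; last by lra.
  move=> a3; rewrite mulrAC ler_pdivrMr; last by rewrite mulr_gt0.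
  lra.
have : h / (2 * eta) * \int[mu]_x (normc (X x) * poisson h (x - xi)) <= h / (2 * eta) * M.
  by rewrite ler_wpM2l // divr_ge0 ?ltW // mulr_gt0.
lra.
Qed.

Lemma eps_Lap_r (X : R -> C) xi : cinteg [set: mR] X -> leb X xi ->
  ccvg (fun n => (hp n)%:C * Lap (FI X) (zr xi n)) 0.
Proof.
move=> iX lX; pose w n (s : R) : C := (hp n)%:C - 'i * (s - xi)%:C.
apply: ccvg_eq (@cauchy_small X xi w iX lX _ _) _.
- by move=> n s; rewrite sqr_normcE !RecE /=; ring.
- move=> n; apply: ccontB; first exact: ccont_cst.
  apply: ccontM; first exact: ccont_cst.
  by apply: ccontR => s; apply: cvgB; [exact: cvg_id|exact: cvg_cst].
- by exists 0%N => n _; rewrite Lap_FI_r.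
Qed.

Lemma eps_Lap_l (X : R -> C) xi : cinteg [set: mR] X -> leb X xi ->
  ccvg (fun n => (hp n)%:C * Lap (fun y => FI X (- y)) (zl xi n)) 0.
Proof.
move=> iX lX; pose w n (s : R) : C := (hp n)%:C + 'i * (s - xi)%:C.
apply: ccvg_eq (@cauchy_small X xi w iX lX _ _) _.
- by move=> n s; rewrite sqr_normcE !RecE /=; ring.
- move=> n; apply: ccontD; first exact: ccont_cst.
  apply: ccontM; first exact: ccont_cst.
  by apply: ccontR => s; apply: cvgB; [exact: cvg_id|exact: cvg_cst].
- by exists 0%N => n _; rewrite Lap_FI_l.
Qed.
End BoundaryLimit.

(** * Joining the two half-lines on the imaginary axis *)

Section LimitFormula.
Variable R : realType.
Notation C := R[i].
Notation mu := (@lebesgue_measure R).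
Notation mR := (measurableTypeR R).

(** Gronwall for the differences, with zero data. Identifies, on the axis, the holomorphic adjoint
    solutions of both half-lines with one given solution, later built from a row of the
    propagator. *)
Lemma adj_unique (T K : R) (l c j : R -> C) (a b J a' b' J' : R -> C) : 0 <= T -> 0 <= K ->
  (forall t, 0 < t < T -> [/\ normc (l t) <= K, normc (c t) <= K & normc (j t) <= K]) ->
  [/\ ccont a, ccont b & ccont J] -> [/\ ccont a', ccont b' & ccont J'] ->
  [/\ a 0 = a' 0, b 0 = b' 0 & J 0 = J' 0] ->
  (forall t, 0 < t < T -> [/\ cder a t (- l t * b t), cder b t (c t * a t) & cder J t (j t * a t)]) ->
  (forall t, 0 < t < T -> [/\ cder a' t (- l t * b' t), cder b' t (c t * a' t) & cder J' t (j t * a' t)]) ->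
  forall t, 0 <= t <= T -> [/\ a t = a' t, b t = b' t & J t = J' t].
Proof.
move=> T0 K0 hK [ca cb cJ] [ca' cb' cJ'] [ea eb eJ] d d' t /andP[t0 tT].
have sub u : 0 < u < t -> 0 < u < T by move=> /andP[-> h]; exact: lt_le_trans tT.
pose A (i k : 'I_3) (u : R) : C := match val i, val k with
  | 0%N, 1%N => - l u | 1%N, 0%N => c u | 2%N, 0%N => j u | _, _ => 0 end.
pose e (i : 'I_3) (u : R) : C := match val i with 0%N => a u - a' u | 1%N => b u - b' u | _ => J u - J' u end.
pose o1 := @Ordinal 3 1 isT; pose o2 := @Ordinal 3 2 isT.
have sum3 (f : 'I_3 -> C) : \sum_k f k = f ord0 + f o1 + f o2.
  rewrite !big_ord_recl big_ord0 addr0 !addrA; do !congr (_ + _); congr f; exact: val_inj.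
have n0K : normc (0 : C) <= K by rewrite normc0.
have key i : normc (e i t) <= 0.
  have -> : 0 = vgron 'I_3 t K * (0 + 0) by rewrite addr0 mulr0.
  apply: (@vector_gronwall _ _ t K A e (fun _ _ => 0) 0 0 t0 K0 (lexx 0) (lexx 0)).
  - move=> i1 k1 u /sub /hK[h1 h2 h3]; rewrite /A; case: i1 => -[|[|[|//]]] /= _; case: k1 => -[|[|[|//]]] /= _;
      rewrite ?normcN; first [exact: n0K|done].
  - by move=> *; rewrite normc0.
  - by move=> i1; rewrite /e; case: i1 => -[|[|[|//]]] /= _; exact: ccontB.
  - move=> i1 u /sub uT; have [d1 d2 d3] := d u uT; have [d1' d2' d3'] := d' u uT.
    rewrite sum3 /A /e; case: i1 => -[|[|[|//]]] /= _.
    + by apply: (cder_eq (cderB d1 d1')); ring.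
    + by apply: (cder_eq (cderB d2 d2')); ring.
    + by apply: (cder_eq (cderB d3 d3')); ring.
  - by move=> i1; rewrite /e; case: i1 => -[|[|[|//]]] /= _; rewrite ?ea ?eb ?eJ subrr normc0.
have z i : e i t = 0 by apply: normc_eq0; apply/eqP; rewrite eq_le key normc_ge0.
by split; apply/eqP; rewrite -subr_eq0; apply/eqP; [exact: (z ord0)|exact: (z o1)|exact: (z o2)].
Qed.

Lemma dl_refl (k : R) (z : C) t : dl (- k) (- z) t = - dl k z t.
Proof. by rewrite /dl mulNr rmorphN; ring. Qed.
Lemma al_refl (k : R) (z : C) t : al (- k) (- z) t = al k z t.
Proof. by rewrite /al dl_refl !sqrrN. Qed.
Lemma cf10_refl (k m c : R) (z : C) t : cf10 (- k) m c (- z) t = cf10 k m c z t.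
Proof. by rewrite /cf10 al_refl sqrrN. Qed.

Lemma al_line (k xi t : R) : al k ('i * xi%:C) t = (k ^+ 2 + (xi - k * t) ^+ 2)%:C.
Proof. by apply: complex_eq; rewrite /al /dl expr2 !RecE /=; ring. Qed.

Lemma line_nonchar (k xi T : R) : k != 0 -> nonchar k T ('i * xi%:C).
Proof.
move=> k0 t _; rewrite al_line; apply: neq0_Rec => /=.
by rewrite ltr_pwDl ?sqr_ge0 // exprn_even_gt0.
Qed.

Lemma near_line_al (k xi : R) (z : C) t : k != 0 -> normc (z - 'i * xi%:C) < `|k| / 2 ->
  (`|k| / 2) ^+ 2 <= normc (al k z t).
Proof.
move=> k0 hz; have kp : 0 < `|k| by rewrite normr_gt0.
have rz : `|Rec z| < `|k| / 2.
  by have := le_lt_trans (normr_Rec _) hz; rewrite (_ : Rec _ = Rec z) // !RecE /=; ring.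
apply: al_lb; first by rewrite divr_ge0 // ltW.
  rewrite (le_trans _ (normr_Rec _)) // Rec_add Rec_opp Rec_dl /=.
  by have := lerB_dist k (Rec z); lra.
rewrite (le_trans _ (normr_Rec _)) // Rec_add Rec_dl /=.
by have := lerB_dist k (- Rec z); rewrite normrN opprK; lra.
Qed.

Lemma disc_copen (z0 : C) (r : R) : copen [set z | normc (z - z0) < r].
Proof.
move=> z /= hz; exists (r - normc (z - z0)); first by rewrite subr_gt0.
move=> w hw /=; have := ler_normcD (w - z) (z - z0); rewrite addrA subrK; lra.
Qed.
Lemma disc_bddC (z0 : C) (r : R) : bddC [set z | normc (z - z0) < r].
Proof.
apply: (@bddC_ball _ _ (r + normc z0)) => z /= hz.
by have := ler_normcD (z - z0) z0; rewrite subrK; lra.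
Qed.

Lemma zr_dist (xi : R) n : normc (zr xi n - 'i * xi%:C) = hp R n.
Proof. by rewrite /zr addrK normcR gtr0_norm // hp_gt0. Qed.
Lemma zl_dist (xi : R) n : normc (zl xi n - - ('i * xi%:C)) = hp R n.
Proof. by rewrite /zl opprK subrK normcR gtr0_norm // hp_gt0. Qed.

(** The boundary term at [y = 0] is odd under the reflection, which makes the contributions of the
    two half-lines cancel on the axis. *)
Lemma Gb_refl (k m : R) (N P V N1 V1 : R -> R -> C) (z : C) t :
  Gb (- k) m (fun t y => N t (- y)) (fun t y => P t (- y)) (fun t y => - V t (- y))
    (fun t y => - N1 t (- y)) (fun t y => V1 t (- y)) (- z) 0 t = - Gb k m N P V N1 V1 z 0 t.
Proof.
rewrite /Gb al_refl dl_refl oppr0 mulrN rmorphN; ring.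
Qed.

(** Both coefficients tend to the same [cc], fast enough to outweigh the growth of [v] and [w]; then
    only the sum [v n + w n] has to converge. *)
Lemma ccvg_split (f g v w : nat -> C) (cc L : C) : ccvg (fun n => v n + w n) L ->
  ccvg (fun n => (f n - cc) * v n) 0 -> ccvg (fun n => (g n - cc) * w n) 0 ->
  ccvg (fun n => f n * v n + g n * w n) (cc * L).
Proof.
move=> h h1 h2; have S := ccvgD (ccvgZ cc h) (ccvgD h1 h2); rewrite addr0 addr0 in S.
have -> // : (fun n => f n * v n + g n * w n) = (fun n => cc * (v n + w n) + ((f n - cc) * v n + (g n - cc) * w n)).
by apply/funext => n; ring.
Qed.

Lemma ccvg_split0 (f g v w : nat -> C) (cc : C) :
  ccvg (fun n => (f n - cc) * v n) 0 -> ccvg (fun n => (g n - cc) * w n) 0 ->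
  ccvg (fun n => f n * v n + g n * w n - cc * (v n + w n)) 0.
Proof.
move=> h1 h2; have S := ccvgD h1 h2; rewrite addr0 in S.
have -> // : (fun n => f n * v n + g n * w n - cc * (v n + w n)) = (fun n => (f n - cc) * v n + (g n - cc) * w n).
by apply/funext => n; ring.
Qed.

(** The identities [Dlt = 0] at [zr] and at [zl] are added. The coefficients are Lipschitz in [z] by
    holomorphy, so replacing them by their boundary values costs [O(hp n)] times one-sided
    transforms of size [o(1 / hp n)]. For Fourier integrals the sums of the two transforms converge.
    For [N T] only the size [o(1 / hp n)] is assumed, and its sum therefore stays on the left. *)
Theorem limit_formula (k m c T B xi : R) (N P V N1 N2 P1 V1 V2 : R -> R -> C) (F : R -> C)
  (X0 XP0 XF XPT : R -> C) (ca cb : C) (a b J1 : R -> C) :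
  0 < m -> 0 <= c -> 0 <= T -> k != 0 -> mode_sys k m c N P V N1 N2 P1 V1 V2 F ->
  (forall y, [/\ normc (N 0 y) <= B, normc (P 0 y) <= B, normc (N T y) <= B, normc (P T y) <= B & normc (F y) <= B]) ->
  [/\ cinteg [set: mR] X0, cinteg [set: mR] XP0, cinteg [set: mR] XF & cinteg [set: mR] XPT] ->
  [/\ N 0 = FI X0, P 0 = FI XP0, F = FI XF & P T = FI XPT] ->
  [/\ leb X0 xi, leb XP0 xi, leb XF xi & leb XPT xi] ->
  ccvg (fun n => (hp R n)%:C * Lap (N T) (zr xi n)) 0 ->
  ccvg (fun n => (hp R n)%:C * Lap (fun y => N T (- y)) (zl xi n)) 0 ->
  [/\ ccont a, ccont b & ccont J1] -> [/\ a 0 = ca, b 0 = cb & J1 0 = 0] ->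
  (forall t, 0 < t < T -> [/\ cder a t (- al k ('i * xi%:C) t * b t),
     cder b t (cf10 k m c ('i * xi%:C) t * a t) & cder J1 t ((al k ('i * xi%:C) t)^-1 ^+ 2 * a t)]) ->
  ccvg (fun n => b T * (Lap (N T) (zr xi n) + Lap (fun y => N T (- y)) (zl xi n)))
    (a T / al k ('i * xi%:C) T * ((2 * pi)%:C * XPT xi) -
     (ca / al k ('i * xi%:C) 0 * ((2 * pi)%:C * XP0 xi) - cb * ((2 * pi)%:C * X0 xi)) +
     (2 * k ^+ 2)%:C * ((2 * pi)%:C * XF xi) * J1 T).
Proof.
move=> m0 c0 T0 k0 ms hB [iX0 iXP0 iXF iXPT] [eN0 eP0 eF ePT] [l0 lP0 lF lPT] hNr hNl [cta ctb ctJ] [a0 b0 J0] hd.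
set z0 := 'i * xi%:C in hd *.
have kp : 0 < `|k| by rewrite normr_gt0.
have k0' : - k != 0 by rewrite oppr_eq0.
have ms' := mode_sys_refl ms.
have [a1 [b1 [J11 [J21 [ini1 eqs1 hol1]]]]] := adj_exists k m c T0 (ms_N ms) (ms_P ms) (ms_V ms) (ms_N1 ms) (ms_V1 ms) ca cb.
have [a2 [b2 [J12 [J22 [ini2 eqs2 hol2]]]]] := adj_exists (- k) m c T0 (ms_N ms') (ms_P ms') (ms_V ms') (ms_N1 ms') (ms_V1 ms') ca cb.
have bb g : (forall y, normc (g y) <= B) -> forall y : R, 0 <= y -> normc (g y) <= B by [].
have B1 y : normc (N 0 y) <= B by case: (hB y). have B2 y : normc (P 0 y) <= B by case: (hB y).
have B3 y : normc (N T y) <= B by case: (hB y). have B4 y : normc (P T y) <= B by case: (hB y).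
have B5 y : normc (F y) <= B by case: (hB y).
have D1 := Dlt_zero m0 c0 T0 ms (fun y _ => B1 y) (fun y _ => B2 y) (fun y _ => B3 y) (fun y _ => B4 y) (fun y _ => B5 y) ini1 eqs1 hol1.
have D2 := Dlt_zero m0 c0 T0 ms' (fun y _ => B1 (- y)) (fun y _ => B2 (- y)) (fun y _ => B3 (- y))
   (fun y _ => B4 (- y)) (fun y _ => B5 (- y)) ini2 eqs2 hol2.
have nc1 : nonchar k T z0 by exact: line_nonchar.
have nc2 : nonchar (- k) T (- z0) by move=> t tT; rewrite al_refl; exact: nc1.
have [[ca1 cb1 cJ11 cJ21] d1] := eqs1 _ nc1; have [[ca2 cb2 cJ12 cJ22] d2] := eqs2 _ nc2.
have [ia1 ib1 iJ11 iJ21] := ini1 _ nc1; have [ia2 ib2 iJ12 iJ22] := ini2 _ nc2.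
have [K K0 hK] : exists2 K : R, 0 <= K & forall t, 0 < t < T ->
    [/\ normc (al k z0 t) <= K, normc (cf10 k m c z0 t) <= K & normc ((al k z0 t)^-1 ^+ 2) <= K].
  have cA i j := ccont_adjA (k := k) m c T0 (ms_N ms) (ms_P ms) (ms_V ms) (ms_N1 ms) (ms_V1 ms) i j nc1.
  have [K1 h1] := ccont_bound 0 T (cA ord0 (@Ordinal 4 1 isT)).
  have [K2 h2] := ccont_bound 0 T (cA (@Ordinal 4 1 isT) ord0).
  have [K3 h3] := ccont_bound 0 T (cA (@Ordinal 4 2 isT) ord0).
  have TT : 0 <= (0 : R) <= T by apply/andP; split.
  have g1 := le_trans (normc_ge0 _) (h1 0 TT); have g2 := le_trans (normc_ge0 _) (h2 0 TT).
  have g3 := le_trans (normc_ge0 _) (h3 0 TT).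
  exists (K1 + K2 + K3); first by rewrite !addr_ge0.
  move=> t /andP[/ltW t0 /ltW tT]; have tt : 0 <= t <= T by rewrite t0.
  have f1 : normc (al k z0 t) <= K1 by rewrite -normcN; have := h1 t tt; rewrite clamp_id.
  have f2 : normc (cf10 k m c z0 t) <= K2 by have := h2 t tt; rewrite clamp_id.
  have f3 : normc ((al k z0 t)^-1 ^+ 2) <= K3 by have := h3 t tt; rewrite clamp_id.
  by split; lra.
have TT : 0 <= T <= T by rewrite T0 lexx.
have U1 := adj_unique T0 K0 hK (And3 cta ctb ctJ) (And3 ca1 cb1 cJ11).
have {}U1 := U1 ltac:(by rewrite a0 b0 J0 ia1 ib1 iJ11) hd ltac:(by move=> t /d1[]).
have U2 := adj_unique T0 K0 hK (And3 cta ctb ctJ) (And3 ca2 cb2 cJ12).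
have {}U2 := U2 ltac:(by rewrite a0 b0 J0 ia2 ib2 iJ12) hd
  ltac:(by move=> t /d2[]; rewrite al_refl cf10_refl).
have [ea1 eb1 eJ1] := U1 T TT; have [ea2 eb2 eJ2] := U2 T TT.
(* [J2] integrates the boundary term at [y = 0]. The adjoint [a] is the same for both half-lines and
   [Gb] is odd, so the two integrands are opposite. *)
have eJ21 : J21 T z0 + J22 T (- z0) = 0.
  apply: normc_eq0; apply/eqP; rewrite eq_le normc_ge0 andbT.
  have := @cmvt R (fun t => J21 t z0 + J22 t (- z0)) (fun=> 0) 0 T 0 T0 (ccontD cJ21 cJ22).
  rewrite iJ21 iJ22 addr0 subr0 mulr0 mul0r; apply; last by move=> *; rewrite normc0.
  move=> t tT; have [_ _ _ e1] := d1 t tT; have [_ _ _ e2] := d2 t tT.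
  have [t0' t1'] := andP tT; have tt : 0 <= t <= T by rewrite (ltW t0') ltW.
  have [f1 _ _] := U1 t tt; have [f2 _ _] := U2 t tt.
  by apply: (cder_eq (cderD e1 e2)); rewrite Gb_refl al_refl -f1 -f2; ring.
have kap0 : 0 < (`|k| / 2) ^+ 2 by rewrite exprn_gt0 // divr_gt0.
pose Dr := [set z : C | normc (z - z0) < `|k| / 2].
pose Dl := [set z : C | normc (z - - z0) < `|k| / 2].
have alr z t : Dr z -> 0 <= t <= T -> (`|k| / 2) ^+ 2 <= normc (al k z t).
  by move=> hz _; exact: near_line_al hz.
have alL z t : Dl z -> 0 <= t <= T -> (`|k| / 2) ^+ 2 <= normc (al (- k) z t).
  move=> hz _; rewrite -[z]opprK al_refl; apply: (near_line_al (xi := xi) t k0).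
  by move: hz; rewrite /Dl /= opprK -normcN opprD.
have atT (D : set C) (f : R -> C -> C) (s : R) : 0 <= s <= T -> hol_family `[0, T] D f -> holo D (f s).
  by move=> sT hf; apply: (fam_sub (g := fun _ : unit => s) _ _ hf) => // j _; rewrite /= in_itv.
have lipr f : holo Dr f -> exists2 L : R, 0 <= L & exists n0, forall n, (n0 <= n)%N -> normc (f (zr xi n) - f z0) <= L * hp R n.
  move=> [f' hf]; have [L L1 hL] := holu_lip (@disc_bddC z0 (`|k| / 2)) hf.
  exists L; first exact: le_trans ler01 L1.
  have [n0 hn0] := hp_lim (divr_gt0 kp (ltr0Sn R 1)); exists n0 => n /hn0 h.
  have m1 : Dr z0 by change (normc (z0 - z0) < `|k| / 2); rewrite subrr normc0 divr_gt0.
  have m2 : Dr (zr xi n) by change (normc (zr xi n - z0) < `|k| / 2); rewrite zr_dist.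
  by rewrite -(zr_dist xi n); exact: (hL tt Logic.I).
have lipl f : holo Dl f -> exists2 L : R, 0 <= L & exists n0, forall n, (n0 <= n)%N -> normc (f (zl xi n) - f (- z0)) <= L * hp R n.
  move=> [f' hf]; have [L L1 hL] := holu_lip (@disc_bddC (- z0) (`|k| / 2)) hf.
  exists L; first exact: le_trans ler01 L1.
  have [n0 hn0] := hp_lim (divr_gt0 kp (ltr0Sn R 1)); exists n0 => n /hn0 h.
  have m1 : Dl (- z0) by change (normc (- z0 - - z0) < `|k| / 2); rewrite subrr normc0 divr_gt0.
  have m2 : Dl (zl xi n) by change (normc (zl xi n - - z0) < `|k| / 2); rewrite zl_dist.
  by rewrite -(zl_dist xi n); exact: (hL tt Logic.I).
have hp0 n : 0 <= hp R n by rewrite ltW // hp_gt0.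
have errr f (v : nat -> C) : holo Dr f -> ccvg (fun n => (hp R n)%:C * v n) 0 -> ccvg (fun n => (f (zr xi n) - f z0) * v n) 0.
  by move=> /lipr[L L0 hL] hv; exact: ccvg_coef L0 hp0 hL hv.
have errl f (v : nat -> C) : holo Dl f -> ccvg (fun n => (hp R n)%:C * v n) 0 -> ccvg (fun n => (f (zl xi n) - f (- z0)) * v n) 0.
  by move=> /lipl[L L0 hL] hv; exact: ccvg_coef L0 hp0 hL hv.
have [ha1 hb1 hJ11 hJ21] := hol1; have [ha2 hb2 hJ12 hJ22] := hol2.
have hr (f : R -> C -> C) : adj_hol k T f -> holo Dr (f T).
  by move=> hf; apply: atT => //; exact: hf (@disc_copen _ _) (@disc_bddC _ _) kap0 alr.
have hl (f : R -> C -> C) : adj_hol (- k) T f -> holo Dl (f T).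
  by move=> hf; apply: atT => //; exact: hf (@disc_copen _ _) (@disc_bddC _ _) kap0 alL.
have T00 : 0 <= (0 : R) <= T by apply/andP; split.
have Vr := fam_alV (@disc_bddC z0 (`|k| / 2)) kap0 alr; have Vl := fam_alV (@disc_bddC (- z0) (`|k| / 2)) kap0 alL.
have Ar : holo Dr (fun z => a1 T z / al k z T) := famM (@disc_bddC _ _) (hr _ ha1) (atT _ _ _ TT Vr).
have Al : holo Dl (fun z => a2 T z / al (- k) z T) := famM (@disc_bddC _ _) (hl _ ha2) (atT _ _ _ TT Vl).
have A0r := atT _ _ _ T00 Vr; have A0l := atT _ _ _ T00 Vl.
have eN0' : (fun y => N 0 (- y)) = (fun y => FI X0 (- y)) by rewrite eN0.
have eP0' : (fun y => P 0 (- y)) = (fun y => FI XP0 (- y)) by rewrite eP0.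
have ePT' : (fun y => P T (- y)) = (fun y => FI XPT (- y)) by rewrite ePT.
have eF' : (fun y => F (- y)) = (fun y => FI XF (- y)) by rewrite eF.
(* each coefficient is split into its boundary value and an error of order [hp n] *)
have eaT : a1 T z0 / al k z0 T = a T / al k z0 T by rewrite ea1.
have eaT' : a2 T (- z0) / al (- k) (- z0) T = a T / al k z0 T by rewrite ea2 al_refl.
have ea0' : (al (- k) (- z0) 0)^-1 = (al k z0 0)^-1 by rewrite al_refl.
have s1 : ccvg (fun n => a1 T (zr xi n) / al k (zr xi n) T * Lap (P T) (zr xi n) +
    a2 T (zl xi n) / al (- k) (zl xi n) T * Lap (fun y => P T (- y)) (zl xi n))
    (a T / al k z0 T * ((2 * pi)%:C * XPT xi)).
  rewrite ePT' ePT; apply: ccvg_split; first exact: Lap_FI_cvg.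
    by rewrite -eaT; exact: errr Ar (eps_Lap_r iXPT lPT).
  by rewrite -eaT'; exact: errl Al (eps_Lap_l iXPT lPT).
have s2 : ccvg (fun n => b1 T (zr xi n) * Lap (N T) (zr xi n) + b2 T (zl xi n) * Lap (fun y => N T (- y)) (zl xi n)
    - b T * (Lap (N T) (zr xi n) + Lap (fun y => N T (- y)) (zl xi n))) 0.
  apply: ccvg_split0; first by rewrite eb1; exact: errr (hr _ hb1) hNr.
  by rewrite eb2; exact: errl (hl _ hb2) hNl.
have s3 : ccvg (fun n => (al k (zr xi n) 0)^-1 * Lap (P 0) (zr xi n) +
    (al (- k) (zl xi n) 0)^-1 * Lap (fun y => P 0 (- y)) (zl xi n))
    ((al k z0 0)^-1 * ((2 * pi)%:C * XP0 xi)).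
  rewrite eP0' eP0; apply: ccvg_split; first exact: Lap_FI_cvg.
    exact: errr A0r (eps_Lap_r iXP0 lP0).
  by rewrite -ea0'; exact: errl A0l (eps_Lap_l iXP0 lP0).
have {}s3 := ccvgZ ca s3.
have s4 : ccvg (fun n => cb * (Lap (N 0) (zr xi n) + Lap (fun y => N 0 (- y)) (zl xi n))) (cb * ((2 * pi)%:C * X0 xi)).
  by rewrite eN0' eN0; apply: ccvgZ; exact: Lap_FI_cvg.
have s5 : ccvg (fun n => J11 T (zr xi n) * Lap F (zr xi n) + J12 T (zl xi n) * Lap (fun y => F (- y)) (zl xi n))
    (J1 T * ((2 * pi)%:C * XF xi)).
  rewrite eF' eF; apply: ccvg_split; first exact: Lap_FI_cvg.
    by rewrite eJ1; exact: errr (hr _ hJ11) (eps_Lap_r iXF lF).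
  by rewrite eJ2; exact: errl (hl _ hJ12) (eps_Lap_l iXF lF).
have s6 : ccvg (fun n => J21 T (zr xi n) + J22 T (zl xi n)) 0.
  have h1 : ccvg (fun n => (hp R n)%:C * 1) 0.
    move=> e e0; have [n0 h] := hp_lim e0; exists n0 => n /h hn.
    by rewrite mulr1 subr0 normcR gtr0_norm ?hp_gt0 // ltW.
  have S6 := ccvgD (errr _ _ (hr _ hJ21) h1) (errl _ _ (hl _ hJ22) h1); rewrite addr0 in S6.
  apply: ccvg_eq S6 _; exists 0%N => n _; rewrite !mulr1.
  by rewrite -[RHS]subr0 -eJ21; ring.
have S := ccvgB (ccvgD (ccvgD (ccvgB s1 (ccvgB s3 s4)) (ccvgZ (2 * k ^+ 2)%:C s5)) s6) s2.
have [n0 hn0] := hp_lim kp.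
rewrite addr0 subr0 (mulrC (J1 T)) (mulrA (2 * k ^+ 2)%:C) (mulrA ca) in S.
apply: ccvg_eq S _; exists n0 => n /hn0 hn.
have rr : Rec (zr xi n) = hp R n by rewrite !RecE /=; ring.
have rl : Rec (zl xi n) = hp R n by rewrite !RecE /=; ring.
have q1 : Dlt k T N P F ca cb a1 b1 J11 J21 (zr xi n) = 0 by apply: D1; rewrite rr hp_gt0.
have q2 := D2 (zl xi n) ltac:(by rewrite rl hp_gt0 normrN).
rewrite /Dlt in q1 q2; rewrite sqrrN in q2.
rewrite -[RHS]addr0 -(addr0 (0 : C)) -{1}q1 -q2.
ring.
Qed.
End LimitFormula.

(** * The propagator *)

Section Propagator.
Variable R : realType.
Notation C := R[i].
Notation mu := (@lebesgue_measure R).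
Notation mR := (measurableTypeR R).

Notation der f t l := (is_derive t (1 : R) f l).

Lemma derM (f g : R -> R) t l l' : der f t l -> der g t l' -> der (fun s => f s * g s) t (l * g t + f t * l').
Proof. by move=> h h'; apply: (is_derive_eq' (is_deriveM h h')); rewrite /GRing.scale /=; ring. Qed.
Lemma derD (f g : R -> R) t l l' : der f t l -> der g t l' -> der (fun s => f s + g s) t (l + l').
Proof. by move=> h h'; apply: (is_derive_eq' (is_deriveD h h')). Qed.
Lemma derZ (c : R) (f : R -> R) t l : der f t l -> der (fun s => c * f s) t (c * l).
Proof. by move=> h; apply: (is_derive_eq' (derM (is_derive_cst c t 1) h)); rewrite mul0r add0r. Qed.
Lemma derB (f g : R -> R) t l l' : der f t l -> der g t l' -> der (fun s => f s - g s) t (l - l').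
Proof. by move=> h h'; apply: (is_derive_eq' (is_deriveB h h')). Qed.
Lemma derV (f : R -> R) t l : f t != 0 -> der f t l -> der (fun s => (f s)^-1) t (- l / f t ^+ 2).
Proof. by move=> h h'; apply: (is_derive_eq' (is_deriveV h h')); rewrite /GRing.scale /=; ring. Qed.
Lemma der_cont (f f' : R -> R) : (forall t, der f t (f' t)) -> continuous f.
Proof. by move=> h t; exact: is_derive_continuous (h t). Qed.

Lemma der_affine (a b t : R) : der (fun s => a - b * s) t (- b).
Proof. by apply: is_derive_eq'; rewrite /GRing.scale /=; ring. Qed.

Lemma energy_decay (E E' g g' : R -> R) (T : R) : 0 <= T ->
  (forall t, der E t (E' t)) -> (forall t, der g t (g' t)) -> (forall t, E' t <= g' t * E t) ->
  E T <= E 0 * expR (g T - g 0).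
Proof.
move=> T0 dE dg h.
have dx t : der (fun t => expR (- g t)) t (- g' t * expR (- g t)).
  have dn : der (fun t => - g t) t (- g' t) by exact: is_deriveN.
  by apply: (is_derive_eq' (is_derive1_comp _ dn)); rewrite mulrC.
have : E T * expR (- g T) <= E 0 * expR (- g 0).
  apply: (@mvt_nonincr _ (fun t => E t * expR (- g t)) (fun t => (E' t - g' t * E t) * expR (- g t)) 0 T T0).
  - apply: continuous_subspaceT; apply: der_cont => t; exact: derM (dE t) (dx t).
  - by move=> t _; apply: (is_derive_eq' (derM (dE t) (dx t))); ring.
  - by move=> t _; rewrite mulr_le0_ge0 ?expR_ge0 // subr_le0.
by rewrite expRD [expR (- g T)]expRN ler_pdivrMr ?expR_gt0 // -mulrA [expR (g T) * _]mulrC mulrA.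
Qed.

(** The fourth root of alpha: every fractional power in [Lmat], [Mvec] and [Bin] is an integer power
    of it. *)
Definition al4 (k xi t : R) : R := Num.sqrt (Num.sqrt (k ^+ 2 + (xi - k * t) ^+ 2)).

Lemma al4_sqr (k xi t : R) : al4 k xi t ^+ 2 = Num.sqrt (k ^+ 2 + (xi - k * t) ^+ 2).
Proof. by rewrite sqr_sqrtr // sqrtr_ge0. Qed.
Lemma al4_X4 (k xi t : R) : al4 k xi t ^+ 4 = k ^+ 2 + (xi - k * t) ^+ 2.
Proof. by rewrite (exprM _ 2 2) al4_sqr sqr_sqrtr // addr_ge0 // sqr_ge0. Qed.
Lemma al4_gt0 (k xi t : R) : k != 0 -> 0 < al4 k xi t.
Proof. by move=> k0; rewrite !sqrtr_gt0 ltr_pwDl ?sqr_ge0 // exprn_even_gt0. Qed.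

Lemma is_derive_al4 (k xi t : R) : k != 0 ->
  der (al4 k xi) t (- (k * (xi - k * t)) / (2 * al4 k xi t ^+ 3)).
Proof.
move=> k0.
have da : der (fun t => k ^+ 2 + (xi - k * t) ^+ 2) t (- 2 * k * (xi - k * t)).
  have du := der_affine xi k t.
  by apply: (is_derive_eq' (derD (is_derive_cst (k ^+ 2) t 1) (derM du du))); ring.
have a0 : 0 < k ^+ 2 + (xi - k * t) ^+ 2 by rewrite ltr_pwDl ?sqr_ge0 // exprn_even_gt0.
have s0 : 0 < Num.sqrt (k ^+ 2 + (xi - k * t) ^+ 2) by rewrite sqrtr_gt0.
have dsq (f : R -> R) l : 0 < f t -> der f t l -> der (fun s => Num.sqrt (f s)) t (l / (2 * Num.sqrt (f t))).
  by move=> f0 df; apply: (is_derive_eq' (is_derive1_comp (is_derive1_sqrt f0) df)); rewrite mulrC.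
have := dsq _ _ s0 (dsq _ _ a0 da); rewrite -/(al4 k xi t) -al4_sqr => h.
by apply: (is_derive_eq' h); have := al4_gt0 xi t k0 => w0; field; rewrite gt_eqF.
Qed.

(** The diagonal entries [h] decay only like [1 / |t|], which is not integrable, so the symmetrized
    energy alone does not give a uniform bound. After correction by a cross term the growth rate is
    a multiple of [1 / (1 + (t - xi / k)^2)], whose primitive is an arctangent and varies by at most
    [pi], whatever [xi], [k] and [T] are. *)
Lemma propagator_energy (k xi c m : R) (x1 x2 : R -> R) : 0 <= c -> 0 < m -> 1 <= `|k| ->
  let sm := Num.sqrt m in
  let s t := Num.sqrt (k ^+ 2 + (xi - k * t) ^+ 2) in
  let h t := k * (xi - k * t) / (2 * s t ^+ 2) in
  (forall t, der x1 t (h t * x1 t - s t / sm * x2 t)) ->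
  (forall t, der x2 t ((1 + c / s t ^+ 2 + 2 * k ^+ 2 * m / s t ^+ 4) * s t / sm * x1 t - h t * x2 t)) ->
  forall T, 0 <= T -> x1 T ^+ 2 + x2 T ^+ 2 <=
    3 * (1 + c + 2 * m) * expR (4 * (c + 4 * m + sm) * pi) * (x1 0 ^+ 2 + x2 0 ^+ 2).
Proof.
move=> c0 m0 k1 sm s h d1 d2 T T0.
have kn0 : k != 0 by rewrite -normr_gt0 (lt_le_trans _ k1).
have sm0 : 0 < sm by rewrite sqrtr_gt0.
have em : m = sm ^+ 2 by rewrite sqr_sqrtr // ltW.
have a0 t : 0 < k ^+ 2 + (xi - k * t) ^+ 2 by rewrite ltr_pwDl ?sqr_ge0 // exprn_even_gt0.
have s0 t : 0 < s t by rewrite sqrtr_gt0.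
have s2 t : s t ^+ 2 = k ^+ 2 + (xi - k * t) ^+ 2 by rewrite sqr_sqrtr // ltW.
have ds t : der s t (- (k * (xi - k * t)) / s t).
  have dw := is_derive_al4 xi t kn0; have w0 := al4_gt0 xi t kn0.
  apply: (is_derive_eq' (is_derive_ext (derM dw dw) _)).
    by move=> r; rewrite -expr2 al4_sqr.
  by rewrite /s -al4_sqr; field; rewrite gt_eqF.
(* [(P, U)] is the unit vector along [(k, xi - k t)] and [i] is alpha to the power -1/2. Derivatives
   are polynomial in these three, and [|k| >= 1] gives [i <= |P|]. *)
pose i t := (s t)^-1; pose P t := k * i t; pose U t := (xi - k * t) * i t.
have i0 t : 0 < i t by rewrite invr_gt0.
have di t : der i t (P t * U t * i t).
  by apply: (is_derive_eq' (derV (lt0r_neq0 (s0 t)) (ds t))); rewrite /P /U /i; field; rewrite gt_eqF.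
have dP t : der P t (P t * P t * U t) by apply: (is_derive_eq' (derZ k (di t))); rewrite /P; ring.
have PU t : P t ^+ 2 + U t ^+ 2 = 1.
  by rewrite /P /U !exprMn -mulrDl -s2 /i exprVn mulfV // expf_neq0 // gt_eqF.
have dU t : der U t (- P t + P t * U t ^+ 2).
  by apply: (is_derive_eq' (derM (der_affine xi k t) (di t))); rewrite /U /P; ring.
have iP t : i t <= `|P t| by rewrite normrM (gtr0_norm (i0 t)) ler_peMl // ltW.
pose Q t := 1 + c * i t ^+ 2 + 2 * m * P t ^+ 2 * i t ^+ 2.
have eh t : h t = P t * U t / 2 by rewrite /h /P /U /i; field; rewrite gt_eqF.
have eQ t : (1 + c / s t ^+ 2 + 2 * k ^+ 2 * m / s t ^+ 4) = Q t.
  by rewrite /Q /P /i; field; rewrite gt_eqF.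
have es t : s t * i t = 1 by rewrite mulfV // gt_eqF.
(* The weight [Q] cancels the rotation, and the diagonal entries leave [P U (Q x1^2 - x2^2) / sm].
   The off-diagonal part, acting on the cross term, produces exactly the opposite, because
   [s t * i t = 1]. *)
pose E t := (Q t * x1 t ^+ 2 + x2 t ^+ 2) / sm - P t * U t * i t * x1 t * x2 t.
pose Q' t := 2 * c * P t * U t * i t ^+ 2 + 8 * m * P t ^+ 3 * U t * i t ^+ 2.
pose A' t := P t ^+ 2 * i t - 3 * P t ^+ 2 * U t ^+ 2 * i t.
pose E' t := Q' t * x1 t ^+ 2 / sm + A' t * x1 t * x2 t.
have dQ t : der Q t (Q' t).
  have di2 := derM (di t) (di t); have dP2 := derM (dP t) (dP t).
  have := derD (derD (is_derive_cst (1 : R) t 1) (derZ c di2)) (derZ (2 * m) (derM dP2 di2)).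
  move=> hh; apply: (is_derive_eq' (is_derive_ext hh _)).
    by move=> r; rewrite /Q /cst /=; ring.
  by rewrite /Q' add0r; ring.
have dE t : der E t (E' t).
  have {}d1 := d1 t; have {}d2 := d2 t; rewrite eh in d1 d2; rewrite eQ in d2.
  have D1 := derM (dQ t) (derM d1 d1); have D2 := derM d2 d2.
  have D3 := derM (derM (derM (derM (dP t) (dU t)) (di t)) d1) d2.
  have hh := derB (derZ sm^-1 (derD D1 D2)) D3.
  apply: (is_derive_eq' (is_derive_ext hh _)).
    by move=> r; rewrite /E; ring.
  rewrite /E' /A' /Q'.
  have -> : P t * U t * i t * x1 t * (Q t * s t / sm * x1 t - P t * U t / 2 * x2 t) =
    P t * U t * x1 t * (Q t * (s t * i t) / sm * x1 t - P t * U t / 2 * i t * x2 t) by ring.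
  have -> : P t * U t * i t * (P t * U t / 2 * x1 t - s t / sm * x2 t) =
    P t * U t * (P t * U t / 2 * i t * x1 t - (s t * i t) / sm * x2 t) by ring.
  by rewrite es; have := PU t; move: (P t) (U t) (i t) (Q t) (s t) (x1 t) (x2 t) => p u j q r y1 y2 /= e;
    field; rewrite gt_eqF.
have kP t : (1 + (t - xi / k) ^+ 2)^-1 = P t ^+ 2.
  by rewrite /P exprMn /i exprVn s2; field; rewrite kn0 /= gt_eqF //= a0.
pose g t := 4 * (c + 4 * m + sm) * atan (t - xi / k).
have dg t : der g t (4 * (c + 4 * m + sm) * P t ^+ 2).
  have da : der (fun t => t - xi / k) t 1.
    by apply: (is_derive_eq' (derB (is_derive_id t 1) (is_derive_cst (xi / k) t 1))); rewrite subr0.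
  apply: derZ; apply: (is_derive_eq' (is_derive1_comp (is_derive1_atan _) da)).
  by rewrite mulr1 kP.
have ibd t : [/\ 0 < i t <= 1, `|P t| <= 1, `|U t| <= 1 & P t ^+ 2 <= 1].
  have := PU t => e; have p1 : `|P t| <= 1 by rewrite ler_norml; have := sqr_ge0 (U t); nra.
  have u1 : `|U t| <= 1 by rewrite ler_norml; have := sqr_ge0 (P t); nra.
  by split => //; [rewrite i0 (le_trans (iP t))|have := sqr_ge0 (U t); lra].
clearbody P U i.
have cross t : `|P t * U t * i t * x1 t * x2 t| <= (Q t * x1 t ^+ 2 + x2 t ^+ 2) / (2 * sm).
  have [/andP[it0 it1] p1 u1 _] := ibd t; rewrite ler_pdivlMr ?mulr_gt0 // !normrM (gtr0_norm it0).
  pose a := sm * `|P t| * i t * `|x1 t|; pose z := `|x2 t|.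
  have a_ge0 : 0 <= a by rewrite /a !mulr_ge0 // ltW.
  have h1 : `|P t| * `|U t| * i t * `|x1 t| * `|x2 t| * (2 * sm) <= 2 * (a * z).
    have -> : `|P t| * `|U t| * i t * `|x1 t| * `|x2 t| * (2 * sm) = `|U t| * (2 * (a * z)) by rewrite /a /z; ring.
    by rewrite ler_piMl // mulr_ge0 // mulr_ge0 // normr_ge0.
  apply: (le_trans h1).
  have h2 : 2 * a ^+ 2 <= Q t * x1 t ^+ 2.
    have -> : Q t * x1 t ^+ 2 = (1 + c * i t ^+ 2) * x1 t ^+ 2 + 2 * a ^+ 2.
      by rewrite /a !exprMn !real_normK ?num_real // -em /Q; ring.
    by rewrite lerDr mulr_ge0 ?sqr_ge0 // addr_ge0 // mulr_ge0 // sqr_ge0.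
  have ez : x2 t ^+ 2 = z ^+ 2 by rewrite real_normK ?num_real.
  by rewrite ez; have := sqr_ge0 (a - z); have := sqr_ge0 a; lra.
have Q1 t : 1 <= Q t <= 1 + c + 2 * m.
  have [/andP[it0 it1] p1 u1 p2] := ibd t.
  have j1 : i t ^+ 2 <= 1 by rewrite expr_le1 // ltW.
  have j0 := sqr_ge0 (i t); have p0 := sqr_ge0 (P t).
  have q1 : c * i t ^+ 2 <= c by rewrite ler_piMr.
  have q2 : 0 <= c * i t ^+ 2 by rewrite mulr_ge0.
  have q3 : P t ^+ 2 * i t ^+ 2 <= 1 by rewrite mulr_ile1.
  have q4 : 0 <= P t ^+ 2 * i t ^+ 2 by rewrite mulr_ge0.
  by rewrite /Q -(mulrA (2 * m)); nra.
have lowE t : (x1 t ^+ 2 + x2 t ^+ 2) / (2 * sm) <= E t.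
  have := cross t; rewrite ler_norml => /andP[_ h1].
  have e1 : (Q t * x1 t ^+ 2 + x2 t ^+ 2) / sm = 2 * ((Q t * x1 t ^+ 2 + x2 t ^+ 2) / (2 * sm)).
    by field; rewrite gt_eqF.
  have h2 : (x1 t ^+ 2 + x2 t ^+ 2) / (2 * sm) <= (Q t * x1 t ^+ 2 + x2 t ^+ 2) / (2 * sm).
    rewrite ler_pM2r ?invr_gt0 ?mulr_gt0 // lerD2r ler_peMl ?sqr_ge0 //.
    by case/andP: (Q1 t).
  by rewrite /E e1; lra.
have upE : E 0 <= 3 * (1 + c + 2 * m) * ((x1 0 ^+ 2 + x2 0 ^+ 2) / (2 * sm)).
  have := cross 0; rewrite ler_norml => /andP[h1 _].
  have e1 : (Q 0 * x1 0 ^+ 2 + x2 0 ^+ 2) / sm = 2 * ((Q 0 * x1 0 ^+ 2 + x2 0 ^+ 2) / (2 * sm)).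
    by field; rewrite gt_eqF.
  have h2 : (Q 0 * x1 0 ^+ 2 + x2 0 ^+ 2) / (2 * sm) <= (1 + c + 2 * m) * ((x1 0 ^+ 2 + x2 0 ^+ 2) / (2 * sm)).
    rewrite mulrA ler_pM2r ?invr_gt0 ?mulr_gt0 //.
    have [/andP[q1 q2]] := Q1 0; have := sqr_ge0 (x1 0); have := sqr_ge0 (x2 0); nra.
  by rewrite /E e1; lra.
have E'le t : E' t <= 4 * (c + 4 * m + sm) * P t ^+ 2 * E t.
  have [/andP[it0 it1] p1 u1 p2] := ibd t; have ip := iP t.
  have hp : P t ^+ 2 = `|P t| ^+ 2 by rewrite real_normK ?num_real.
  have b1 : Q' t <= (2 * c + 8 * m) * P t ^+ 2.
    have k1' : `|P t * U t * i t ^+ 2| <= P t ^+ 2.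
      have -> : P t * U t * i t ^+ 2 = P t * (U t * i t * i t) by ring.
      rewrite hp expr2 normrM; apply: ler_wpM2l; first exact: normr_ge0.
      apply: le_trans ip; rewrite !normrM (gtr0_norm it0) ler_piMl ?(ltW it0) //.
      by rewrite mulr_ile1 // ltW.
    have k2' : `|P t ^+ 3 * U t * i t ^+ 2| <= P t ^+ 2.
      have -> : P t ^+ 3 * U t * i t ^+ 2 = P t ^+ 2 * (P t * U t * i t ^+ 2) by ring.
      by rewrite normrM ger0_norm ?sqr_ge0 // ler_piMr ?sqr_ge0 // (le_trans k1').
    have := ler_norm (P t * U t * i t ^+ 2); have := ler_norm (P t ^+ 3 * U t * i t ^+ 2) => z1 z2.
    have -> : Q' t = 2 * c * (P t * U t * i t ^+ 2) + 8 * m * (P t ^+ 3 * U t * i t ^+ 2) by rewrite /Q'; ring.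
    have c2 : 0 <= 2 * c by rewrite mulr_ge0.
    have m8 : 0 <= 8 * m by rewrite mulr_ge0 // ltW.
    rewrite [leRHS]mulrDl; exact: lerD (ler_wpM2l c2 (le_trans z2 k1')) (ler_wpM2l m8 (le_trans z1 k2')).
  have b2 : `|A' t| <= 4 * P t ^+ 2.
    have uu : U t ^+ 2 <= 1 by have := PU t; have := sqr_ge0 (P t); lra.
    have pi0 : 0 <= P t ^+ 2 * i t by rewrite mulr_ge0 ?sqr_ge0 // ltW.
    have pi1 : P t ^+ 2 * i t <= P t ^+ 2 by rewrite ler_piMr ?sqr_ge0.
    have -> : A' t = P t ^+ 2 * i t * (1 - 3 * U t ^+ 2) by rewrite /A'; ring.
    have := sqr_ge0 (U t); rewrite normrM ger0_norm // => u0.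
    have h4 : `|1 - 3 * U t ^+ 2| <= 4 by rewrite ler_norml; lra.
    by rewrite [4 * _]mulrC; apply: ler_pM.
  have b3 : A' t * x1 t * x2 t <= 2 * P t ^+ 2 * (x1 t ^+ 2 + x2 t ^+ 2).
    apply: (le_trans (ler_norm _)); rewrite -mulrA normrM.
    have hx : `|x1 t * x2 t| <= (x1 t ^+ 2 + x2 t ^+ 2) / 2.
      by rewrite ler_norml; have := sqr_ge0 (x1 t - x2 t); have := sqr_ge0 (x1 t + x2 t); lra.
    apply: (le_trans (ler_pM (normr_ge0 _) (normr_ge0 _) b2 hx)).
    by rewrite le_eqVlt; apply/orP; left; apply/eqP; field.
  have b4 : Q' t * x1 t ^+ 2 / sm <= (2 * c + 8 * m) * P t ^+ 2 * (x1 t ^+ 2 + x2 t ^+ 2) / sm.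
    rewrite ler_pM2r ?invr_gt0 //; apply: (le_trans (ler_wpM2r (sqr_ge0 _) b1)).
    apply: ler_wpM2l; last by rewrite lerDl sqr_ge0.
    by rewrite mulr_ge0 ?sqr_ge0 // addr_ge0 // mulr_ge0 // ltW.
  apply: le_trans (_ : 4 * (c + 4 * m + sm) * P t ^+ 2 * ((x1 t ^+ 2 + x2 t ^+ 2) / (2 * sm)) <= _).
    apply: (le_trans (lerD b4 b3)); rewrite le_eqVlt; apply/orP; left; apply/eqP.
    by field; rewrite gt_eqF.
  apply: ler_wpM2l (lowE t); rewrite mulr_ge0 ?sqr_ge0 // mulr_ge0 // !addr_ge0 // ?mulr_ge0 // ltW //.
have fin := energy_decay T0 dE dg E'le.
have gT : g T - g 0 <= 4 * (c + 4 * m + sm) * pi.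
  rewrite /g -mulrBr; apply: ler_wpM2l.
    by rewrite mulr_ge0 // !addr_ge0 // ?mulr_ge0 // ltW.
  by have := atan_ltpi2 (T - xi / k); have := atan_gtNpi2 (0 - xi / k); lra.
have sm2 : 0 < 2 * sm by rewrite mulr_gt0.
rewrite -(ler_pM2r (x := (2 * sm)^-1)) ?invr_gt0 //.
apply: (le_trans (lowE T)); apply: (le_trans fin).
have E00 : 0 <= E 0 by apply: le_trans (lowE 0); rewrite divr_ge0 ?addr_ge0 ?sqr_ge0 // ltW.
have eT : expR (g T - g 0) <= expR (4 * (c + 4 * m + sm) * pi) by rewrite ler_expR.
apply: (le_trans (ler_pM E00 (expR_ge0 _) upE eT)).
by rewrite le_eqVlt; apply/orP; left; apply/eqP; ring.
Qed.

Notation o0 := (ord0 : 'I_2).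
Notation o1 := (lift ord0 (ord0 : 'I_1) : 'I_2).

Lemma ord2 (i : 'I_2) : i = o0 \/ i = o1.
Proof. by case: i => -[|[|//]] hi; [left|right]; exact: val_inj. Qed.

Section Inverse.
Variables (L : R -> 'M[R]_2) (S : R -> R -> 'M[R]_2).
Hypotheses (hS : is_propagator L S) (tr0 : forall t, L t o0 o0 + L t o1 o1 = 0).

Lemma propagator_der t s i j : der (fun tau => S tau s i j) t (L t i o0 * S t s o0 j + L t i o1 * S t s o1 j).
Proof. by apply: (is_derive_eq' (hS.2 t s i j)); rewrite !mxE !big_ord_recl big_ord0 addr0. Qed.

(* the Wronskian of two solutions is constant, since [L] has zero trace *)
Lemma wronskian_cst s s' j j' t t' : S t s o0 j * S t s' o1 j' - S t s o1 j * S t s' o0 j' =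
  S t' s o0 j * S t' s' o1 j' - S t' s o1 j * S t' s' o0 j'.
Proof.
apply: (is_derive_0_is_cst (f := fun t => S t s o0 j * S t s' o1 j' - S t s o1 j * S t s' o0 j')) => r.
have d i1 s1 j1 := propagator_der r s1 i1 j1.
apply: (is_derive_eq' (derB (derM (d o0 s j) (d o1 s' j')) (derM (d o1 s j) (d o0 s' j')))).
have -> : L r o1 o1 = - L r o0 o0 by apply/eqP; rewrite -addr_eq0 addrC tr0.
by ring.
Qed.

(** The Wronskian of a column started at [s] and one started at 0 is compared at the times 0 and
    [s]: [S 0 s] is the cofactor matrix of [S s 0]. Entrywise bounds pass from one to the other. *)
Lemma propagator_inv s : [/\ S 0 s o0 o0 = S s 0 o1 o1, S 0 s o0 o1 = - S s 0 o0 o1,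
  S 0 s o1 o0 = - S s 0 o1 o0 & S 0 s o1 o1 = S s 0 o0 o0].
Proof.
have id t : [/\ S t t o0 o0 = 1, S t t o0 o1 = 0, S t t o1 o0 = 0 & S t t o1 o1 = 1].
  by rewrite (hS.1 t); split; rewrite mxE.
have [a b c d] := id 0; have [a' b' c' d'] := id s.
have w j j' := wronskian_cst s 0 j j' 0 s; move: (w o0 o0) (w o0 o1) (w o1 o0) (w o1 o1).
by rewrite a b c d a' b' c' d' => *; split; lra.
Qed.

(** In the second argument the rows solve the adjoint equation [r' = - r L]; it is obtained from the
    forward equation for [S t 0] through the cofactors. *)
Lemma propagator_row_der i t :
  der (fun t => S 0 t i o0) t (- (S 0 t i o0 * L t o0 o0 + S 0 t i o1 * L t o1 o0)) /\
  der (fun t => S 0 t i o1) t (- (S 0 t i o0 * L t o0 o1 + S 0 t i o1 * L t o1 o1)).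
Proof.
have e : L t o1 o1 = - L t o0 o0 by apply/eqP; rewrite -addr_eq0 addrC tr0.
have [h1 h2 h3 h4] := propagator_inv t; have d i1 j1 := propagator_der t 0 i1 j1.
case: (ord2 i) => ->; split; rewrite ?h1 ?h2 ?h3 ?h4.
- apply: (is_derive_eq' (is_derive_ext (d o1 o1) _)) => [r|]; last by rewrite e; ring.
  by have [->] := propagator_inv r.
- apply: (is_derive_eq' (is_derive_ext (is_deriveN (d o0 o1)) _)) => [r|]; last by rewrite e; ring.
  by have [_ ->] := propagator_inv r.
- apply: (is_derive_eq' (is_derive_ext (is_deriveN (d o1 o0)) _)) => [r|]; last by rewrite e; ring.
  by have [_ _ ->] := propagator_inv r.
- apply: (is_derive_eq' (is_derive_ext (d o0 o0) _)) => [r|]; last by rewrite e; ring.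
  by have [_ _ _ ->] := propagator_inv r.
Qed.
End Inverse.

Section Row.
Variables (e m xi : R) (k : int) (S : R -> R -> 'M[R]_2).
Hypotheses (m0 : 0 < m) (k0 : k != 0) (hS : is_propagator (Lmat e m k xi) S).
Notation kR := (k%:~R : R).
Notation w := (al4 kR xi).
Notation sm := (Num.sqrt m).

Lemma powR_alpha t n : alpha k xi t `^ (4^-1 * n%:R) = w t ^+ n.
Proof.
have a0 : 0 <= alpha k xi t by rewrite /alpha addr_ge0 // sqr_ge0.
rewrite powRrM powR_mulrn ?powR_ge0 //; congr (_ ^+ _).
have -> : (4^-1 : R) = 2^-1 * 2^-1 by field.
by rewrite powRrM !powR12_sqrt // sqrtr_ge0.
Qed.

Lemma intr_norm_ge1 : 1 <= `|kR|.
Proof. by rewrite -intr_norm ler1z -gtz0_ge1 normr_gt0. Qed.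
Lemma intr_neq0' : kR != 0.
Proof. by rewrite intr_eq0. Qed.

Let cc : R := 4 * pi * e ^+ 2.

Lemma LmatE t : [/\ Lmat e m k xi t o0 o0 = kR * (xi - kR * t) / (2 * w t ^+ 4),
   Lmat e m k xi t o0 o1 = - (w t ^+ 2 / sm),
   Lmat e m k xi t o1 o0 = (1 + cc / w t ^+ 4 + 2 * kR ^+ 2 * m / w t ^+ 8) * w t ^+ 2 / sm &
   Lmat e m k xi t o1 o1 = - (kR * (xi - kR * t) / (2 * w t ^+ 4))].
Proof.
have w0 := al4_gt0 xi t intr_neq0'.
have ea : alpha k xi t = w t ^+ 4 by rewrite al4_X4.
have e2 : alpha k xi t `^ 2^-1 = w t ^+ 2 by rewrite -powR_alpha; congr (_ `^ _); field.
have e6 : alpha k xi t `^ (3 / 2) = w t ^+ 6 by rewrite -powR_alpha; congr (_ `^ _); field.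
have sm0 : 0 < sm by rewrite sqrtr_gt0.
have em : m = sm ^+ 2 by rewrite sqr_sqrtr // ltW.
split; rewrite /Lmat /mx2 !mxE /= /dalpha ?e2 ?e6 ?ea.
- by field; rewrite gt_eqF.
- by field; rewrite gt_eqF.
- by move: sm0 em; move: (Num.sqrt m) => q q0 ->; rewrite /cc; field; rewrite !gt_eqF.
- by field; rewrite gt_eqF.
Qed.

Lemma Lmat_tr t : Lmat e m k xi t o0 o0 + Lmat e m k xi t o1 o1 = 0.
Proof. by have [-> _ _ ->] := LmatE t; rewrite subrr. Qed.

(** The first factor compares the energy from above and below: its weight is at most
    [1 + 4 pi e^2 + 2 m], and the cross term changes the quadratic part by at most one half, hence
    the ratio 3. The exponent is the total growth of the energy. *)
Definition Kprop : R := 3 * (1 + 4 * pi * e ^+ 2 + 2 * m) * expR (4 * (4 * pi * e ^+ 2 + 4 * m + sm) * pi).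

Lemma propagator_bound T i j : 0 <= T -> S 0 T i j ^+ 2 <= Kprop.
Proof.
move=> T0; have cc0 : 0 <= cc by rewrite /cc mulr_ge0 ?sqr_ge0 // mulr_ge0 // pi_ge0.
have h j1 : S T 0 o0 j1 ^+ 2 + S T 0 o1 j1 ^+ 2 <= Kprop * (S 0 0 o0 j1 ^+ 2 + S 0 0 o1 j1 ^+ 2).
  apply: (propagator_energy (xi := xi) cc0 m0 intr_norm_ge1 (x1 := fun t => S t 0 o0 j1) (x2 := fun t => S t 0 o1 j1)) => // t;
    apply: (is_derive_eq' (propagator_der hS t 0 _ j1)); have [r1 r2 r3 r4] := LmatE t; rewrite ?r1 ?r2 ?r3 ?r4 -al4_sqr -!exprM; ring.
have u j1 : S 0 0 o0 j1 ^+ 2 + S 0 0 o1 j1 ^+ 2 = 1.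
  by rewrite (hS.1 0); case: (ord2 j1) => ->; rewrite !mxE /= ?expr1n ?expr0n /= ?addr0 ?add0r.
have b i1 j1 : S T 0 i1 j1 ^+ 2 <= Kprop.
  have := h j1; rewrite u mulr1; have := sqr_ge0 (S T 0 o0 j1); have := sqr_ge0 (S T 0 o1 j1).
  by case: (ord2 i1) => ->; lra.
have [h1 h2 h3 h4] := propagator_inv hS Lmat_tr T.
by case: (ord2 i) => ->; case: (ord2 j) => ->; rewrite ?h1 ?h2 ?h3 ?h4 ?sqrrN.
Qed.

Lemma propagator_row i : exists J : R -> R, [/\ J 0 = 0,
  forall t, [/\ der (fun t => S 0 t i o1 * w t) t (- w t ^+ 4 * (- S 0 t i o0 / (sm * w t))),
     der (fun t => - S 0 t i o0 / (sm * w t)) t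
        ((2 * kR ^+ 2 / w t ^+ 8 + m^-1 + 4 * pi * e ^+ 2 / m / w t ^+ 4) * (S 0 t i o1 * w t)) &
     der J t (S 0 t i o1 * w t / w t ^+ 8)] &
  forall T F, 0 <= T -> \int[mu]_(s in `[0, T]) ((S 0 s *m Mvec k xi s) i ord0 * F) = - 2 * kR ^+ 2 * J T * F].
Proof.
have w0 t := al4_gt0 xi t intr_neq0'; have sm0 : 0 < sm by rewrite sqrtr_gt0.
have em : m = sm ^+ 2 by rewrite sqr_sqrtr // ltW.
have dr t := propagator_row_der hS Lmat_tr i t; have dw t := is_derive_al4 xi t intr_neq0'.
have d2 t : der (fun t => S 0 t i o1) t _ := (dr t).2.
have da t := derM (d2 t) (dw t).
have w8 t : w t ^+ 8 != 0 by rewrite expf_neq0 // gt_eqF.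
have d8 t : exists l, der (fun t => (w t ^+ 8)^-1) t l.
  have x2 := derM (dw t) (dw t); have x4 := derM x2 x2; have x8 := derM x4 x4.
  eexists; apply: derV => //; apply: (is_derive_ext x8) => r; ring.
have cj : continuous (fun t => S 0 t i o1 * w t / w t ^+ 8).
  by move=> t; have [l hl] := d8 t; exact: is_derive_continuous (derM (da t) hl).
exists (prim (fun t => S 0 t i o1 * w t / w t ^+ 8)); split; first exact: prim0.
  move=> t; have [l1 l2 l3 l4] := LmatE t; have [h1 h2] := dr t; rewrite l1 l2 l3 l4 in h1 h2; split.
  - by apply: (is_derive_eq' (derM h2 (dw t))); field; rewrite !gt_eqF.
  - have wn : sm * w t != 0 by rewrite mulf_neq0 // gt_eqF.
    have dsw := derZ sm (dw t); have hh := derM (derZ (-1) h1) (derV (f := fun s => sm * w s) wn dsw).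
    apply: (is_derive_eq' (is_derive_ext hh _)); first by move=> r; rewrite mulN1r.
    by have := w0 t; move: sm0 em; move: (Num.sqrt m) => q q0 -> wt0; rewrite /cc; field; rewrite !gt_eqF.
  - exact: is_derive_prim.
move=> T F T0; rewrite /prim.
rewrite (Rintegral_nil _ T0) subr0.
have -> : (fun s => (S 0 s *m Mvec k xi s) i ord0 * F) = (fun s => - 2 * kR ^+ 2 * F * (S 0 s i o1 * w s / w s ^+ 8)).
  apply/funext => s; rewrite mxE !big_ord_recl big_ord0 addr0 /Mvec !mxE /=.
  have -> : alpha k xi s `^ (7 / 4) = w s ^+ 7 by rewrite -powR_alpha; congr (_ `^ _); field.
  by field; rewrite gt_eqF.
rewrite RintegralZl //; last exact: cont_integrable.
by ring.
Qed.
End Row.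
End Propagator.

(** * Fourier modes of the solution *)

Section TestFunctions.
Variable R : realType.
Notation C := R[i].
Notation mu := (@lebesgue_measure R).
Notation mR := (measurableTypeR R).
Notation der f t l := (is_derive t (1 : R) f l).

(** Differentiability [n] times through explicit witnesses: stable under sums, products and affine
    substitutions, and converted to iterated [derive1] by [dern_smooth1]. *)
Fixpoint dern (n : nat) (f : R -> R) : Prop :=
  if n is n'.+1 then exists f', (forall y, der f y (f' y)) /\ dern n' f' else True.

Lemma dern_smooth1 f : (forall n, dern n f) -> smooth1 f.
Proof.
move=> h n y; move: (h n.+1) => {h}; elim: n f => [|n IH] f [f' [hf h]]; first by have [] := hf y.
have -> : iter n.+1 (@derive1 R R) f = iter n (@derive1 R R) f'.
  by rewrite iterSr; congr iter; apply/funext => x; have [_ d] := hf x; rewrite derive1E d.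
exact: IH.
Qed.

Lemma dernS n f : dern n.+1 f -> dern n f.
Proof. by elim: n f => [//|n IH] f [f' [hf h]]; exists f'; split => //; exact: IH. Qed.

Lemma dernD n f g : dern n f -> dern n g -> dern n (fun x => f x + g x).
Proof.
elim: n f g => [//|n IH] f g [f' [hf hf']] [g' [hg hg']].
by exists (fun x => f' x + g' x); split; [move=> y; exact: derD|exact: IH].
Qed.

Lemma dernM n f g : dern n f -> dern n g -> dern n (fun x => f x * g x).
Proof.
elim: n f g => [//|n IH] f g hf hg.
have f0 := dernS hf; have g0 := dernS hg; move: hf hg => [f' [hf hf']] [g' [hg hg']].
exists (fun x => f' x * g x + f x * g' x); split; first by move=> y; exact: derM.
by apply: dernD; exact: IH.
Qed.

Lemma dern_cst n (c : R) : dern n (fun=> c).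
Proof. by elim: n c => [//|n IH] c; exists (fun=> 0); split => // y; exact: is_derive_cst. Qed.

Lemma dern_affine n f (a b : R) : dern n f -> dern n (fun x => f (a * x + b)).
Proof.
elim: n f => [//|n IH] f [f' [hf hf']].
exists (fun x => a * f' (a * x + b)); split; last by apply: dernM (dern_cst n a) (IH _ hf').
move=> y; have da : der (fun x => a * x + b) y a.
  by apply: (is_derive_eq' (derD (derZ a (is_derive_id y 1)) (is_derive_cst b y 1))); rewrite mulr1 addr0.
by apply: (is_derive_eq' (is_derive1_comp (hf _) da)); rewrite mulrC.
Qed.

Lemma dern_cossin n : dern n (@cos R) /\ dern n (@sin R).
Proof.
elim: n => [//|n [hc hs]]; split.
  exists (fun x => -1 * sin x); split; last exact: dernM (dern_cst n _) hs.
  by move=> y; rewrite mulN1r; exact: is_derive_cos.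
by exists (@cos R); split => // y; exact: is_derive_sin.
Qed.

(** The span of this family is closed under differentiation, so smoothness at 0 reduces to one
    derivative for each member. *)
Definition flat (n : nat) (x : R) : R := if 0 < x then x^-1 ^+ n * expR (- x^-1) else 0.

(** The exponential of [x^-1] dominates the power [n + 2] of [x^-1 / (n + 2)]: two powers more than
    [x^-1 ^+ n], which leaves a quadratic bound and hence derivative 0 at the origin. *)
Lemma flat_le n x : `|flat n x| <= (n.+2%:R ^+ n.+2) * x ^+ 2.
Proof.
rewrite /flat; case: ifP => [x0|_]; last by rewrite normr0 mulr_ge0 ?sqr_ge0 ?exprn_ge0.
have n0 : 0 < n.+2%:R :> R by rewrite ltr0n.
rewrite ger0_norm; last by apply: mulr_ge0; rewrite ?expR_ge0 // exprn_ge0 // invr_ge0 (ltW x0).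
have h : (x^-1 / n.+2%:R) ^+ n.+2 <= expR x^-1.
  have -> : expR x^-1 = expR (x^-1 / n.+2%:R) ^+ n.+2.
    by rewrite -expRM_natr mulfVK // gt_eqF.
  have q0 : 0 <= x^-1 / n.+2%:R by rewrite divr_ge0 ?invr_ge0 ?(ltW x0).
  apply: lerXn2r; rewrite ?nnegrE ?expR_ge0 //.
  by apply: le_trans (expR_ge1Dx _); rewrite lerDr.
rewrite expRN ler_pdivrMr ?expR_gt0 //.
apply: le_trans (ler_wpM2l _ h); last by rewrite mulr_ge0 ?sqr_ge0 ?exprn_ge0 // (ltW n0).
have e : x^-1 ^+ n.+2 = x^-1 ^+ n * x^-1 ^+ 2 by rewrite -exprD addn2.
have N0 : n.+2%:R ^+ n.+2 != 0 :> R by rewrite expf_neq0 // gt_eqF.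
rewrite exprMn e (exprVn n.+2%:R); move: (_ ^+ n.+2) N0 => A A0; move: (x^-1 ^+ n) => B.
by rewrite le_eqVlt; apply/orP; left; apply/eqP; field; rewrite A0 gt_eqF.
Qed.

Lemma is_derive_flat n x : der (flat n) x (flat n.+2 x - n%:R * flat n.+1 x).
Proof.
have [x0|x0|->] := ltgtP x 0.
- apply: (@near_eq_is_derive _ _ _ (fun=> 0)); rewrite ?oner_eq0 //.
    near=> y; rewrite /flat ltNge; have -> // : y <= 0 by near: y; exact: lt_le_nbhsl.
  rewrite /flat !ltNge (ltW x0) /= mulr0 subr0; exact: is_derive_cst.
- have xn : x != 0 by rewrite gt_eqF.
  apply: (@near_eq_is_derive R R R (fun x : R => x^-1 ^+ n * expR (- x^-1)) (flat n)).
    by near=> y; rewrite /flat; have -> // : 0 < y by near: y; exact: lt_nbhsr.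
  rewrite /flat x0.
  have dv := derV xn (is_derive_id x 1).
  have de : der (fun x => expR (- x^-1)) x _ := is_derive1_comp (is_derive_expR _) (is_deriveN dv).
  have dn : der (fun x : R => x^-1 ^+ n) x (- n%:R * x^-1 ^+ n.+1).
    elim: n => [|n IH]; first by rewrite oppr0 mul0r; exact: is_derive_cst.
    apply: (is_derive_eq' (is_derive_ext (derM dv IH) _)); first by move=> y; rewrite exprS.
    by rewrite !exprS -natr1; field.
  by apply: (is_derive_eq' (derM dn de)); rewrite !exprS; field.
- rewrite {2 3}/flat ltxx mulr0 subr0.
  apply: (@quad_is_derive _ _ _ _ 1 (n.+2%:R ^+ n.+2)); rewrite ?exprn_ge0 // => h _.
  by rewrite add0r mulr0 subr0 [flat n 0]/flat ltxx subr0 flat_le.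
Unshelve. all: by end_near.
Qed.

Lemma dern_flat N n : dern N (flat n).
Proof.
elim: N n => [//|N IH] n; exists (fun x => flat n.+2 x + (- n%:R) * flat n.+1 x); split.
  by move=> y; rewrite mulNr; exact: is_derive_flat.
by apply: dernD => //; exact: dernM (dern_cst N _) (IH _).
Qed.

(** Mass and mollification are integrals over [[-1, 1]], which contains the support when [r <= 1];
    the domain of integration is the same for every width [r]. *)
Record test (r : R) (chi chi' : R -> R) : Prop := Test {
  test_smooth : forall n, dern n chi;
  test_der : forall u, der chi u (chi' u);
  test_cont' : continuous chi';
  test_supp : forall u, r <= `|u| -> chi u = 0;
  test_ge0 : forall u, 0 <= chi u;
  test_mass : \int[mu]_(u in `[-1, 1]) chi u = 1 }.

Lemma test_exists (r : R) : 0 < r <= 1 -> exists chi chi', test r chi chi'.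
Proof.
move=> /andP[r0 r1].
pose f (u : R) := flat 0 (r^-1 * u + 1) * flat 0 (- r^-1 * u + 1).
have f_ge0 u : 0 <= f u.
  by rewrite /f /flat; do 2 case: ifP; rewrite ?mul0r ?mulr0 // !expr0 !mul1r => *; rewrite mulr_ge0 // expR_ge0.
have df n : dern n f by apply: dernM; apply: dern_affine; exact: dern_flat.
have f0 u : r <= `|u| -> f u = 0.
  move=> ru; rewrite /f /flat; case: ifP => h1; last by rewrite mul0r.
  case: ifP => h2; last by rewrite mulr0.
  have : 1 <= r^-1 * `|u| by rewrite mulrC ler_pdivlMr // mul1r.
  rewrite -[X in X * _]gtr0_norm ?invr_gt0 // -normrM ler_normr; move: h1 h2; rewrite mulNr; lra.
have [g [hg [g' [hg' _]]]] := df 2%N.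
have cf : continuous f := der_cont hg.
have Z0 : 0 < \int[mu]_(u in `[-1, 1]) f u.
  have rr : 0 <= r / 2 by rewrite divr_ge0 // ltW.
  have e1 : -1 <= - (r / 2) by lra.
  have e2 : r / 2 <= 1 by lra.
  have e3 : - (r / 2) <= r / 2 by lra.
  rewrite (Rintegral_cat cf e1 (le_trans e3 e2)) (Rintegral_cat cf e3 e2).
  have p a b : 0 <= \int[mu]_(u in `[a, b]) f u by apply: Rintegral_ge0.
  (* On the middle half of the support both factors have argument at least 1/2, hence are at least
     [expR (-2)]. *)
  have : expR (-2) * expR (-2) * r <= \int[mu]_(u in `[- (r / 2), (r / 2)]) f u.
    have er : r = r / 2 - - (r / 2) by lra.
    rewrite [X in _ * X <= _]er -Rint_cst //; apply: le_Rintegral => //; try by apply: cont_integrable => //; exact: cst_continuous.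
    move=> u /=; rewrite in_itv /= => /andP[u1 u2].
    have hu : - 2^-1 <= r^-1 * u <= 2^-1.
      rewrite [r^-1 * u]mulrC ler_pdivlMr // ler_pdivrMr //; lra.
    have key x : 2^-1 <= x -> expR (-2) <= flat 0 x.
      move=> hx; have x0 : 0 < x by lra.
      by rewrite /flat x0 expr0 mul1r ler_expR lerN2 invf_ple ?posrE.
    by apply: ler_pM; rewrite ?expR_ge0 //; apply: key; lra.
  have : 0 < expR (-2) * expR (-2) * r by rewrite !mulr_gt0 ?expR_gt0.
  move=> h1 h2; apply: (lt_le_trans h1); apply: (le_trans h2).
  by rewrite -[leLHS]add0r lerD ?p // lerDl p.
set Z := (X in 0 < X) in Z0.
exists (fun u => Z^-1 * f u), (fun u => Z^-1 * g u); split.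
- by move=> n; exact: dernM (dern_cst n _) (df n).
- by move=> u; exact: derZ.
- by apply: (@der_cont _ _ (fun u => Z^-1 * g' u)) => u; exact: derZ.
- by move=> u /f0 ->; rewrite mulr0.
- by move=> u; rewrite mulr_ge0 // invr_ge0 ltW.
- rewrite RintegralZl //; last exact: cont_integrable.
  by rewrite -/Z mulVf // gt_eqF.
Qed.
End TestFunctions.

(** * Sheared Fourier modes of smooth periodic functions *)

Section ModeFunctions.
Variable R : realType.
Notation C := R[i].
Notation mu := (@lebesgue_measure R).
Notation mR := (measurableTypeR R).
Notation der f t l := (is_derive t (1 : R) f l).
Implicit Types (f g : R -> R -> R -> R).

Lemma smooth3_pdir d f : smooth3 f -> smooth3 (pdir d f).
Proof.
move=> hf ds; have -> : pD ds (pdir d f) = pD (rcons ds d) f; last exact: hf.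
by elim: ds => [//|d' ds /= ->].
Qed.
Lemma smooth3_pt f : smooth3 f -> smooth3 (pt f). Proof. exact: (smooth3_pdir Dt). Qed.
Lemma smooth3_px f : smooth3 f -> smooth3 (px f). Proof. exact: (smooth3_pdir Dx). Qed.
Lemma smooth3_py f : smooth3 f -> smooth3 (py f). Proof. exact: (smooth3_pdir Dy). Qed.

Lemma smooth3_der f t x y : smooth3 f -> [/\ der (fun s => f s x y) t (pt f t x y),
  der (fun s => f t s y) x (px f t x y) & der (fun s => f t x s) y (py f t x y)].
Proof.
move=> hf; have [_ /(_ t x y) [h1 [h2 h3]]] := hf [::].
have dd (g : R -> R) s : derivable g s 1 -> der g s (derive1 g s) by move=> h; rewrite derive1E; exact: derivableP.
exact: And3 (dd (fun s => f s x y) t h1) (dd (fun s => f t s y) x h2) (dd (fun s => f t x s) y h3).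
Qed.

Lemma cpair (T U V : topologicalType) (f : T -> U) (g : T -> V) : continuous f -> continuous g ->
  continuous (fun x => (f x, g x)).
Proof. by move=> cf cg x; exact: (cvg_pair (cf x) (cg x)). Qed.
Lemma ccomp (T U V : topologicalType) (f : T -> U) (g : U -> V) : continuous f -> continuous g ->
  continuous (fun x => g (f x)).
Proof. by move=> cf cg x; apply: continuous_comp; [exact: cf|exact: cg]. Qed.
Lemma cfst (T U : topologicalType) : continuous (fun p : T * U => p.1).
Proof. by move=> p; exact: cvg_fst. Qed.
Lemma csnd (T U : topologicalType) : continuous (fun p : T * U => p.2).
Proof. by move=> p; exact: cvg_snd. Qed.
Lemma caddr (T : topologicalType) (f g : T -> R) : continuous f -> continuous g -> continuous (fun x => f x + g x).
Proof. by move=> cf cg x; apply: cvgD; [exact: cf|exact: cg]. Qed.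
Lemma cmulr (T : topologicalType) (f g : T -> R) : continuous f -> continuous g -> continuous (fun x => f x * g x).
Proof. by move=> cf cg x; apply: cvgM; [exact: cf|exact: cg]. Qed.
Lemma ccstr (T : topologicalType) (c : R) : continuous (fun _ : T => c).
Proof. by move=> x; exact: cvg_cst. Qed.

Lemma smooth3_cont (T : topologicalType) f (a b c : T -> R) : smooth3 f ->
  continuous a -> continuous b -> continuous c -> continuous (fun p => f (a p) (b p) (c p)).
Proof.
move=> hf ca cb cc; have [cf _] := hf [::].
exact: (ccomp (cpair (cpair ca cb) cc) cf).
Qed.

Variable k : int.
Notation kR := (k%:~R : R).
Let K : C := kR%:C * 'i.

Definition ek (x : R) : C := cexp (- (K * x%:C)).
Lemma ccont_ek : ccont ek.
Proof. by apply: ccont_cexp; apply: ccontN; apply: ccontM; [exact: ccont_cst|exact: ccont_RC]. Qed.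

(** Equal to [2 * pi] times the coefficient [xcoef], which cancels the constant in the Parseval
    identity of [is_FT]. *)
Definition Hm (g : R -> R -> R) (w : R) : C := cint `[0, 2 * pi] (fun x => (g x w)%:C * ek x).
(** Multiplication by this phase removes the transport [y d/dx] from the mode and turns [d/dy] into
    [d/dy - i k t]. *)
Definition shear (t w : R) : C := cexp ((kR * t * w)%:C * 'i).
Definition Hs f (t w : R) : C := shear t w * Hm (f t) w.

Let pi2 : 0 <= 2 * pi :> R. Proof. by rewrite mulr_ge0 // pi_ge0. Qed.
Let Hint f t w : smooth3 f -> ccont (fun x => (f t x w)%:C * ek x).
Proof.
move=> hf; apply: ccontM ccont_ek; apply: ccontR;
exact: (@smooth3_cont _ f (fun=> t) id (fun=> w) hf (@ccstr _ _) (fun x => cvg_id) (@ccstr _ _)).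
Qed.

Lemma jcont_shear : jcont shear.
Proof.
apply: ccont_cexp; apply: ccontM (ccont_cst _ _); apply: ccontR; apply: cmulr (@csnd _ _).
by apply: cmulr (@cfst _ _); exact: ccstr.
Qed.

Lemma jcont_Hs f : smooth3 f -> jcont (Hs f).
Proof.
move=> hf; apply: ccontM jcont_shear _.
apply: (@cint_param_cont _ _ (fun (p : R * R) x => (f p.1 x p.2)%:C * ek x) _ _ pi2).
apply: ccontM; last exact: ccont_comp ccont_ek (@csnd _ _).
apply: ccontR; apply: smooth3_cont hf _ (@csnd _ _) _; apply: ccomp (@cfst _ _) _; [exact: cfst|exact: csnd].
Qed.

Lemma cder_Hm_t f t w : smooth3 f -> cder (fun t => Hm (f t) w) t (Hm (pt f t) w).
Proof.
move=> hf; have jc g : smooth3 g -> jcont (fun t x => (g t x w)%:C * ek x).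
  move=> hg; apply: ccontM; last exact: ccont_comp ccont_ek (@csnd _ _).
  by apply: ccontR; apply: smooth3_cont hg (@cfst _ _) (@csnd _ _) (@ccstr _ _).
apply: (cint_param_der (r := 1) pi2 ltr01 (jc _ hf) (jc _ (smooth3_pt hf))) => s x _ _.
have [h _ _] := smooth3_der s x w hf.
by apply: (cder_eq (cderM (cder_R h) (cder_cst (ek x) s))); rewrite mulr0 addr0.
Qed.

Lemma cder_Hm_w f t w : smooth3 f -> cder (Hm (f t)) w (Hm (py f t) w).
Proof.
move=> hf; have jc g : smooth3 g -> jcont (fun w x => (g t x w)%:C * ek x).
  move=> hg; apply: ccontM; last exact: ccont_comp ccont_ek (@csnd _ _).
  by apply: ccontR; apply: smooth3_cont hg (@ccstr _ _) (@csnd _ _) (@cfst _ _).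
apply: (cint_param_der (r := 1) pi2 ltr01 (jc _ hf) (jc _ (smooth3_py hf))) => s x _ _.
have [_ _ h] := smooth3_der t x s hf.
by apply: (cder_eq (cderM (cder_R h) (cder_cst (ek x) s))); rewrite mulr0 addr0.
Qed.

Lemma ek_2pi : ek (2 * pi) = 1.
Proof.
have z1 : cexp ((2 * pi)%:C * 'i) = 1 :> C.
  have -> : 2 * pi = pi *+ 2 :> R by rewrite mulr_natl.
  by rewrite /cexp Rec_mul Imc_mul /= mulr0 mul0r mulr1 mul0r subr0 addr0 expR0 !mul1r cos2pi sin2pi.
have zn n : cexp ((n%:R * (2 * pi))%:C * 'i) = 1 :> C.
  elim: n => [|n IH]; first by rewrite !mul0r cexp0.
  have -> : n.+1%:R = n%:R + 1 :> R by rewrite natr1.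
  by rewrite mulrDl mul1r rmorphD mulrDl cexpD IH z1 mulr1.
rewrite /ek /K mulrAC -rmorphM.
case: k => n; first by rewrite cexpN zn invr1.
by rewrite -mulNr -rmorphN -mulNr NegzE mulrNz opprK zn.
Qed.

Lemma Hm_px f t w : smooth3 f -> xperiodic3 f -> Hm (px f t) w = K * Hm (f t) w.
Proof.
move=> hf pf.
have de x : cder ek x (- K * ek x).
  by apply: cder_cexp; apply: cderN; apply: (cder_eq (cderZ K (cder_id x))); rewrite mulr1.
have d x : cder (fun x => (f t x w)%:C * ek x) x ((px f t x w)%:C * ek x - K * ((f t x w)%:C * ek x)).
  have [_ h _] := smooth3_der t x w hf.
  by apply: (cder_eq (cderM (cder_R h) (de x))); ring.
have c1 := Hint t w (smooth3_px hf); have c2 := Hint t w hf.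
have := cint_FTC pi2 (ccontB c1 (ccontM (ccont_cst _ K) c2)) d.
have -> : f t (2 * pi) w = f t 0 w by rewrite -(pf t 0 w) add0r.
rewrite ek_2pi /ek mulr0 oppr0 cexp0 subrr cintB //; first 2 [exact: ccont_cinteg|exact: ccont_cinteg (ccontM (ccont_cst _ K) c2)].
by rewrite cintZ //; [move=> /eqP; rewrite subr_eq0 => /eqP|exact: ccont_cinteg].
Qed.

(** The sheared mode of the derivative [d/dt + y d/dx] along the flow. *)
Definition HT f (t w : R) : C := Hs (pt f) t w + w%:C * Hs (px f) t w.

Lemma jcont_HT f : smooth3 f -> jcont (HT f).
Proof.
move=> hf; apply: ccontD; first exact: jcont_Hs (smooth3_pt hf).
by apply: ccontM (jcont_Hs (smooth3_px hf)); exact: ccont_comp (@ccont_RC _) (@csnd _ _).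
Qed.

Lemma cder_Hs_t f t w : smooth3 f -> xperiodic3 f -> cder (Hs f ^~ w) t (HT f t w).
Proof.
move=> hf pf.
have d : cder (shear ^~ w) t (K * w%:C * shear t w).
  apply: cder_cexp; have h : der (fun t => kR * t * w) t (kR * w).
    by apply: (is_derive_eq' (derM (derZ kR (is_derive_id t 1)) (is_derive_cst w t 1))); rewrite mulr1 mulr0 addr0.
  by apply: (cder_eq (cderM (cder_R h) (cder_cst 'i t))); rewrite mulr0 addr0 rmorphM mulrAC.
apply: (cder_eq (cderM d (cder_Hm_t t w hf))).
by rewrite /HT /Hs Hm_px //; ring.
Qed.

Lemma cder_Hs_w f t w : smooth3 f -> cder (Hs f t) w (Hs (py f) t w + (kR * t)%:C * 'i * Hs f t w).
Proof.
move=> hf.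
have d : cder (shear t) w ((kR * t)%:C * 'i * shear t w).
  apply: cder_cexp; have h : der (fun w => kR * t * w) w (kR * t).
    by apply: (is_derive_eq' (derZ (kR * t) (is_derive_id w 1))); rewrite mulr1.
  by apply: (cder_eq (cderM (cder_R h) (cder_cst 'i w))); rewrite mulr0 addr0.
by apply: (cder_eq (cderM d (cder_Hm_w t w hf))); rewrite /Hs; ring.
Qed.

(** Transfers a linear relation at fixed height to the modes. Five terms cover each equation of the
    system; shorter ones are padded with zero coefficients. *)
Lemma Hm5 (a1 a2 a3 a4 a5 : R) (f1 f2 f3 f4 f5 : R -> R -> R -> R) t w :
  smooth3 f1 -> smooth3 f2 -> smooth3 f3 -> smooth3 f4 -> smooth3 f5 ->
  (forall x, a1 * f1 t x w + a2 * f2 t x w + a3 * f3 t x w + a4 * f4 t x w + a5 * f5 t x w = 0) ->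
  a1%:C * Hs f1 t w + a2%:C * Hs f2 t w + a3%:C * Hs f3 t w + a4%:C * Hs f4 t w + a5%:C * Hs f5 t w = 0.
Proof.
move=> h1 h2 h3 h4 h5 h.
have I g a : smooth3 g -> cinteg `[0, 2 * pi] (fun x => a%:C * ((g t x w)%:C * ek x)).
  by move=> hg; apply: ccont_cinteg; apply: ccontM (ccont_cst _ _) _; exact: Hint.
have Z g a : smooth3 g -> a%:C * Hm (g t) w = cint `[0, 2 * pi] (fun x => a%:C * ((g t x w)%:C * ek x)).
  by move=> hg; rewrite cintZ //; exact: ccont_cinteg (Hint _ _ hg).
suff : a1%:C * Hm (f1 t) w + a2%:C * Hm (f2 t) w + a3%:C * Hm (f3 t) w + a4%:C * Hm (f4 t) w + a5%:C * Hm (f5 t) w = 0.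
  by move=> e; rewrite /Hs -[RHS](mulr0 (shear t w)) -e; ring.
have J1 := I _ a1 h1; have J2 := I _ a2 h2; have J3 := I _ a3 h3; have J4 := I _ a4 h4; have J5 := I _ a5 h5.
have mI : measurable (`[0, 2 * pi] : set mR) by [].
have J12 := cintegD mI J1 J2; have J123 := cintegD mI J12 J3; have J1234 := cintegD mI J123 J4.
rewrite !Z // -(cintD mI J1 J2) -(cintD mI J12 J3) -(cintD mI J123 J4) -(cintD mI J1234 J5).
rewrite -(mul0r (cint `[0, 2 * pi] ek)) -cintZ //; last exact: ccont_cinteg ccont_ek.
apply: eq_cint => x _; rewrite mul0r !mulrA -!mulrDl.
by rewrite -!rmorphM -!rmorphD /= h mul0r.
Qed.
End ModeFunctions.

(** * Mollified modes and the equations they satisfy *)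

Section Mollified.
Variable R : realType.
Notation C := R[i].
Notation mu := (@lebesgue_measure R).
Notation mR := (measurableTypeR R).
Notation der f t l := (is_derive t (1 : R) f l).

Definition cv (chi : R -> R) (h : R -> R -> C) (t y : R) : C :=
  cint `[-1, 1] (fun u => h t (y + u) * (chi u)%:C).

Let le11 : -1 <= 1 :> R. Proof. by rewrite lerN10 || lra. Qed.

Section Fixed.
Variable chi : R -> R.
Hypothesis cchi : continuous chi.

Let cI (h : R -> R -> C) t y : jcont h -> ccont (fun u => h t (y + u) * (chi u)%:C).
Proof.
move=> hj; apply: ccontM (ccontR cchi).
apply: (@ccont_comp _ _ _ (h t) (fun u => y + u)); first exact: jcont_y.
by apply: caddr; [exact: ccstr|move=> x; exact: cvg_id].
Qed.

Let jcI (h : R * R -> C) : ccont h -> ccont (fun q : R * R * R => h (q.1.1, q.1.2 + q.2) * (chi q.2)%:C).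
Proof.
move=> hj; apply: ccontM; last exact: (@ccont_comp _ _ _ (fun u => (chi u)%:C) _ (ccontR cchi) (@csnd _ _)).
apply: (@ccont_comp _ _ _ h (fun q : R * R * R => (q.1.1, q.1.2 + q.2))) => //.
apply: cpair; first exact: ccomp (@cfst _ _) (@cfst _ _).
by apply: caddr (@csnd _ _); exact: ccomp (@cfst _ _) (@csnd _ _).
Qed.

Lemma jcont_cv h : jcont h -> jcont (cv chi h).
Proof.
move=> hj; apply: (@cint_param_cont _ _ (fun (p : R * R) u => h p.1 (p.2 + u) * (chi u)%:C) _ _ le11).
exact: (jcI hj).
Qed.

Lemma cv_sum3 (c1 c2 c3 : C) (h h1 h2 h3 : R -> R -> C) t y : jcont h1 -> jcont h2 -> jcont h3 ->
  (forall w, h t w = c1 * h1 t w + c2 * h2 t w + c3 * h3 t w) ->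
  cv chi h t y = c1 * cv chi h1 t y + c2 * cv chi h2 t y + c3 * cv chi h3 t y.
Proof.
move=> j1 j2 j3 e.
have I g c : jcont g -> cinteg `[-1, 1] (fun u => c * (g t (y + u) * (chi u)%:C)).
  by move=> hg; apply: ccont_cinteg; apply: ccontM (ccont_cst _ _) _; exact: cI.
have Z g c : jcont g -> c * cv chi g t y = cint `[-1, 1] (fun u => c * (g t (y + u) * (chi u)%:C)).
  by move=> hg; rewrite cintZ //; exact: ccont_cinteg (cI _ _ hg).
have mI : measurable (`[-1, 1] : set mR) by [].
have J1 := I _ c1 j1; have J2 := I _ c2 j2; have J3 := I _ c3 j3.
rewrite !Z // -(cintD mI J1 J2) -(cintD mI (cintegD mI J1 J2) J3).
by apply: eq_cint => u _; rewrite e; ring.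
Qed.

Lemma cder_cv_t (h h' : R -> R -> C) t y : jcont h -> jcont h' ->
  (forall s w, cder (h ^~ w) s (h' s w)) -> cder (cv chi h ^~ y) t (cv chi h' t y).
Proof.
move=> hj hj' d.
have J g : jcont g -> jcont (fun t u => g t (y + u) * (chi u)%:C).
  move=> hg; apply: ccontM; last exact: (@ccont_comp _ _ _ (fun u => (chi u)%:C) _ (ccontR cchi) (@csnd _ _)).
  apply: (@ccont_comp _ _ _ (fun p => g p.1 p.2) (fun q : R * R => (q.1, y + q.2))) => //.
  by apply: cpair (@cfst _ _) _; apply: caddr (@csnd _ _); exact: ccstr.
apply: (cint_param_der (r := 1) le11 ltr01 (J _ hj) (J _ hj')) => s u _ _.
by apply: (cder_eq (cderM (d s (y + u)) (cder_cst _ s))); rewrite mulr0 addr0.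
Qed.

Lemma cder_shift (f : R -> C) (c x : R) l : cder f (x + c) l -> cder (fun x => f (x + c)) x l.
Proof.
have dx : der (fun x : R => x + c) x 1 by apply: is_derive_eq'; rewrite addr0.
by move=> [d1 d2]; split;
  [apply: (is_derive_eq' (is_derive1_comp (f := fun s => Rec (f s)) (g := fun x : R => x + c) d1 dx))|
   apply: (is_derive_eq' (is_derive1_comp (f := fun s => Imc (f s)) (g := fun x : R => x + c) d2 dx))]; rewrite ?mul1r ?mulr1.
Qed.

Lemma cder_cv_y (h h' : R -> R -> C) t y : jcont h -> jcont h' ->
  (forall s w, cder (h s) w (h' s w)) -> cder (cv chi h t) y (cv chi h' t y).
Proof.
move=> hj hj' d.
have J g : jcont g -> jcont (fun y u => g t (y + u) * (chi u)%:C).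
  move=> hg; apply: ccontM; last exact: (@ccont_comp _ _ _ (fun u => (chi u)%:C) _ (ccontR cchi) (@csnd _ _)).
  apply: (@ccont_comp _ _ _ (g t) (fun q : R * R => q.1 + q.2)); first exact: jcont_y.
  exact: caddr (@cfst _ _) (@csnd _ _).
apply: (cint_param_der (r := 1) le11 ltr01 (J _ hj) (J _ hj')) => s u _ _.
by apply: (cder_eq (cderM (cder_shift (d t (s + u))) (cder_cst _ s))); rewrite mulr0 addr0.
Qed.
End Fixed.

Variables (r : R) (chi chi' : R -> R).
Hypotheses (r1 : r <= 1) (tchi : test r chi chi').

Lemma test_cont : continuous chi.
Proof. exact: der_cont (test_der tchi). Qed.

Lemma cv_parts (h h' : R -> R -> C) t y : jcont h -> jcont h' ->
  (forall s w, cder (h s) w (h' s w)) -> cv chi h' t y = - cv chi' h t y.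
Proof.
move=> hj hj' d.
have c1 (g : R -> R -> C) (psi : R -> R) : continuous psi -> jcont g -> ccont (fun u : R => g t (y + u) * (psi u)%:C).
  move=> cp hg; apply: ccontM (ccontR cp).
  apply: (@ccont_comp _ _ _ (g t) (fun u => y + u)); first exact: jcont_y.
  by apply: caddr; [exact: ccstr|move=> x; exact: cvg_id].
have D u : cder (fun u => h t (y + u) * (chi u)%:C) u (h' t (y + u) * (chi u)%:C + h t (y + u) * (chi' u)%:C).
  apply: cderM (cder_R (test_der tchi u)).
  by apply: (cder_ext (cder_shift (f := h t) (c := y) (x := u) (l := h' t (y + u)) _)) => [|v]; rewrite 1?addrC //.
have := cint_FTC le11 (ccontD (c1 _ _ test_cont hj') (c1 _ _ (test_cont' tchi) hj)) D.
rewrite cintD //; first 2 [exact: ccont_cinteg (c1 _ _ test_cont hj')|exact: ccont_cinteg (c1 _ _ (test_cont' tchi) hj)].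
rewrite !(test_supp tchi) ?normrN ?normr1 // !mulr0 subrr => /eqP; rewrite addr_eq0 => /eqP; exact.
Qed.

Variable k : int.
Notation kR := (k%:~R : R).
Let K : C := kR%:C * 'i.
Notation Hk := (Hs k).
Notation HTk := (HT k).

Lemma cder_cv_Hs f t y : smooth3 f ->
  cder (cv chi (Hk f) t) y (cv chi (Hk (py f)) t y + (kR * t)%:C * 'i * cv chi (Hk f) t y).
Proof.
move=> hf; have j1 := jcont_Hs k hf; have j2 := jcont_Hs k (smooth3_py hf).
have jt : jcont (fun t w => (kR * t)%:C * 'i * Hk f t w).
  apply: ccontM _ j1; apply: ccontM (ccont_cst _ _); apply: ccontR.
  by apply: cmulr (@cfst _ _); exact: ccstr.
apply: (cder_eq (cder_cv_y test_cont t y j1 (ccontD j2 jt) (fun s w => cder_Hs_w k s w hf))).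
rewrite (@cv_sum3 _ test_cont 1 ((kR * t)%:C * 'i) 0
  (fun s w => Hk (py f) s w + (kR * s)%:C * 'i * Hk f s w) (Hk (py f)) (Hk f) (Hk f)) //.
  by rewrite mul1r mul0r addr0.
by move=> w /=; rewrite mul1r mul0r addr0.
Qed.

Lemma cv_Hs_py f t y : smooth3 f ->
  cv chi (Hk (py f)) t y = - cv chi' (Hk f) t y - (kR * t)%:C * 'i * cv chi (Hk f) t y.
Proof.
move=> hf; have j1 := jcont_Hs k hf; have j2 := jcont_Hs k (smooth3_py hf).
have jt : jcont (fun t w => (kR * t)%:C * 'i * Hk f t w).
  apply: ccontM _ j1; apply: ccontM (ccont_cst _ _); apply: ccontR.
  by apply: cmulr (@cfst _ _); exact: ccstr.
rewrite -(cv_parts t y j1 (ccontD j2 jt) (fun s w => cder_Hs_w k s w hf)).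
rewrite (@cv_sum3 _ test_cont 1 ((kR * t)%:C * 'i) 0
  (fun s w => Hk (py f) s w + (kR * s)%:C * 'i * Hk f s w) (Hk (py f)) (Hk f) (Hk f)) //.
  by rewrite mul1r mul0r addr0 addrK.
by move=> w /=; rewrite mul1r mul0r addr0.
Qed.

Lemma Hs_px f t w : smooth3 f -> xperiodic3 f -> Hk (px f) t w = K * Hk f t w.
Proof. by move=> hf pf; rewrite /Hs Hm_px // mulrCA. Qed.

Local Opaque cv Hs pt px py.

(* Time derivatives along the shear; the [y]-derivative is put on the test function, so that mixed
   derivatives of the solution are never exchanged. *)
Lemma mode_der (c1 c2 c3 : C) f g1 g2 g3 t y : smooth3 f -> xperiodic3 f ->
  smooth3 g1 -> smooth3 g2 -> smooth3 g3 ->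
  (forall w, HTk f t w = c1 * Hk g1 t w + c2 * Hk g2 t w + c3 * Hk g3 t w) ->
  cder (cv chi (Hk f) ^~ y) t (c1 * cv chi (Hk g1) t y + c2 * cv chi (Hk g2) t y + c3 * cv chi (Hk g3) t y) /\
  cder (cv chi (Hk (py f)) ^~ y) t (c1 * cv chi (Hk (py g1)) t y + c2 * cv chi (Hk (py g2)) t y +
     c3 * cv chi (Hk (py g3)) t y - K * cv chi (Hk f) t y).
Proof.
move=> hf pf h1 h2 h3 e.
have jf := jcont_Hs k hf; have jT := jcont_HT k hf.
have j1 := jcont_Hs k h1; have j2 := jcont_Hs k h2; have j3 := jcont_Hs k h3.
have d (psi : R -> R) : continuous psi -> cder (cv psi (Hk f) ^~ y) t
    (c1 * cv psi (Hk g1) t y + c2 * cv psi (Hk g2) t y + c3 * cv psi (Hk g3) t y).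
  move=> cp; rewrite -(cv_sum3 cp y j1 j2 j3 e).
  exact: (@cder_cv_t psi cp (Hk f) (HTk f) t y jf jT (fun s w => @cder_Hs_t R k f s w hf pf)).
split; first exact: d test_cont.
have dk : cder (fun s => (kR * s)%:C * 'i) t K.
  apply: (cder_eq (cderM (cder_R (derZ kR (is_derive_id t 1))) (cder_cst 'i t))).
  by rewrite mulr1 mulr0 addr0.
apply: (cder_ext (cder_eq (cderB (cderN (d _ (test_cont' tchi))) (cderM dk (d _ test_cont))) _)); last first.
  by move=> s; rewrite cv_Hs_py.
have alg (A B1 B2 B3 D1 D2 D3 Y1 Y2 Y3 K0 q : C) : Y1 = - D1 - q * B1 -> Y2 = - D2 - q * B2 -> Y3 = - D3 - q * B3 ->
  - (c1 * D1 + c2 * D2 + c3 * D3) - (K0 * A + q * (c1 * B1 + c2 * B2 + c3 * B3)) =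
  c1 * Y1 + c2 * Y2 + c3 * Y3 - K0 * A by move=> -> -> ->; ring.
exact: alg (cv_Hs_py t y h1) (cv_Hs_py t y h2) (cv_Hs_py t y h3).
Qed.

Variables (e m : R) (eta ux uy phi : R -> R -> R -> R).
Hypotheses (m0 : m != 0) (seta : smooth3 eta) (sux : smooth3 ux) (suy : smooth3 uy) (sphi : smooth3 phi)
  (peta : xperiodic3 eta) (pux : xperiodic3 ux) (puy : xperiodic3 uy) (pphi : xperiodic3 phi)
  (sol : EP_solution e m eta ux uy phi).
Notation M f := (cv chi (Hk f)).

(** The mollified mode of eta + curl u. *)
Definition modeF (t y : R) : C := M eta t y - M (py ux) t y + K * M uy t y.

(** Conservation of [modeF]: gradients have no curl, and the divergence in the continuity equation
    cancels the one which the shear produces in the equation for curl u. With curl u expressed by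
    it, the elliptic equation for u^y is an algebraic identity. *)
Lemma modes_sys : mode_sys kR m (4 * pi * e ^+ 2) (M eta)
  (fun t y => K * M ux t y + M (py uy) t y) (M uy) (M (py eta)) (M (py (py eta)))
  (fun t y => K * M (py ux) t y + M (py (py uy)) t y) (M (py uy)) (M (py (py uy))) (modeF 0).
Proof.
have pxP (f : R -> R -> R -> R) : smooth3 f -> xperiodic3 f -> xperiodic3 (px f).
  move=> hf pf t x y; have [_ d1 _] := smooth3_der t x y hf; have [_ d2 _] := smooth3_der t (x + 2 * pi) y hf.
  have ds : der (fun x => f t x y) x (px f t (x + 2 * pi) y).
    have dx : der (fun x : R => x + 2 * pi) x 1 by apply: is_derive_eq'; rewrite addr0.
    apply: (is_derive_ext (is_derive_eq' (is_derive1_comp (g := fun x => x + 2 * pi) d2 dx) _)); first by rewrite ?mul1r ?mulr1.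
    by move=> s; exact: pf.
  by case: d1 ds => _ <- [_ <-].
have syeta := smooth3_py seta; have syux := smooth3_py sux; have syuy := smooth3_py suy; have syphi := smooth3_py sphi.
have syyeta := smooth3_py syeta; have syyphi := smooth3_py syphi; have syyuy := smooth3_py syuy.
have cN (x : R) : (- x)%:C = - x%:C :> C by apply: complex_eq; rewrite /= ?oppr0.
have T1 t w : 0 <= t -> HTk eta t w = - K * Hk ux t w + (-1) * Hk (py uy) t w + 0 * Hk eta t w.
  move=> t0; have e0 x : 1 * pt eta t x w + w * px eta t x w + 1 * px ux t x w + 1 * py uy t x w + 0 * eta t x w = 0.
    by have [q _ _ _] := sol x w t0; rewrite -[RHS]q; ring.
  have := @Hm5 R k 1 w 1 1 0 _ _ _ _ _ t w (smooth3_pt seta) (smooth3_px seta) (smooth3_px sux) syuy seta e0.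
  rewrite (Hs_px t w sux pux) /HT; move: (Hk (pt eta) t w) (Hk (px eta) t w) (Hk ux t w) (Hk (py uy) t w) (Hk eta t w) K.
  by move=> a b c d f q h; rewrite -[LHS]subr0 -[X in _ - X = _]h; ring.
have T2 t w : 0 <= t -> HTk ux t w = (-1) * Hk uy t w + (- m^-1%:C * K) * Hk eta t w + ((e / m)%:C * K) * Hk phi t w.
  move=> t0; have e0 x : 1 * pt ux t x w + w * px ux t x w + 1 * uy t x w + m^-1 * px eta t x w + - (e / m) * px phi t x w = 0.
    by have [_ q _ _] := sol x w t0; rewrite mulNr -q; ring.
  have := @Hm5 R k 1 w 1 m^-1 (- (e / m)) _ _ _ _ _ t w (smooth3_pt sux) (smooth3_px sux) suy (smooth3_px seta) (smooth3_px sphi) e0.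
  rewrite (Hs_px t w seta peta) (Hs_px t w sphi pphi) /HT cN.
  move: (Hk (pt ux) t w) (Hk (px ux) t w) (Hk uy t w) (Hk eta t w) (Hk phi t w) K (m^-1%:C) ((e / m)%:C).
  by move=> a b c d f q m' em h; rewrite -[LHS]subr0 -[X in _ - X = _]h; ring.
have T3 t w : 0 <= t -> HTk uy t w = (- m^-1%:C) * Hk (py eta) t w + (e / m)%:C * Hk (py phi) t w + 0 * Hk eta t w.
  move=> t0; have e0 x : 1 * pt uy t x w + w * px uy t x w + m^-1 * py eta t x w + - (e / m) * py phi t x w + 0 * eta t x w = 0.
    by have [_ _ q _] := sol x w t0; rewrite mulNr -q; ring.
  have := @Hm5 R k 1 w m^-1 (- (e / m)) 0 _ _ _ _ _ t w (smooth3_pt suy) (smooth3_px suy) syeta syphi seta e0.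
  rewrite /HT cN.
  move: (Hk (pt uy) t w) (Hk (px uy) t w) (Hk (py eta) t w) (Hk (py phi) t w) (Hk eta t w) (m^-1%:C) ((e / m)%:C).
  by move=> a b c d f m' em h; rewrite -[LHS]subr0 -[X in _ - X = _]h; ring.
have KK : K * K = - (kR ^+ 2)%:C by rewrite /K mulrACA -expr2 -[_ * 'i]expr2 sqr_i mulrN1 rmorphXn.
have T4 t w : 0 <= t -> Hk (py (py phi)) t w = (kR ^+ 2)%:C * Hk phi t w + (4 * pi * e)%:C * Hk eta t w + 0 * Hk eta t w.
  move=> t0; have e0 x : 1 * px (px phi) t x w + 1 * py (py phi) t x w + - (4 * pi * e) * eta t x w + 0 * eta t x w + 0 * eta t x w = 0.
    by have [_ _ _ q] := sol x w t0; rewrite mulNr -q; ring.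
  have epp : Hk (px (px phi)) t w = - (kR ^+ 2)%:C * Hk phi t w.
    by rewrite -KK -mulrA -(Hs_px t w sphi pphi); exact: Hs_px (smooth3_px sphi) (pxP _ sphi pphi).
  have alg (A B D E q p p' : C) : A = - q * D -> p' = - p ->
      1%:C * A + 1%:C * B + p' * E + 0%:C * E + 0%:C * E = 0 -> B = q * D + p * E + 0 * E.
    by move=> -> -> h; rewrite -[LHS]subr0 -[X in _ - X = _]h; ring.
  exact: alg epp (cN _) (@Hm5 R k 1 1 (- (4 * pi * e)) 0 0 _ _ _ _ _ t w (smooth3_px (smooth3_px sphi)) syyphi seta seta seta e0).
have J (f : R -> R -> R -> R) : smooth3 f -> jcont (M f) by move=> hf; exact: (@jcont_cv chi test_cont (Hk f) (jcont_Hs k hf)).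
have JK (f : R -> R -> R -> R) : smooth3 f -> jcont (fun t y => K * M f t y) by move=> hf; apply: ccontM (ccont_cst _ _) (J _ hf).
have M4 t y : 0 <= t -> M (py (py phi)) t y = (kR ^+ 2)%:C * M phi t y + (4 * pi * e)%:C * M eta t y.
  move=> t0; rewrite (cv_sum3 test_cont y (jcont_Hs k sphi) (jcont_Hs k seta) (jcont_Hs k seta) (fun w => T4 t w t0)).
  by rewrite mul0r addr0.
have Neta t y (t0 : 0 <= t) := mode_der y seta peta sux syuy seta (fun w => T1 t w t0).
have Nux t y (t0 : 0 <= t) := mode_der y sux pux suy seta sphi (fun w => T2 t w t0).
have Nuy t y (t0 : 0 <= t) := mode_der y suy puy syeta syphi seta (fun w => T3 t w t0).
have algF (X Py Et Ey Ph K0 mi em : C) : - K0 * X + (-1) * Py + 0 * Et -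
    ((-1) * Py + - mi * K0 * Ey + em * K0 * Ph - K0 * X) + K0 * (- mi * Ey + em * Ph + 0 * Et) = 0 by ring.
have Fcst t y : 0 <= t -> modeF t y = modeF 0 y.
  move=> t0; apply: (cder0_cst (f := modeF ^~ y) t0).
    by apply: jcont_t; apply: ccontD; [apply: ccontB|]; [exact: J|exact: J|exact: JK].
  move=> s /andP[/ltW s0 _].
  apply: (cder_eq (cderD (cderB (Neta s y s0).1 (Nux s y s0).2) (cderZ K (Nuy s y s0).1))).
  exact: algF.
split.
- exact: J. - exact: ccontD (JK _ sux) (J _ syuy). - exact: J. - exact: J. - exact: J.
- exact: ccontD (JK _ syux) (J _ syyuy). - exact: J. - exact: J.
- apply: (jcont_y (g := modeF) 0); apply: ccontD; [apply: ccontB|]; [exact: J|exact: J|exact: JK].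
- move=> t y t0; apply: (cder_eq (Neta t y t0).1).
  have alg (K0 X Y Z : C) : - K0 * X + (-1) * Y + 0 * Z = - (K0 * X + Y) by ring.
  exact: alg.
- move=> t y t0; apply: (cder_eq (cderD (cderZ K (Nux t y t0).1) (Nuy t y t0).2)).
  have ec : (4 * pi * e ^+ 2 / m)%:C = (e / m)%:C * (4 * pi * e)%:C by rewrite -rmorphM; congr (_%:C); field.
  have e2k : - (2 * kR)%:C * 'i = - (2 * K) by rewrite rmorphM rmorph_nat mulNr mulrA.
  have alg (K0 V E E0 F N2 V2 mi em c4 cm k2 a2 : C) : F = k2 * V2 + c4 * E -> cm = em * c4 -> a2 = - (2 * K0) -> K0 * K0 = - k2 ->
    K0 * ((-1) * V + - mi * K0 * E + em * K0 * V2) + (- mi * N2 + em * F + 0 * E0 - K0 * V) =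
    a2 * V - mi * (N2 - k2 * E) + cm * E by move=> -> -> -> h; ring: h.
  exact: alg (M4 t y t0) ec e2k KK.
- by move=> t y; exact: cder_cv_Hs.
- by move=> t y; exact: cder_cv_Hs.
- move=> t y; apply: (cder_eq (cderD (cderZ K (cder_cv_Hs t y sux)) (cder_cv_Hs t y syuy))).
  have alg (K0 q X X1 Y Y1 : C) : K0 * (X1 + q * X) + (Y1 + q * Y) = K0 * X1 + Y1 + q * (K0 * X + Y) by ring.
  exact: alg.
- by move=> t y; exact: cder_cv_Hs.
- by move=> t y; exact: cder_cv_Hs.
- move=> t y t0; have alg (K0 k2 V2 V X E F : C) : F = E - X + K0 * V -> K0 * K0 = - k2 ->
    V2 - k2 * V = K0 * X + V2 + K0 * (F - E) by move=> -> h; ring: h.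
  exact: alg (esym (Fcst t y t0)) KK.
Qed.
End Mollified.

(** * Mollified modes as Fourier integrals *)

Section FourierLink.
Variable R : realType.
Notation C := R[i].
Notation mu := (@lebesgue_measure R).
Notation mR := (measurableTypeR R).
Notation der f t l := (is_derive t (1 : R) f l).

Lemma compact_cinteg (f : R -> C) (M : R) : ccont f -> (forall u, M < `|u| -> f u = 0) ->
  cinteg [set: mR] f /\ cint [set: mR] f = cint `[- M, M] f.
Proof.
move=> cf f0.
have out u : ~ (`[- M, M]%classic : set R) u -> f u = 0.
  move=> h; apply: f0; rewrite ltNge; apply/negP => h'; apply: h.
  by rewrite /= in_itv /= -ler_norml.
split; last first.
  rewrite [RHS]cint_set_indic //; apply: eq_cint => u _; rewrite indicE.
  by case: (boolP (u \in _)) => [_|/negP h]; rewrite ?mulr1 // mulr0 out // => h'; apply: h; rewrite inE.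
have [h1 h2] := ccont_cinteg (- M) M cf.
split; [move: h1|move: h2]; move=> /integrable_mkcond h; (have {h} := h ltac:(exact: measurable_itv));
  congr (integrable _ _ _); apply/funext => u; rewrite patchE; case: ifPn => // /negP hu;
  by rewrite /= out // => h'; apply: hu; rewrite inE.
Qed.

Lemma cinteg_shift (c : R) (f : R -> C) : cinteg [set: mR] f -> cinteg [set: mR] (fun x => f (x + c)).
Proof. by move=> [h1 h2]; split; [exact: (integrable_shift c h1)|exact: (integrable_shift c h2)]. Qed.

(** The conjugate of the Fourier transform of the real function [psi], as it occurs in Parseval's
    identity. *)
Definition ftest (psi : R -> R) (xi : R) : C :=
  cint [set: mR] (fun v => cexp ('i * xi%:C * v%:C) * (psi v)%:C).

Lemma cexp_i (x : R) : cexp (x%:C * 'i) = cos x +i* sin x.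
Proof. by rewrite /cexp Rec_mul Imc_mul /= mulr0 mul0r mulr1 mul0r subr0 addr0 expR0 !mul1r. Qed.

Lemma cexp_ii (x y : R) : cexp ('i * x%:C * y%:C) = cos (x * y) +i* sin (x * y).
Proof. by rewrite -mulrA -rmorphM mulrC cexp_i. Qed.

Section Link.
Variables (k : int) (g : R -> R -> R) (G : int -> R -> R * R).
Notation kR := (k%:~R : R).
Hypotheses (cg : forall w, continuous (fun x => g x w)) (cH : ccont (Hm k g)) (hG : is_FT g G).
Definition Gc (xi : R) : C := (G k xi).1 +i* (G k xi).2.

Lemma Hm_xcoef w : Hm k g w = (2 * pi)%:C * ((xcoef g k w).1 +i* (xcoef g k w).2).
Proof.
have p0 : 2 * pi != 0 :> R by rewrite mulf_neq0 // gt_eqF // pi_gt0.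
have eK x : ek k x = cos (kR * x) +i* - sin (kR * x).
  by rewrite /ek mulrAC -rmorphM -mulNr -rmorphN cexp_i cosN sinN.
have cI (h : R -> R) : continuous h -> mu.-integrable `[0, 2 * pi] (EFin \o (fun x => h (kR * x) * g x w)).
  move=> ch; apply: cont_integrable; apply: (@cmulr _ _ (fun x => h (kR * x)) (g ^~ w)); last exact: cg.
  apply: (@ccomp _ _ _ (fun x => kR * x) h _ ch).
  by apply: cmulr; [exact: ccstr|move=> x; exact: cvg_id].
have e1 : Rec (Hm k g w) = \int[mu]_(x in `[0, 2 * pi]) (cos (kR * x) * g x w).
  by rewrite /Hm cintRec; apply: eq_Rintegral => x _; rewrite eK Rec_mul /= mul0r subr0 mulrC.
have e2 : Imc (Hm k g w) = - \int[mu]_(x in `[0, 2 * pi]) (sin (kR * x) * g x w).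
  rewrite -mulN1r -RintegralZl //; last exact: cI (@sin R) (@continuous_sin R).
  by rewrite /Hm cintImc; apply: eq_Rintegral => x _; rewrite eK Imc_mul /= mul0r addr0 mulN1r mulrN mulrC.
apply: complex_eq; rewrite ?e1 ?e2 ?Rec_mul ?Imc_mul /= mul0r ?subr0 ?addr0 /xcoef /Tper /= ?mulrN mulVKf //.
Qed.

Lemma ftest_pair (psi : R -> R) (M : R) : (forall n, dern n psi) -> (forall u, M < `|u| -> psi u = 0) ->
  cinteg [set: mR] (fun xi => Gc xi * ftest psi xi) /\
  cint [set: mR] (fun v => Hm k g v * (psi v)%:C) = cint [set: mR] (fun xi => Gc xi * ftest psi xi).
Proof.
move=> hs h0; have p0 : 2 * pi != 0 :> R by rewrite mulf_neq0 // gt_eqF // pi_gt0.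
have cs : compact_supp psi by exists M.
have [i1 i2 e1 e2] := hG k (dern_smooth1 hs) cs.
have eR xi : Rec (ftest psi xi) = \int[mu]_y (cos (xi * y) * psi y).
  by rewrite cintRec; apply: eq_Rintegral => v _; rewrite cexp_ii Rec_mul /= mulr0 subr0.
have eI xi : Imc (ftest psi xi) = \int[mu]_y (sin (xi * y) * psi y).
  by rewrite cintImc; apply: eq_Rintegral => v _; rewrite cexp_ii Imc_mul /= mulr0 add0r.
have fR xi : Rec (Gc xi * ftest psi xi) =
    (G k xi).1 * \int[mu]_y (cos (xi * y) * psi y) - (G k xi).2 * \int[mu]_y (sin (xi * y) * psi y).
  by rewrite Rec_mul eR eI.
have fI xi : Imc (Gc xi * ftest psi xi) =
    (G k xi).1 * \int[mu]_y (sin (xi * y) * psi y) + (G k xi).2 * \int[mu]_y (cos (xi * y) * psi y).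
  by rewrite Imc_mul eR eI.
have j1 : mu.-integrable [set: mR] (EFin \o (fun xi => Rec (Gc xi * ftest psi xi))).
  have -> : (fun xi => Rec (Gc xi * ftest psi xi)) = _ := funext fR; exact: i1.
have j2 : mu.-integrable [set: mR] (EFin \o (fun xi => Imc (Gc xi * ftest psi xi))).
  have -> : (fun xi => Imc (Gc xi * ftest psi xi)) = _ := funext fI; exact: i2.
split => //.
have [d1 [hd1 _]] := hs 1%N; have cpsi : continuous psi := der_cont hd1.
have cHp : ccont (fun v => Hm k g v * (psi v)%:C) := ccontM cH (ccontR cpsi).
have [I1 I2] := (compact_cinteg (M := M) cHp (fun u h => ltac:(by cbv beta; rewrite (h0 u h) mulr0))).1.
have a1 v : Rec (Hm k g v * (psi v)%:C) = (2 * pi) * ((xcoef g k v).1 * psi v).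
  by rewrite Hm_xcoef !Rec_mul /= !(mul0r, mulr0, subr0) mulrA.
have a2 v : Imc (Hm k g v * (psi v)%:C) = (2 * pi) * ((xcoef g k v).2 * psi v).
  by rewrite Hm_xcoef !Imc_mul /= !(mul0r, mulr0, add0r, addr0) mulrA.
have key (f h : R -> R) (z : R) : (forall v, f v = (2 * pi) * h v) -> mu.-integrable [set: mR] (EFin \o f) ->
    \int[mu]_v h v = (2 * pi)^-1 * z -> \int[mu]_v f v = z.
  move=> e If eh; have ef : h = (fun v => (2 * pi)^-1 * f v) by apply/funext => v; rewrite e mulKf.
  by apply: (mulfI (x := (2 * pi)^-1)); [rewrite invr_eq0|rewrite -eh ef RintegralZl].
apply: complex_eq; rewrite !(cintRec, cintImc).
  by apply: (key _ _ _ a1 I1); rewrite e1; congr (_ * _); apply: eq_Rintegral => xi _; rewrite fR.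
by apply: (key _ _ _ a2 I2); rewrite e2; congr (_ * _); apply: eq_Rintegral => xi _; rewrite fI.
Qed.

Variables (r : R) (chi chi' : R -> R) (T : R).
Hypotheses (r1 : r <= 1) (tchi : test r chi chi').
(** The shear shifts frequencies by [k T], and the mollifier multiplies by its transform; unlike
    [Gc] alone, the product is known to be integrable. *)
Definition FX (eta : R) : C := Gc (eta - kR * T) * ftest chi eta.

(** The test function at work is [exp (i k T v) chi (v - y)], while [is_FT] admits real ones only:
    its real and imaginary parts [pc] and [ps] are paired separately and recombined in [Q]. *)
Theorem cv_FI : cinteg [set: mR] FX /\
  forall y, cint `[-1, 1] (fun u => shear k T (y + u) * Hm k g (y + u) * (chi u)%:C) = FI FX y.
Proof.
have tc := test_cont tchi.
have chi0 u : 1 < `|u| -> chi u = 0 by move=> h; apply: (test_supp tchi); apply: le_trans (ltW h).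
(* The trivial coefficients 1 and 0 give the arguments the shape expected by [dern_affine]. *)
pose pc y v := cos (kR * T * v + 0) * chi (1 * v + - y); pose ps y v := sin (kR * T * v + 0) * chi (1 * v + - y).
have dc y n : dern n (pc y).
  by apply: dernM; apply: dern_affine; [case: (dern_cossin R n)|exact: test_smooth tchi n].
have ds y n : dern n (ps y).
  by apply: dernM; apply: dern_affine; [case: (dern_cossin R n)|exact: test_smooth tchi n].
have sc y u : 1 + `|y| < `|u| -> chi (1 * u + - y) = 0.
  by move=> h; apply: chi0; rewrite mul1r; have := lerB_dist u y; lra.
have [Ic Is] : (forall y, cinteg [set: mR] (fun xi => Gc xi * ftest (pc y) xi)) /\
    (forall y, cinteg [set: mR] (fun xi => Gc xi * ftest (ps y) xi)).
  split=> y; [apply: (ftest_pair (M := 1 + `|y|) (dc y) _).1|apply: (ftest_pair (M := 1 + `|y|) (ds y) _).1] => u /sc h;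
    by rewrite /pc /ps h mulr0.
have Ec y := (ftest_pair (dc y) (M := 1 + `|y|) (fun u h => ltac:(by rewrite /pc (sc y u h) mulr0))).2.
have Es y := (ftest_pair (ds y) (M := 1 + `|y|) (fun u h => ltac:(by rewrite /ps (sc y u h) mulr0))).2.
have cexpc xi : ccont (fun v : R => cexp ('i * xi%:C * v%:C)).
  by apply: ccont_cexp; apply: ccontM (ccont_cst _ _) (@ccont_RC _).
have csh y : continuous (fun v : R => chi (1 * v + - y)).
  apply: (ccomp _ tc); apply: caddr; last exact: ccstr.
  by apply: cmulr; [exact: ccstr|move=> x; exact: cvg_id].
have smul y (h : R -> R) : continuous h -> continuous (fun v : R => h (kR * T * v + 0) * chi (1 * v + - y)).
  move=> ch; apply: cmulr (csh y); apply: (ccomp _ ch); apply: caddr; last exact: ccstr.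
  by apply: cmulr; [exact: ccstr|move=> x; exact: cvg_id].
have cshear v : shear k T v = cos (kR * T * v + 0) +i* sin (kR * T * v + 0) by rewrite /shear cexp_i addr0.

have Q y xi : ftest (pc y) xi + 'i * ftest (ps y) xi =
    cexp ('i * (xi + kR * T)%:C * y%:C) * ftest chi (xi + kR * T).
  have cp (h : R -> R) : continuous h -> cinteg [set: mR] (fun v => cexp ('i * xi%:C * v%:C) *
      (h (kR * T * v + 0) * chi (1 * v + - y))%:C).
    move=> ch; apply: (compact_cinteg (M := 1 + `|y|) _ _).1.
      by apply: ccontM (cexpc xi) (ccontR _); exact: smul.
    by move=> u /sc ->; rewrite !mulr0.
  rewrite {1 2}/ftest -(@cintZ R setT (fun v => cexp ('i * xi%:C * v%:C) * (ps y v)%:C)) //; last exact: cp (@sin R) (@continuous_sin R).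
  rewrite -cintD //; [|exact: cp (@cos R) (@continuous_cos R)|apply: cintegZ => //; exact: cp (@sin R) (@continuous_sin R)].
  have hI : cinteg [set: mR] (fun v => cexp ('i * (xi + kR * T)%:C * v%:C) * (chi v)%:C).
    apply: (compact_cinteg (M := 1) _ _).1; first exact: ccontM (cexpc _) (ccontR tc).
    by move=> u /chi0 ->; rewrite mulr0.
  rewrite [RHS](_ : _ = cint [set: mR] (fun v => cexp ('i * (xi + kR * T)%:C * y%:C) *
      (cexp ('i * (xi + kR * T)%:C * (v - y)%:C) * (chi (v - y))%:C))); last first.
    have cs := cint_shift (- y) (cintegZ (cexp ('i * (xi + kR * T)%:C * y%:C)) (@measurableT _ mR) hI).
    by rewrite /ftest -cintZ // -[LHS]cs.
  apply: eq_cint => v _.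
  have -> : cexp ('i * (xi + kR * T)%:C * y%:C) * (cexp ('i * (xi + kR * T)%:C * (v - y)%:C) * (chi (v - y))%:C) =
      cexp ('i * xi%:C * v%:C) * (shear k T v * (chi (v - y))%:C).
    rewrite mulrA -cexpD [RHS]mulrA /shear -cexpD; congr (cexp _ * _).
    by apply: complex_eq; rewrite !RecE /=; ring.
  rewrite /pc /ps mul1r cshear mulrCA -mulrDr; congr (_ * _).
  by apply: complex_eq; rewrite !RecE /=; ring.
have QI y : cinteg [set: mR] (fun xi => Gc xi * (cexp ('i * (xi + kR * T)%:C * y%:C) * ftest chi (xi + kR * T))).
  apply: (eq_cinteg (f := fun xi => Gc xi * ftest (pc y) xi + 'i * (Gc xi * ftest (ps y) xi))) => //.
    by move=> xi _; rewrite -Q; ring.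
  by apply: cintegD => //; exact: cintegZ.
have IX : cinteg [set: mR] FX.
  have := cinteg_shift (- (kR * T)) (QI 0); apply: eq_cinteg => // eta _.
  by rewrite subrK mulr0 cexp0 mul1r.
split=> // y.
have LHS : cint `[-1, 1] (fun u => shear k T (y + u) * Hm k g (y + u) * (chi u)%:C) =
    cint [set: mR] (fun v => Hm k g v * (pc y v)%:C + 'i * (Hm k g v * (ps y v)%:C)).
  have cc : ccont (fun v => shear k T v * Hm k g v * (chi (v - y))%:C).
    apply: ccontM; first exact: ccontM (jcont_y T (jcont_shear R k)) cH.
    apply: ccontR; apply: (@ccomp _ _ _ (fun v : R => v - y) chi _ tc).
    by apply: (@caddr _ _ id (fun=> - y)); [move=> x; exact: cvg_id|exact: ccstr].
  have cc' : ccont (fun u => shear k T (y + u) * Hm k g (y + u) * (chi u)%:C).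
    have cy : continuous (fun u : R => y + u) by apply: caddr; [exact: ccstr|move=> x; exact: cvg_id].
    apply: ccontM (ccontR tc); apply: ccontM.
      exact: (ccont_comp (jcont_y T (jcont_shear R k)) cy).
    exact: (ccont_comp cH cy).
  have [_ <-] := compact_cinteg (M := 1) cc' (fun u h => ltac:(by cbv beta; rewrite (chi0 u h) mulr0)).
  have [jj _] := compact_cinteg (M := 1 + `|y|) cc (fun u h => ltac:(by cbv beta; have := sc y u h; rewrite mul1r => ->; rewrite mulr0)).
  transitivity (cint [set: mR] (fun v : R => shear k T v * Hm k g v * (chi (v - y))%:C)).
    by rewrite -[RHS](cint_shift y jj); apply: eq_cint => u _; rewrite addrK (addrC u).
  apply: eq_cint => v _; rewrite cshear /pc /ps mul1r.
  by move: (Hm k g v) => hv; apply: complex_eq; rewrite !RecE /=; ring.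
have HI (h : R -> R) : continuous h -> cinteg [set: mR] (fun v => Hm k g v * (h (kR * T * v + 0) * chi (1 * v + - y))%:C).
  move=> ch; apply: (compact_cinteg (M := 1 + `|y|) _ _).1; first by apply: ccontM cH (ccontR _); exact: smul.
  by move=> u /sc ->; rewrite !mulr0.
rewrite LHS cintD //; [|exact: HI (@cos R) (@continuous_cos R)|apply: cintegZ => //; exact: HI (@sin R) (@continuous_sin R)].
rewrite cintZ //; last exact: HI (@sin R) (@continuous_sin R).
rewrite Ec Es -cintZ // -cintD //; last exact: cintegZ.
rewrite /FI -[RHS](cint_shift (kR * T) (FI_cinteg y IX)).
by apply: eq_cint => xi _; rewrite /FX addrK mulrCA -mulrDr Q; ring.
Qed.

Lemma ftest_near1 eta : 0 < r -> normc (ftest chi eta - 1) <= 4 * `|eta| * r.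
Proof.
move=> r0; have tc := test_cont tchi.
have chi0 u : 1 < `|u| -> chi u = 0 by move=> h; apply: (test_supp tchi); apply: le_trans (ltW h).
have ce : ccont (fun v : R => cexp ('i * eta%:C * v%:C) * (chi v)%:C).
  by apply: ccontM (ccontR tc); apply: ccont_cexp; apply: ccontM (ccont_cst _ _) (@ccont_RC _).
have [_ e1] := compact_cinteg (M := 1) ce (fun u h => ltac:(by cbv beta; rewrite (chi0 u h) mulr0)).
have e2 : (1 : C) = cint `[-1, 1] (fun v => (chi v)%:C).
  apply: complex_eq; first by rewrite cintRec /= (test_mass tchi).
  by rewrite cintImc /= Rint_cst ?mul0r // ; lra.
rewrite /ftest e1 e2 -cintB //; first 2 [exact: ccont_cinteg|exact: ccont_cinteg (ccontR tc)].
have ci := cont_integrable (-1) 1 tc.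
have b v : normc (cexp ('i * eta%:C * v%:C) * (chi v)%:C - (chi v)%:C) <= 2 * `|eta| * r * chi v.
  rewrite -[X in _ - X]mul1r -mulrBl normcM normcR (ger0_norm (test_ge0 tchi v)).
  have [vr|rv] := ltP `|v| r; last by rewrite (test_supp tchi rv) !mulr0.
  apply: ler_wpM2r; first exact: test_ge0 tchi v.
  have z0 : Rec (0 : C) <= 0 by [].
  have := @cexp_lip R 0 ('i * eta%:C * v%:C) 0 z0; rewrite cexp0 subr0 expR0 mulr1 => h.
  have h' : Rec ('i * eta%:C * v%:C) <= 0 by rewrite !RecE /=; lra.
  apply: (le_trans (h h')); rewrite !normcM normc_i !normcR mul1r mulrA.
  by apply: ler_wpM2l; [rewrite mulr_ge0|exact: ltW].
have bI : mu.-integrable `[-1, 1] (EFin \o (fun v => 2 * `|eta| * r * chi v)) by apply: integrableZ'.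
apply: (le_trans (cint_le _ _ bI _)) => //.
  by apply: cintegB => //; [exact: ccont_cinteg|exact: ccont_cinteg (ccontR tc)].
by rewrite RintegralZl // (test_mass tchi); lra.
Qed.
End Link.
End FourierLink.

(** * Square integrals and Fatou *)

Import HBNNSimple.

Section Plancherel.
Variable R : realType.
Notation C := R[i].
Notation mu := (@lebesgue_measure R).
Notation mR := (measurableTypeR R).

(* [f] need not be measurable: the integral of a nonnegative function is a supremum over simple
   minorants. *)
Lemma le_int_ae (f g : R -> \bar R) : (forall x, 0 <= f x)%E -> (forall x, 0 <= g x)%E ->
  measurable_fun [set: mR] g -> {ae mu, forall x, (f x <= g x)%E} -> (\int[mu]_x f x <= \int[mu]_x g x)%E.
Proof.
move=> f0 g0 mg fg; rewrite [leLHS]ge0_integralTE //; apply: ub_ereal_sup => _ [h hf <-].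
have := @integral_nnsfun _ mR R mu setT measurableT h; rewrite patch_setT => <-.
apply: ae_ge0_le_integral => //.
- by move=> x _; rewrite lee_fin; exact: fun_ge0.
- exact/measurable_EFinP.
- apply: (@filterS _ _ (ae_filter_ringOfSetsType mu) _ _ _ fg) => x h1 _; exact: le_trans (hf x) h1.
Qed.

Lemma limn_einf_ge (u : nat -> \bar R) (l : R) :
  (forall e : R, 0 < e -> exists n0, forall n, (n0 <= n)%N -> (l%:E <= u n + e%:E)%E) -> (l%:E <= limn_einf u)%E.
Proof.
move=> h; apply/lee_addgt0Pr => e e0; have [n0 hn] := h e e0.
rewrite -leeBlDr //; rewrite limn_einf_lim; apply: lime_ge; first exact: is_cvg_einfs.
exists n0 => // n /= n0n; apply: le_ereal_inf_tmp => _ [j /= nj <-].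
by rewrite EFinN leeBlDr // hn // (leq_trans n0n).
Qed.

Lemma limn_einf_int (F : nat -> R -> \bar R) (B : \bar R) :
  (forall n, measurable_fun [set: mR] (F n)) -> (forall n x, 0 <= F n x)%E -> (forall n, \int[mu]_x F n x <= B)%E ->
  [/\ measurable_fun [set: mR] (fun x => limn_einf (F ^~ x)), forall x, (0 <= limn_einf (F ^~ x))%E &
    (\int[mu]_x limn_einf (F ^~ x) <= B)%E].
Proof.
move=> mF F0 hB; split.
- under eq_fun do rewrite limn_einf_lim.
  apply: (emeasurable_fun_cvg (fun n x => einfs (F ^~ x) n)).
    by move=> n; exact: measurable_fun_einfs.
  by move=> x _; exact: is_cvg_einfs.
- by move=> x; apply: limn_einf_ge => e e0; exists 0%N => n _; rewrite adde_ge0 // lee_fin ltW.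
- apply: (le_trans (fatou _ measurableT mF _)) => //.
  rewrite limn_einf_lim; apply: lime_le; first exact: is_cvg_einfs.
  by exists 0%N => // n _; apply: (le_trans _ (hB n)); apply: ereal_inf_lbound; exists n => /=.
Qed.

Lemma fatou_bound (F : nat -> R -> R) (f : R -> R) (B : \bar R) :
  (forall n, measurable_fun [set: mR] (F n)) -> (forall n x, 0 <= F n x) -> (forall x, 0 <= f x) ->
  (forall n, \int[mu]_x (F n x)%:E <= B)%E ->
  (forall x (e : R), 0 < e -> exists n0, forall n, (n0 <= n)%N -> f x <= F n x + e) ->
  (\int[mu]_x (f x)%:E <= B)%E.
Proof.
move=> mF F0 f0 hB hf.
have [mG G0] := @limn_einf_int (fun n x => (F n x)%:E) B (fun n => (measurable_EFinP _ _).2 (mF n))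
  (fun n x => F0 n x) hB.
apply: le_trans; apply: le_int_ae => //; apply: nearW => x; apply: limn_einf_ge => e e0.
by have [n0 hn] := hf x e e0; exists n0 => n /hn h; rewrite -EFinD lee_fin.
Qed.

(** Iterated lower limits: the inner index is the distance to the imaginary axis, the outer one the
    width of the mollifier. [G] provides a measurable majorant for limits whose own measurability is
    not established. *)
Lemma fatou2 (F : nat -> nat -> R -> R) (B : \bar R) :
  (forall j n, measurable_fun [set: mR] (F j n)) -> (forall j n x, 0 <= F j n x) ->
  (forall j n, \int[mu]_x (F j n x)%:E <= B)%E ->
  exists G : R -> \bar R, [/\ measurable_fun [set: mR] G, forall x, (0 <= G x)%E, (\int[mu]_x G x <= B)%E &
    forall x l, (forall e : R, 0 < e -> exists j0, forall j, (j0 <= j)%N -> exists n0, forall n, (n0 <= n)%N ->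
      l <= F j n x + e) -> (l%:E <= G x)%E].
Proof.
move=> mF F0 hB.
have h j := @limn_einf_int (fun n x => (F j n x)%:E) B (fun n => (measurable_EFinP _ _).2 (mF j n))
  (fun n x => F0 j n x) (hB j).
have [mG G0 GB] := @limn_einf_int (fun j x => limn_einf (fun n => (F j n x)%:E)) B
  (fun j => let: And3 a _ _ := h j in a) (fun j => let: And3 _ a _ := h j in a) (fun j => let: And3 _ _ a := h j in a).
exists (fun x => limn_einf (fun j => limn_einf (fun n => (F j n x)%:E))); split => // x l hl.
apply: limn_einf_ge => e e0; have [j0 hj] := hl e e0; exists j0 => j /hj [n0 hn].
rewrite -leeBlDr // -EFinB; apply: limn_einf_ge => e' e'0; exists n0 => n /hn h1.
by rewrite -EFinD lee_fin; lra.
Qed.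

Definition cj (z : C) : C := Rec z +i* - Imc z.
Lemma cjM (z w : C) : cj (z * w) = cj z * cj w.
Proof. by apply: complex_eq; rewrite /cj !RecE /=; ring. Qed.
Lemma normc_cj (z : C) : normc (cj z) = normc z.
Proof. by rewrite !normc_sqrtE /= sqrrN. Qed.
Lemma mul_cj (z : C) : z * cj z = (normc z ^+ 2)%:C.
Proof. by rewrite sqr_normcE; apply: complex_eq; rewrite /cj !RecE /=; ring. Qed.
Lemma cinteg_cj (f : R -> C) : cinteg [set: mR] f -> cinteg [set: mR] (fun x => cj (f x)).
Proof.
move=> [h1 h2]; split => //; have := integrableZ' (-1) (@measurableT _ mR) h2.
by congr (integrable _ _ _); apply/funext => x; rewrite /= mulN1r.
Qed.
Lemma cint_cj (f : R -> C) : cinteg [set: mR] f -> cint [set: mR] (fun x => cj (f x)) = cj (cint [set: mR] f).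
Proof.
move=> [h1 h2]; apply: complex_eq => //; rewrite cintImc [RHS](_ : _ = - Imc (cint [set: mR] f)) // cintImc -mulN1r -RintegralZl //.
by apply: eq_Rintegral => x _; rewrite /= mulN1r.
Qed.

Lemma cinteg_indic (D : set mR) (f : R -> C) : measurable D -> cinteg D f ->
  cinteg [set: mR] (fun y => f y * (\1_D y)%:C).
Proof.
move=> mD [h1 h2].
have e x : f x * (\1_D x)%:C = if x \in D then f x else 0.
  by rewrite indicE; case: (x \in D); rewrite ?mulr1 ?mulr0.
split; [move: h1|move: h2] => /(integrable_mkcond _ mD); congr (integrable _ _ _);
  by apply/funext => x; rewrite /= e patchE; case: (x \in D).
Qed.

Lemma FI_mult (a b : R -> C) : cinteg [set: mR] a -> cinteg [set: mR] b ->
  cint [set: mR] (fun s => a s * FI b s) = cint [set: mR] (fun y => b y * FI a y).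
Proof.
move=> ia ib; have [[a1 a2] [b1 b2]] := (cinteg_cmeas ia, cinteg_cmeas ib).
pose P (p : mR * mR) : C := b p.1 * a p.2 * cexp ('i * (p.1)%:C * (p.2)%:C).
have mc (h : R -> R) : continuous h -> measurable_fun [set: mR * mR] (fun p => h (p.1 * p.2)).
  move=> ch; apply: (measurableT_comp (f := h)); first exact: continuous_measurable_fun.
  exact: measurable_funM.
have m1 (h : R -> R) : measurable_fun [set: mR] h -> measurable_fun [set: mR * mR] (fun p => h p.1).
  by move=> mh; apply: measurableT_comp.
have m2 (h : R -> R) : measurable_fun [set: mR] h -> measurable_fun [set: mR * mR] (fun p => h p.2).
  by move=> mh; apply: measurableT_comp.
have [b1' b2' a1' a2'] := And4 (m1 _ b1) (m1 _ b2) (m2 _ a1) (m2 _ a2).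
have [cc cs] := (mc _ (@continuous_cos R), mc _ (@continuous_sin R)).
have PR : measurable_fun setT (fun p => Rec (P p)).
  under eq_fun do rewrite /P cexp_ii !(Rec_mul, Imc_mul) /=.
  by apply: measurable_funB; apply: measurable_funM => //; [apply: measurable_funB|apply: measurable_funD]; apply: measurable_funM.
have PI : measurable_fun setT (fun p => Imc (P p)).
  under eq_fun do rewrite /P cexp_ii !(Rec_mul, Imc_mul) /=.
  by apply: measurable_funD; apply: measurable_funM => //; [apply: measurable_funB|apply: measurable_funD]; apply: measurable_funM.
have bP (x y : R) : normc (P (x, y)) <= normc (b x) * normc (a y).
  by rewrite /P /= !normcM normc_cexp_i mulr1.
have F := cfubini (P := P) (A := fun x => normc (b x)) (E := fun x => normc (a x)) PR PI bP
  (cinteg_normc measurableT ib) (cinteg_normc measurableT ia).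
transitivity (cint [set: mR] (fun y => cint [set: mR] (fun x => P (x, y)))).
  apply: eq_cint => y _; rewrite /FI -(cintZ (a y) measurableT (FI_cinteg y ib)).
  by apply: eq_cint => x _; rewrite /P /= mulrCA mulrA.
rewrite F; apply: eq_cint => x _; rewrite /FI -(cintZ (b x) measurableT (FI_cinteg x ia)).
by apply: eq_cint => y _; rewrite /P /= -mulrA; congr (_ * (_ * cexp _)); ring.
Qed.

Lemma Lap_line (g : R -> C) (B e s : R) : ccont g -> (forall y, 0 <= y -> normc (g y) <= B) -> 0 < e ->
  ccont (fun xi : R => Lap g (e%:C + 'i * (s * xi)%:C)).
Proof.
move=> cg bg e0; apply: cder_cont => t.
pose rho := normc (e%:C + 'i * (s * t)%:C) + 1.
pose D := [set z : C | e / 2 < Rec z /\ normc z < rho].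
have e2 : 0 < e / 2 by rewrite divr_gt0.
have [f' hf] := Lap_hol cg bg e2 (D := D) (fun z h => ltW h.1).
have [K K1 [_ hK]] : exists2 K : R, 1 <= K & (forall z, D z -> normc (Lap g z) <= K /\ normc (f' z) <= K) /\
  (forall z w, D z -> D w -> normc (Lap g w - Lap g z - f' z * (w - z)) <= K * normc (w - z) ^+ 2).
  by have [K K1 h] := holu_K hf; exists K => //; exact: (h tt Logic.I).
have oD : copen D by exact: line_copen.
have Dt : D (e%:C + t%:C * ('i * s%:C)).
  have -> : e%:C + t%:C * ('i * s%:C) = e%:C + 'i * (s * t)%:C by rewrite rmorphM; ring.
  split; last by rewrite /rho ltrDl.
  by rewrite !RecE /=; lra.
eexists; apply: (cder_ext (holo_cder (le_trans ler01 K1) oD hK Dt)) => xi.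
by congr (Lap g _); rewrite rmorphM; ring.
Qed.

Lemma FI_bound (h : R -> C) s : cinteg [set: mR] h -> normc (FI h s) <= 2 * \int[mu]_y normc (h y).
Proof.
move=> ih; apply: cint_le => //; [exact: FI_cinteg|exact: cinteg_normc|].
by move=> y _; rewrite normcM normc_cexp_i mulr1.
Qed.

Lemma poisson_sym (d x y : R) : poisson d (x - y) = poisson d (y - x).
Proof. by rewrite /poisson -opprB sqrrN. Qed.

(** The damping makes both half-line integrals pairings of [cj h] with Laplace transforms of [FI h],
    whose sum is by [FI_poisson] the Poisson integral [W] of [h]. The pairing with [W] is bounded by
    [2 |h y| |h s| <= |h y|^2 + |h s|^2]; each square meets a kernel of mass [2 * pi], hence
    [4 * pi]. *)
Lemma FI_sqr_damped (h : R -> C) (d : R) : cinteg [set: mR] h -> ccont (FI h) -> 0 < d ->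
  mu.-integrable [set: mR] (EFin \o (fun y => normc (h y) ^+ 2)) ->
  ((\int[mu]_(s in `[0, +oo[) (normc (FI h s) ^+ 2 * expR (- (d * s))) +
   \int[mu]_(s in `[0, +oo[) (normc (FI h (- s)) ^+ 2 * expR (- (d * s))))%:E <=
  (4 * pi)%:E * \int[mu]_y (normc (h y) ^+ 2)%:E)%E.
Proof.
move=> ih cF d0 h2; set M := 2 * \int[mu]_y normc (h y).
have bF s : normc (FI h s) <= M by exact: FI_bound.
have cFn : ccont (fun s => FI h (- s)).
  by apply: (ccont_comp cF) => s; apply: cvgN; exact: cvg_id.
have cinthc := cinteg_cj ih.
have cjF s : cj (FI h s) = FI (fun y => cj (h y)) (- s).
  rewrite /FI -cint_cj; last exact: FI_cinteg.
  apply: eq_cint => y _; rewrite cjM; congr (_ * _); rewrite !cexp_ii mulrN cosN sinN //.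
(* the damped square integral, as a pairing of [cj h] with a Laplace transform *)
have half (g gc : R -> C) : ccont g -> (forall s, normc (g s) <= M) -> cinteg [set: mR] gc -> (forall s, cj (g s) = FI gc s) ->
    (\int[mu]_(s in `[0, +oo[) (normc (g s) ^+ 2 * expR (- (d * s))))%:C =
    cint [set: mR] (fun y => gc y * Lap g (d%:C + 'i * (- 1 * y)%:C)).
  move=> cg bg igc eg.
  have Rz y : Rec (d%:C + 'i * (- 1 * y)%:C : C) = d by rewrite !RecE /=; ring.
  have e0 s : cexp (- (d%:C * s%:C)) = (expR (- (d * s)))%:C :> C.
    by rewrite /cexp Rec_opp Imc_opp -rmorphM /= oppr0 cos0 sin0 mulr0 mulr1.
  have Lc y := @Lap_cinteg R g M cg (fun s _ => bg s) (d%:C + 'i * (- 1 * y)%:C) ltac:(by rewrite Rz).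
  pose a s := cexp (- (d%:C * s%:C)) * g s * (\1_(`[0, +oo[%classic : set mR) s)%:C.
  have ia : cinteg [set: mR] a.
    apply: cinteg_indic => //; have := Lc 0; apply: eq_cinteg => // s _.
    by rewrite mulr0 mulr0 addr0.
  have Fa y : FI a y = Lap g (d%:C + 'i * (- 1 * y)%:C).
    rewrite /Lap cint_set_indic //; apply: eq_cint => s _; rewrite /a.
    have -> : cexp (- ((d%:C + 'i * (- 1 * y)%:C) * s%:C)) = cexp (- (d%:C * s%:C)) * cexp ('i * s%:C * y%:C).
      by rewrite -cexpD; congr cexp; rewrite mulN1r rmorphN; ring.
    by ring.
  transitivity (cint [set: mR] (fun s => a s * FI gc s)); last first.
    by rewrite (FI_mult ia igc); apply: eq_cint => y _; rewrite Fa.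
  transitivity (cint `[0, +oo[ (fun s => (normc (g s) ^+ 2 * expR (- (d * s)))%:C)).
    apply: complex_eq; first by rewrite cintRec.
    by rewrite cintImc /=; under eq_Rintegral do rewrite /=; rewrite Rintegral_cst // mul0r.
  rewrite cint_set_indic //; apply: eq_cint => s _.
  by rewrite /a -eg e0 rmorphM /= -mul_cj; ring.
have gcn : cinteg [set: mR] (fun y => cj (h (- y))) by exact: cinteg_neg cinthc.
have A1 := half (FI h) _ cF bF gcn (fun s => ltac:(by rewrite cjF -FI_neg)).
have A2 := half (fun s => FI h (- s)) _ cFn (fun s => bF (- s)) cinthc (fun s => ltac:(by rewrite cjF opprK)).
have L1c := Lap_line (-1) cF (fun y _ => bF y) d0; have L2c := Lap_line (-1) cFn (fun y _ => bF (- y)) d0.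
have Lb (g : R -> C) y : ccont g -> (forall s, normc (g s) <= M) -> normc (Lap g (d%:C + 'i * (- 1 * y)%:C)) <= 2 * M / d.
  move=> cg bg; have Rz : Rec (d%:C + 'i * (- 1 * y)%:C : C) = d by rewrite !RecE /=; ring.
  by rewrite -[in leRHS]Rz; apply: (Lap_le cg (fun s _ => bg s)); rewrite Rz.
have I2 := cinteg_bddM (B := 2 * M / d) measurableT cinthc (ccont_cmeas measurableT L2c) (fun y _ => Lb _ y cFn (fun s => bF (- s))).
have I1 := cinteg_bddM (B := 2 * M / d) measurableT gcn (ccont_cmeas measurableT L1c) (fun y _ => Lb _ y cF bF).
pose W y := cint [set: mR] (fun s => h s * (poisson d (s - y))%:C).
have IW : cinteg [set: mR] (fun y => cj (h y) * W y) /\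
    (\int[mu]_(s in `[0, +oo[) (normc (FI h s) ^+ 2 * expR (- (d * s))) +
     \int[mu]_(s in `[0, +oo[) (normc (FI h (- s)) ^+ 2 * expR (- (d * s))))%:C = cint [set: mR] (fun y => cj (h y) * W y).
  have e y : cj (h (- (- y))) * Lap (FI h) (d%:C + 'i * (- 1 * (- y))%:C) +
      cj (h y) * Lap (fun s => FI h (- s)) (d%:C + 'i * (- 1 * y)%:C) = cj (h y) * W y.
    by rewrite opprK -mulrDr !mulN1r opprK rmorphN mulrN FI_poisson.
  have J1 := cinteg_neg I1; split.
    by apply: (eq_cinteg (f := fun y => _ + _)) (cintegD measurableT J1 I2) => // y _; rewrite -e.
  have chain (x1 x2 : R) (z1 z1' z2 S S' : C) : x1%:C = z1 -> x2%:C = z2 -> z1' = z1 -> S = z1' + z2 -> S = S' ->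
    (x1 + x2)%:C = S' by move=> <- <- -> -> <-; rewrite rmorphD.
  exact: chain A1 A2 (cint_neg I1) (cintD measurableT J1 I2) (eq_cint (D := setT) (fun y _ => e y)).
have toR (x : R) (f : R -> C) : x%:C = cint [set: mR] f -> x = \int[mu]_y Rec (f y) by move=> hx; rewrite -cintRec -hx.
have [{}IW /toR ->] := IW.
have nb y : normc (cj (h y) * W y) <= \int[mu]_s (normc (h y) ^+ 2 * poisson d (s - y)) +
    \int[mu]_s (normc (h s) ^+ 2 * poisson d (s - y)).
  have [pI pm] := poisson_shift y d0.
  have q1 := poisson_mulr_integrable y d0 (cinteg_normc measurableT ih).
  have q2 := poisson_mulr_integrable y d0 h2.
  have q3 := integrableZ' (normc (h y) ^+ 2) (@measurableT _ mR) pI.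
  rewrite -RintegralD // normcM normc_cj.
  have w1 : normc (W y) <= 2 * \int[mu]_s (normc (h s) * poisson d (s - y)).
    apply: cint_le => //; last by move=> s _; rewrite normcM normcR ger0_norm // poisson_ge0.
    apply: (cinteg_bddM (B := 2 / d)) => //.
      apply: ccont_cmeas => //; apply: ccontR; apply: (ccomp _ (continuous_poisson d0)).
      by apply: (@caddr _ _ id (fun=> - y)); [move=> x; exact: cvg_id|exact: ccstr].
    by move=> s _; rewrite normcR ger0_norm ?poisson_le // poisson_ge0.
  apply: (le_trans (ler_wpM2l (normc_ge0 _) w1)).
  rewrite mulrA -RintegralZl //; apply: le_Rintegral => //; first exact: integrableZ'.
    by have := integrableD measurableT q3 q2; congr (integrable _ _ _); apply/funext.
  move=> s _; have := sqr_ge0 (normc (h y) - normc (h s)); have := poisson_ge0 (s - y) d0; nra.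
have mh2 : measurable_fun [set: mR] (fun y => normc (h y) ^+ 2) by case/integrableP: h2 => /measurable_EFinP.
have mP2 : measurable_fun [set: mR * mR] (fun p => (normc (h p.2) ^+ 2 * poisson d (p.2 - p.1))%:E).
  apply/measurable_EFinP; apply: measurable_funM; first exact: (measurableT_comp mh2).
  apply: (measurableT_comp (f := poisson d)); first by apply: continuous_measurable_fun; exact: continuous_poisson.
  exact: measurable_funB.
have P0 (x y : R) : 0 <= poisson d (x - y) by exact: poisson_ge0.
apply: (@le_trans _ _ (\int[mu]_y ((normc (h y) ^+ 2 * (2 * pi))%:E + \int[mu]_s (normc (h s) ^+ 2 * poisson d (s - y))%:E))%E).
  have i0 := IW.1; rewrite /Rintegral fineK; last exact: integrable_fin_num.
  apply: (le_trans (lee_abs _)); apply: (le_trans (le_abse_integral _ _ _)) => //; first by case/integrableP: i0.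
  apply: le_int_ae.
  - by [].
  - move=> y; apply: adde_ge0; first by rewrite lee_fin mulr_ge0 ?sqr_ge0 // mulr_ge0 // pi_ge0.
    by apply: integral_ge0 => s _; rewrite lee_fin mulr_ge0 ?sqr_ge0.
  - apply: emeasurable_funD; first by apply/measurable_EFinP; apply: measurable_funM.
    apply: (measurable_fun_fubini_tonelli_F (fun p : mR * mR => (normc (h p.2) ^+ 2 * poisson d (p.2 - p.1))%:E)) => //.
    by move=> p; rewrite lee_fin mulr_ge0 ?sqr_ge0.
  - apply: nearW => y; apply: (@le_trans _ _ (normc (cj (h y) * W y))%:E).
      change (`|(Rec (cj (h y) * W y))%:E| <= (normc (cj (h y) * W y))%:E)%E.
      by rewrite abse_EFin lee_fin; exact: normr_Rec.
    rewrite -[X in (_ + X)%E]fineK; last first.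
      by apply: integrable_fin_num => //; exact: poisson_mulr_integrable.
    rewrite -EFinD lee_fin; apply: (le_trans (nb y)).
    have [pI pm] := poisson_shift y d0.
    by rewrite RintegralZl // pm.
have n1 (y : mR) : [set: mR] y -> (0 <= (normc (h y) ^+ 2 * (2 * pi))%:E)%E.
  by move=> _; rewrite lee_fin mulr_ge0 ?sqr_ge0 // mulr_ge0 // pi_ge0.
have n2 : measurable_fun [set: mR] (fun y => (normc (h y) ^+ 2 * (2 * pi))%:E).
  by apply/measurable_EFinP; apply: measurable_funM.
have n3 (y : mR) : [set: mR] y -> (0 <= \int[mu]_s (normc (h s) ^+ 2 * poisson d (s - y))%:E)%E.
  by move=> _; apply: integral_ge0 => s _; rewrite lee_fin mulr_ge0 ?sqr_ge0.
have n4 : measurable_fun [set: mR] (fun y => \int[mu]_s (normc (h s) ^+ 2 * poisson d (s - y))%:E)%E.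
  apply: (measurable_fun_fubini_tonelli_F (fun p : mR * mR => (normc (h p.2) ^+ 2 * poisson d (p.2 - p.1))%:E)) => //.
  by move=> p; rewrite lee_fin mulr_ge0 ?sqr_ge0.
rewrite (ge0_integralD mu measurableT n1 n2 n3 n4).
have p2 : 0 <= 2 * pi :> R by rewrite mulr_ge0 // pi_ge0.
have E1 : (\int[mu]_y (normc (h y) ^+ 2 * (2 * pi))%:E = (2 * pi)%:E * \int[mu]_y (normc (h y) ^+ 2)%:E)%E.
  under eq_integral do rewrite mulrC EFinM.
  by rewrite ge0_integralZl_EFin //; [move=> y _; rewrite lee_fin sqr_ge0|exact/measurable_EFinP].
have F := @fubini_tonelli _ _ mR mR R mu mu (fun p => (normc (h p.2) ^+ 2 * poisson d (p.2 - p.1))%:E) mP2.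
rewrite {}F; last by move=> p; rewrite lee_fin mulr_ge0 ?sqr_ge0.
under [X in (_ + X <= _)%E]eq_integral => s _.
  have [pI pm] := poisson_shift s d0.
  rewrite (_ : \int[mu]_y _ = (normc (h s) ^+ 2 * (2 * pi))%:E)%E; last first.
    rewrite -pm EFinM /Rintegral fineK; last exact: integrable_fin_num.
    rewrite -ge0_integralZl_EFin ?sqr_ge0 //; first by apply: eq_integral => y _; rewrite /= EFinM poisson_sym.
      by move=> y _; rewrite lee_fin.
    by case/integrableP: pI.
  over.
rewrite E1 -ge0_muleDl ?lee_fin // -EFinD; apply: lee_wpmul2r; first by apply: integral_ge0 => y _; rewrite lee_fin sqr_ge0.
by rewrite lee_fin; lra.
Qed.
End Plancherel.

(** * Square integrals of Laplace transforms and of mollified functions *)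

Section SquareIntegrals.
Variable R : realType.
Notation C := R[i].
Notation mu := (@lebesgue_measure R).
Notation mR := (measurableTypeR R).
Notation hl := (`[0, +oo[%classic : set mR).

Let mneg : measurable_fun [set: mR] (fun x : mR => - x : mR).
Proof. by apply: continuous_measurable_fun => x; apply: cvgN; exact: cvg_id. Qed.
Let mhl : measurable hl. Proof. exact: measurable_itv. Qed.

Lemma le_int_halves (phi : R -> R) : measurable_fun [set: mR] phi -> (forall x, 0 <= phi x) ->
  (\int[mu]_x (phi x)%:E <= \int[mu]_(x in hl) (phi x)%:E + \int[mu]_(x in hl) (phi (- x))%:E)%E.
Proof.
move=> mp p0; pose D := hl.
have mD : measurable D by exact: measurable_itv.
have mI : measurable_fun [set: mR] (\1_D : mR -> R) by exact: measurable_indic.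
have mpn : measurable_fun [set: mR] (fun x => phi (- x)).
  by apply: (measurableT_comp mp); exact: mneg.
have I0 x : 0 <= (\1_D x : R) by rewrite indicE ler0n.
have ind (f : R -> R) : (forall x, 0 <= f x) -> (\int[mu]_(x in D) (f x)%:E = \int[mu]_x (f x * \1_D x)%:E)%E.
  move=> f0; rewrite integral_mkcond; apply: eq_integral => x _; rewrite patchE indicE.
  by case: (x \in D); rewrite ?mulr1 ?mulr0.
rewrite !ind //.
have m1 : measurable_fun [set: mR] (fun x => (phi x * \1_D x)%:E) by apply/measurable_EFinP; exact: measurable_funM.
have m2 : measurable_fun [set: mR] (fun x => (phi (- x) * \1_D x)%:E) by apply/measurable_EFinP; exact: measurable_funM.
rewrite -(ge0_int_neg m2); last by move=> x; rewrite lee_fin mulr_ge0.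
have m3 : measurable_fun [set: mR] (fun x => (phi (- - x) * \1_D (- x))%:E).
  by apply: (measurableT_comp m2); exact: mneg.
rewrite -(ge0_integralD mu measurableT _ m1 _ m3); first last.
- by move=> x _; rewrite lee_fin mulr_ge0.
- by move=> x _; rewrite lee_fin mulr_ge0.
apply: le_int_ae => //.
- by move=> x; rewrite adde_ge0 // lee_fin mulr_ge0.
- exact: emeasurable_funD.
- apply: nearW => x; rewrite -EFinD lee_fin opprK -mulrDr ler_peMr //.
  rewrite !indicE; have [x0|x0] := leP 0 x.
    by rewrite (_ : x \in D) ?lerDl ?ler0n // inE /D /= in_itv /= andbT.
  by rewrite (_ : - x \in D) ?lerDr ?ler0n // inE /D /= in_itv /= andbT oppr_ge0 ltW.
Qed.

(** On a vertical line the Laplace transform is the Fourier integral of [exp (- e y) g y] cut off to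
    the half-line. Fatou removes the damping of [FI_sqr_damped]; the bound is uniform in [e]. *)
Lemma Lap_L2 (g : R -> C) (B e : R) : ccont g -> (forall y, normc (g y) <= B) -> 0 < e ->
  (\int[mu]_xi (normc (Lap g (e%:C - 'i * xi%:C)) ^+ 2)%:E <=
   (4 * pi)%:E * \int[mu]_(y in hl) (normc (g y) ^+ 2)%:E)%E.
Proof.
move=> cg bg e0; have B0 : 0 <= B := le_trans (normc_ge0 _) (bg 0).
have Re (x : R) : Rec (e%:C - 'i * x%:C : C) = e by rewrite !RecE /=; ring.
pose h y := cexp (- ((e%:C - 'i * (0 : R)%:C) * y%:C)) * g y * (\1_hl y)%:C.
have hb y : normc (h y) <= B.
  rewrite /h !normcM normcR indicE; case: (boolP (y \in hl)) => hy; last by rewrite normr0 mulr0.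
  rewrite normr1 mulr1; apply: le_trans (bg y); rewrite normc_cexp Rec_opp Rec_mulR Re ler_piMl ?normc_ge0 //.
  rewrite -expR0 ler_expR oppr_le0 mulr_ge0 ?(ltW e0) //.
  by move: hy; rewrite inE /= in_itv /= andbT.
have ih : cinteg [set: mR] h.
  by apply: cinteg_indic => //; apply: (Lap_cinteg cg (fun y _ => bg y)); rewrite Re.
have Fh xi : FI h xi = Lap g (e%:C - 'i * xi%:C).
  rewrite /Lap cint_set_indic //; apply: eq_cint => y _; rewrite /h.
  have -> : cexp (- ((e%:C - 'i * xi%:C) * y%:C)) = cexp (- ((e%:C - 'i * (0 : R)%:C) * y%:C)) * cexp ('i * y%:C * xi%:C) :> C.
    by rewrite -cexpD; congr cexp; rewrite mulr0; ring.
  by ring.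
have cF : ccont (FI h).
  have -> : FI h = (fun xi => Lap g (e%:C + 'i * (-1 * xi)%:C)).
    by apply/funext => xi; rewrite Fh mulN1r rmorphN mulrN.
  exact: Lap_line cg (fun y _ => bg y) e0.
have mh : measurable_fun [set: mR] (fun y => normc (h y)).
  by case/integrableP: (cinteg_normc measurableT ih) => /measurable_EFinP.
have h2 : mu.-integrable [set: mR] (EFin \o (fun y => normc (h y) ^+ 2)).
  apply: (integrable_le (g := fun y => B * normc (h y))) => //; first exact: measurable_funX.
    by apply: integrableZ' => //; exact: cinteg_normc.
  by move=> y _; rewrite ger0_norm ?sqr_ge0 // expr2 ler_wpM2r ?normc_ge0.
under eq_integral do rewrite -Fh.
set M := 2 * \int[mu]_y normc (h y).
have bF s : normc (FI h s) <= M by exact: FI_bound.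
have cF2 : continuous (fun s => normc (FI h s) ^+ 2) by exact: cmulr (ccont_normc cF) (ccont_normc cF).
apply: (@le_trans _ _ ((4 * pi)%:E * \int[mu]_y (normc (h y) ^+ 2)%:E)%E); last first.
  apply: lee_wpmul2l; first by rewrite lee_fin mulr_ge0 // pi_ge0.
  rewrite [leRHS]integral_mkcond; apply: le_int_ae.
  - by move=> y; rewrite lee_fin sqr_ge0.
  - by move=> y; rewrite patchE; case: ifP; rewrite // lee_fin sqr_ge0.
  - apply/(measurable_restrictT _ _).1 => //; apply/measurable_EFinP.
    apply: measurable_funTS; apply: continuous_measurable_fun.
    exact: cmulr (ccont_normc cg) (ccont_normc cg).
  - apply: nearW => y; rewrite patchE /h !normcM normcR indicE; case: (boolP (y \in hl)) => hy.
      rewrite normr1 mulr1 lee_fin; apply: lerXn2r; rewrite ?nnegrE ?normc_ge0 //.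
        by apply: mulr_ge0; exact: normc_ge0.
      rewrite normc_cexp Rec_opp Rec_mulR Re ler_piMl ?normc_ge0 // -expR0 ler_expR oppr_le0 mulr_ge0 // ?(ltW e0) //.
      by move: hy; rewrite inE /= in_itv /= andbT.
    by rewrite normr0 mulr0 expr0n.
apply: (@fatou_bound _ (fun n s => normc (FI h s) ^+ 2 * expR (- (hp R n * `|s|)))).
- move=> n; apply: continuous_measurable_fun; apply: cmulr cF2 _.
  apply: (@ccomp _ _ _ (fun s : R => - (hp R n * `|s|)) (@expR R)); last exact: continuous_expR.
  move=> s; apply: cvgN; apply: cvgM; first exact: cvg_cst.
  exact: norm_continuous.
- by move=> n s; rewrite mulr_ge0 ?sqr_ge0 ?expR_ge0.
- by move=> s; rewrite sqr_ge0.
- move=> n; have d0 := hp_gt0 R n.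
  have mF : measurable_fun [set: mR] (fun s => normc (FI h s) ^+ 2 * expR (- (hp R n * `|s|))).
    apply: continuous_measurable_fun; apply: cmulr cF2 _.
    apply: (@ccomp _ _ _ (fun s : R => - (hp R n * `|s|)) (@expR R)); last exact: continuous_expR.
    move=> s; apply: cvgN; apply: cvgM; first exact: cvg_cst.
    exact: norm_continuous.
  apply: (le_trans (le_int_halves mF _)); first by move=> s; rewrite mulr_ge0 ?sqr_ge0 ?expR_ge0.
  apply: le_trans (FI_sqr_damped ih cF d0 h2); rewrite EFinD.
  have half (f : R -> R) : continuous f -> (forall s, 0 <= f s <= M ^+ 2) ->
      (\int[mu]_(s in hl) (f s * expR (- (hp R n * `|s|)))%:E =
      (\int[mu]_(s in hl) (f s * expR (- (hp R n * s))))%:E)%E.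
    move=> cf bf; have cfe : continuous (fun s => f s * expR (- (hp R n * s))).
      apply: cmulr cf _; apply: (@ccomp _ _ _ (fun s : R => - (hp R n * s)) (@expR R)); last exact: continuous_expR.
      by move=> s; apply: cvgN; apply: cvgM; [exact: cvg_cst|exact: cvg_id].
    rewrite /Rintegral fineK.
      by apply: eq_integral => s; rewrite inE /= in_itv /= andbT => s0; rewrite ger0_norm.
    apply: integrable_fin_num => //.
    apply: (integrable_le (g := fun s => M ^+ 2 * expR (- (hp R n * s)))) => //.
    - by apply: measurable_funTS; exact: continuous_measurable_fun.
    - exact: exp_integrable.
    - by move=> s _; have /andP[f0 f1] := bf s; rewrite ger0_norm ?mulr_ge0 ?expR_ge0 // ler_wpM2r ?expR_ge0.
  have fb s : 0 <= normc (FI h s) ^+ 2 <= M ^+ 2.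
    have M0 : 0 <= M := le_trans (normc_ge0 _) (bF 0).
    apply/andP; split; first exact: sqr_ge0.
    by apply: lerXn2r; rewrite ?nnegrE; [exact: normc_ge0|exact: M0|exact: bF].
  have cF2n : continuous (fun s => normc (FI h (- s)) ^+ 2).
    by apply: (@ccomp _ _ _ (fun s : R => - s) (fun s => normc (FI h s) ^+ 2)) => // s; apply: cvgN; exact: cvg_id.
  have H1 := half _ cF2 fb; have H2 := half _ cF2n (fun s => fb (- s)).
  apply: leeD; first by rewrite -H1.
  by rewrite -H2 le_eqVlt; apply/orP; left; apply/eqP; apply: eq_integral => s _; rewrite normrN.
- move=> s r r0; pose A := normc (FI h s) ^+ 2 * `|s| + 1.
  have A0 : 0 < A by rewrite ltr_wpDl // mulr_ge0 ?sqr_ge0.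
  have [n0 hn] := hp_lim (divr_gt0 r0 A0); exists n0 => n /hn h1.
  have := expR_ge1Dx (- (hp R n * `|s|)) => h3.
  have h4 : hp R n * A < r by rewrite -ltr_pdivlMr.
  have := ler_wpM2l (sqr_ge0 (normc (FI h s))) h3; rewrite /A in h4; have := hp_gt0 R n.
  by rewrite mulrDr mulr1 mulrN mulrCA; rewrite mulrDr mulr1 in h4; lra.
Qed.

(** The [L^2] substitute for [cauchy_small], used for [N T]. From [e^(-h y) |g| <= l |g|^2 + e^(-2 h
    y) / (4 l)] the product with [h] is at most [2 l A h + 1 / (4 l)]; [l] is taken large before [h]
    is taken small. *)
Lemma hp_Lap0 (g : R -> C) (B : R) (z : nat -> C) : ccont g -> (forall y, normc (g y) <= B) ->
  (\int[mu]_(y in hl) (normc (g y) ^+ 2)%:E < +oo)%E -> (forall n, Rec (z n) = hp R n) ->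
  ccvg (fun n => (hp R n)%:C * Lap g (z n)) 0.
Proof.
move=> cg bg fin rz; have mg : continuous (fun y => normc (g y) ^+ 2) by exact: cmulr (ccont_normc cg) (ccont_normc cg).
have ig : mu.-integrable hl (EFin \o (fun y => normc (g y) ^+ 2)).
  apply/integrableP; split; first by apply/measurable_EFinP; apply: measurable_funTS; exact: continuous_measurable_fun.
  by under eq_integral do rewrite /= ger0_norm ?sqr_ge0 //.
set A := \int[mu]_(y in hl) (normc (g y) ^+ 2).
have A0 : 0 <= A by apply: Rintegral_ge0 => y _; rewrite sqr_ge0.
have key n (l : R) : 0 < l -> normc ((hp R n)%:C * Lap g (z n)) <= 2 * l * A * hp R n + (4 * l)^-1.
  move=> l0; have d0 := hp_gt0 R n; have d2 : 0 < 2 * hp R n by rewrite mulr_gt0.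
  have ei := exp_integrable 0 (4 * l)^-1 d2; have [_ em] := exp_weight 0 d2.
  have li := integrableZ' l mhl ig.
  have bb : normc (Lap g (z n)) <= 2 * \int[mu]_(y in hl) (l * normc (g y) ^+ 2 + (4 * l)^-1 * expR (- (2 * hp R n * y))).
    apply: cint_le => //.
    - by apply: (Lap_cinteg cg (fun y _ => bg y)); rewrite rz.
    - by have := integrableD mhl li ei; congr (integrable _ _ _); apply/funext.
    - move=> y _; rewrite normcM normc_cexp Rec_opp Rec_mulR rz.
      have -> : expR (- (2 * hp R n * y)) = expR (- (hp R n * y)) ^+ 2 by rewrite expr2 -expRD; congr expR; ring.
      move: (normc (g y)) (expR _) => a b; rewrite -subr_ge0.
      have -> : l * a ^+ 2 + (4 * l)^-1 * b ^+ 2 - b * a = (4 * l)^-1 * (2 * l * a - b) ^+ 2 by field; rewrite gt_eqF.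
      by rewrite mulr_ge0 ?sqr_ge0 // invr_ge0 mulr_ge0 // ltW.
  rewrite normcM normcR gtr0_norm //; apply: (le_trans (ler_wpM2l (ltW d0) bb)).
  rewrite RintegralD // !RintegralZl //; last first.
    by have [] := exp_weight 0 d2.
  rewrite em mulr0 oppr0 expR0 -/A le_eqVlt; apply/orP; left; apply/eqP.
  by field; rewrite !gt_eqF.
move=> e e0; have l0 : 0 < e^-1 by rewrite invr_gt0.
have q0 : 0 < e ^+ 2 / (4 * A + 1) by rewrite divr_gt0 ?exprn_gt0 // ltr_wpDl // mulr_ge0.
have [n0 hn] := hp_lim q0; exists n0 => n /hn h; rewrite subr0; apply: (le_trans (key n _ l0)).
have h' : hp R n * (4 * A + 1) < e ^+ 2 by rewrite -ltr_pdivlMr // ltr_wpDl // mulr_ge0.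
have -> : (4 * e^-1)^-1 = e / 4 by field; rewrite gt_eqF.
have : 2 * e^-1 * A * hp R n <= e / 2.
  rewrite (_ : 2 * e^-1 * A * hp R n = (2 * A * hp R n) / e); last by ring.
  by rewrite ler_pdivrMr //; have := hp_gt0 R n; nra.
by lra.
Qed.

Section Mollify.
Variables (r : R) (chi chi' : R -> R) (G : R -> C).
Hypotheses (r1 : r <= 1) (tchi : test r chi chi') (cG : ccont G).
Let N (y : R) := cint `[-1, 1] (fun u => G (y + u) * (chi u)%:C).
Let q (v : R) := normc (G v) ^+ 2.
Let cq : continuous q. Proof. exact: cmulr (ccont_normc cG) (ccont_normc cG). Qed.
Let cadd (y : R) : continuous (fun u : R => y + u).
Proof. by apply: caddr; [exact: ccstr|move=> x; exact: cvg_id]. Qed.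

Let cshift (f : R -> R) (y : R) : continuous f -> continuous (fun u => f (y + u)).
Proof.
by move=> cf; apply: (@ccomp _ _ _ (fun u => y + u) f).
Qed.
Let cGs (y : R) : ccont (fun u => G (y + u)).
Proof. by split; [exact: (@cshift (fun v => Rec (G v)) y cG.1)|exact: (@cshift (fun v => Imc (G v)) y cG.2)]. Qed.

(** Cauchy-Schwarz for the probability density [chi], as nonnegativity of the variance of [|G|]; the
    factor 4 is the square of the 2 lost on components. *)
Lemma mollify_sqr y : normc (N y) ^+ 2 <= 4 * \int[mu]_(u in `[-1, 1]) (q (y + u) * chi u).
Proof.
have tc := test_cont tchi; have cp : continuous (fun u => normc (G (y + u))) by apply: (@cshift (fun v => normc (G v))); exact: ccont_normc.
set M := \int[mu]_(u in `[-1, 1]) (normc (G (y + u)) * chi u).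
have i0 : mu.-integrable `[-1, 1] (EFin \o chi) by exact: cont_integrable.
have i1 : mu.-integrable `[-1, 1] (EFin \o (fun u => normc (G (y + u)) * chi u)) by apply: cont_integrable; exact: cmulr.
have i2 : mu.-integrable `[-1, 1] (EFin \o (fun u => q (y + u) * chi u)).
  by apply: cont_integrable; apply: cmulr tc; exact: cshift cq.
have nM : normc (N y) <= 2 * M.
  apply: cint_le => //; first by apply: ccont_cinteg; apply: ccontM (ccontR tc); exact: cGs.
  by move=> u _; rewrite normcM normcR ger0_norm // (test_ge0 tchi).
have mI : measurable (`[-1, 1] : set mR) by [].
have M2 : M ^+ 2 <= \int[mu]_(u in `[-1, 1]) (q (y + u) * chi u).
  have j1 := integrableZ' (- 2 * M) mI i1; have j0 := integrableZ' (M ^+ 2) mI i0.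
  have j10 : mu.-integrable `[-1, 1] (EFin \o (fun u => - 2 * M * (normc (G (y + u)) * chi u) + M ^+ 2 * chi u)).
    by have := integrableD mI j1 j0; congr (integrable _ _ _); apply/funext.
  have : 0 <= \int[mu]_(u in `[-1, 1]) (q (y + u) * chi u + (- 2 * M * (normc (G (y + u)) * chi u) + M ^+ 2 * chi u)).
    apply: Rintegral_ge0 => u _.
    have -> : q (y + u) * chi u + (- 2 * M * (normc (G (y + u)) * chi u) + M ^+ 2 * chi u) = (normc (G (y + u)) - M) ^+ 2 * chi u.
      by rewrite /q; ring.
    by rewrite mulr_ge0 ?sqr_ge0 // (test_ge0 tchi).
  rewrite (RintegralD mI i2 j10) (RintegralD mI j1 j0) (RintegralZl _ mI i1) (RintegralZl _ mI i0) (test_mass tchi) -/M.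
  by move: (\int[mu]_(u in `[-1, 1]) (q (y + u) * chi u)) => I h; nra.
have N0 := normc_ge0 (N y); move: M2 N0 nM; move: (\int[mu]_(u in _) (q _ * _)) (normc (N y)) M => I n M1; nra.
Qed.

Lemma mollify_L2 : (\int[mu]_y (normc (N y) ^+ 2)%:E <= 4%:E * \int[mu]_v (q v)%:E)%E.
Proof.
have tc := test_cont tchi.
pose D : set mR := `[-1, 1]%classic; have mD : measurable D by exact: measurable_itv.
pose c (u : R) := chi u * \1_D u.
have c0 u : 0 <= c u by rewrite mulr_ge0 ?(test_ge0 tchi) // indicE ler0n.
have mc : measurable_fun [set: mR] c.
  by apply: measurable_funM; [exact: continuous_measurable_fun|exact: measurable_indic].
have mq : measurable_fun [set: mR] q by exact: continuous_measurable_fun.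
have q0 v : 0 <= q v by exact: sqr_ge0.
pose f (p : mR * mR) := (q (p.1 + p.2) * c p.2)%:E.
have mf : measurable_fun [set: mR * mR] f.
  apply/measurable_EFinP; apply: measurable_funM; last exact: (measurableT_comp mc).
  by apply: (measurableT_comp mq); exact: measurable_funD.
have f0 p : (0 <= f p)%E by rewrite lee_fin mulr_ge0.
have ind (h : R -> R) : mu.-integrable D (EFin \o h) -> (\int[mu]_u (h u * \1_D u)%:E = (\int[mu]_(u in D) h u)%:E)%E.
  move=> ih; rewrite /Rintegral fineK; last exact: integrable_fin_num.
  rewrite integral_mkcond; apply: eq_integral => u _; rewrite patchE indicE.
  by case: (u \in D); rewrite ?mulr1 ?mulr0.
apply: (@le_trans _ _ (\int[mu]_y (4%:E * \int[mu]_u f (y, u)))%E).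
  apply: le_int_ae.
  - by move=> y; rewrite lee_fin sqr_ge0.
  - by move=> y; rewrite mule_ge0 ?lee_fin // integral_ge0.
  - by apply: measurable_funeM; exact: measurable_fun_fubini_tonelli_F.
  - apply: nearW => y; have -> : (\int[mu]_u f (y, u) = (\int[mu]_(u in D) (q (y + u) * chi u))%:E)%E.
      rewrite -ind; first by apply: eq_integral => u _; rewrite /f /c mulrA.
      by apply: cont_integrable; apply: cmulr tc; exact: cshift cq.
    by rewrite -EFinM lee_fin mollify_sqr.
rewrite ge0_integralZl_EFin //; last 2 first.
- by move=> y _; exact: integral_ge0.
- exact: measurable_fun_fubini_tonelli_F.
apply: lee_wpmul2l; first by rewrite lee_fin.
rewrite (fubini_tonelli f mf f0).
have e u : (\int[mu]_y f (y, u) = (c u)%:E * \int[mu]_v (q v)%:E)%E.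
  rewrite -(@ge0_int_shift _ u (fun v => (q v)%:E)) //; last exact/measurable_EFinP.
  have mm : measurable_fun [set: mR] (fun y => (q (y + u))%:E).
    by apply/measurable_EFinP; apply: (measurableT_comp mq); exact: measurable_shift.
  have qn (y : mR) : [set: mR] y -> (0 <= (q (y + u))%:E)%E by rewrite lee_fin.
  rewrite -(ge0_integralZl_EFin mu measurableT qn mm (c0 u)).
  by apply: eq_integral => y _; rewrite /f EFinM muleC.
under eq_integral do rewrite e muleC.
rewrite ge0_integralZl //; last 3 first.
- exact/measurable_EFinP.
- by move=> u _; rewrite lee_fin.
- by apply: integral_ge0 => v _; rewrite lee_fin.
by rewrite ind ?(test_mass tchi) ?mule1 //; exact: cont_integrable.
Qed.

(** Finite [L^2] norm becomes a uniform bound after mollification; the half-line transform of [N T]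
    relies on it. *)
Lemma mollify_bound : (\int[mu]_v (q v)%:E < +oo)%E -> exists B, forall y, normc (N y) <= B.
Proof.
move=> fin; have tc := test_cont tchi.
have iq : mu.-integrable [set: mR] (EFin \o q).
  apply/integrableP; split; first by apply/measurable_EFinP; exact: continuous_measurable_fun.
  by under eq_integral do rewrite /= ger0_norm ?sqr_ge0 //.
have [K hK] := ccont_bound (-1) 1 (ccontR tc).
have K0 : 0 <= K by apply: le_trans (normc_ge0 _) (hK 0 _); lra.
exists (4 * (K * \int[mu]_v q v) + 1) => y.
have Q0 : 0 <= \int[mu]_v q v by apply: Rintegral_ge0 => v _; exact: sqr_ge0.
have := mollify_sqr y; have : \int[mu]_(u in `[-1, 1]) (q (y + u) * chi u) <= K * \int[mu]_v q v.
  have cqy : continuous (fun u => q (y + u)) by exact: cshift cq.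
  have mI : measurable (`[-1, 1] : set mR) by [].
  have iy : mu.-integrable `[-1, 1] (EFin \o (fun u => q (y + u))) by exact: cont_integrable.
  have iT : mu.-integrable [set: mR] (EFin \o (fun u => q (y + u))).
    by have := integrable_shift y iq; congr (integrable _ _ _); apply/funext => u; rewrite /= addrC.
  apply: (@le_trans _ _ (\int[mu]_(u in `[-1, 1]) (K * q (y + u)))).
    apply: le_Rintegral => //; [by apply: cont_integrable; exact: cmulr|exact: integrableZ'|].
    move=> u /=; rewrite in_itv /= => uD; rewrite mulrC ler_wpM2r ?sqr_ge0 //.
    by have := hK u uD; rewrite normcR; exact: le_trans (ler_norm _).
  rewrite RintegralZl //; apply: (ler_wpM2l K0).
  have -> : \int[mu]_v q v = \int[mu]_u q (y + u).
    by rewrite -(Rint_shift y iq); apply: eq_Rintegral => u _; rewrite addrC.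
  rewrite -lee_fin /Rintegral !fineK; [|exact: integrable_fin_num..].
  apply: ge0_subset_integral => //; first by case/integrableP: iT.
  by move=> u _; rewrite lee_fin sqr_ge0.
by have := normc_ge0 (N y); move: (K * _) (\int[mu]_(u in _) _) => I J; nra.
Qed.
End Mollify.
End SquareIntegrals.

(** * Bessel's inequality in x *)

Section Bessel.
Variable R : realType.
Notation C := R[i].
Notation mu := (@lebesgue_measure R).
Notation mR := (measurableTypeR R).

Let pi2 : 0 <= 2 * pi :> R. Proof. by rewrite mulr_ge0 // pi_ge0. Qed.
Let mI : measurable (`[0, 2 * pi] : set mR). Proof. exact: measurable_itv. Qed.

Lemma ek_trig (k : int) (x : R) : ek k x = cos (k%:~R * x) +i* - sin (k%:~R * x).
Proof. by rewrite /ek mulrAC -rmorphM -mulNr -rmorphN cexp_i cosN sinN. Qed.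

Lemma ek_mul_cj (k l : int) (x : R) : cj (ek k x) * ek l x = ek (l - k) x.
Proof.
rewrite !ek_trig rmorphB /= mulrBl cosB sinB; apply: complex_eq; rewrite /cj !RecE /=; ring.
Qed.

Lemma ek_orth (k l : int) : cint `[0, 2 * pi] (fun x : R => cj (ek k x) * ek l x) = if k == l then (2 * pi)%:C else 0.
Proof.
have -> : (fun x : R => cj (ek k x) * ek l x) = ek (l - k) by apply/funext => x; exact: ek_mul_cj.
have [->|kl] := eqVneq k l.
  transitivity (cint `[0, 2 * pi] (fun _ : R => (1 : C))).
    by apply: eq_cint => x _; rewrite subrr ek_trig mulr0z mul0r cos0 sin0 oppr0.
  apply: complex_eq; first by rewrite cintRec /= Rint_cst // mul1r subr0.
  by rewrite cintImc /= Rint_cst // mul0r.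
set j := l - k; pose K : C := (j%:~R : R)%:C * 'i.
have j0 : (j%:~R : R) != 0 by rewrite intr_eq0 subr_eq0 eq_sym.
have K0 : K != 0 by apply/eqP => /(congr1 (@complex.Im R)); rewrite !RecE /=; move/eqP; rewrite mulr1 mul0r addr0 (negbTE j0).
have d x : cder (fun x => - K^-1 * ek j x) x (ek j x).
  have de : cder (ek j) x (- K * ek j x).
    by apply: cder_cexp; apply: cderN; apply: (cder_eq (cderZ K (cder_id x))); rewrite mulr1.
  by apply: (cder_eq (cderZ (- K^-1) de)); rewrite mulrA mulrNN mulVf // mul1r.
rewrite (cint_FTC pi2 (ccont_ek R j) d) ek_2pi /ek mulr0 oppr0 cexp0 subrr //.
Qed.

Lemma ccont_cj (T : topologicalType) (f : T -> C) : ccont f -> ccont (fun x => cj (f x)).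
Proof. by move=> [h1 h2]; split => // x; apply: cvgN; exact: h2. Qed.

(** Induction on [s]: subtracting the projection on one mode leaves the other coefficients unchanged
    by orthogonality and lowers the squared norm by [|c|^2 / (2 pi)]. *)
Lemma bessel (s : seq int) (r : R -> C) : uniq s -> ccont r ->
  \sum_(k <- s) normc (cint `[0, 2 * pi] (fun x => r x * ek k x)) ^+ 2 <=
  2 * pi * \int[mu]_(x in `[0, 2 * pi]) normc (r x) ^+ 2.
Proof.
have p0 : 0 < pi :> R := pi_gt0 R.
have alg (p q z : C) : normc z ^+ 2 = 1 -> normc (p - (2 * pi)^-1%:C * q * cj z) ^+ 2 =
    normc p ^+ 2 + (- pi^-1 * Rec (cj q * (p * z)) + (2 * pi)^-1 ^+ 2 * normc q ^+ 2).
  move: p q z => [p p'] [y z] [u v]; rewrite !sqr_normcE /cj !RecE /= => uv.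
  have -> : (2 * pi)^-1 ^+ 2 * (y ^+ 2 + z ^+ 2) = (2 * pi)^-1 ^+ 2 * (y ^+ 2 + z ^+ 2) * (u ^+ 2 + v ^+ 2) by rewrite uv mulr1.
  have -> : pi^-1 = 2 * (2 * pi)^-1 :> R by rewrite invfM mulrA divff ?mul1r.
  by ring.
elim: s r => [|k s IH] r.
  by move=> _ _; rewrite big_nil mulr_ge0 // Rintegral_ge0 // => x _; exact: sqr_ge0.
rewrite cons_uniq => /andP[ks us] cr; rewrite big_cons.
set c := cint `[0, 2 * pi] (fun x => r x * ek k x).
pose a : C := (2 * pi)^-1%:C * c; pose r' x := r x - a * cj (ek k x).
have ce := @ccont_ek R; have cce k' := ccont_cj (ce k').
have cr' : ccont r' by apply: ccontB cr _; apply: ccontM (ccont_cst _ _) (cce k).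
have e l : l \in s -> cint `[0, 2 * pi] (fun x => r' x * ek l x) = cint `[0, 2 * pi] (fun x => r x * ek l x).
  move=> ls; have kl : k != l by apply: contraNneq ks => ->.
  have I1 := ccont_cinteg 0 (2 * pi) (ccontM cr (ce l)).
  have I2 := ccont_cinteg 0 (2 * pi) (ccontM (cce k) (ce l)).
  rewrite (eq_cint (g := fun x => r x * ek l x - a * (cj (ek k x) * ek l x))); last by move=> x _; rewrite /r'; ring.
  by rewrite (cintB mI I1 (cintegZ a mI I2)) (cintZ a mI I2) ek_orth (negbTE kl) mulr0 subr0.
have := IH r' us cr'; rewrite (eq_big_seq _ (fun l ls => congr1 (fun z => normc z ^+ 2) (e l ls))) => h.
have nsq x : normc (r' x) ^+ 2 = normc (r x) ^+ 2 + (- pi^-1 * Rec (cj c * (r x * ek k x)) + (2 * pi)^-1 ^+ 2 * normc c ^+ 2).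
  by apply: alg; rewrite sqr_normcE ek_trig /= sqrrN cos2Dsin2.
have cn (f : R -> C) : ccont f -> mu.-integrable `[0, 2 * pi] (EFin \o (fun x => normc (f x) ^+ 2)).
  by move=> cf; apply: cont_integrable; exact: cmulr (ccont_normc cf) (ccont_normc cf).
have Ic := ccont_cinteg 0 (2 * pi) (ccontM cr (ce k)).
have Iz := cintegZ (cj c) mI Ic.
have J1 := integrableZ' (- pi^-1) mI Iz.1.
have J2 : mu.-integrable `[0, 2 * pi] (EFin \o (fun _ : R => (2 * pi)^-1 ^+ 2 * normc c ^+ 2)).
  by apply: cont_integrable; exact: ccstr.
have J12 : mu.-integrable `[0, 2 * pi] (EFin \o (fun x => - pi^-1 * Rec (cj c * (r x * ek k x)) + (2 * pi)^-1 ^+ 2 * normc c ^+ 2)).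
  by have := integrableD mI J1 J2; congr (integrable _ _ _); apply/funext.
have E : \int[mu]_(x in `[0, 2 * pi]) normc (r' x) ^+ 2 =
    \int[mu]_(x in `[0, 2 * pi]) normc (r x) ^+ 2 - (2 * pi)^-1 * normc c ^+ 2.
  under eq_Rintegral do rewrite nsq.
  rewrite (RintegralD mI (cn _ cr) J12) (RintegralD mI J1 J2) (RintegralZl _ mI Iz.1) Rint_cst //.
  rewrite -cintRec (cintZ (cj c) mI Ic) -/c [cj c * c]mulrC mul_cj subr0.
  have fin (u v : R) : u + (- pi^-1 * v + (2 * pi)^-1 ^+ 2 * v * (2 * pi)) = u - (2 * pi)^-1 * v.
    have -> : pi^-1 = 2 * (2 * pi)^-1 :> R by rewrite invfM mulrA divff ?mul1r.
    rewrite (_ : (2 * pi)^-1 ^+ 2 * v * (2 * pi) = (2 * pi)^-1 * v * ((2 * pi)^-1 * (2 * pi))); last by ring.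
    by rewrite mulVf ?mulr1; [ring|rewrite gt_eqF // mulr_gt0].
  exact: fin.
rewrite E in h; have -> : normc c ^+ 2 = 2 * pi * ((2 * pi)^-1 * normc c ^+ 2) by rewrite mulrA mulfV ?mul1r // gt_eqF // mulr_gt0.
by rewrite -lerBrDl; apply: (le_trans h); rewrite mulrBr.
Qed.

Lemma continuous_Hm (f : R -> R -> R -> R) k t : smooth3 f -> ccont (Hm k (f t)).
Proof. by move=> hf; apply: cder_cont => w; eexists; exact: cder_Hm_w. Qed.

(** Step functions in the first variable, on the grid of mesh [2^-n] covering [[- 2^n, 2^n[], have
    values measurable in the second variable and converge pointwise by continuity. *)
Lemma caratheodory_measurable (f : R -> R -> R) : (forall y, continuous (f ^~ y)) ->
  (forall x, measurable_fun [set: mR] (f x)) -> measurable_fun [set: mR * mR] (fun p => f p.1 p.2).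
Proof.
move=> cf mf; pose a (n : nat) (j : nat) : R := j%:R * hp R n - 2 ^+ n.
pose D n j : set mR := `[a n j, a n j.+1[%classic.
pose F n (p : mR * mR) := \sum_(j < 2 * 2 ^ n * 2 ^ n) f (a n j) p.2 * \1_(D n j) p.1.
apply: (measurable_fun_cvg (h := F)) => [n|[x y] _ /=].
  apply: measurable_sum => j; apply: measurable_funM.
    by apply: (measurableT_comp (mf (a n j))); exact: measurable_snd.
  apply: (measurableT_comp (f := \1_(D n j) : mR -> R)); last exact: measurable_fst.
  by apply: measurable_indic; exact: measurable_itv.
apply/cvgrPdist_le => e e0.
have [d d0 hd] : exists2 d : R, 0 < d & forall z, `|x - z| < d -> `|f x y - f z y| <= e.
  by have /cvgrPdist_le/(_ e e0)[d /= d0 hd] := cf y x; exists d.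
have [n0 hn0] := hp_lim d0; have [n1 hn1] : exists n1, forall n, (n1 <= n)%N -> `|x| < 2 ^+ n.
  have [n1 h] := @hp_lim R (`|x| + 1)^-1 ltac:(by rewrite invr_gt0 ltr_wpDl); exists n1 => n /h.
  have p2 : 0 < 2 ^+ n :> R by rewrite exprn_gt0.
  by rewrite /hp exprVn ltf_pV2 ?posrE ?ltr_wpDl //; lra.
exists (maxn n0 n1) => // n /=; rewrite geq_max => /andP[/hn0 h0 /hn1 h1].
have p2 : 0 < 2 ^+ n :> R by rewrite exprn_gt0.
have hpn : hp R n * 2 ^+ n = 1 by rewrite /hp exprVn mulVf // gt_eqF.
have hp0 := hp_gt0 R n.
pose j := Num.truncn ((x + 2 ^+ n) * 2 ^+ n).
have x0 : 0 <= (x + 2 ^+ n) * 2 ^+ n by rewrite mulr_ge0 ?(ltW p2) //; move: h1; rewrite ltr_norml => /andP[]; lra.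
have /andP[j1 j2] : j%:R <= (x + 2 ^+ n) * 2 ^+ n < j.+1%:R by exact: truncn_itv.
have jlt : (j < 2 * 2 ^ n * 2 ^ n)%N.
  rewrite -(ltr_nat R); apply: (le_lt_trans j1); rewrite !natrM !natrX ltr_pM2r //.
  by move: h1; rewrite ltr_norml => /andP[]; lra.
have inD i : (x \in D n i) = (i == j).
  have -> : (x \in D n i) = (i%:R <= (x + 2 ^+ n) * 2 ^+ n < i.+1%:R).
    rewrite (_ : (x \in D n i) = (a n i <= x < a n i.+1)); last by apply/idP/idP; rewrite inE /D /= in_itv.
    have e1 (b : R) : (b * hp R n - 2 ^+ n <= x) = (b <= (x + 2 ^+ n) * 2 ^+ n).
      by rewrite lerBlDr -(ler_pM2r p2) -mulrA hpn mulr1.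
    by rewrite /a e1 [x < _]ltNge e1 -ltNge.
  apply/idP/eqP => [/andP[i1 i2]|->]; last by rewrite j1.
  have h2 := le_lt_trans i1 j2; have h3 := le_lt_trans j1 i2; rewrite !ltr_nat in h2 h3.
  by apply/eqP; rewrite eqn_leq -ltnS h2 -ltnS h3.
have -> : F n (x, y) = f (a n j) y.
  rewrite /F (bigD1 (Ordinal jlt)) //= indicE inD eqxx mulr1 big1 ?addr0 // => i ij.
  by rewrite indicE inD; case: eqP => [e1|_]; [case/eqP: ij; exact: val_inj|rewrite mulr0].
apply: hd; have : x \in D n j by rewrite inD.
rewrite inE /D /= in_itv /= => /andP[]; rewrite /a -natr1 => q1 q2.
by rewrite ltr_norml; lra.
Qed.

(** Bessel at each height, then Tonelli to exchange the order of integration, as [L2norm2]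
    integrates in [x] last. *)
Lemma sum_modes (f : R -> R -> R -> R) t (s : seq int) : smooth3 f -> uniq s ->
  (\sum_(k <- s) \int[mu]_w (normc (Hm k (f t) w) ^+ 2)%:E <= (2 * pi)%:E * L2norm2 (f t))%E.
Proof.
move=> hf us; pose D : set mR := `[0, 2 * pi]%classic.
have cN k : continuous (fun w => normc (Hm k (f t) w) ^+ 2).
  by have ch := ccont_normc (continuous_Hm k t hf); exact: (cmulr ch ch).
have cx w : continuous (fun x => f t x w).
  by apply: (@smooth3_cont _ _ f (fun=> t) id (fun=> w)) => //; [exact: ccstr|move=> x; exact: cvg_id|exact: ccstr].
pose phi (p : mR * mR) := (f t p.1 p.2 ^+ 2 * \1_D p.1)%:E.
have mphi : measurable_fun [set: mR * mR] phi.
  apply/measurable_EFinP; apply: measurable_funM; last first.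
    apply: (measurableT_comp (f := \1_D : mR -> R)); last exact: measurable_fst.
    exact: measurable_indic.
  by apply: measurable_funX; apply: (caratheodory_measurable cx) => x; apply: continuous_measurable_fun;
    apply: (@smooth3_cont _ _ f (fun=> t) (fun=> x) id) => //; [exact: ccstr|exact: ccstr|move=> z; exact: cvg_id].
have phi0 p : (0 <= phi p)%E by rewrite lee_fin mulr_ge0 ?sqr_ge0 // indicE ler0n.
have inner w : (\int[mu]_x phi (x, w) = (\int[mu]_(x in D) (f t x w ^+ 2))%:E)%E.
  rewrite /Rintegral fineK; last by apply: integrable_fin_num => //; apply: cont_integrable; exact: cmulr.
  rewrite [RHS]integral_mkcond; apply: eq_integral => x _; rewrite patchE /phi /= indicE.
  by case: (x \in D); rewrite ?mulr1 ?mulr0.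
have L2 : (L2norm2 (f t) = \int[mu]_x \int[mu]_w phi (x, w))%E.
  rewrite /L2norm2 integral_mkcond; apply: eq_integral => x _; rewrite patchE /phi /= indicE -/D.
  by case: (x \in D); [apply: eq_integral => w _; rewrite mulr1|rewrite integral0_eq // => w _; rewrite mulr0].
rewrite L2 (fubini_tonelli phi mphi phi0) -(ge0_integral_sum mu measurableT); first last.
- by move=> k w _; rewrite lee_fin sqr_ge0.
- by move=> k; apply/measurable_EFinP; exact: continuous_measurable_fun.
have mF := measurable_fun_fubini_tonelli_G phi mphi phi0.
have G0 w : setT w -> (0 <= \int[mu]_x phi (x, w))%E by move=> _; exact: integral_ge0.
have := ge0_integralZl_EFin mu measurableT G0 (mF mu) pi2; rewrite /fubini_G => <-.
apply: le_int_ae.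
- by move=> w; rewrite sume_ge0 // => k _; rewrite lee_fin sqr_ge0.
- by move=> w; rewrite mule_ge0 ?lee_fin // integral_ge0.
- exact: (measurable_funeM _ (mF mu)).
- apply: nearW => w; rewrite inner sumEFin -EFinM lee_fin.
  have := @bessel s (fun x => (f t x w)%:C) us (ccontR (cx w)).
  by under [X in _ <= 2 * pi * X]eq_Rintegral do rewrite normcR real_normK ?num_real //.
Qed.
End Bessel.

(** * The lower bound *)

Section ModeLimit.
Variable R : realType.
Notation C := R[i].
Notation mu := (@lebesgue_measure R).
Notation mR := (measurableTypeR R).
Notation hl := (`[0%R, +oo[%classic : set R).
Notation o0 := (ord0 : 'I_2).
Notation o1 := (lift ord0 ord0 : 'I_2).

Lemma ccvg_to (u : nat -> C) a b : ccvg u a -> a = b -> ccvg u b. Proof. by move=> h <-. Qed.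

Lemma ccont_opp (g : R -> C) : ccont g -> ccont (fun y => g (- y)).
Proof.
have co : continuous (fun y : R => - y) by move=> y; apply: cvgN; exact: cvg_id.
by move=> [h1 h2]; split; [exact: (ccomp co h1)|exact: (ccomp co h2)].
Qed.

Lemma measurable_normc2 (g : R -> C) : ccont g -> measurable_fun [set: mR] (fun y => (normc (g y) ^+ 2)%:E).
Proof.
move=> cg; apply/measurable_EFinP; apply: continuous_measurable_fun.
by have ch := ccont_normc cg; exact: (cmulr ch ch).
Qed.

Lemma int_half_le (g : R -> C) : ccont g ->
  (\int[mu]_(y in hl) (normc (g y) ^+ 2)%:E <= \int[mu]_y (normc (g y) ^+ 2)%:E)%E /\
  (\int[mu]_(y in hl) (normc (g (- y)) ^+ 2)%:E <= \int[mu]_y (normc (g y) ^+ 2)%:E)%E.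
Proof.
move=> cg; have H (f : R -> C) : ccont f -> (\int[mu]_(y in hl) (normc (f y) ^+ 2)%:E <= \int[mu]_y (normc (f y) ^+ 2)%:E)%E.
  move=> cf; apply: ge0_subset_integral => //;
    solve [exact: measurable_itv|exact: measurable_normc2|by move=> y _; rewrite lee_fin sqr_ge0].
split; first exact: H.
apply: (le_trans (H _ (ccont_opp cg))).
by rewrite (ge0_int_neg (f := fun y => (normc (g y) ^+ 2)%:E) (measurable_normc2 cg)) // => y; rewrite lee_fin sqr_ge0.
Qed.

Lemma FI_add (X Y : R -> C) : cinteg [set: mR] X -> cinteg [set: mR] Y ->
  FI (fun s => X s + Y s) = fun y => FI X y + FI Y y.
Proof.
move=> hX hY; apply/funext => y.
have I Z : cinteg [set: mR] Z -> cinteg [set: mR] (fun x => Z x * cexp ('i * x%:C * y%:C)).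
  move=> hZ; apply: (cinteg_bddM (B := 1) measurableT hZ (ccont_cmeas measurableT _)) => [|x _].
    apply: cder_cont => x; eexists; apply: cder_cexp; exact: (cderM (cderZ 'i (cder_id x)) (cder_cst y%:C x)).
  by rewrite normc_cexp_i.
rewrite /FI -(cintD measurableT (I _ hX) (I _ hY)); apply: eq_cint => x _; exact: mulrDl.
Qed.

Definition Rc m (Sk : R -> R -> 'M[R]_2) (Eta0 Psi0 Om0 : int -> R -> R * R) k (xi T : R) (i : 'I_2) : C :=
  (Rvec m Sk Eta0 Psi0 Om0 k xi T).1 i ord0 +i* (Rvec m Sk Eta0 Psi0 Om0 k xi T).2 i ord0.

Lemma Rc_eq m Sk Eta0 Psi0 Om0 (k : int) xi T i (J : R) :
  (forall F, \int[mu]_(s in `[0, T]) ((Sk 0 s *m Mvec k xi s) i ord0 * F) = -2 * k%:~R ^+ 2 * J * F) ->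
  Rc m Sk Eta0 Psi0 Om0 k xi T i =
    ((i == o0)%:R / (Num.sqrt m * al4 k%:~R xi 0))%:C * Gc k Eta0 xi +
    ((i != o0)%:R / al4 k%:~R xi 0 ^+ 3)%:C * Gc k Psi0 xi +
    (- (2 * k%:~R ^+ 2 * J))%:C * (Gc k Eta0 xi + Gc k Om0 xi).
Proof.
move=> hJ.
have qE : k%:~R ^+ 2 + xi ^+ 2 = alpha k xi 0 by rewrite /alpha mulr0 subr0.
have q1 : (k%:~R ^+ 2 + xi ^+ 2) `^ 4^-1 = al4 k%:~R xi 0.
  by rewrite qE -[4^-1]mulr1 (powR_alpha xi k 0 1).
have q3 : (k%:~R ^+ 2 + xi ^+ 2) `^ (3 / 4) = al4 k%:~R xi 0 ^+ 3.
  by rewrite qE mulrC (powR_alpha xi k 0 3).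
by apply: complex_eq; rewrite /Rc /Rvec /Bin q1 q3 !mxE !RecE /= hJ; case: (ord2 i) => -> /=;
  rewrite ?mul0r ?mul1r ?mulr0; ring.
Qed.

Lemma sum5 (a b c d f : R) : 0 <= a -> 0 <= b -> 0 <= c -> 0 <= d -> 0 <= f ->
  [/\ a <= a + b + c + d + f, b <= a + b + c + d + f, c <= a + b + c + d + f, d <= a + b + c + d + f & f <= a + b + c + d + f].
Proof. by move=> *; split; lra. Qed.

Section Fixed.
Variables (r : R) (chi chi' : R -> R) (e m T : R) (k : int).
Variables (eta ux uy phi : R -> R -> R -> R) (Eta0 Psi0 Om0 Psit : int -> R -> R * R).
Hypotheses (r1 : r <= 1) (tc : test r chi chi') (m0 : 0 < m) (k0 : k != 0) (T0 : 0 <= T).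
Hypotheses (se : smooth3 eta) (sx : smooth3 ux) (sy : smooth3 uy) (sp : smooth3 phi).
Hypotheses (pe : xperiodic3 eta) (qx : xperiodic3 ux) (qy : xperiodic3 uy) (pp : xperiodic3 phi).
Hypothesis EP : EP_solution e m eta ux uy phi.
Hypotheses (FE : is_FT (eta 0) Eta0) (FP : is_FT (divu ux uy 0) Psi0) (FO : is_FT (curlu ux uy 0) Om0).
Hypothesis FT : is_FT (divu ux uy T) Psit.
Hypothesis Hfin : (\int[mu]_w (normc (Hm k (eta T) w) ^+ 2)%:E < +oo)%E.
Notation kR := (k%:~R : R).
Let K : C := kR%:C * 'i.
Let ct := test_cont tc.

(** The one term without a Fourier integral: its boundedness and square integrability come from the
    finite norm [Hfin] alone. *)
Let NT : R -> C := cv chi (Hs k eta) T.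

Lemma ccont_NT : ccont NT.
Proof. exact: jcont_y (jcont_cv ct (jcont_Hs k se)). Qed.

Lemma NT_bound : (exists B, forall y, normc (NT y) <= B) /\
  (\int[mu]_y (normc (NT y) ^+ 2)%:E <= 4%:E * \int[mu]_w (normc (Hm k (eta T) w) ^+ 2)%:E)%E.
Proof.
have cH : ccont (Hs k eta T) := jcont_y T (jcont_Hs k se).
have nH w : normc (Hs k eta T w) = normc (Hm k (eta T) w).
  rewrite /Hs normcM (_ : normc (shear k T w) = 1) ?mul1r // /shear normc_cexp RecE /=.
  by rewrite mulr0 mul0r subr0 expR0.
have eH : (\int[mu]_w (normc (Hs k eta T w) ^+ 2)%:E = \int[mu]_w (normc (Hm k (eta T) w) ^+ 2)%:E)%E.
  by apply: eq_integral => w _; rewrite nH.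
split; last by rewrite -eH; exact: (mollify_L2 tc cH).
by apply: (mollify_bound tc cH); rewrite eH.
Qed.

Let slice (f : R -> R -> R -> R) t w : smooth3 f -> continuous (fun x => f t x w).
Proof.
move=> hf; apply: (@smooth3_cont _ _ f (fun=> t) id (fun=> w)) => //; [exact: ccstr|move=> x; exact: cvg_id|exact: ccstr].
Qed.

Let Ik (f : R -> R -> R -> R) t w : smooth3 f -> cinteg `[0, 2 * pi] (fun x => (f t x w)%:C * ek k x).
Proof. by move=> hf; apply: ccont_cinteg; exact: ccontM (ccontR (@slice _ t w hf)) (ccont_ek R k). Qed.

Lemma Hm_divu t w : Hm k (divu ux uy t) w = K * Hm k (ux t) w + Hm k (py uy t) w.
Proof.
rewrite -(Hm_px k t w sx qx) /Hm -(cintD _ (@Ik _ t w (smooth3_px sx)) (@Ik _ t w (smooth3_py sy))); last exact: measurable_itv.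
by apply: eq_cint => x _; rewrite /divu rmorphD; exact: mulrDl.
Qed.

Lemma Hm_curlu t w : Hm k (curlu ux uy t) w = K * Hm k (uy t) w - Hm k (py ux t) w.
Proof.
rewrite -(Hm_px k t w sy qy) /Hm -(cintB _ (@Ik _ t w (smooth3_px sy)) (@Ik _ t w (smooth3_py sx))); last exact: measurable_itv.
by apply: eq_cint => x _; rewrite /curlu addrC rmorphB; exact: mulrBl.
Qed.

Lemma FI_divu t G : is_FT (divu ux uy t) G -> cinteg [set: mR] (FX k G chi t) /\
  (fun y => K * cv chi (Hs k ux) t y + cv chi (Hs k (py uy)) t y) = FI (FX k G chi t).
Proof.
move=> hG.
have cg w : continuous (divu ux uy t ^~ w) by exact: caddr (@slice _ t w (smooth3_px sx)) (@slice _ t w (smooth3_py sy)).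
have cH : ccont (Hm k (divu ux uy t)).
  rewrite (funext (Hm_divu t)); apply: ccontD (continuous_Hm k t (smooth3_py sy)).
  exact: ccontM (ccont_cst _ _) (continuous_Hm k t sx).
have [I1 E1] := @cv_FI R k (divu ux uy t) G cg cH hG r chi chi' t r1 tc.
split=> //; apply/funext => y; rewrite -E1.
have alg (s p q a b : C) : s * (p * a + b) = p * (s * a) + 1 * (s * b) + 0 * q by ring.
have := @cv_sum3 R chi ct K 1 0 (fun s w => shear k s w * Hm k (divu ux uy s) w) (Hs k ux) (Hs k (py uy)) (Hs k uy) t y
  (jcont_Hs k sx) (jcont_Hs k (smooth3_py sy)) (jcont_Hs k sy).
rewrite mul1r mul0r addr0 => <- // w; rewrite Hm_divu; exact: alg.
Qed.

Lemma FI_modeF : cinteg [set: mR] (fun s => FX k Eta0 chi 0 s + FX k Om0 chi 0 s) /\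
  modeF chi k eta ux uy 0 = FI (fun s => FX k Eta0 chi 0 s + FX k Om0 chi 0 s).
Proof.
have cg w : continuous (curlu ux uy 0 ^~ w).
  have h1 := @slice _ 0 w (smooth3_py sx); have h2 := @slice _ 0 w (smooth3_px sy).
  by move=> x; apply: cvgD; [apply: cvgN; exact: h1|exact: h2].
have cH : ccont (Hm k (curlu ux uy 0)).
  rewrite (funext (Hm_curlu 0)); apply: ccontB (continuous_Hm k 0 (smooth3_py sx)).
  exact: ccontM (ccont_cst _ _) (continuous_Hm k 0 sy).
have [I1 E1] := @cv_FI R k (curlu ux uy 0) Om0 cg cH FO r chi chi' 0 r1 tc.
have [I2 E2] := @cv_FI R k (eta 0) Eta0 (fun w => @slice _ 0 w se) (continuous_Hm k 0 se) FE r chi chi' 0 r1 tc.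
split; first exact: cintegD.
rewrite FI_add //; apply/funext => y; rewrite -E1 -E2 /modeF.
have alg (s p q a b : C) : s * (p * a - b) = p * (s * a) + -1 * (s * b) + 0 * q by ring.
have alg2 (a b c : C) : a - b + c = a + (c + -1 * b + 0 * a) by ring.
have := @cv_sum3 R chi ct K (-1) 0 (fun s w => shear k s w * Hm k (curlu ux uy s) w) (Hs k uy) (Hs k (py ux)) (Hs k eta) 0 y
  (jcont_Hs k sy) (jcont_Hs k (smooth3_py sx)) (jcont_Hs k se).
move=> h; rewrite [LHS]alg2; congr (_ + _); symmetry; apply: h => w; rewrite Hm_curlu; exact: alg.
Qed.

(** [limit_formula] for the adjoint solution given by row [i] of the propagator: its data at time 0
    reproduce the weights of [Bin], and its [J1] the Duhamel integral of R_-. The exceptional null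
    set is that of the four Fourier densities and does not depend on [i]. *)
Lemma mode_limit (S0 : R -> R -> R -> 'M[R]_2) : (forall xi, is_propagator (Lmat e m k xi) (S0 xi)) ->
  \forall xi \ae mu, forall i : 'I_2,
  ccvg (fun n => (- S0 xi 0 T i o0 / (Num.sqrt m * al4 kR xi T))%:C * (Lap NT (zr xi n) + Lap (fun y => NT (- y)) (zl xi n)))
    ((2 * pi)%:C * ftest chi xi * ((S0 xi 0 T i o1 / al4 kR xi T ^+ 3)%:C * Gc k Psit (xi - kR * T) -
       Rc m (S0 xi) Eta0 Psi0 Om0 k xi T i)).
Proof.
move=> pS.
have alg (p q x c d E P O Ps jj kk : C) : x * (p * (Ps * q)) - (d * (p * (P * q)) - - c * (p * (E * q))) +
    kk * (p * (E * q + O * q)) * jj = p * q * (x * Ps - (c * E + d * P + - (kk * jj) * (E + O))) by ring.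
have sys := @modes_sys R r chi chi' r1 tc k e m eta ux uy phi (lt0r_neq0 m0) se sx sy sp pe qx qy pp EP.
have k0' : kR != 0 := intr_neq0' R k0.
have [[B BN] LN] := NT_bound; have cN := ccont_NT.
have Lfin : (\int[mu]_y (normc (NT y) ^+ 2)%:E < +oo)%E.
  by apply: (le_lt_trans LN); rewrite lte_mul_pinfty.
have [h1 h2] := int_half_le cN.
have [IE EE] := @cv_FI R k (eta 0) Eta0 (fun w => @slice _ 0 w se) (continuous_Hm k 0 se) FE r chi chi' 0 r1 tc.
have [IP PE] := FI_divu FP; have [IT TE] := FI_divu FT; have [IF FF] := FI_modeF.
pose F := ae_filter_ringOfSetsType mu.
apply: (@filterS _ _ F _ _ _ (@filterI _ _ F _ _ (@filterI _ _ F _ _ (ae_leb IE) (ae_leb IP)) (@filterI _ _ F _ _ (ae_leb IF) (ae_leb IT)))) => xi [[l1 l2] [l3 l4]] i.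
have [J [J0 D hJ]] := propagator_row m0 k0 (pS xi) i.
have wp t : 0 < al4 kR xi t := al4_gt0 xi t k0'.
have alE t : al kR ('i * xi%:C) t = (al4 kR xi t ^+ 4)%:C by rewrite al_line al4_X4.
pose a t : C := (S0 xi 0 t i o1 * al4 kR xi t)%:C.
pose b t : C := (- S0 xi 0 t i o0 / (Num.sqrt m * al4 kR xi t))%:C.
pose J1 t : C := (J t)%:C.
have ca : ccont a by apply: cder_cont => t; have [d _ _] := D t; eexists; exact: cder_R d.
have cb : ccont b by apply: cder_cont => t; have [_ d _] := D t; eexists; exact: cder_R d.
have cJ : ccont J1 by apply: cder_cont => t; have [_ _ d] := D t; eexists; exact: cder_R d.
have c0 : 0 <= 4 * pi * e ^+ 2 :> R by rewrite mulr_ge0 ?sqr_ge0 // mulr_ge0 // pi_ge0.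
pose bd (X : R -> C) : R := 2 * \int[mu]_y normc (X y).
have bdP X Y y : cinteg [set: mR] X -> Y = FI X -> normc (Y y) <= bd X by move=> iX ->; exact: FI_bound.
have NE : cv chi (Hs k eta) 0 = FI (FX k Eta0 chi 0) := funext EE.
pose BB := bd (FX k Eta0 chi 0) + bd (FX k Psi0 chi 0) + B + bd (FX k Psit chi T) + bd (fun s => FX k Eta0 chi 0 s + FX k Om0 chi 0 s).
have := @limit_formula R kR m (4 * pi * e ^+ 2) T BB xi _ _ _ _ _ _ _ _ _ _ _ _ _ (a 0) (b 0) a b J1 m0 c0 T0 k0' sys _
  (And4 IE IP IF IT) (And4 NE PE FF TE) (And4 l1 l2 l3 l4) _ _ (And3 ca cb cJ) (And3 erefl erefl (congr1 (fun x => x%:C) J0)) _.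
move=> H; apply: (ccvg_to (H _ _ _ _)) => {H}.
- move=> y; have q1 := bdP _ _ y IE NE; have q2 := bdP _ _ y IP PE; have q3 := BN y; have q4 := bdP _ _ y IT TE; have q5 := bdP _ _ y IF FF.
  have n1 := le_trans (normc_ge0 _) q1; have n2 := le_trans (normc_ge0 _) q2; have n3 := le_trans (normc_ge0 _) q3.
  have n4 := le_trans (normc_ge0 _) q4; have n5 := le_trans (normc_ge0 _) q5.
  have [s1 s2 s3 s4 s5] := sum5 n1 n2 n3 n4 n5.
  by split; [exact: le_trans q1 s1|exact: le_trans q2 s2|exact: le_trans q3 s3|exact: le_trans q4 s4|exact: le_trans q5 s5].
- by apply: (hp_Lap0 cN BN (le_lt_trans h1 Lfin)) => n; rewrite /zr !RecE /=; ring.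
- by apply: (hp_Lap0 (ccont_opp cN) (fun y => BN (- y)) (le_lt_trans h2 Lfin)) => n; rewrite /zl !RecE /=; ring.
- move=> t _; have [d1 d2 d3] := D t; split.
  + by apply: (cder_eq (cder_R d1)); rewrite alE rmorphM rmorphN.
  + apply: (cder_eq (cder_R d2)); rewrite /cf10 alE -fmorphV -rmorphXn -!rmorphM -!rmorphD -rmorphM; congr (_ %:C); congr (_ * _).
    by rewrite exprVn -exprM.
  + apply: (cder_eq (cder_R d3)); rewrite alE -fmorphV -rmorphXn -rmorphM; congr (_ %:C).
    by rewrite exprVn -exprM mulrC.
have -> := Rc_eq m Eta0 Psi0 Om0 (fun F => hJ T F T0).
have S00 j : S0 xi 0 0 i j = (i == j)%:R by rewrite (pS xi).1 mxE.
have wn t : al4 kR xi t != 0 by rewrite gt_eqF.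
have e1 : a T / al kR ('i * xi%:C) T = (S0 xi 0 T i o1 / al4 kR xi T ^+ 3)%:C.
  by rewrite alE -fmorph_div; congr (_ %:C); move: (wn T) => ?; field.
have e2 : a 0 / al kR ('i * xi%:C) 0 = ((i != o0)%:R / al4 kR xi 0 ^+ 3)%:C.
  rewrite alE -fmorph_div; congr (_ %:C); rewrite S00 (_ : (i == o1) = (i != o0)); last by case: (ord2 i) => ->.
  by move: (wn 0) => ?; field.
have e3 : b 0 = - ((i == o0)%:R / (Num.sqrt m * al4 kR xi 0))%:C.
  by rewrite /b S00 mulNr rmorphN.
have e4 : (- (2 * kR ^+ 2 * J T))%:C = - ((2 * kR ^+ 2)%:C * J1 T) by rewrite rmorphN rmorphM.
rewrite e1 e2 e3 e4 /FX !mulr0 !subr0; exact: alg.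
Qed.
End Fixed.
End ModeLimit.

(** * The weighted estimate of R_- in one mode *)

Section ModeBound.
Variable R : realType.
Notation C := R[i].
Notation mu := (@lebesgue_measure R).
Notation mR := (measurableTypeR R).
Notation hl := (`[0%R, +oo[%classic : set R).
Notation o0 := (ord0 : 'I_2).
Notation o1 := (lift ord0 ord0 : 'I_2).

Lemma ccvg_sqr (u : nat -> C) L e : ccvg u L -> 0 < e ->
  exists n0, forall n, (n0 <= n)%N -> normc L ^+ 2 <= normc (u n) ^+ 2 + e.
Proof.
move=> h e0; have L0 := normc_ge0 L; have d0 : 0 < 2 * normc L + 1 by rewrite ltr_wpDl // mulr_ge0.
have [n0 hn] := h (e / (2 * normc L + 1)) (divr_gt0 e0 d0); exists n0 => n /hn {}hn.
have a0 := normc_ge0 (u n); have := ler_normcD (u n) (L - u n); rewrite addrC subrK normcC => h1.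
have h2 : normc L - normc (u n) <= e / (2 * normc L + 1) by lra.
have [aL|La] := leP (normc L) (normc (u n)).
  by rewrite (le_trans (_ : _ <= normc (u n) ^+ 2)) ?lerDl ?(ltW e0) // ler_sqr ?nnegrE.
move: h2; rewrite ler_pdivlMr // => h2; nra.
Qed.

Lemma sqr_le2 (a b c : R) : 0 <= a -> a <= b + c -> a ^+ 2 <= 2 * b ^+ 2 + 2 * c ^+ 2.
Proof.
move=> a0 h; have : a ^+ 2 <= (b + c) ^+ 2 by rewrite ler_sqr ?nnegrE // (le_trans a0).
by have := sqr_ge0 (b - c); nra.
Qed.

(** The triangle inequality isolates [Rr]. Multiplying by [w ^+ 2], which is the square root of
    alpha, removes the weight on [N] and turns the error [e / (4 w^2)] into [e / 4], doubled by the
    squared triangle inequality. *)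
Lemma comp_ineq (K m w S0 S1 e : R) (q Ps Rr N : C) : 0 < m -> 0 < w -> S0 ^+ 2 <= K -> S1 ^+ 2 <= K ->
  normc ((2 * pi)%:C * q * ((S1 / w ^+ 3)%:C * Ps - Rr)) ^+ 2 <=
    normc ((- S0 / (Num.sqrt m * w))%:C * N) ^+ 2 + e / (4 * w ^+ 2) ->
  (2 * pi) ^+ 2 * normc q ^+ 2 * (w ^+ 2 * normc Rr ^+ 2 - 2 * K * normc Ps ^+ 2 / w ^+ 4) <=
    2 * K / m * normc N ^+ 2 + e / 2.
Proof.
move=> m0 w0 k0 k1.
pose D := normc ((S1 / w ^+ 3)%:C * Ps - Rr) ^+ 2; pose A := (2 * pi) ^+ 2 * normc q ^+ 2.
rewrite (_ : normc ((2 * pi)%:C * q * _) ^+ 2 = A * D); last first.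
  by rewrite !normcM normcR /A /D !exprMn real_normK ?num_real // exprMn.
rewrite (_ : normc (_ * N) ^+ 2 = S0 ^+ 2 / m / w ^+ 2 * normc N ^+ 2); last first.
  rewrite normcM normcR exprMn real_normK ?num_real //; congr (_ * _).
  by rewrite exprMn sqrrN exprVn exprMn sqr_sqrtr ?(ltW m0) // invfM mulrA.
rewrite -/A => h.
have A0 : 0 <= A by rewrite mulr_ge0 ?sqr_ge0.
have w2 : 0 < w ^+ 2 by rewrite exprn_gt0.
have wn : w != 0 by rewrite gt_eqF.
have hD : normc Rr ^+ 2 <= 2 * D + 2 * (S1 ^+ 2 / w ^+ 6 * normc Ps ^+ 2).
  have := ler_normcB ((S1 / w ^+ 3)%:C * Ps) ((S1 / w ^+ 3)%:C * Ps - Rr).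
  rewrite opprB addrCA subrr addr0 normcM normcR => h1.
  have -> : S1 ^+ 2 / w ^+ 6 * normc Ps ^+ 2 = (`|S1 / w ^+ 3| * normc Ps) ^+ 2.
    by rewrite exprMn real_normK ?num_real // exprMn exprVn -exprM.
  by rewrite addrC; exact: sqr_le2 (normc_ge0 _) h1.
have h2 : w ^+ 2 * (A * D) <= K / m * normc N ^+ 2 + e / 4.
  apply: (le_trans (ler_wpM2l (ltW w2) h)).
  have -> : w ^+ 2 * (S0 ^+ 2 / m / w ^+ 2 * normc N ^+ 2 + e / (4 * w ^+ 2)) = S0 ^+ 2 * (m^-1 * normc N ^+ 2) + e / 4.
    by field; rewrite wn gt_eqF.
  by rewrite lerD2r -mulrA; apply: ler_wpM2r; rewrite // mulr_ge0 ?sqr_ge0 // invr_ge0 ltW.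
have h3 : w ^+ 2 * normc Rr ^+ 2 - 2 * K * normc Ps ^+ 2 / w ^+ 4 <= 2 * (w ^+ 2 * D).
  have h4 := ler_wpM2l (ltW w2) hD.
  have e4 : w ^+ 2 * (2 * D + 2 * (S1 ^+ 2 / w ^+ 6 * normc Ps ^+ 2)) = 2 * (w ^+ 2 * D) + 2 * (S1 ^+ 2 * (normc Ps ^+ 2 / w ^+ 4)) by field.
  have : S1 ^+ 2 * (normc Ps ^+ 2 / w ^+ 4) <= K * (normc Ps ^+ 2 / w ^+ 4).
    by apply: ler_wpM2r; rewrite // mulr_ge0 ?sqr_ge0 // invr_ge0 exprn_ge0 ?(ltW w0).
  by move: h4; rewrite e4 -!mulrA; move: (_ / w ^+ 4) (w ^+ 2 * D) (w ^+ 2 * normc Rr ^+ 2) => ? ? ?; lra.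
apply: (le_trans (ler_wpM2l A0 h3)).
rewrite (_ : A * (2 * (w ^+ 2 * D)) = 2 * (w ^+ 2 * (A * D))); last by ring.
rewrite (_ : 2 * K / m * normc N ^+ 2 + e / 2 = 2 * (K / m * normc N ^+ 2 + e / 4)); first by rewrite ler_pM2l.
by rewrite mulrDr; congr (_ + _); [rewrite !mulrA|field].
Qed.

(** A one-sided bound for [X] of either sign, in the form required by [fatou2]; applied to both [X]
    and [- X] it gives convergence. *)
Lemma ftest_lim (chi chi' : nat -> R -> R) : (forall j, test (hp R j) (chi j) (chi' j)) -> (forall j, hp R j <= 1) ->
  forall xi X e, 0 < e -> exists j0, forall j, (j0 <= j)%N -> X <= normc (ftest (chi j) xi) ^+ 2 * X + e.
Proof.
move=> tc h1 xi X e e0.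
have c0 : 0 < 4 * `|xi| + 1 by rewrite ltr_wpDl // mulr_ge0.
have X0 : 0 < 3 * `|X| + 1 by rewrite ltr_wpDl // mulr_ge0.
have [j1 hj1] := hp_lim (divr_gt0 ltr01 c0); have [j2 hj2] := hp_lim (divr_gt0 (divr_gt0 e0 X0) c0).
exists (maxn j1 j2) => j; rewrite geq_max => /andP[/hj1 a1 /hj2 a2].
have := ftest_near1 (h1 j) (tc j) xi (hp_gt0 R j); set q := ftest _ _ => hq.
move: a1 a2; rewrite !ltr_pdivlMr // => a1 a2.
have hd : normc (q - 1) <= hp R j * (4 * `|xi| + 1).
  by apply: (le_trans hq); rewrite mulrC; apply: ler_wpM2l; rewrite ?lerDl ?ltW ?hp_gt0.
have n1 := ler_normcD (q - 1) 1; rewrite subrK normc1 in n1.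
have n2 := ler_normcD (1 - q) q; rewrite subrK normc1 normcC in n2.
have q0 := normc_ge0 q; have d0 := normc_ge0 (q - 1).
move: (normc q) (normc (q - 1)) (hp R j * _) q0 d0 n1 n2 hd a1 a2 => p d c q0 d0 n1 n2 hd a1 a2.
have b1 : `|1 - p ^+ 2| <= 3 * d.
  by rewrite ler_norml; apply/andP; split; nra.
have b2 : (1 - p ^+ 2) * X <= 3 * d * `|X|.
  by apply: (le_trans (ler_norm _)); rewrite normrM; apply: ler_wpM2r.
have b3 : 3 * d * `|X| <= e by have := normr_ge0 X; nra.
by lra.
Qed.

(** Since [|k| >= 1], one has [T^2 <= (k T)^2 <= 2 xi^2 + 2 (xi - k T)^2] and
    [1 + (xi - k T)^2 <= alpha]. The time weight is paid for by the frequency and by the distance to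
    the critical time. *)
Lemma jb_ineq (k : int) (xi T : R) : k != 0 -> (jb xi)^-1 <= 2 / jb T * al4 k%:~R xi T ^+ 2.
Proof.
move=> k0; have kn := intr_norm_ge1 R k0.
have k1 : 1 <= (k%:~R : R) ^+ 2 by rewrite -real_normK ?num_real // expr_ge1.
have jp x : 0 < jb x :> R by rewrite sqrtr_gt0 ltr_pwDl ?sqr_ge0.
rewrite mulrAC ler_pdivlMr ?jp // mulrC ler_pdivrMr ?jp // al4_sqr.
set al := _ + _ ^+ 2; have a0 : 0 <= al by rewrite addr_ge0 ?sqr_ge0.
have e2 : 2 = Num.sqrt 4 :> R by rewrite (_ : 4 = 2 ^+ 2) ?sqrtr_sqr ?ger0_norm //; ring.
rewrite {1}e2 /jb -!sqrtrM ?mulr_ge0 // ler_sqrt; last by rewrite !mulr_ge0 // addr_ge0 ?sqr_ge0.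
have t2 : T ^+ 2 <= (k%:~R * T) ^+ 2 by rewrite exprMn ler_peMl ?sqr_ge0.
have [y yE] : exists y, y = xi - k%:~R * T by eexists.
have al1 : 1 + y ^+ 2 <= al by rewrite /al -yE lerD2r.
have : (k%:~R * T) ^+ 2 <= 2 * xi ^+ 2 + 2 * y ^+ 2.
  by rewrite (_ : k%:~R * T = xi - y); [have := sqr_ge0 (xi + y); nra|rewrite yE; ring].
have x2 := sqr_ge0 xi; have y2 := sqr_ge0 y.
have : (1 + y ^+ 2) * (1 + xi ^+ 2) <= al * (1 + xi ^+ 2) by apply: ler_wpM2r => //; lra.
have := mulr_ge0 x2 y2.
by move: (k%:~R * T) t2 => ? ?; lra.
Qed.

Lemma sum_ineq (p q w y z K M P W n d : R) :
  p * q * (w * y - 2 * K * P / W) <= 2 * K / M * n + d / 2 / 2 -> p * q * (w * z - 2 * K * P / W) <= 2 * K / M * n + d / 2 / 2 ->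
  q * (p * (w * (y + z) - 4 * K * P / W)) + d / 2 <= 4 * K / M * n + d.
Proof.
have -> : 4 * K * P / W = 2 * (2 * K * P / W) by ring.
have -> : 4 * K / M * n = 2 * (2 * K / M * n) by ring.
by move: (2 * K * P / W) (2 * K / M * n) => u v; lra.
Qed.

Lemma mode_cst (p K M h : R) : p != 0 -> M != 0 -> (4 * p ^+ 2)^-1 * (4 * K / M * (64 * p * h)) = 64 * K / (p * M) * h.
Proof. by move=> p0 M0; field; rewrite p0 M0. Qed.

Lemma Kprop_gt0 (e m : R) : 0 < m -> 0 < Kprop e m.
Proof.
move=> m0; rewrite /Kprop; have : 0 <= 4 * pi * e ^+ 2 by rewrite mulr_ge0 ?sqr_ge0 // mulr_ge0 // pi_ge0.
move: (4 * pi * e ^+ 2) => q q0; apply: mulr_gt0; last exact: expR_gt0.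
by apply: mulr_gt0 => //; lra.
Qed.

Section Fixed.
Variables (e m T : R) (k : int).
Variables (eta ux uy phi : R -> R -> R -> R) (Eta0 Psi0 Om0 Psit : int -> R -> R * R).
Hypotheses (m0 : 0 < m) (k0 : k != 0) (T0 : 0 <= T).
Hypotheses (se : smooth3 eta) (sx : smooth3 ux) (sy : smooth3 uy) (sp : smooth3 phi).
Hypotheses (pe : xperiodic3 eta) (qx : xperiodic3 ux) (qy : xperiodic3 uy) (pp : xperiodic3 phi).
Hypothesis EP : EP_solution e m eta ux uy phi.
Hypotheses (FE : is_FT (eta 0) Eta0) (FP : is_FT (divu ux uy 0) Psi0) (FO : is_FT (curlu ux uy 0) Om0).
Hypothesis FT : is_FT (divu ux uy T) Psit.
Notation kR := (k%:~R : R).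
Notation Kp := (Kprop e m).
Variable h : R.
Hypothesis Hh : (\int[mu]_w (normc (Hm k (eta T) w) ^+ 2)%:E = h%:E)%E.

Let Hfin : (\int[mu]_w (normc (Hm k (eta T) w) ^+ 2)%:E < +oo)%E. Proof. by rewrite Hh ltry. Qed.

Let NL (g : R -> C) n xi := Lap g (zr xi n) + Lap (fun y => g (- y)) (zl xi n).

(** The constant [64 * pi] is a product of 2 from squaring a sum, 2 from the two half-lines,
    [4 * pi] from [Lap_L2] and 4 from mollification. *)
Lemma NL_L2 (g : R -> C) (B c : R) n : ccont g -> (forall y, normc (g y) <= B) -> 0 <= c ->
  (\int[mu]_y (normc (g y) ^+ 2)%:E <= (4 * h)%:E)%E ->
  measurable_fun [set: mR] (fun xi => c * normc (NL g n xi) ^+ 2) /\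
  (\int[mu]_xi (c * normc (NL g n xi) ^+ 2)%:E <= (c * (64 * pi * h))%:E)%E.
Proof.
move=> cg gB c0 hg; have cg' := ccont_opp cg; have p0 := pi_ge0 R.
have hn0 := hp_gt0 R n.
have zrE xi : zr xi n = (hp R n)%:C + 'i * (1 * xi)%:C by rewrite mul1r.
have zlE xi : zl xi n = (hp R n)%:C + 'i * (-1 * xi)%:C by rewrite mulN1r rmorphN mulrN.
have c1 : ccont (fun xi => Lap g (zr xi n)).
  by rewrite (funext (fun xi => congr1 (Lap g) (zrE xi))); exact: Lap_line cg (fun y _ => gB y) hn0.
have c2 : ccont (fun xi => Lap (fun y => g (- y)) (zl xi n)).
  by rewrite (funext (fun xi => congr1 (Lap _) (zlE xi))); exact: Lap_line cg' (fun y _ => gB (- y)) hn0.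
have mN : measurable_fun [set: mR] (fun xi => c * normc (NL g n xi) ^+ 2).
  apply: continuous_measurable_fun; have ch := ccont_normc (ccontD c1 c2).
  exact: (cmulr (@ccstr R R c) (cmulr ch ch)).
split => //.
have [i1 i2] := int_half_le cg.
have b2 : (\int[mu]_xi (normc (Lap (fun y => g (- y)) (zl xi n)) ^+ 2)%:E <= (4 * pi)%:E * (4 * h)%:E)%E.
  apply: (le_trans (Lap_L2 cg' (fun y => gB (- y)) hn0)); apply: lee_wpmul2l; first by rewrite lee_fin mulr_ge0.
  exact: le_trans i2 hg.
have b1 : (\int[mu]_xi (normc (Lap g (zr xi n)) ^+ 2)%:E <= (4 * pi)%:E * (4 * h)%:E)%E.
  have <- : (\int[mu]_xi (normc (Lap g (zl xi n)) ^+ 2)%:E = \int[mu]_xi (normc (Lap g (zr xi n)) ^+ 2)%:E)%E.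
    rewrite -(ge0_int_neg (f := fun xi => (normc (Lap g (zr xi n)) ^+ 2)%:E)); first last.
    - by move=> x; rewrite lee_fin sqr_ge0.
    - exact: measurable_normc2.
    by apply: eq_integral => xi _; rewrite /zr /zl rmorphN mulrN.
  apply: (le_trans (Lap_L2 cg gB hn0)); apply: lee_wpmul2l; first by rewrite lee_fin mulr_ge0.
  exact: le_trans i1 hg.
have A0 (f : R -> C) : forall x, [set: mR] x -> (0 <= (normc (f x) ^+ 2)%:E)%E by move=> x _; rewrite lee_fin sqr_ge0.
have m1 := measurable_normc2 c1; have m2 := measurable_normc2 c2.
apply: (@le_trans _ _ (\int[mu]_xi ((2 * c)%:E * ((normc (Lap g (zr xi n)) ^+ 2)%:E + (normc (Lap (fun y => g (- y)) (zl xi n)) ^+ 2)%:E)))%E).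
  apply: le_int_ae.
  - by move=> x; rewrite lee_fin mulr_ge0 ?sqr_ge0.
  - by move=> x; rewrite lee_fin mulr_ge0 ?addr_ge0 ?sqr_ge0 // mulr_ge0.
  - by apply: measurable_funeM; exact: emeasurable_funD.
  - apply: nearW => x; rewrite lee_fin /NL.
    have := ler_normcD (Lap g (zr x n)) (Lap (fun y => g (- y)) (zl x n)).
    move=> h1; rewrite [2 * c]mulrC -mulrA; apply: ler_wpM2l => //.
    by rewrite mulrDr; exact: sqr_le2 (normc_ge0 _) h1.
rewrite ge0_integralZl_EFin //; first last.
- by rewrite mulr_ge0.
- exact: emeasurable_funD.
- by move=> x _; rewrite lee_fin addr_ge0 ?sqr_ge0.
rewrite (ge0_integralD mu measurableT (A0 _) m1 (A0 _) m2).
rewrite (_ : (c * (64 * pi * h))%:E = (2 * c)%:E * ((4 * pi)%:E * (4 * h)%:E + (4 * pi)%:E * (4 * h)%:E))%E; last first.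
  by apply: (congr1 EFin (x := c * (64 * pi * h)) (y := 2 * c * (4 * pi * (4 * h) + 4 * pi * (4 * h)))); ring.
have cc : (0 <= (2 * c)%:E)%E by rewrite lee_fin mulr_ge0.
exact: (lee_wpmul2l cc (leeD b1 b2)).
Qed.

(** For each mollifier the limit formula bounds R_-, weighted by the squared transform of the test
    function, up to the part coming from [Psit]; that weight tends to 1 as the width shrinks.
    Translating by [k T] turns the shifted density of [Psit] over alpha into the one defining
    [Qnorm2]. *)
Lemma mode_bound (S0 : R -> R -> R -> 'M[R]_2) : (forall xi, is_propagator (Lmat e m k xi) (S0 xi)) ->
  (\int[mu]_xi ((jb xi)^-1 * vnorm2 (Rvec m (S0 xi) Eta0 Psi0 Om0 k xi T))%:E <=
   (2 / jb T)%:E * ((64 * Kp / (pi * m))%:E * h%:E +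
     (4 * Kp)%:E * \int[mu]_xi (cabs2 (Psit k xi) / (kR ^+ 2 + xi ^+ 2))%:E))%E.
Proof.
move=> pS; have Kp0 := Kprop_gt0 e m0; have p0 := pi_gt0 R.
have k0' : kR != 0 := intr_neq0' R k0.
have hp1 j : hp R j <= 1 by rewrite /hp exprn_ile1 ?invr_ge0 // invf_le1 // ler1n.
have tj j : exists c : (R -> R) * (R -> R), test (hp R j) c.1 c.2.
  by have [c [c' tc]] := @test_exists R (hp R j) ltac:(by rewrite hp_gt0 hp1); exists (c, c').
have [ch hch] := choice tj.
pose N j : R -> C := cv (ch j).1 (Hs k eta) T.
have cN j : ccont (N j) by exact: (ccont_NT T k (hch j) se).
have bN j : (exists B, forall y, normc (N j y) <= B) /\ (\int[mu]_y (normc (N j y) ^+ 2)%:E <= (4 * h)%:E)%E.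
  by have := NT_bound (hch j) se Hfin; rewrite Hh -EFinM.
pose c := 4 * Kp / m; have c0 : 0 <= c by exact: (divr_ge0 (mulr_ge0 (ler0n _ 4) (ltW Kp0)) (ltW m0)).
pose F j n xi := c * normc (NL (N j) n xi) ^+ 2.
have hF j n : measurable_fun [set: mR] (F j n) /\ (\int[mu]_xi (F j n xi)%:E <= (c * (64 * pi * h))%:E)%E.
  by have [[B hB] hb] := bN j; exact: (NL_L2 n (cN j) hB c0 hb).
have [G [mG G0 iG hG]] := fatou2 (fun j n => (hF j n).1) (fun j n x => mulr_ge0 c0 (sqr_ge0 _)) (fun j n => (hF j n).2).
have lim j := @mode_limit R (hp R j) (ch j).1 (ch j).2 e m T k eta ux uy phi Eta0 Psi0 Om0 Psit (hp1 j) (hch j)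
  m0 k0 T0 se sx sy sp pe qx qy pp EP FE FP FO FT Hfin S0 pS.
have q1 := ftest_lim hch hp1.
pose P2 xi := normc (Gc k Psit (xi - kR * T)) ^+ 2.
(* Measurability is available for the integrable products [FX]; their squared moduli converge to
   [P2] as the mollifier shrinks. *)
have mP2 : measurable_fun [set: mR] P2.
  apply: (measurable_fun_cvg (h := fun j xi => normc (FX k Psit (ch j).1 T xi) ^+ 2)) => [j|xi _].
    have [I _] := FI_divu k (hp1 j) (hch j) sx sy qx FT; have [J1 J2] := cinteg_cmeas I.
    rewrite (_ : (fun xi => _) = (fun xi => Rec (FX k Psit (ch j).1 T xi) ^+ 2 + Imc (FX k Psit (ch j).1 T xi) ^+ 2)).
      by apply: measurable_funD; exact: measurable_funX.
    by apply/funext => xi; rewrite sqr_normcE.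
  apply/cvgrPdist_le => d d0; have [j1 h1] := q1 xi (P2 xi) d d0; have [j2 h2] := q1 xi (- P2 xi) d d0.
  exists (maxn j1 j2); first by [].
  move=> j hj; have /andP[/h1 a1 /h2 a2] : (j1 <= j)%N && (j2 <= j)%N by rewrite -geq_max; exact: hj.
  change (`|P2 xi - normc (FX k Psit (ch j).1 T xi) ^+ 2| <= d).
  rewrite /FX normcM exprMn -/(P2 xi) ler_norml; move: a1 a2; rewrite mulrN mulrC.
  by move: (P2 xi * _) => u a1 a2; apply/andP; split; lra.
pose al xi := kR ^+ 2 + (xi - kR * T) ^+ 2.
have al0 xi : 0 < al xi by rewrite /al ltr_pwDl ?sqr_ge0 // exprn_even_gt0.
have mal : measurable_fun [set: mR] (fun xi => (P2 xi / al xi)%:E).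
  apply/measurable_EFinP; apply: measurable_funM => //; apply: continuous_measurable_fun => x.
  apply: cvgV; first by rewrite gt_eqF.
  apply: cvgD; first exact: cvg_cst.
  by apply: cvgM; (apply: cvgB; [exact: cvg_id|exact: cvg_cst]).
have shift : (\int[mu]_xi (P2 xi / al xi)%:E = \int[mu]_xi (cabs2 (Psit k xi) / (kR ^+ 2 + xi ^+ 2))%:E)%E.
  rewrite -(ge0_int_shift (kR * T) mal); last by move=> x; rewrite lee_fin divr_ge0 ?sqr_ge0 ?(ltW (al0 x)).
  by apply: eq_integral => xi _; rewrite /P2 /al addrK sqr_normcE.
have jp x : 0 < jb x :> R by rewrite sqrtr_gt0 ltr_pwDl ?sqr_ge0.
have i4 : 0 <= (4 * pi ^+ 2)^-1 :> R by rewrite invr_ge0 mulr_ge0 ?sqr_ge0.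
have jT : 0 <= 2 / jb T by rewrite divr_ge0 ?(ltW (jp T)).
have K4 : 0 <= 4 * Kp by exact: (mulr_ge0 (ler0n _ 4) (ltW Kp0)).
have a0 x : (0 <= (P2 x / al x)%:E)%E by rewrite lee_fin divr_ge0 ?sqr_ge0 ?(ltW (al0 x)).
pose g1 xi := ((4 * pi ^+ 2)^-1%:E * G xi + (4 * Kp)%:E * (P2 xi / al xi)%:E)%E.
have mg1 : measurable_fun [set: mR] g1 by apply: emeasurable_funD; exact: measurable_funeM.
have g10 x : (0 <= g1 x)%E by apply: adde_ge0; apply: mule_ge0; rewrite ?lee_fin // -?lee_fin.
apply: (@le_trans _ _ (\int[mu]_xi ((2 / jb T)%:E * g1 xi))%E).
  apply: le_int_ae => [x|x||].
  - by rewrite lee_fin mulr_ge0 ?invr_ge0 ?(ltW (jp x)) // sumr_ge0 // => i _; rewrite addr_ge0 ?sqr_ge0.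
  - by apply: mule_ge0.
  - exact: measurable_funeM.
  apply: (@filterS _ _ (ae_filter_ringOfSetsType mu) _ _ _ (ae_foralln lim)) => xi hl.
  set V := vnorm2 _; set w := al4 kR xi T; have w0 : 0 < w := al4_gt0 xi T k0'.
  have VE : V = \sum_(i < 2) normc (Rc m (S0 xi) Eta0 Psi0 Om0 k xi T i) ^+ 2.
    by apply: eq_bigr => i _; rewrite sqr_normcE.
  have V0 : 0 <= V by rewrite VE sumr_ge0 // => i _; exact: sqr_ge0.
  have w4 : w ^+ 4 = al xi by rewrite /w al4_X4.
  (* With the part from [Psit] subtracted, the remainder is bounded by limits of [|N|^2] alone. It
     may be negative, which the one-sided [ftest_lim] allows. *)
  pose X := (2 * pi) ^+ 2 * (w ^+ 2 * V - 4 * Kp * P2 xi / w ^+ 4).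
  have XG : (X%:E <= G xi)%E.
    apply: hG => d d0; have d2 : 0 < d / 2 by rewrite divr_gt0.
    have [j0 hj] := q1 xi X (d / 2) d2; exists j0 => j /hj {}hj.
    have d3 : 0 < d / 2 / (4 * w ^+ 2) by rewrite divr_gt0 // mulr_gt0 // exprn_gt0.
    have [n0 h0] := ccvg_sqr (hl j o0) d3; have [n1 h1] := ccvg_sqr (hl j o1) d3.
    exists (maxn n0 n1) => n; rewrite geq_max => /andP[/h0 {}h0 /h1 {}h1].
    have pb i i' := propagator_bound m0 k0 (pS xi) i i' T0.
    have r0 := comp_ineq m0 w0 (pb _ _) (pb _ _) h0; have r1 := comp_ineq m0 w0 (pb _ _) (pb _ _) h1.
    apply: (le_trans hj); rewrite /F /c /X VE big_ord_recl big_ord1 -/(P2 xi) -/(NL (N j) n xi).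
    exact: sum_ineq r0 r1.
  have s1 : ((2 / jb T * (w ^+ 2 * V))%:E <= (2 / jb T)%:E * g1 xi)%E.
    rewrite EFinM; apply: lee_wpmul2l; rewrite ?lee_fin // /g1.
    apply: (le_trans _ (leeD2r _ (lee_wpmul2l _ XG))); last by rewrite lee_fin.
    rewrite -!EFinM -EFinD lee_fin /X w4 (_ : (2 * pi) ^+ 2 = 4 * pi ^+ 2); last by ring.
    rewrite mulrA mulVf ?mul1r; last by rewrite gt_eqF // mulr_gt0 // exprn_gt0.
    by rewrite -[4 * Kp * P2 xi / _]mulrA subrK.
  apply: le_trans s1; rewrite lee_fin mulrA; apply: ler_wpM2r => //; exact: jb_ineq.
rewrite ge0_integralZl_EFin //; apply: lee_wpmul2l; rewrite ?lee_fin //.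
rewrite ge0_integralD //; first last.
- exact: measurable_funeM.
- by move=> x _; rewrite mule_ge0 // lee_fin.
- exact: measurable_funeM.
- by move=> x _; rewrite mule_ge0 // lee_fin.
rewrite !ge0_integralZl_EFin // shift; apply: leeD => //.
apply: (le_trans (lee_wpmul2l _ iG)); first by rewrite lee_fin.
rewrite -!EFinM lee_fin /c le_eqVlt; apply/orP; left; apply/eqP.
exact: mode_cst (lt0r_neq0 p0) (lt0r_neq0 m0).
Qed.
End Fixed.
End ModeBound.

Local Close Scope complex_scope.

Theorem theorem1p4 (R : realType) (e m : R) :
  0 < e -> 0 < m ->
  exists C : R, 0 < C /\
  forall (eta ux uy phi : R -> R -> R -> R),
    smooth3 eta -> smooth3 ux -> smooth3 uy -> smooth3 phi ->
    xperiodic3 eta -> xperiodic3 ux -> xperiodic3 uy -> xperiodic3 phi ->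
    EP_solution e m eta ux uy phi ->
    zero_xavg (eta 0) -> zero_xavg (divu ux uy 0) -> zero_xavg (curlu ux uy 0) ->
    forall (Eta0 Psi0 Om0 : int -> R -> R * R),
      is_FT (eta 0) Eta0 -> is_FT (divu ux uy 0) Psi0 -> is_FT (curlu ux uy 0) Om0 ->
      (sob_norm2 0 (- 2^-1) Eta0 < +oo)%E ->
      (sob_norm2 0 (- 2^-1) Om0 < +oo)%E ->
      (sob_norm2 (- (3 / 2)) (- 2) Psi0 < +oo)%E ->
    forall S : int -> R -> R -> R -> 'M[R]_2,
      (forall (k : int) (xi : R), k != 0 -> is_propagator (Lmat e m k xi) (S k xi)) ->
    forall t : R, 0 <= t ->
    forall Psit : int -> R -> R * R, is_FT (divu ux uy t) Psit ->
      (Qnorm2 Psit + (m^-1)%:E * L2norm2 (eta t)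
       >= (C * jb t)%:E *
          \esum_(k in [set k : int | k != 0%R])
            \int[lebesgue_measure]_(xi in [set: R])
              ((jb xi)^-1 * vnorm2 (Rvec m (S k xi) Eta0 Psi0 Om0 k xi t))%:E)%E.
Proof.
move=> e0 m0; have K0 := Kprop_gt0 e m0; have p0 := pi_gt0 R.
have K256 : 0 < 256 * Kprop e m by rewrite pmulr_rgt0 ?ltr0n.
(* Each mode carries a factor [2 / <t>], and after summation the terms with eta and psi both have
   coefficient at most [128 * Kprop e m]. *)
exists (256 * Kprop e m)^-1; split; first by rewrite invr_gt0.
move=> eta ux uy phi se sx sy sp pe qx qy pp EP _ _ _ Eta0 Psi0 Om0 FE FP FO _ _ _ S pS t t0 Psit FT.
have jt : 0 < jb t by rewrite sqrtr_gt0 ltr_pwDl ?sqr_ge0.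
have m1 : 0 < m^-1 by rewrite invr_gt0.
pose P k := (\int[lebesgue_measure]_xi (cabs2 (Psit k xi) / (k%:~R ^+ 2 + xi ^+ 2))%:E)%E.
have P0 k : (0 <= P k)%E.
  by apply: integral_ge0 => xi _; rewrite lee_fin divr_ge0 ?addr_ge0 ?sqr_ge0.
have Q0 : (0 <= Qnorm2 Psit)%E by apply: esum_ge0 => k _; exact: P0.
have L0 : (0 <= L2norm2 (eta t))%E.
  by apply: integral_ge0 => x _; apply: integral_ge0 => y _; rewrite lee_fin sqr_ge0.
(* An infinite norm makes the claim trivial; otherwise every mode of [eta t] has finite norm, as
   [mode_bound] requires. *)
have [Linf|Lfin] := eqVneq (L2norm2 (eta t)) +oo%E.
  by rewrite Linf gt0_muley ?lte_fin // addey ?leey // gt_eqF // (lt_le_trans _ Q0).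
have C0 : 0 < (256 * Kprop e m)^-1 * jb t by rewrite mulr_gt0 // invr_gt0.
(* The sum over nonzero frequencies is a supremum over finite sets [A], for which Bessel's
   inequality is available. *)
rewrite -lee_pdivlMl //; apply: ge_ereal_sup => _ [A [fA sA] <-].
rewrite fsbig_finite //=; set s := finmap.enum_fset _.
have us : uniq s := finmap.fset_uniq _.
have sk k : k \in s -> k != 0.
  move=> ks; have : k \in A by rewrite -(in_fset_set fA); exact: ks.
  by rewrite inE => /sA.
pose H k := (\int[lebesgue_measure]_w (ComplexField.Normc.normc (Hm k (eta t) w) ^+ 2)%:E)%E.
have H0 k : (0 <= H k)%E by apply: integral_ge0 => w _; rewrite lee_fin sqr_ge0.
have HL s' : uniq s' -> (\sum_(k <- s') H k <= (2 * pi)%:E * L2norm2 (eta t))%E.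
  by move=> us'; exact: (sum_modes t se us').
have Lf : ((2 * pi)%:E * L2norm2 (eta t) < +oo)%E by rewrite lte_mul_pinfty ?lee_fin ?mulr_ge0 ?(ltW p0) // ltey.
have Hf k : (H k < +oo)%E by have := HL [:: k] isT; rewrite big_seq1 => h; exact: le_lt_trans h Lf.
pose c1 := 64 * Kprop e m / (pi * m); pose c2 := 4 * Kprop e m.
have c10 : 0 < c1 by rewrite divr_gt0 // mulr_gt0.
have c20 : 0 < c2 by rewrite mulr_gt0.
have jt2 : 0 < 2 / jb t by rewrite divr_gt0.
have bound k : k \in s -> (\int[lebesgue_measure]_xi ((jb xi)^-1 * vnorm2 (Rvec m (S k xi) Eta0 Psi0 Om0 k xi t))%:E <=
    (2 / jb t)%:E * (c1%:E * H k + c2%:E * P k))%E.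
  move=> /sk k0; have hk : H k = (fine (H k))%:E by rewrite fineK // ge0_fin_numE.
  rewrite hk; exact: (mode_bound m0 k0 t0 se sx sy sp pe qx qy pp EP FE FP FO FT hk (S0 := S k) (fun xi => pS k xi k0)).
apply: (@le_trans _ _ (\sum_(k <- s) ((2 / jb t)%:E * (c1%:E * H k + c2%:E * P k)))%E).
  by rewrite big_seq [leRHS]big_seq; apply: lee_sum => k ks; exact: bound.
have c10' := ltW c10; have c20' := ltW c20.
rewrite -ge0_sume_distrr; last by move=> k _; rewrite adde_ge0 // mule_ge0 // lee_fin.
rewrite big_split /= -ge0_sume_distrr; last by move=> k _; exact: H0.
rewrite -ge0_sume_distrr; last by move=> k _; exact: P0.
have HP : (\sum_(k <- s) P k <= Qnorm2 Psit)%E.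
  by apply: esum_ge; exists A; [split=> // x _|rewrite fsbig_finite].
have a1 : (c1%:E * (\sum_(k <- s) H k) <= (128 * Kprop e m)%:E * (m^-1%:E * L2norm2 (eta t)))%E.
  apply: (@le_trans _ _ (c1%:E * ((2 * pi)%:E * L2norm2 (eta t)))%E).
    by apply: lee_wpmul2l; [rewrite lee_fin|exact: HL].
  rewrite !muleA -!EFinM (_ : c1 * (2 * pi) = 128 * Kprop e m * m^-1) //.
  by rewrite /c1; move: pi p0 (Kprop e m) => p pp0 K; field; rewrite !gt_eqF.
have a2 : (c2%:E * (\sum_(k <- s) P k) <= (128 * Kprop e m)%:E * Qnorm2 Psit)%E.
  apply: (@le_trans _ _ (c2%:E * Qnorm2 Psit)%E); first by apply: lee_wpmul2l; rewrite ?lee_fin.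
  by apply: lee_wpmul2r => //; rewrite lee_fin /c2; lra.
have jt2' : (0 <= (2 / jb t)%:E)%E by rewrite lee_fin ltW.
apply: (le_trans (lee_wpmul2l jt2' (leeD a1 a2))).
rewrite -ge0_muleDr //; last by rewrite mule_ge0 // lee_fin ltW.
rewrite muleA -EFinM [X in (_ * X)%E]addeC le_eqVlt; apply/orP; left; apply/eqP; congr (_ %:E * _)%E.
by move: (jb t) jt (Kprop e m) K0 => j j0 K KK; field; rewrite !gt_eqF.
Qed.
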